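(* Let $p(\cdot),q(\cdot)\in\mathcal{P}_0(\mathbb{R}^n)\cap C^{\log}(\mathbb{R}^n)$ and $s(\cdot)\in C^{\log}(\mathbb{R}^n)$. Let $\{a_{\nu,m}\}_{\nu\in\mathbb{N}_0,m\in\mathbb{Z}^n}$ be a family of smooth atoms for $F^{s(\cdot)}_{p(\cdot),q(\cdot)}(\mathbb{R}^n)$. If $\lambda=\{\lambda_{\nu,m}\}_{(\nu,m)\in\mathbb{N}_0\times\mathbb{Z}^n}\in f^{s(\cdot)}_{p(\cdot),q(\cdot)}$, then $$\left\|\sum_{\nu\in\mathbb{N}_0}\sum_{m\in\mathbb{Z}^n}\lambda_{\nu,m}a_{\nu,m}\right\|_{F^{s(\cdot)}_{p(\cdot),q(\cdot)}}\lesssim\|\lambda\|_{f^{s(\cdot)}_{p(\cdot),q(\cdot)}},$$ where the sum is taken in $\mathcal{S}'(\mathbb{R}^n)$ and the implicit constant does not depend on $\lambda$.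
   Context: For measurable $g$ on $\mathbb{R}^n$, $g^-$ and $g^+$ denote its essential infimum and supremum. $\mathcal{P}_0(\mathbb{R}^n)$ is the set of measurable $p:\mathbb{R}^n\to(0,\infty)$ with $0<p^-\le p^+<\infty$. $C^{\log}(\mathbb{R}^n)$ is the set of $p:\mathbb{R}^n\to\mathbb{R}$ for which there are $C_{\log}(p)>0$ and $p_\infty\in\mathbb{R}$ with $|p(x)-p(y)|\le C_{\log}(p)/\log(e+|x-y|^{-1})$ ($x\neq y$) and $|p(x)-p_\infty|\le C_{\log}(p)/\log(e+|x|)$. $\|f\|_{L^{p(\cdot)}}=\inf\{\lambda>0:\int(|f(x)|/\lambda)^{p(x)}dx\le1\}$. For sequences $\{f_j\}_{j\ge0}$ of measurable functions, $\|\{f_j\}\|_{L^{p(\cdot)}(\ell^{q(\cdot)})}=\|(\sum_j|f_j(\cdot)|^{q(\cdot)})^{1/q(\cdot)}\|_{L^{p(\cdot)}}$. $\Phi(\mathbb{R}^n)$ is the collection of systems $\{\theta_j\}_{j\ge0}\subset\mathcal{S}(\mathbb{R}^n)$ with $\operatorname{supp}\theta_0\subset\{|x|\le2\}$, $\operatorname{supp}\theta_j\subset\{2^{j-1}\le|x|\le2^{j+1}\}$ ($j\ge1$), $\sup_{j,x}2^{j|\alpha|}|D^\alpha\theta_j(x)|<\infty$ for every multi-index $\alpha$, and $\sum_j\theta_j\equiv1$. $\theta(D)f=\mathcal{F}^{-1}[\theta\cdot\mathcal{F}f]$. Fix $\theta\in\Phi(\mathbb{R}^n)$; $F^{s(\cdot)}_{p(\cdot),q(\cdot)}(\mathbb{R}^n)$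 is the set of $f\in\mathcal{S}'(\mathbb{R}^n)$ with $\|f\|_{F^{s(\cdot)}_{p(\cdot),q(\cdot)}}=\|\{2^{js(\cdot)}\theta_j(D)f\}_{j\ge0}\|_{L^{p(\cdot)}(\ell^{q(\cdot)})}<\infty$. $Q_{\nu,m}=\prod_{i=1}^n[2^{-\nu}m_i,2^{-\nu}(m_i+1))$ with characteristic function $\chi_{\nu,m}$. $f^{s(\cdot)}_{p(\cdot),q(\cdot)}$ is the set of complex sequences $\lambda$ with $\|\lambda\|_{f^{s(\cdot)}_{p(\cdot),q(\cdot)}}=\|\{2^{\nu s(\cdot)}\sum_m\lambda_{\nu,m}\chi_{\nu,m}\}_{\nu\ge0}\|_{L^{p(\cdot)}(\ell^{q(\cdot)})}<\infty$. Atoms: fix $\gamma>1$. For $K\in\mathbb{N}_0$, $L\in\mathbb{Z}$, a function $a\in C^K(\mathbb{R}^n)$ is a $[K,L]$-atom centered at $Q_{\nu,m}$ if $\operatorname{supp}a\subset\gamma Q_{\nu,m}$, $\|\partial^\alpha a\|_\infty\le2^{\nu|\alpha|}$ for $|\alpha|\le K$, and, when $\nu\ge1$, $\int x^\beta a(x)dx=0$ for $|\beta|\le L$ (no moment condition if $L\le-1$, and none for $\nu=0$). For $L:\mathbb{R}^n\to\mathbb{R}$, $\{a_{\nu,m}\}$ is a family of $[K,L]$ smooth atoms if each $a_{\nu,m}$ is a $[K,\lfloor L^-_{Q_{\nu,m}}\rfloor]$-atom centered at $Q_{\nu,m}$, where $L^-_{Q_{\nu,m}}=\operatorname{ess\,inf}_{x\in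 Q_{\nu,m}}L(x)$. It is a family of smooth atoms for $F^{s(\cdot)}_{p(\cdot),q(\cdot)}(\mathbb{R}^n)$ if it is a family of $[K,L+\epsilon]$ smooth atoms for some constant $\epsilon>0$, some $K>s^+$, and $L(\cdot)=\sigma_{p(\cdot),q(\cdot)}-s(\cdot)$, where $\sigma_{p(\cdot),q(\cdot)}=n\left(\frac1{\min(1,p(\cdot),q(\cdot))}-1\right)$. For such a family and $\lambda\in f^{s(\cdot)}_{p(\cdot),q(\cdot)}$ the sum $\sum_\nu\sum_m\lambda_{\nu,m}a_{\nu,m}$ converges in $\mathcal{S}'(\mathbb{R}^n)$. *)

(* Defs.v *)
From HB Require Import structures.
From mathcomp Require Import all_boot all_order all_algebra finmap.
From mathcomp Require Import all_classical all_reals all_analysis.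
From mathcomp Require Import ess_sup_inf complex.

Set Implicit Arguments.
Unset Strict Implicit.
Unset Printing Implicit Defensive.

Import Order.TTheory GRing.Theory Num.Theory.
Import numFieldNormedType.Exports.
Import ComplexField.

Local Open Scope classical_set_scope.
Local Open Scope complex_scope.
Local Open Scope ring_scope.

(* The sigma-algebra generated by the coordinates, i.e. the Borel one. *)
Definition rV_display : measure_display -> measure_display.
Proof. exact. Qed.

Section measurable_rV.
Context {R : realType} (n : nat).

Let coors : 'I_n -> 'rV[R]_n -> R := fun i x => x ord0 i.

Let rV_set0 : g_sigma_preimage coors set0.
Proof. exact: sigma_algebra0. Qed.

Let rV_setC A : g_sigma_preimage coors A -> g_sigma_preimage coors (~` A).
Proof. exact: sigma_algebraC. Qed.

Let rV_bigcup (F : _^nat) : (forall i, g_sigma_preimage coors (F i)) ->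
  g_sigma_preimage coors (\bigcup_i (F i)).
Proof. exact: sigma_algebra_bigcup. Qed.

HB.instance Definition _ := @isMeasurable.Build (rV_display default_measure_display)
  'rV[R]_n (g_sigma_preimage coors) rV_set0 rV_setC rV_bigcup.

End measurable_rV.

Section rV_measurability.
Context d (T : measurableType d) (R : realType).

Lemma measurable_rV_coord n (i : 'I_n) :
  measurable_fun [set: 'rV[R]_n] (fun x : 'rV[R]_n => x ord0 i).
Proof.
move=> _ Y mY; rewrite setTI; apply: sub_sigma_algebra => /=.
rewrite -bigcup_seq/=; exists i => /=; first by rewrite mem_index_enum.
by exists Y => //; rewrite setTI.
Qed.

Lemma measurable_fun_rVP n (f : T -> 'rV[R]_n) :
  (forall i, measurable_fun [set: T] (fun t => f t ord0 i)) ->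
  measurable_fun [set: T] f.
Proof.
move=> mf; suff : g_sigma_preimage (fun i t => f t ord0 i) `<=` measurable.
  move=> prefS _ A mA; rewrite setTI; apply: prefS.
  rewrite (@g_sigma_preimage_comp _ R n 'rV[R]_n (fun i x => x ord0 i) T f).
  by exists A => //; rewrite setTI.
apply: smallest_sub; first exact: sigma_algebra_measurable.
case: n f mf => [|n] f mf; first by rewrite big_ord0.
rewrite -bigcup_mkord_ord; apply: bigcup_sub => i Ii.
by move=> A [B mB <-]; exact: mf.
Qed.

End rV_measurability.

(* Lebesgue measure on R^n, built as an iterated product since the library only
   has it on R: identify R^(n+1) with R * R^n and push the product forward. *)
Section lebesgue_rV_step.
Context (R : realType) (n : nat).
Variable m : {sigma_finite_measure set 'rV[R]_n -> \bar R}.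

Definition rV_cons (z : measurableTypeR R * 'rV[R]_n) : 'rV[R]_n.+1 :=
  row_mx (\row_(_ < 1) (z.1 : R)) z.2.

Definition rV_uncons (x : 'rV[R]_n.+1) : measurableTypeR R * 'rV[R]_n :=
  (x ord0 ord0, rsubmx (x : 'rV[R]_(1 + n))).

Lemma rV_consK : cancel rV_cons rV_uncons.
Proof.
case=> t y; rewrite /rV_cons /rV_uncons row_mxKr; congr pair.
rewrite (_ : ord0 = lshift n (ord0 : 'I_1)); last exact: val_inj.
by rewrite (@row_mxEl _ 1 1 n) mxE.
Qed.

Lemma measurable_rV_cons : measurable_fun [set: measurableTypeR R * 'rV[R]_n] rV_cons.
Proof.
apply: measurable_fun_rVP => i.
case: (split_ordP (i : 'I_(1 + n))) => j ->.
  under eq_fun do rewrite /rV_cons (@row_mxEl _ 1 1 n) mxE.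
  exact: measurable_fst.
under eq_fun do rewrite /rV_cons (@row_mxEr _ 1 1 n).
exact: (measurableT_comp (measurable_rV_coord _) measurable_snd).
Qed.

Lemma measurable_rV_uncons : measurable_fun [set: 'rV[R]_n.+1] rV_uncons.
Proof.
apply/measurable_fun_pairP; split; first exact: measurable_rV_coord.
apply: measurable_fun_rVP => i.
under eq_fun do rewrite /= mxE.
exact: measurable_rV_coord.
Qed.

Definition lebesgue_rV_step : set 'rV[R]_n.+1 -> \bar R :=
  pushforward (@lebesgue_measure R \x m)%E rV_cons.

Let step0 : lebesgue_rV_step set0 = 0%E.
Proof. by rewrite /lebesgue_rV_step /pushforward preimage_set0 measure0. Qed.

Let step_ge0 A : (0 <= lebesgue_rV_step A)%E.
Proof. by rewrite /lebesgue_rV_step /pushforward measure_ge0. Qed.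

Let step_sigma_additive : semi_sigma_additive lebesgue_rV_step.
Proof.
move=> F mF tF mUF; rewrite /lebesgue_rV_step /pushforward preimage_bigcup.
apply: measure_semi_sigma_additive.
- move=> k; rewrite -[X in measurable X]setTI.
  by apply: measurable_rV_cons => //; exact: mF.
- apply/trivIsetP => /= i j _ _ ij; rewrite -preimage_setI.
  by move/trivIsetP : tF => /(_ _ _ _ _ ij) ->//; rewrite preimage_set0.
- rewrite -preimage_bigcup -[X in measurable X]setTI.
  exact: measurable_rV_cons.
Qed.

HB.instance Definition _ := isMeasure.Build _ _ _ lebesgue_rV_step
  step0 step_ge0 step_sigma_additive.

Let step_sigma_finite : sigma_finite setT lebesgue_rV_step.
Proof.
have /sigma_finiteP[F [TF ndF Foo]] := sigma_finiteT (@lebesgue_measure R).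
have /sigma_finiteP[G [TG ndG Goo]] := sigma_finiteT m.
exists (fun i => rV_uncons @^-1` (F i `*` G i)).
  rewrite -preimage_bigcup -[LHS](preimage_setT rV_uncons); congr (_ @^-1` _).
  rewrite -setXTT TF TG predeqE => -[x y]; split.
    move=> [/= [i _ Fix] [k _ Gky]]; exists (maxn i k) => //; split.
    - by move: x Fix; exact/subsetPset/ndF/leq_maxl.
    - by move: y Gky; exact/subsetPset/ndG/leq_maxr.
  by move=> [i _ []/= ? ?]; split; exists i.
move=> i; have [mFi Fi] := Foo i; have [mGi Gi] := Goo i; split.
  rewrite -[X in measurable X]setTI.
  by apply: measurable_rV_uncons => //; exact: measurableX.
rewrite /lebesgue_rV_step /pushforward -comp_preimage.
rewrite (_ : rV_uncons \o rV_cons = id); last exact/funext/rV_consK.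
by rewrite preimage_id product_measure1E// lte_mul_pinfty// ge0_fin_numE.
Qed.

HB.instance Definition _ := Measure_isSigmaFinite.Build _ _ _ lebesgue_rV_step
  step_sigma_finite.

End lebesgue_rV_step.

Fixpoint lebesgue_rV (R : realType) (n : nat) :
    {sigma_finite_measure set 'rV[R]_n -> \bar R} :=
  if n is n'.+1 then lebesgue_rV_step (lebesgue_rV R n')
  else \d_(0 : 'rV[R]_0).

Section complex_analysis.
Context {R : realType}.

Definition cmod (z : R[i]) : R := Normc.normc z.

Definition expi (t : R) : R[i] := cos t +i* sin t.

Definition ccvg (u : nat -> R[i]) (l : R[i]) :=
  (fun k => cmod (u k - l)) @ \oo --> (0 : R).

(* Unconditional convergence of a family over an arbitrary index set: the net
   of its finite partial sums tends to l. *)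
Definition csummable_to (I : choiceType) (u : I -> R[i]) (l : R[i]) :=
  forall e : R, 0 < e -> exists A : {fset I}, forall B : {fset I},
    (A `<=` B)%fset -> cmod (\sum_(i <- B) u i - l) < e.

Context {n : nat}.
Implicit Types (x y : 'rV[R]_n) (f g : 'rV[R]_n -> R[i]).
Local Notation mu := (lebesgue_rV R n).

(* The norm carried by 'rV[R]_n in the library is the sup norm. *)
Definition enorm x : R := Num.sqrt (\sum_i x ord0 i ^+ 2).

Definition dotv x y : R := \sum_i x ord0 i * y ord0 i.

Definition cmeasurable f :=
  measurable_fun setT (fun x => complex.Re (f x)) /\
  measurable_fun setT (fun x => complex.Im (f x)).

Definition cintegrable f :=
  mu.-integrable setT (fun x => (complex.Re (f x))%:E) /\
  mu.-integrable setT (fun x => (complex.Im (f x))%:E).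

Definition cintegral f : R[i] :=
  (\int[mu]_x complex.Re (f x)) +i* (\int[mu]_x complex.Im (f x)).

Definition ccontinuous f :=
  continuous (fun x => complex.Re (f x)) /\
  continuous (fun x => complex.Im (f x)).

Definition csupp f : set 'rV[R]_n := closure [set x | f x != 0].

Definition evec (i : 'I_n) : 'rV[R]_n := delta_mx ord0 i.

Definition pderivable (i : 'I_n) f := forall x,
  derivable (fun y => complex.Re (f y)) x (evec i) /\
  derivable (fun y => complex.Im (f y)) x (evec i).

Definition pderive (i : 'I_n) f : 'rV[R]_n -> R[i] := fun x =>
  ('D_(evec i) (fun y => complex.Re (f y)) x) +i*
  ('D_(evec i) (fun y => complex.Im (f y)) x).

Fixpoint classC (k : nat) f : Prop :=
  ccontinuous f /\
  if k is k'.+1 then forall i, pderivable i f /\ classC k' (pderive i f)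
  else True.

Definition mindex := {ffun 'I_n -> nat}.
Implicit Types a b : mindex.

Definition mdeg a : nat := (\sum_i a i)%N.

Definition mpow x b : R := \prod_i x ord0 i ^+ b i.

Definition mderive a f : 'rV[R]_n -> R[i] :=
  foldr (fun i g => iter (a i) (pderive i) g) f (enum 'I_n).

Definition schwartz f :=
  (forall k, classC k f) /\
  forall a b, exists c : R, forall x, cmod ((mpow x b)%:C * mderive a f x) <= c.

(* A distribution is represented by a functional on all functions; only its
   values on Schwartz functions are meaningful.  Continuity is continuity at 0
   for the topology generated by the seminorms sup |x^b D^a f|. *)
Definition tdist := ('rV[R]_n -> R[i]) -> R[i].

Definition tempered (T : tdist) :=
  (forall (c : R[i]) f g, schwartz f -> schwartz g ->
     T (fun x => c * f x + g x) = c * T f + T g) /\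
  forall e : R, 0 < e -> exists N : nat, exists2 d : R, 0 < d &
    forall f, schwartz f ->
      (forall a b, (mdeg a <= N)%N -> (mdeg b <= N)%N ->
         forall x, cmod ((mpow x b)%:C * mderive a f x) <= d) ->
      cmod (T f) <= e.

Definition pairing g : tdist := fun f => cintegral (fun x => g x * f x).

Definition represents g (T : tdist) :=
  cmeasurable g /\
  forall f, schwartz f ->
    cintegrable (fun x => g x * f x) /\ T f = pairing g f.

Definition fourier f : 'rV[R]_n -> R[i] := fun xi =>
  (Num.sqrt (2 * pi) ^- n)%:C * cintegral (fun x => expi (- dotv x xi) * f x).

Definition ifourier f : 'rV[R]_n -> R[i] := fun x =>
  (Num.sqrt (2 * pi) ^- n)%:C * cintegral (fun xi => expi (dotv x xi) * f xi).

Definition dist_fourier (T : tdist) : tdist :=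
  fun f => T (fourier f).

Definition dist_ifourier (T : tdist) : tdist :=
  fun f => T (ifourier f).

Definition dist_mul g (T : tdist) : tdist :=
  fun f => T (fun x => g x * f x).

(* theta(D) T = F^-1 [theta F T], each operation acting by transposition on the
   test function: <theta(D) T, f> = <T, F (theta F^-1 f)>. *)
Definition fmult (theta : 'rV[R]_n -> R[i]) (T : tdist) : tdist :=
  dist_ifourier (dist_mul theta (dist_fourier T)).

Definition P0 (p : 'rV[R]_n -> R) :=
  [/\ measurable_fun setT p, forall x, 0 < p x,
      (0 < ess_inf mu (fun x => (p x)%:E))%E &
      (ess_sup mu (fun x => (p x)%:E) < +oo)%E].

Definition Clog (p : 'rV[R]_n -> R) :=
  exists (c pinf : R), [/\ 0 < c,
    forall x y, x != y ->
      `|p x - p y| <= c / ln (expR 1 + (enorm (x - y))^-1) &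
    forall x, `|p x - pinf| <= c / ln (expR 1 + enorm x)].

(* Extended-valued functions are allowed since the inner l^q sum in Lplq may
   be infinite; the infimum of the empty set is +oo. *)
Definition Lp (p : 'rV[R]_n -> R) (f : 'rV[R]_n -> \bar R) : \bar R :=
  ereal_inf [set l%:E | l in [set l : R | 0 < l /\
    (\int[mu]_x poweR (`|f x| * (l^-1)%:E) (p x) <= 1)%E]].

Definition Lplq (p q : 'rV[R]_n -> R) (f : nat -> 'rV[R]_n -> R[i]) : \bar R :=
  Lp p (fun x => poweR
    (\sum_(0 <= j <oo) poweR (cmod (f j x))%:E (q x))%E (q x)^-1).

Definition in_Phi (theta : nat -> 'rV[R]_n -> R[i]) :=
  [/\ forall j, schwartz (theta j),
      csupp (theta 0%N) `<=` [set x | enorm x <= 2],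
      forall j, (1 <= j)%N ->
        csupp (theta j) `<=` [set x | 2 ^+ j.-1 <= enorm x <= 2 ^+ j.+1],
      forall a, exists c : R, forall j x,
        2 ^+ (j * mdeg a) * cmod (mderive a (theta j) x) <= c &
      forall x, ccvg (fun N => \sum_(j < N) theta j x) 1].

(* Each theta_j(D) T is the distribution of a function that is unique up to a
   null set.  The infimum ranges over the choices of these functions, hence is
   the norm of any of them, and it is +oo were some theta_j(D) T not a
   function. *)
Definition Fnorm (theta : nat -> 'rV[R]_n -> R[i]) (s p q : 'rV[R]_n -> R)
    (T : tdist) : \bar R :=
  ereal_inf [set Lplq p q (fun j x => (2 `^ (j%:R * s x))%:C * g j x) |
    g in [set g : nat -> 'rV[R]_n -> R[i] |
      forall j, represents (g j) (fmult (theta j) T)]].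

Definition cubeQ (nu : nat) (m : 'rV[int]_n) : set 'rV[R]_n :=
  [set x | forall i, 2 ^- nu * (m ord0 i)%:~R <= x ord0 i
                     < 2 ^- nu * (m ord0 i + 1)%:~R].

(* The sum over m has at most one nonzero term at each point. *)
Definition fseqnorm (s p q : 'rV[R]_n -> R)
    (lambda : nat -> 'rV[int]_n -> R[i]) : \bar R :=
  Lplq p q (fun nu x => (2 `^ (nu%:R * s x))%:C *
    \sum_(m \in [set: 'rV[int]_n]) lambda nu m * (\1_(cubeQ nu m) x)%:C).

Definition cube_center (nu : nat) (m : 'rV[int]_n) : 'rV[R]_n :=
  \row_i (2 ^- nu * ((m ord0 i)%:~R + 2^-1)).

Definition dilQ (gamma : R) (nu : nat) (m : 'rV[int]_n) : set 'rV[R]_n :=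
  [set cube_center nu m + gamma *: (x - cube_center nu m) | x in cubeQ nu m].

Definition is_atom (gamma : R) (K : nat) (L : int) (nu : nat) (m : 'rV[int]_n)
    (f : 'rV[R]_n -> R[i]) :=
  [/\ classC K f,
      csupp f `<=` dilQ gamma nu m,
      forall a, (mdeg a <= K)%N ->
        forall x, cmod (mderive a f x) <= 2 ^+ (nu * mdeg a) &
      (1 <= nu)%N -> forall b, ((mdeg b)%:Z <= L) ->
        cintegral (fun x => (mpow x b)%:C * f x) = 0].

Definition ess_inf_on (A : set 'rV[R]_n) (f : 'rV[R]_n -> R) : \bar R :=
  ereal_sup [set y | \forall x \ae mu, A x -> (y <= (f x)%:E)%E].

Definition smooth_atoms (gamma : R) (K : nat) (L : 'rV[R]_n -> R)
    (f : nat -> 'rV[int]_n -> 'rV[R]_n -> R[i]) :=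
  forall nu m,
    is_atom gamma K (Num.floor (fine (ess_inf_on (cubeQ nu m) L))) nu m (f nu m).

Definition sigma_pq (p q : 'rV[R]_n -> R) : 'rV[R]_n -> R :=
  fun x => n%:R * ((Num.min 1 (Num.min (p x) (q x)))^-1 - 1).

Definition F_atoms (gamma : R) (s p q : 'rV[R]_n -> R)
    (f : nat -> 'rV[int]_n -> 'rV[R]_n -> R[i]) :=
  exists (eps : R) (K : nat), [/\ 0 < eps,
    (ess_sup mu (fun x => (s x)%:E) < (K%:R)%:E)%E &
    smooth_atoms gamma K (fun x => sigma_pq p q x - s x + eps) f].

(* T is the iterated sum over nu and m of lambda_{nu,m} f_{nu,m} in S'(R^n):
   for each nu the family in m sums unconditionally to a tempered distribution
   S nu, and the series of the S nu converges to T. *)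
Definition atomic_sum (lambda : nat -> 'rV[int]_n -> R[i])
    (f : nat -> 'rV[int]_n -> 'rV[R]_n -> R[i]) (T : tdist) :=
  exists S : nat -> tdist,
    (forall nu, tempered (S nu) /\ forall phi, schwartz phi ->
       csummable_to (fun m => lambda nu m * pairing (f nu m) phi) (S nu phi)) /\
    (tempered T /\ forall phi, schwartz phi ->
       ccvg (fun N => \sum_(nu < N) S nu phi) (T phi)).

End complex_analysis.

(* Main.v *)
(* Let K_j be the inverse Fourier transform of theta_j.  By Fubini's theorem,
   theta_j(D) of the atomic sum is the sum of the lambda_(nu,m) (K_j * a_(nu,m)).
   The moments of the atoms (for nu = j + d) and their smoothness (for nu < j)
   give decay 2^(-d eps), respectively 2^(-(j - nu) del), up to the majorant [hh].
   As the maximal function is not available for variable q, the modular of the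
   majorants is bounded through the telescoping equivalence of
   (sum_(i <= N) g_i)^r with sum_j g_j (sum_(i <= j) g_i)^(r - 1), r = p / q, which
   reduces the claim to linear averages over cubes, at whose scale log-Hölder
   continuity makes the exponents constant; the factor d + 1 lost on the way is
   absorbed by the decay. *)

From HB Require Import structures.
Require Import Defs.
From mathcomp Require Import all_boot all_order all_algebra finmap.
From mathcomp Require Import all_classical all_reals all_analysis.
From mathcomp Require Import measurable_realfun ess_sup_inf complex zify ring lra.

Set Implicit Arguments.
Unset Strict Implicit.
Unset Printing Implicit Defensive.

Import Order.TTheory GRing.Theory Num.Theory.
Import numFieldNormedType.Exports.

Local Open Scope classical_set_scope.
Local Open Scope ring_scope.
Local Notation mu := (lebesgue_rV _ _).
Local Notation meas u := (measurable_fun [set: 'rV[_]_(_)] u).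
Local Notation intg u := (mu.-integrable [set: 'rV[_]_(_)] (EFin \o u)).
Local Notation jmeas F := (measurable_fun [set: 'rV[_]_(_) * 'rV[_]_(_)] (fun t => F t.1 t.2)).

(* Let [Lam] stand for the q-th powers of the weighted coefficients, so that the modular is the
   integral of [Fsum ^ r]. Telescoping replaces it by the linear densities [aseq], and where [r < 1]
   averages of these control the majorants. Where [r >= 1] the relation
   [Lam = aseq * Fsum ^ (1 - r)] has a negative exponent; there [Lam] itself is averaged, Tonelli's
   theorem moves the average onto the weight [Zj ^ (r - 1)] that telescoping produces on the output
   side, and Young's inequality splits the product. A small multiple of the quantity under estimate
   remains and is absorbed, which requires that quantity to be finite beforehand. Exponents can be
   changed only on bases that lie between powers of [scl]; hence the floors added to the
   coefficients and to the majorants. Each change costs a power of [om], paid for by the decay of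
   the kernels, while the additive constants in [tame] depend on that decay. The circle is broken by
   the order of quantifiers in [exponent_change]: the power of [om] is fixed before the additive
   constant. *)
Create HintDb nneg.

Ltac unfold_var := match goal with |- is_true (_ ?v) => is_var v; unfold v end.

Ltac nneg := cbv beta; lazymatch goal with
  | |- forall _, _ => let x := fresh "x" in intro x; nneg
  | |- is_true (@Order.le _ _ _ (@EFin _ _)) => rewrite lee_fin; nneg
  | |- is_true (@Order.lt _ _ _ (@EFin _ _)) => rewrite lte_fin; nneg
  | |- is_true (@Order.le _ _ _ (cst _ _)) => rewrite /cst; nneg
  | |- is_true (@Order.le _ _ _ (@mule _ _ _)) => apply: mule_ge0; nneg
  | |- is_true (@Order.le _ _ _ (@integral _ _ _ _ _ _)) => apply: integral_ge0; nneg
  | |- is_true (@Order.le _ _ _ (@fine _ _)) => first [by [] | apply: fine_ge0; nneg]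
  | |- is_true (@Order.le _ _ _ (@GRing.mul _ _ _)) => first [by [] | apply: mulr_ge0; nneg]
  | |- is_true (@Order.lt _ _ _ (@GRing.mul _ _ _)) => first [by [] | apply: mulr_gt0; nneg]
  | |- is_true (@Order.le _ _ _ (@GRing.exp _ _ _)) => first [by [] | apply: exprn_ge0; nneg]
  | |- is_true (@Order.lt _ _ _ (@GRing.exp _ _ _)) => first [by [] | apply: exprn_gt0; nneg]
  | |- is_true (@Order.le _ _ _ (@GRing.inv _ _)) => rewrite invr_ge0; nneg
  | |- is_true (@Order.lt _ _ _ (@GRing.inv _ _)) => rewrite invr_gt0; nneg
  | |- is_true (@Order.le _ _ _ (@GRing.add _ _ (@GRing.opp _ _))) => rewrite subr_ge0; by [] || exact: ltW
  | |- is_true (@Order.le _ _ _ (@GRing.add _ _ _)) => first [by [] | apply: addr_ge0; nneg]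
  | |- is_true (@Order.lt _ _ _ (@GRing.add _ _ _)) =>
      first [by [] | apply: ltr_wpDl; nneg | apply: ltr_pwDl; nneg]
  | |- is_true (@Order.le _ _ _ (@powR _ _ _)) => exact: powR_ge0
  | |- is_true (@Order.lt _ _ _ (@powR _ _ _)) => apply: powR_gt0; nneg
  | |- is_true (@Order.le _ _ _ (@ln _ _)) =>
      first [solve [auto 3 with nneg] | apply: ln_ge0; by rewrite ?ler1n ?lerDl]
  | |- is_true (@Order.le _ _ _ (@bigop.body _ _ _ _ _)) =>
      first [apply: sumr_ge0; nneg | apply: sume_ge0; nneg]
  | |- is_true (@Order.le _ _ _ _) =>
      first [by [] | solve [auto 3 with nneg] | match goal with H : _ |- _ => by apply: H end
            | unfold_var; nneg | apply: ltW; nneg]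
  | |- _ => first [by [] | solve [auto 3 with nneg] | match goal with H : _ |- _ => by apply: H end
                  | unfold_var; nneg | by rewrite ?ltr0n ?lt_max ?ltr01 ?ler0n]
  end.

(** * Lebesgue measure and dyadic cubes *)

Section lebesgue_rV_integral.
Context {R : realType}.
Local Notation leb := (@lebesgue_measure R).

Lemma ge0_integral_rVS n (f : 'rV[R]_n.+1 -> \bar R) :
  measurable_fun setT f -> (forall x, (0 <= f x)%E) ->
  (\int[lebesgue_rV R n.+1]_x f x =
   \int[leb]_t \int[lebesgue_rV R n]_y f (rV_cons (t, y)))%E.
Proof.
move=> mf f0; rewrite /= /lebesgue_rV_step.
rewrite (ge0_integral_pushforward (@measurable_rV_cons R n))//.
rewrite preimage_setT fubini_tonelli1//.
  by apply: measurableT_comp => //; exact: measurable_rV_cons.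
by move=> x; exact: f0.
Qed.

Lemma ge0_integral_rV0 (f : 'rV[R]_0 -> \bar R) :
  measurable_fun setT f -> (forall x, (0 <= f x)%E) ->
  (\int[lebesgue_rV R 0]_x f x = f (0 : 'rV[R]_0)%R)%E.
Proof. by move=> mf f0; rewrite /= integral_dirac// diracT mul1e. Qed.

Lemma rV_cons0 n t (y : 'rV[R]_n) : rV_cons (t, y) ord0 ord0 = t.
Proof. by have /(congr1 fst) := rV_consK (t, y). Qed.

Lemma rV_consS n t (y : 'rV[R]_n) i : rV_cons (t, y) ord0 (lift ord0 i) = y ord0 i.
Proof.
rewrite /rV_cons (_ : lift ord0 i = rshift 1 i) ?(@row_mxEr _ 1 1 n)//.
exact: val_inj.
Qed.

Lemma rV_consD n t u (y z : 'rV[R]_n) :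
  rV_cons (t + u, y + z) = rV_cons (t, y) + rV_cons (u, z).
Proof.
apply/rowP => i; rewrite [RHS]mxE; case: (unliftP ord0 i) => [j|] ->.
  by rewrite !rV_consS mxE.
by rewrite !rV_cons0.
Qed.

Lemma rV_cons_uncons n (x : 'rV[R]_n.+1) : rV_cons (rV_uncons x) = x.
Proof.
case: n x => [|n] x; apply/rowP => i.
  by rewrite ord1; rewrite /rV_uncons rV_cons0.
case: (unliftP ord0 i) => [j|] ->; last by rewrite /rV_uncons rV_cons0.
rewrite /rV_uncons rV_consS mxE; congr (x _ _); exact: val_inj.
Qed.

Lemma ge0_integral_rV_prod n (u : 'I_n -> R -> \bar R) :
  (forall i, measurable_fun setT (u i)) -> (forall i t, (0 <= u i t)%E) ->
  (\int[lebesgue_rV R n]_x \prod_(i < n) u i (x ord0 i) =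
   \prod_(i < n) \int[leb]_t u i t)%E.
Proof.
move=> mu0 u0; elim: n u mu0 u0 => [|n IH] u mu0 u0.
  rewrite ge0_integral_rV0 ?big_ord0//; last by move=> x; rewrite big_ord0.
  by under eq_fun do rewrite big_ord0; exact: measurable_cst.
have mprod m (v : 'I_m -> R -> \bar R) : (forall i, measurable_fun setT (v i)) ->
    measurable_fun setT (fun x : 'rV[R]_m => \prod_(i < m) v i (x ord0 i))%E.
  move=> mv; elim: (index_enum _) => [|i l IHl].
    by under eq_fun do rewrite big_nil; exact: measurable_cst.
  under eq_fun do rewrite big_cons; apply: emeasurable_funM => //.
  by apply: measurableT_comp => //; exact: measurable_rV_coord.
rewrite ge0_integral_rVS//; last first.
- by move=> x; rewrite prode_ge0.
- exact: mprod.
rewrite big_ord_recl -IH//.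
under eq_integral => t _.
  under eq_integral => y _.
    rewrite big_ord_recl rV_cons0.
    under eq_bigr do rewrite rV_consS.
    over.
  rewrite ge0_integralZl//; last 2 first.
  - by apply: (mprod _ (fun i => u (lift ord0 i))).
  - by move=> y _; rewrite prode_ge0.
  over.
rewrite ge0_integralZr//; first exact: mu0.
by apply: integral_ge0 => y _; rewrite prode_ge0.
Qed.

Lemma ge0_integral_leb_translate (f : R -> \bar R) (v : R) :
  measurable_fun setT f -> (forall x, (0 <= f x)%E) ->
  (\int[leb]_t f (t + v)%R = \int[leb]_t f t)%E.
Proof.
move=> mf f0.
have mt : @measurable_fun _ _ (measurableTypeR R) (measurableTypeR R) setT
    (fun t => t + v).
  by apply: measurable_funD => //; exact: measurable_cst.
pose T : {mfun measurableTypeR R >-> measurableTypeR R} :=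
  @mfun_Sub _ _ (measurableTypeR R) (measurableTypeR R) _ (mem_set mt).
have eT : T = (fun t => t + v) :> (R -> R) by [].
pose nu := pushforward leb T.
(* Lebesgue measure is determined by its values on half-open intervals, whose length a translation
   preserves. *)
have H A : measurable A -> leb A = nu A.
  apply: lebesgue_measure_unique => X [[a b] /= _ <-].
  rewrite /nu /pushforward.
  rewrite (_ : _ @^-1` _ = `]a - v, b - v]%classic); last first.
    by apply/seteqP; split => x /=; rewrite !in_itv/= ltrBlDr lerBrDr.
  rewrite !lebesgue_measure_itv/= !lte_fin ltrD2r; case: ifP => // _.
  by rewrite -!EFinD; congr (_%:E); ring.
transitivity (\int[nu]_t f t)%E; last by apply: eq_measure_integral => A mA _; first [exact: H | exact/esym/H].
by rewrite /nu (ge0_integral_pushforward (phi := T)) ?preimage_setT.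
Qed.

Lemma meas_rVD n (v : 'rV[R]_n) : 
  measurable_fun [set: 'rV[R]_n] (fun x : 'rV[R]_n => x + v).
Proof.
apply: measurable_fun_rVP => i; under eq_fun do rewrite mxE.
apply: measurable_funD; [exact: measurable_rV_coord | exact: measurable_cst].
Qed.

Lemma ge0_integral_translate n (f : 'rV[R]_n -> \bar R) (v : 'rV[R]_n) :
  measurable_fun setT f -> (forall x, (0 <= f x)%E) ->
  (\int[lebesgue_rV R n]_x f (x + v)%R = \int[lebesgue_rV R n]_x f x)%E.
Proof.
move=> mf f0; elim: n f v mf f0 => [|n IH] f v mf f0.
  by apply: eq_integral => x _; congr f; rewrite [LHS]thinmx0 [RHS]thinmx0.
have mfv : measurable_fun [set: 'rV[R]_n.+1] (fun x : 'rV[R]_n.+1 => f (x + v)).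
  by apply: measurableT_comp => //; exact: meas_rVD.
apply: etrans (ge0_integral_rVS mfv (fun x => f0 _)) (etrans _ (esym (ge0_integral_rVS mf f0))).
case: (rV_uncons v) (rV_cons_uncons v) => t0 y0 <-.
have mc : measurable_fun setT (fun x : measurableTypeR R * 'rV[R]_n => f (rV_cons x)).
  by apply: measurableT_comp => //; exact: measurable_rV_cons.
under eq_integral => t _.
  under eq_integral do rewrite -rV_consD.
  rewrite (IH (fun y => f (rV_cons (t + t0, y))))//; last first.
    by apply: (measurableT_comp mf); apply: (measurableT_comp (@measurable_rV_cons R n)); exact: measurable_pair1.
  over.
rewrite (ge0_integral_leb_translate (f := fun t => \int[lebesgue_rV R n]_y f (rV_cons (t, y)))%E)//.
  exact: (measurable_fun_fubini_tonelli_F (m2 := lebesgue_rV R n) _ mc (fun=> f0 _)).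
by nneg.
Qed.

Lemma ler_coord n (x : 'rV[R]_n) i : `|x ord0 i| <= `|x|.
Proof.
rewrite [leRHS]/Num.Def.normr/= mx_normrE.
exact: (le_bigmax _ (fun ij : 'I_1 * 'I_n => `|x ij.1 ij.2|) (ord0, i)).
Qed.

Lemma ler_rV_norm n (x : 'rV[R]_n) c : 0 <= c ->
  (forall i, `|x ord0 i| <= c) -> `|x| <= c.
Proof.
move=> c0 xc; rewrite [leLHS]/Num.Def.normr/= mx_normrE.
by apply/bigmax_leP; split=> // -[i j] _ /=; rewrite (ord1 i).
Qed.

Lemma meas_rV_norm n : measurable_fun [set: 'rV[R]_n] (fun x : 'rV[R]_n => `|x|).
Proof.
under eq_fun do rewrite /Num.Def.normr/= mx_normrE.
elim: (index_enum _) => [|i l IHl].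
  by under eq_fun do rewrite big_nil; exact: measurable_cst.
under eq_fun do rewrite big_cons; apply: measurable_maxr => //.
apply: measurableT_comp => //; case: i => a b /=; rewrite (ord1 a).
exact: measurable_rV_coord.
Qed.

Lemma integral_inv_sqr (s : R) : 0 < s ->
  (\int[leb]_t ((1 + s * `|t|) ^- 2)%:E = (2 / s)%:E)%E.
Proof.
move=> s0; have p0 t : 0 < 1 + s * `|t| by nneg.
have cf : continuous (fun t : R => (1 + s * `|t|) ^- 2).
  move=> t; apply: cvgV; first by rewrite expf_neq0// gt_eqF.
  have c1 : {for t, continuous (fun t : R => 1 + s * `|t|)}.
    by apply: cvgD; [exact: cvg_cst | apply: cvgMr; exact: norm_continuous].
  exact: (continuous_comp c1 (@exprn_continuous R 2 _)).
rewrite (@ge0_symfun_integralT _ (fun t => (1 + s * `|t|) ^- 2))//; last first.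
- by move=> t /=; rewrite normrN.
- by nneg.
rewrite (_ : [set x | _] = `[0, +oo[%classic); last first.
  by apply/seteqP; split => x /=; rewrite in_itv/= andbT.
(* An antiderivative of the integrand on the half-line, vanishing at infinity. *)
pose F t : R := - (s * (1 + s * t))^-1.
have q0 (t : R) : 0 <= t -> 0 < 1 + s * t by nneg.
have dF (t : R) : 0 <= t -> is_derive t 1 F ((1 + s * t) ^- 2).
  move=> t0; have := q0 _ t0 => /gt_eqF/negbT n0.
  have n1 : s * (1 + s * t) != 0 by rewrite mulf_neq0// gt_eqF.
  apply: is_derive_eq; rewrite /GRing.scale/= mulr1 !(mul0r, mulr0, addr0, add0r, mulr1).
  by field; rewrite ?n0 gt_eqF.
rewrite (@ge0_continuous_FTC2y _ _ F 0 0).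
- rewrite -EFinD -EFinM /F mulr0 addr0 mulr1; congr (_%:E); ring.
- by nneg.
- by apply: continuous_subspaceT; exact: cf.
- rewrite -[X in _ --> X]oppr0; apply: cvgN; apply/gtr0_cvgV0.
    by apply: filterS (nbhs_pinfty_ge (num_real 0)) => t t0; rewrite mulr_gt0// q0.
  apply/cvgryPge => A; apply: filterS (nbhs_pinfty_ge (num_real (s^-1 * (s^-1 * A - 1)))) => t.
  by rewrite ler_pdivrMl// lerBlDl ler_pdivrMl.
- by move=> x x0; have [] := dF x (ltW x0).
- have [] := dF 0 (lexx _) => /derivable1_diffP/differentiable_continuous h _.
  exact: cvg_at_right_filter.
- move=> x; rewrite in_itv/= andbT => x0; rewrite derive1E.
  by have [_ ->] := dF x (ltW x0); rewrite ger0_norm// ltW.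
Qed.

Lemma meas_funV d (T : measurableType d) (f : T -> R) :
  measurable_fun setT f -> measurable_fun setT (fun x => (f x)^-1).
Proof.
move=> mf; rewrite (_ : (fun _ => _) = fun x => f x * ((f x ^+ 2) `^ (- 1))).
  apply: measurable_funM => //; apply: (measurableT_comp (measurable_powR _)).
  exact: measurable_funX.
apply/funext => x; rewrite powR_inv1 ?sqr_ge0//.
have [->|fx0] := eqVneq (f x) 0; first by rewrite invr0 mul0r.
by rewrite expr2 invfM mulrA mulfV// mul1r.
Qed.

Lemma meas_fun_powR d (T : measurableType d) (f g : T -> R) :
  measurable_fun setT f -> measurable_fun setT g ->
  measurable_fun setT (fun x => f x `^ g x).
Proof.
move=> mf mg.
rewrite (_ : (fun _ => _) = fun x => if f x == 0 then (g x == 0)%:R else expR (g x * ln (f x)))//.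
apply: measurable_fun_ifT.
- by apply: measurable_fun_eqr => //; exact: measurable_cst.
- rewrite (_ : (fun x => _) = fun x => if g x == 0 then 1 else 0 : R); last first.
    by apply/funext => x; case: eqP.
  apply: measurable_fun_ifT; try exact: measurable_cst.
  by apply: measurable_fun_eqr => //; exact: measurable_cst.
- apply: measurableT_comp => //; apply: measurable_funM => //.
  by apply: measurableT_comp => //; exact: measurable_ln.
Qed.

Lemma meas_kernel n (s : R) (y : 'rV[R]_n) M :
  measurable_fun [set: 'rV[R]_n] (fun x : 'rV[R]_n => (1 + s * `|x - y|) ^- M).
Proof.
apply: meas_funV; apply: measurable_funX.
apply: measurable_funD; first exact: measurable_cst.
apply: measurable_funM; first exact: measurable_cst.
by apply: (measurableT_comp (@meas_rV_norm n)); exact: meas_rVD.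
Qed.

(** The sup norm dominates each coordinate, so the kernel is at most a product of one-dimensional
    kernels of exponent 2. This is why [2 * n] is the decay reserved for integrability
    throughout. *)
Lemma integral_kernel_le n (s : R) (y : 'rV[R]_n) : 0 < s ->
  (\int[lebesgue_rV R n]_x ((1 + s * `|x - y|) ^- (2 * n))%:E <= ((2 / s) ^+ n)%:E)%E.
Proof.
move=> s0.
rewrite (ge0_integral_translate (f := fun x => ((1 + s * `|x|) ^- (2 * n))%:E))//; last 2 first.
- by apply/measurable_EFinP; have := meas_kernel s (0 : 'rV[R]_n) (2 * n); under eq_fun do rewrite subr0.
- by nneg.
have m1 : measurable_fun setT (fun t : R => ((1 + s * `|t|) ^- 2)%:E).
  apply/measurable_EFinP; apply: meas_funV; apply: measurable_funX.
  apply: measurable_funD; first exact: measurable_cst.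
  apply: measurable_funM; first exact: measurable_cst.
  exact: normr_measurable.
have E := @ge0_integral_rV_prod n (fun=> fun t => ((1 + s * `|t|) ^- 2)%:E) (fun=> m1).
rewrite (_ : ((2 / s) ^+ n)%:E = \prod_(i < n) \int[leb]_t ((1 + s * `|t|) ^- 2)%:E)%E; last first.
  under eq_bigr do rewrite integral_inv_sqr//.
  by rewrite prodEFin prodr_const card_ord.
rewrite -E; last by nneg.
apply: ge0_le_integral => //.
- by nneg.
- by apply/measurable_EFinP; have := meas_kernel s (0 : 'rV[R]_n) (2 * n); under eq_fun do rewrite subr0.
- elim: (index_enum _) => [|i l IHl].
    by under eq_fun do rewrite big_nil; exact: measurable_cst.
  under eq_fun do rewrite big_cons; apply: emeasurable_funM => //.
  by apply: (measurableT_comp m1); exact: measurable_rV_coord.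
move=> x _; rewrite prodEFin lee_fin prodfV lef_pV2 ?posrE; last 2 first.
- by nneg.
- by apply: prodr_gt0 => i _; rewrite exprn_gt0// ltr_pwDl// mulr_ge0// ltW.
rewrite exprM -[X in _ ^+ X]card_ord -prodr_const; apply: ler_prod => i _.
rewrite exprn_ge0 ?addr_ge0 ?mulr_ge0 ?(ltW s0)//= lerXn2r ?nnegrE//.
- by nneg.
- by nneg.
- by rewrite lerD2l ler_pM2l// ler_coord.
Qed.

End lebesgue_rV_integral.

Section dyadic_cubes.
Context {R : realType} {n : nat}.
Local Notation cubeQ := (@cubeQ R n).
Implicit Types (j : nat) (x y : 'rV[R]_n) (m : 'rV[int]_n).

Definition cidx j x : 'rV[int]_n := \row_i Num.floor (2 ^+ j * x ord0 i).

(** The lower corner of the dyadic cube of [x], where variable exponents are frozen so as to become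
    constant on cubes. *)
Definition corner j x : 'rV[R]_n := \row_i (2 ^- j * (Num.floor (2 ^+ j * x ord0 i))%:~R).

Lemma cubeQP j m x : cubeQ j m x <-> cidx j x = m.
Proof.
have p2 : 0 < 2 ^+ j :> R by nneg.
have E k i : (2 ^- j * (k ord0 i)%:~R <= x ord0 i < 2 ^- j * (k ord0 i + 1)%:~R) =
    (Num.floor (2 ^+ j * x ord0 i) == k ord0 i :> int).
  by rewrite floor_eq ler_pdivrMl// -ltr_pdivlMl ?invr_gt0// invrK.
split=> [H|<-].
  by apply/rowP => i; rewrite mxE; apply/eqP; rewrite -E.
by move=> i; rewrite E mxE.
Qed.

Lemma cidx_coarse j d x y : cidx (j + d) x = cidx (j + d) y -> cidx j x = cidx j y.
Proof.
move=> /rowP H; apply/rowP => i; have := H i; rewrite !mxE => {}H.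
have p2 : 0 < 2 ^+ d :> R by nneg.
apply: floor_def.
set a := Num.floor (2 ^+ j * y _ i).
have := floor_itv (2 ^+ j * y ord0 i); rewrite -/a => /andP[a1 a2].
have := floor_itv (2 ^+ (j + d) * x ord0 i); rewrite H => /andP[b1 b2].
have := floor_itv (2 ^+ (j + d) * y ord0 i) => /andP[c1 c2].
move: b1 b2 c1 c2; set b := Num.floor _ => b1 b2 c1 c2.
have e z : 2 ^+ (j + d) * z = 2 ^+ d * (2 ^+ j * z) :> R by rewrite exprD mulrCA mulrA.
have A1 : (2 ^+ d * a <= b)%R.
  rewrite -ltzD1 -(ltr_int R); apply: le_lt_trans c2.
  by rewrite e rmorphM/= rmorphXn/= ler_pM2l.
have A2 : (b < 2 ^+ d * (a + 1))%R.
  rewrite -(ltr_int R); apply: le_lt_trans c1 _.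
  by rewrite e rmorphM/= rmorphXn/= ltr_pM2l.
apply/andP; split.
  rewrite -(ler_pM2l p2) -e; apply: le_trans b1.
  by move: A1; rewrite -(ler_int R) rmorphM/= rmorphXn.
rewrite -(ltr_pM2l p2) -e; apply: lt_le_trans b2 _.
by move: A2; rewrite -lezD1 -(ler_int R) rmorphM/= rmorphXn.
Qed.

Lemma corner_dist j x : `|x - corner j x| <= 2 ^- j.
Proof.
have p2 : 0 < 2 ^+ j :> R by nneg.
apply: ler_rV_norm => [|i]; first by nneg.
rewrite !mxE; have /andP[h1 h2] := floor_itv (2 ^+ j * x ord0 i).
rewrite ger0_norm; last by rewrite subr_ge0 ler_pdivrMl.
rewrite lerBlDr -[X in _ <= X + _]mulr1 -mulrDr ler_pdivlMl//.
by rewrite rmorphD/= in h2; lra.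
Qed.

Lemma corner_cidx j x y : cidx j x = cidx j y -> corner j x = corner j y.
Proof. by move=> /rowP H; apply/rowP => i; have := H i; rewrite !mxE => ->. Qed.

Lemma cidx_dist j x y : cidx j x = cidx j y -> `|x - y| <= 2 ^- j.
Proof.
have p2 : 0 < 2 ^+ j :> R by nneg.
move=> /rowP H; apply: ler_rV_norm => [|i]; first by nneg.
have := H i; rewrite !mxE => {}H.
have /andP[h1 h2] := floor_itv (2 ^+ j * x ord0 i).
have /andP[] := floor_itv (2 ^+ j * y ord0 i); rewrite -H => h3 h4.
rewrite rmorphD/= in h2 h4.
rewrite -[leLHS](mulKf (lt0r_neq0 p2)) -[leRHS]mulr1 ler_pM2l ?invr_gt0//.
rewrite -[X in X * `|_|](ger0_norm (ltW p2)) -normrM mulrBr ler_norml.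
by apply/andP; split; lra.
Qed.

Lemma meas_cubeQ j m : measurable (cubeQ j m).
Proof.
rewrite (_ : cubeQ j m = \bigcap_(i in [set: 'I_n]) [set x : 'rV[R]_n |
    x ord0 i \in `[2 ^- j * (m ord0 i)%:~R, 2 ^- j * (m ord0 i + 1)%:~R[]).
  apply: fin_bigcap_measurable => // i _.
  have := @measurable_rV_coord R n i measurableT _
    (measurable_itv `[2 ^- j * (m ord0 i)%:~R, 2 ^- j * (m ord0 i + 1)%:~R[).
  by rewrite setTI.
apply/seteqP; split=> x H i => [_|]; first by have := H i; rewrite /= ?in_itv.
by have := H i I; rewrite /= ?in_itv.
Qed.

Lemma meas_cidx d' (T : measurableType d') j (u : 'rV[int]_n -> T) :
  measurable_fun [set: 'rV[R]_n] (fun x => u (cidx j x)).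
Proof.
move=> _ Y mY; rewrite setTI.
rewrite (_ : _ @^-1` Y = \bigcup_(m in [set: 'rV[int]_n])
    (cubeQ j m `&` [set _ | Y (u m)])).
  apply: countable_bigcupT_measurable; first exact: countableP.
  move=> m; have [Ym|nYm] := pselect (Y (u m)).
    rewrite (_ : _ `&` _ = cubeQ j m); first exact: meas_cubeQ.
    by apply/seteqP; split=> [x []|x].
  by rewrite (_ : _ `&` _ = set0)//; apply/seteqP; split=> [x []|x].
apply/seteqP; split=> [x /= Yx|x [m _] []].
  by exists (cidx j x) => //; split=> //; apply/cubeQP.
by move=> /cubeQP <-.
Qed.

Lemma measure_cubeQ j m : mu (cubeQ j m) = ((2 ^- j) ^+ n)%:E.
Proof.
have p2 : 0 < 2 ^+ j :> R by nneg.
pose I i := `[2 ^- j * (m ord0 i)%:~R, 2 ^- j * (m ord0 i + 1)%:~R[%classic : set R.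
have E : \1_(cubeQ j m) = (fun x : 'rV[R]_n => \prod_(i < n) \1_(I i) (x ord0 i)) :> (_ -> R).
  apply/funext => x; rewrite indicE; case: (boolP (x \in cubeQ j m)).
    rewrite inE => Qx; rewrite big1// => i _; rewrite indicE (_ : _ \in _)//.
    by rewrite inE /I/= in_itv/=; exact: Qx.
  rewrite notin_setE => nQ.
  have [i /negP ni] : exists i, ~ (2 ^- j * (m ord0 i)%:~R <= x ord0 i < 2 ^- j * (m ord0 i + 1)%:~R).
    by apply/not_existsP => H; apply: nQ => i; have := H i => /contrapT.
  by rewrite (bigD1 i)//= indicE memNset ?mul0r// /I /= in_itv; exact/negP.
rewrite -[cubeQ j m]setIT -(integral_indic _ _ (meas_cubeQ j m))// E.
under eq_integral do rewrite -prodEFin.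
rewrite (@ge0_integral_rV_prod _ n (fun i t => (\1_(I i) t)%:E))//.
  have EI i : (\int[@lebesgue_measure R]_t (\1_(I i) t)%:E = (2 ^- j)%:E)%E.
    rewrite integral_indic//= ?setIT; last exact: measurable_itv.
    rewrite lebesgue_measure_itv/= lte_fin ltr_pM2l ?invr_gt0// ltr_int ltzD1 lexx.
    by rewrite -EFinB -mulrBr rmorphD/= addrAC subrr add0r mulr1.
  by under eq_bigr do rewrite EI; rewrite prodEFin prodr_const card_ord.
by move=> i; apply/measurable_EFinP; apply: measurable_indic; exact: measurable_itv.
Qed.

(** The sigma-algebra is the one generated by the coordinates, so continuity is used through
    approximation: [f] is the limit of its values at the corners, which are functions of the cube
    index. *)
Lemma meas_cont (f : 'rV[R]_n -> R) : continuous f -> measurable_fun setT f.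
Proof.
move=> cf; apply: (@measurable_fun_cvg _ _ _ _ (fun j x => f (corner j x))) => //.
  move=> j; rewrite (_ : (fun _ => _) = fun x => (fun m : 'rV[int]_n =>
     f (\row_i (2 ^- j * (m ord0 i)%:~R))) (cidx j x)); first exact: (meas_cidx j (fun m : 'rV[int]_n => f (\row_i (2 ^- j * (m ord0 i)%:~R)))).
  by apply/funext => x; congr f; apply/rowP => i; rewrite !mxE.
move=> x _; suff H : (fun j => corner j x) @ \oo --> x by exact: (cvg_comp _ _ H (cf x)).
apply/cvgrPdist_le => e e0.
near=> j; apply: le_trans (corner_dist _ _) _.
rewrite invf_ple ?posrE ?exprn_gt0//; apply: (@le_trans _ _ j%:R).
  by near: j; exact: nbhs_infty_ger.
by rewrite -natrX ler_nat ltnW// ltn_expl.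
Unshelve. all: by end_near. Qed.

End dyadic_cubes.

(** * Slowly varying exponents *)

Section slow_variation.
Context {R : realType} {n : nat}.
Implicit Types (i j : nat) (x y z : 'rV[R]_n) (e : 'rV[R]_n -> R).

Definition om j x y : R := 1 + 2 ^+ j * `|x - y|.

(** Joins the scale and the position: its logarithm weighs the local log-Hölder modulus at distance
    [2 ^- j] and the decay at infinity at once. *)
Definition scl j x : R := 2 ^+ j.+1 * (1 + `|x|).

Lemma om_ge1 j x y : 1 <= om j x y.
Proof. by rewrite lerDl mulr_ge0// exprn_ge0. Qed.

Lemma om_gt0 j x y : 0 < om j x y.
Proof. exact: lt_le_trans (om_ge1 _ _ _). Qed.
Hint Extern 0 (is_true (@Order.lt _ _ _ (om _ _ _))) => by apply: om_gt0 : nneg.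

Lemma om_ge0 j x y : 0 <= om j x y.
Proof. exact/ltW/om_gt0. Qed.

Lemma omC j x y : om j x y = om j y x.
Proof. by rewrite /om distrC. Qed.

Lemma ler_om i j x y : (i <= j)%N -> om i x y <= om j x y.
Proof. by move=> ij; rewrite lerD2l ler_wpM2r// ler_weXn2l// ler1n. Qed.

(** Peetre's inequality; it moves a weight from one point to another at the cost of a further
    weight. *)
Lemma om_tri j x y z : om j x z <= om j x y * om j y z.
Proof.
rewrite /om; have := ler_distD y x z.
have p2 : 0 < 2 ^+ j :> R by nneg.
move=> h; rewrite mulrDl mul1r mulrDr mulr1 -!addrA lerD2l.
have : 0 <= 2 ^+ j * `|x - y| * (2 ^+ j * `|y - z|) by nneg.
have : 2 ^+ j * `|x - z| <= 2 ^+ j * `|x - y| + 2 ^+ j * `|y - z|.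
  by rewrite -mulrDr ler_pM2l.
lra.
Qed.

Lemma om_near j x y : `|x - y| <= 2 ^- j -> om j x y <= 2.
Proof.
have p2 : 0 < 2 ^+ j :> R by nneg.
move=> h; rewrite /om (_ : 2 = 1 + 1)// lerD2l.
by rewrite mulrC -ler_pdivlMr// div1r.
Qed.

Lemma scl_ge2 j x : 2 <= scl j x.
Proof.
have h : 1 <= 2 ^+ j :> R by rewrite exprn_ege1// ler1n.
rewrite /scl exprS; have := normr_ge0 x => h2.
have : 1 <= 2 ^+ j * (1 + `|x|) by rewrite -[leLHS]mulr1 ler_pM// lerDl.
rewrite -mulrA; lra.
Qed.

Lemma scl_gt0 j x : 0 < scl j x.
Proof. exact: lt_le_trans (scl_ge2 _ _). Qed.
Hint Extern 0 (is_true (@Order.lt _ _ _ (scl _ _))) => by apply: scl_gt0 : nneg.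

Lemma ln_scl_ge0 j x : 0 <= ln (scl j x).
Proof. by rewrite ln_ge0// (le_trans _ (scl_ge2 _ _))// ler1n. Qed.
Hint Extern 0 (is_true (@Order.le _ _ _ (ln (scl _ _)))) => by apply: ln_scl_ge0 : nneg.

Lemma ln_om_ge0 j x y : 0 <= ln (om j x y).
Proof. by nneg. Qed.
Hint Extern 0 (is_true (@Order.le _ _ _ (ln (om _ _ _)))) => by apply: ln_om_ge0 : nneg.

Lemma ln_scl j x : ln (scl j x) = j.+1%:R * ln 2 + ln (1 + `|x|).
Proof.
by rewrite /scl lnM ?posrE ?exprn_gt0 ?ltr_pwDl// lnXn// mulr_natl.
Qed.

(* The two log-Hölder conditions combined: over a distance [2^-j om] an exponent
   moves so little that powers of size [scl j x ^ +-A] are only changed by a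
   power of [om]; see [exponent_change]. *)
Definition slow e := (exists b, forall x, `|e x| <= b) /\
  exists2 c, 0 <= c &
    forall j x y, `|e x - e y| * ln (scl j x) <= c * (1 + ln (om j x y)).

Lemma slowD e e' : slow e -> slow e' -> slow (fun x => e x + e' x).
Proof.
move=> [[b hb] [c c0 hc]] [[b' hb'] [c' c0' hc']]; split.
  by exists (b + b') => x; apply: le_trans (ler_normD _ _) _; rewrite lerD.
exists (c + c') => [|j x y]; first exact: addr_ge0.
rewrite mulrDl; apply: le_trans (lerD (hc _ _ _) (hc' _ _ _)).
rewrite -mulrDl ler_wpM2r ?ln_scl_ge0// opprD addrACA; exact: ler_normD.
Qed.

Lemma slow_cst k : slow (fun=> k).
Proof.
split; first by exists `|k|.
by exists 0 => // j x y; rewrite subrr normr0 !mul0r.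
Qed.

Lemma slowM e e' : slow e -> slow e' -> slow (fun x => e x * e' x).
Proof.
move=> [[b hb] [c c0 hc]] [[b' hb'] [c' c0' hc']]; split.
  by exists (b * b') => x; rewrite normrM ler_pM.
have b0 : 0 <= b by apply: le_trans (hb 0).
have b0' : 0 <= b' by apply: le_trans (hb' 0).
exists (c * b' + b * c') => [|j x y]; first by nneg.
rewrite (_ : e x * e' x - e y * e' y = (e x - e y) * e' x + e y * (e' x - e' y)); last by ring.
apply: le_trans (ler_wpM2r (ln_scl_ge0 _ _) (ler_normD _ _)) _.
rewrite !normrM mulrDl [leRHS]mulrDl lerD//.
  rewrite mulrAC [leRHS]mulrAC ler_pM// ?mulr_ge0 ?ln_scl_ge0//.
by rewrite -!mulrA ler_pM// ?mulr_ge0 ?ln_scl_ge0.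
Qed.

Lemma slowN e : slow e -> slow (fun x => - e x).
Proof.
move=> /(slowM (slow_cst (-1))); congr slow.
by apply/funext => x; rewrite mulN1r.
Qed.

Lemma slowV e (m : R) : 0 < m -> (forall x, m <= e x) -> slow e ->
  slow (fun x => (e x)^-1).
Proof.
move=> m0 me [_ [c c0 hc]].
have e0 x : 0 < e x by apply: lt_le_trans (me x).
split.
  exists m^-1 => x; rewrite ger0_norm ?invr_ge0 ?(ltW (e0 x))//.
  by rewrite lef_pV2 ?posrE.
exists (m^-1 * m^-1 * c) => [|j x y]; first by nneg.
rewrite (_ : (e x)^-1 - (e y)^-1 = (e x)^-1 * (e y)^-1 * (e y - e x)); last first.
  by field; rewrite !gt_eqF.
rewrite normrM distrC.
have i0 : 0 <= (e x)^-1 / e y by nneg.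
have im : (e x)^-1 / e y <= m^-1 * m^-1.
  by apply: ler_pM; rewrite ?invr_ge0 ?(ltW (e0 _))// lef_pV2 ?posrE.
rewrite (ger0_norm i0) -[leLHS]mulrA -[leRHS]mulrA; apply: ler_pM => //.
by nneg.
Qed.

Lemma enorm_ge x : `|x| <= enorm x.
Proof.
apply: ler_rV_norm => [|i]; first exact: sqrtr_ge0.
rewrite -sqrtr_sqr /enorm ler_sqrt; last by apply: sumr_ge0 => k _; exact: sqr_ge0.
by rewrite (bigD1 i)//= lerDl; apply: sumr_ge0 => k _; exact: sqr_ge0.
Qed.

Lemma enorm_le x : enorm x <= n%:R * `|x|.
Proof.
rewrite /enorm -[leRHS]ger0_norm ?mulr_ge0// -sqrtr_sqr ler_sqrt ?sqr_ge0//.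
apply: (@le_trans _ _ (\sum_(i < n) `|x| ^+ 2)).
  apply: ler_sum => i _; rewrite -[leLHS]ger0_norm ?sqr_ge0// normrX.
  by rewrite lerXn2r ?nnegrE// ler_coord.
rewrite sumr_const card_ord -[_ *+ n]mulr_natl exprMn; apply: ler_wpM2r; first exact: sqr_ge0.
rewrite -natrX ler_nat; case: (n) => // k; rewrite expnS expn1; exact: leq_pmulr.
Qed.

(** [ln (scl j x)] is the sum of [j.+1 * ln 2] and [ln (1 + |x|)]. The condition at infinity, used
    at both points, pays for the second summand. For the first, either [om] exceeds [2 ^ (j / 2)]
    and boundedness of [e] suffices, or the points are closer than [2 ^ (- j / 2)] and the local
    condition applies. *)
Lemma Clog_slow e : (0 < n)%N -> Clog e -> slow e.
Proof.
move=> n0 [c [einf [c0 h1 h2]]].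
have e1 : 1 < expR 1 :> R by rewrite expR_gt1.
have L1 (a : R) : 0 <= a -> 1 <= ln (expR 1 + a).
  by move=> a0; rewrite -[leLHS]expRK ler_ln ?posrE ?expR_gt0 ?lerDl// ltr_pwDl ?expR_gt0.
have E0 x : 0 <= enorm x by exact: sqrtr_ge0.
have h2' x : `|e x - einf| <= c / ln (expR 1 + `|x|).
  apply: le_trans (h2 x) _; rewrite ler_pM2l// lef_pV2 ?posrE; last 2 first.
  - by apply: lt_le_trans (L1 _ (E0 x)).
  - by apply: lt_le_trans (L1 _ (normr_ge0 x)).
  by rewrite ler_ln ?posrE ?ltr_pwDl ?expR_gt0// lerD2l enorm_ge.
have hb x : `|e x| <= `|einf| + c.
  rewrite -[e x](subrK einf) addrC; apply: le_trans (ler_normD _ _) _.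
  rewrite lerD2l; apply: le_trans (h2' x) _.
  by rewrite ler_pdivrMr ?ler_peMr ?(ltW c0) ?L1//; apply: lt_le_trans (L1 _ (normr_ge0 x)).
split; first by exists (`|einf| + c).
pose b := `|einf| + c.
have b0 : 0 <= b by nneg.
have l2 : 0 < ln 2 :> R by rewrite ln_gt0// ltr1n.
have ln0 : 0 <= ln n%:R :> R by nneg.
exists (2 * c + 2 * b * (2 + ln 2) + c * (2 + 2 * ln n%:R + ln 2)) => [|j x y].
  by nneg.
have lo := ln_om_ge0 j x y.
rewrite ln_scl mulrDr addrC.
have H1 : `|e x - e y| * ln (1 + `|x|) <= c * (2 + ln (om j x y)).
  have LX := L1 _ (normr_ge0 x); have LY := L1 _ (normr_ge0 y).
  have d1 : `|e x - e y| <= c / ln (expR 1 + `|x|) + c / ln (expR 1 + `|y|).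
    rewrite (_ : e x - e y = (e x - einf) - (e y - einf)); last by ring.
    by apply: le_trans (ler_normB _ _) _; rewrite lerD.
  have lx : ln (1 + `|x|) <= ln (expR 1 + `|x|).
    by rewrite ler_ln ?posrE ?ltr_pwDl ?expR_gt0// lerD2r ltW.
  have lxy : ln (1 + `|x|) <= ln (expR 1 + `|y|) + ln (om j x y).
    rewrite -lnM ?posrE ?om_gt0 ?ltr_pwDl ?expR_gt0//.
    rewrite ler_ln ?posrE ?mulr_gt0 ?om_gt0 ?ltr_pwDl ?expR_gt0//.
    have o1 : 1 + `|x - y| <= om j x y by rewrite lerD2l ler_peMl// exprn_ege1// ler1n.
    apply: (@le_trans _ _ ((1 + `|y|) * (1 + `|x - y|))); last first.
      by rewrite ler_pM ?addr_ge0// lerD2r ltW.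
    have := ler_normD (x - y) y; rewrite subrK => ht.
    have := mulr_ge0 (normr_ge0 y) (normr_ge0 (x - y)); nra.
  have l0 : 0 <= ln (1 + `|x|) by nneg.
  apply: le_trans (ler_wpM2r l0 d1) _; rewrite mulrDl.
  have T1 : c / ln (expR 1 + `|x|) * ln (1 + `|x|) <= c.
    rewrite -mulrA ler_piMr ?(ltW c0)// ler_pdivrMl ?mulr1//.
    exact: lt_le_trans LX.
  have T2 : c / ln (expR 1 + `|y|) * ln (1 + `|x|) <= c * (1 + ln (om j x y)).
    rewrite -mulrA ler_pM2l// ler_pdivrMl; last exact: lt_le_trans LY.
    nra.
  lra.
have H2 : `|e x - e y| * (j.+1%:R * ln 2) <=
    2 * b * (2 + ln 2) * (1 + ln (om j x y)) + c * (2 + 2 * ln n%:R + ln 2).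
  have jl : j.+1%:R * ln 2 = j%:R * ln 2 + ln 2 :> R by rewrite -natr1 mulrDl mul1r.
  have P1 : 0 <= 2 * b * (2 + ln 2) * (1 + ln (om j x y)).
    by nneg.
  have P2 : 0 <= c * (2 + 2 * ln n%:R + ln 2).
    by nneg.
  have [xy|xy] := eqVneq x y; first by rewrite {1}xy subrr normr0 mul0r addr_ge0.
  have [big|small] := lerP (j%:R * ln 2) (2 * ln (om j x y)).
    have D : `|e x - e y| <= 2 * b.
      by apply: le_trans (ler_normB _ _) _; rewrite mulr2n mulrDl mul1r lerD.
    apply: (@le_trans _ _ (2 * b * (2 + ln 2) * (1 + ln (om j x y)))); last by lra.
    rewrite -mulrA; apply: ler_pM => //; first by nneg.
    rewrite jl; nra.
  apply: (@le_trans _ _ (c * (2 + 2 * ln n%:R + ln 2))); last by lra.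
  have D0 : 0 < `|x - y| by rewrite normr_gt0 subr_eq0.
  have En : 0 < enorm (x - y) by apply: lt_le_trans (enorm_ge _).
  have L := L1 _ (ltW (_ : 0 < (enorm (x - y))^-1)); rewrite invr_gt0 in L; have {}L := L En.
  set l := ln (expR 1 + (enorm (x - y))^-1) in L *.
  have Hl : j%:R * ln 2 <= 2 * l + 2 * ln n%:R.
    have nD : 0 < n%:R * `|x - y| by nneg.
    have : ln ((n%:R * `|x - y|)^-1) <= l.
      rewrite ler_ln ?posrE ?invr_gt0// ?ltr_pwDl ?expR_gt0 ?invr_ge0//.
      apply: (@le_trans _ _ (enorm (x - y))^-1); last by rewrite lerDr expR_ge0.
      by rewrite lef_pV2 ?posrE// enorm_le.
    rewrite lnV ?posrE// lnM ?posrE ?ltr0n//.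
    have : ln (2 ^+ j * `|x - y|) <= ln (om j x y).
      by rewrite ler_ln ?posrE ?om_gt0 ?mulr_gt0 ?exprn_gt0// lerDr.
    rewrite lnM ?posrE ?exprn_gt0// lnXn// -[ln 2 *+ j]mulr_natl.
    lra.
  apply: (@le_trans _ _ (c / l * (j.+1%:R * ln 2))).
    by rewrite ler_wpM2r ?h1// mulr_ge0// ltW.
  rewrite -mulrA ler_pM2l// ler_pdivrMl ?(lt_le_trans _ L)// jl.
  nra.
have K1 : 0 <= c * ln (om j x y) by nneg.
have K2 : 0 <= c * (2 + 2 * ln n%:R + ln 2) * ln (om j x y).
  by nneg.
lra.
Qed.

(* [t] is bounded above and below by powers of [scl j x]; additive constants
   are kept apart since they must not influence the exponent in [exponent_change]. *)
Definition tame (A C : R) j x (t : R) := 0 < t /\ `|ln t| <= A * ln (scl j x) + C.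

Lemma powR_expR (t a : R) : 0 < t -> t `^ a = expR (a * ln t).
Proof. by move=> t0; rewrite /powR gt_eqF. Qed.

Lemma ln_om_pow (B : nat) j x y : expR (B%:R * ln (om j x y)) = om j x y ^+ B.
Proof. by rewrite mulrC expRM lnK ?posrE ?om_gt0// powR_mulrn ?ltW ?om_gt0. Qed.

(** The two exponents differ by a multiple of [(1 + ln om) / ln scl], while the logarithm of the
    base is at most [A * ln scl + C]. Only the product of the leading terms contributes a power of
    [om]; [C] meets the boundedness of [e] and enters [D] alone. *)
Lemma exponent_change e (A : R) : slow e -> 0 <= A ->
  exists B : nat, forall C, 0 <= C -> exists2 D : R, 0 < D & forall j x y t,
    tame A C j x t ->
    t `^ e x <= D * om j x y ^+ B * t `^ e y /\ t `^ e y <= D * om j x y ^+ B * t `^ e x.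
Proof.
move=> [[b hb] [c c0 hc]] A0.
exists (Num.trunc (A * c)).+1 => C C0; exists (expR (A * c + 2 * b * C)) => [|j x y t [t0 ht]].
  exact: expR_gt0.
suff H : `|e x - e y| * `|ln t| <= A * c + 2 * b * C + (Num.trunc (A * c)).+1%:R * ln (om j x y).
  rewrite !powR_expR// -ln_om_pow -!expRD !ler_expR.
  have h1 := ler_norm ((e x - e y) * ln t); have h2 := ler_norm ((e y - e x) * ln t).
  by move: h1 h2; rewrite !normrM (distrC (e y)) !mulrBl => h1 h2; split; lra.
have D : `|e x - e y| <= 2 * b.
  by apply: le_trans (ler_normB _ _) _; rewrite mulr2n mulrDl mul1r lerD.
apply: (@le_trans _ _ (`|e x - e y| * (A * ln (scl j x) + C))).
  by rewrite ler_wpM2l.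
have Ac : A * c <= (Num.trunc (A * c)).+1%:R by rewrite ltW// truncnS_gt.
have := hc j x y; have lo := ln_om_ge0 j x y => H.
have H1 : A * (`|e x - e y| * ln (scl j x)) <= A * (c * (1 + ln (om j x y))).
  by rewrite ler_wpM2l.
have H2 : `|e x - e y| * C <= 2 * b * C by rewrite ler_wpM2r.
have H3 : A * c * ln (om j x y) <= (Num.trunc (A * c)).+1%:R * ln (om j x y).
  by rewrite ler_wpM2r.
nra.
Qed.

(** The form in which exponents get frozen: [y] is the point of integration and [z] is [y] itself or
    a corner near it. *)
Definition exp_change e (A : R) (B : nat) := forall C, 0 <= C -> exists2 D : R, 0 < D &
  forall j x y z t, `|y - z| <= 2 ^- j -> tame A C j x t ->
    t `^ e x <= D * om j x y ^+ B * t `^ e z /\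
    t `^ e z <= D * om j x y ^+ B * t `^ e x.

Lemma slow_exp_change e (A : R) : slow e -> 0 <= A -> exists B, exp_change e A B.
Proof.
move=> se A0; have [B H] := exponent_change se A0; exists B => C C0.
have [D D0 {}H] := H C C0; exists (D * 2 ^+ B) => [|j x y z t yz tt].
  by nneg.
have h : om j x z ^+ B <= 2 ^+ B * om j x y ^+ B.
  rewrite -exprMn lerXn2r ?nnegrE ?mulr_ge0 ?om_ge0// mulrC.
  apply: le_trans (om_tri j x y _) _; rewrite ler_wpM2l ?om_ge0//.
  exact: om_near.
have [h1 h2] := H j x z t tt.
split; [apply: le_trans h1 _|apply: le_trans h2 _];
  by rewrite ler_wpM2r ?powR_ge0// -mulrA ler_pM2l.
Qed.

Lemma exp_changeW e (A : R) B B' : (B <= B')%N -> exp_change e A B -> exp_change e A B'.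
Proof.
move=> BB H C /H[D D0 {}H]; exists D => // j x y z t yz tt.
have h : D * om j x y ^+ B <= D * om j x y ^+ B' by rewrite ler_pM2l// ler_weXn2l// om_ge1.
have [h1 h2] := H j x y z t yz tt.
by split; [apply: le_trans h1 _|apply: le_trans h2 _]; rewrite ler_wpM2r ?powR_ge0.
Qed.

Lemma corner_near j nu y : (j <= nu)%N -> `|y - corner nu y| <= 2 ^- j.
Proof.
move=> jn; apply: le_trans (corner_dist _ _) _.
by rewrite lef_pV2 ?posrE ?exprn_gt0// ler_weXn2l// ler1n.
Qed.

Lemma tame_le (A A' C C' : R) j x t : A <= A' -> C <= C' -> tame A C j x t -> tame A' C' j x t.
Proof.
move=> AA CC [t0 h]; split=> //; apply: le_trans h _; rewrite lerD//.
by rewrite ler_wpM2r// ln_scl_ge0.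
Qed.

Lemma tame_between (A C : R) j x l u t : tame A C j x l -> tame A C j x u ->
  l <= t <= u -> tame A C j x t.
Proof.
move=> [l0 hl] [u0 hu] /andP[lt tu]; have t0 : 0 < t by apply: lt_le_trans lt.
split=> //; move: hl hu; rewrite !ler_norml => /andP[h1 _] /andP[_ h2].
apply/andP; split; first by apply: le_trans h1 _; rewrite ler_ln.
by apply: le_trans h2; rewrite ler_ln.
Qed.

Lemma tame_powR (A C b e : R) j x t : `|e| <= b -> tame A C j x t ->
  tame (b * A) (b * C) j x (t `^ e).
Proof.
move=> eb [t0 h]; split; first exact: powR_gt0.
rewrite ln_powR normrM -mulrA -mulrDr ler_pM//.
Qed.

Lemma tameM (A C A' C' : R) j x t t' : tame A C j x t -> tame A' C' j x t' ->
  tame (A + A') (C + C') j x (t * t').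
Proof.
move=> [t0 h] [t0' h']; split; first exact: mulr_gt0.
rewrite lnM ?posrE//; apply: le_trans (ler_normD _ _) _.
by rewrite mulrDl addrACA lerD.
Qed.

Lemma tame_cst (k : R) j x : 0 < k -> tame 0 `|ln k| j x k.
Proof. by move=> k0; split=> //; rewrite mul0r add0r. Qed.

Lemma tame_scl (A : R) j x : tame `|A| 0 j x (scl j x `^ A).
Proof.
split; first by nneg.
by rewrite ln_powR normrM addr0 (ger0_norm (ln_scl_ge0 _ _)).
Qed.

Lemma tame_scale (A C : R) i j x t : 0 <= A -> (i <= j)%N -> tame A C i x t -> tame A C j x t.
Proof.
move=> A0 ij [t0 h]; split=> //; apply: le_trans h _; rewrite lerD2r ler_wpM2l//.
rewrite ler_ln ?posrE ?scl_gt0// ler_wpM2r ?addr_ge0// ler_weXn2l//.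
by rewrite ler1n.
Qed.

Lemma scl_near j x x' : `|x - x'| <= 1 -> scl j x <= 2 * scl j x'.
Proof.
move=> h; rewrite /scl mulrCA ler_wpM2l ?exprn_ge0//.
have := ler_normD (x - x') x'; rewrite subrK; have := normr_ge0 x'; lra.
Qed.

Lemma tame_near (A C : R) j x x' t : 0 <= A -> `|x - x'| <= 1 -> tame A C j x t ->
  tame A (C + A * ln 2) j x' t.
Proof.
move=> A0 xx' [t0 h]; split=> //; apply: le_trans h _.
have : ln (scl j x) <= ln 2 + ln (scl j x').
  by rewrite -lnM ?posrE ?scl_gt0// ler_ln ?posrE ?mulr_gt0 ?scl_gt0// scl_near.
by move=> /(ler_wpM2l A0); rewrite mulrDr; lra.
Qed.

End slow_variation.

Hint Extern 0 (is_true (@Order.lt _ _ _ (om _ _ _))) => by apply: om_gt0 : nneg.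
Hint Extern 0 (is_true (@Order.lt _ _ _ (scl _ _))) => by apply: scl_gt0 : nneg.
Hint Extern 0 (is_true (@Order.le _ _ _ (ln (scl _ _)))) => by apply: ln_scl_ge0 : nneg.
Hint Extern 0 (is_true (@Order.le _ _ _ (ln (om _ _ _)))) => by apply: ln_om_ge0 : nneg.

(** * Telescoping of powers of partial sums *)

Section powR_sums.
Context {R : realType}.

Lemma powR_near (t t' c b e : R) : 0 < t -> 0 < t' -> 1 <= c -> `|e| <= b ->
  t <= c * t' -> t' <= c * t -> t `^ e <= c `^ b * t' `^ e.
Proof.
move=> t0 t0' c1 eb tt tt'; have c0 : 0 < c by apply: lt_le_trans c1.
rewrite !powR_expR// -expRD ler_expR -lerBlDr -mulrBr.
apply: le_trans (ler_norm _) _; rewrite normrM ler_pM// ler_norml.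
rewrite -ler_ln ?posrE ?mulr_gt0// lnM ?posrE// in tt.
rewrite -ler_ln ?posrE ?mulr_gt0// lnM ?posrE// in tt'.
by apply/andP; split; lra.
Qed.

Lemma powR_le_tangent (u r : R) : 0 <= u -> 0 < r -> r <= 1 -> u `^ r <= 1 + r * (u - 1).
Proof.
move=> u0 r0 r1; have [->|u_gt0] : u = 0 \/ 0 < u by rewrite le0r in u0; move/orP: u0 => [/eqP|]; [left|right].
  by rewrite powR0 ?gt_eqF//; lra.
have [->|rn1] := eqVneq r 1; first by rewrite powRr1//; lra.
have r1' : 0 < 1 - r by rewrite subr_gt0 lt_neqAle rn1.
(* Young's inequality for the product of [u ^ r] and 1 with exponents [1 / r] and [1 / (1 - r)] is
   the tangent bound. *)
have := @conjugate_powR R (u `^ r) 1 r^-1 (1 - r)^-1 (powR_ge0 _ _) ler01.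
rewrite !invrK mulr1 powR1 -powRrM mulfV ?gt_eqF// powRr1//.
rewrite !invr_gt0 => /(_ r0 r1'); rewrite addrC subrK => /(_ erefl); lra.
Qed.

Lemma powR_ge_tangent (u r : R) : 0 <= u -> 1 <= r -> 1 + r * (u - 1) <= u `^ r.
Proof.
move=> u0 r1; have r0 : 0 < r by apply: lt_le_trans r1.
have := @powR_le_tangent (u `^ r) r^-1 (powR_ge0 _ _).
rewrite invr_gt0 => /(_ r0); rewrite invf_le1// => /(_ r1).
rewrite -powRrM mulfV ?gt_eqF// powRr1// => h.
have : r * u <= r * (1 + r^-1 * (u `^ r - 1)) by rewrite ler_pM2l.
rewrite mulrDr mulrA mulfV ?gt_eqF//; lra.
Qed.

Variable g : nat -> R.
Hypothesis g0 : forall i, 0 < g i.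

Lemma psum_gt0 N : 0 < \sum_(i < N.+1) g i.
Proof. by rewrite big_ord_recr/= ltr_wpDl// sumr_ge0// => i _; exact: ltW. Qed.

Lemma ler_psum N M : (N <= M)%N -> \sum_(i < N) g i <= \sum_(i < M) g i.
Proof.
move=> /subnKC <-; rewrite big_split_ord/= lerDl.
by nneg.
Qed.

(** For [r >= 1] the inner partial sums are enlarged to the full one. For [r < 1] the proof is by
    induction on [N]: with [u] the ratio of two consecutive partial sums, the step is the bound of
    [u ^ r] by its tangent at 1. *)
Lemma sum_powR_le (r : R) N : 0 < r ->
  \sum_(i < N.+1) g i * (\sum_(l < i.+1) g l) `^ (r - 1) <=
  Num.max 1 r^-1 * (\sum_(i < N.+1) g i) `^ r.
Proof.
move=> r0; have [r1|/ltW r1] := lerP 1 r.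
  apply: (@le_trans _ _ (\sum_(i < N.+1) g i * (\sum_(l < N.+1) g l) `^ (r - 1))).
    apply: ler_sum => i _; rewrite ler_wpM2l ?(ltW (g0 _))//.
    apply: ge0_ler_powR; rewrite ?subr_ge0 ?nnegrE ?(ltW (psum_gt0 _))//.
    by apply: ler_psum.
  rewrite -mulr_suml mulr_powRB1 ?(ltW (psum_gt0 _))//.
  by rewrite ler_peMl ?powR_ge0// le_max lexx.
rewrite (_ : Num.max 1 r^-1 = r^-1); last by apply/max_idPr; rewrite invf_ge1.
elim: N => [|N IH].
  rewrite !big_ord_recl !big_ord0/= !addr0 mulr_powRB1 ?(ltW (g0 _))//.
  by rewrite ler_peMl ?powR_ge0// invf_ge1.
rewrite big_ord_recr/=; apply: le_trans (lerD IH (lexx _)) _.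
set a := \sum_(i < N.+1) g i; rewrite [X in _ <= _ * X `^ _]big_ord_recr/= -/a.
rewrite (_ : \sum_(l < N.+2) g l = a + g N.+1); last by rewrite big_ord_recr.
have a0 : 0 < a := psum_gt0 _; have b0 : 0 < a + g N.+1 by nneg.
have u0 : 0 <= a / (a + g N.+1) by nneg.
have := powR_le_tangent u0 r0 r1; set u := a / _ in u0 *.
have ae : a = u * (a + g N.+1) by rewrite /u mulrAC -mulrA mulfV ?mulr1// gt_eqF.
have ge : g N.+1 = (1 - u) * (a + g N.+1) by rewrite mulrBl -ae; ring.
move=> h.
have aE : a `^ r = u `^ r * (a + g N.+1) `^ r by rewrite [in LHS]ae powRM// ltW.
have gE : g N.+1 * (a + g N.+1) `^ (r - 1) = (1 - u) * (a + g N.+1) `^ r.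
  by rewrite -[in RHS](mulr_powRB1 (ltW b0) r0) mulrA -ge.
rewrite aE gE; move: h (powR_gt0 r b0); set B := _ `^ r => h B0.
rewrite mulrA -mulrDl ler_pM2r// -(ler_pM2l r0) mulrDr !mulrA mulfV ?gt_eqF//; lra.
Qed.

(** With [u] as above the inductive step reads [1 <= u ^ r + m * (1 - u)]; it follows from the
    tangent at 1 if [r >= 1] and from [u <= u ^ r] if [r < 1]. *)
Lemma powR_sum_le (r : R) N : 0 < r ->
  (\sum_(i < N.+1) g i) `^ r <=
  Num.max 1 r * \sum_(i < N.+1) g i * (\sum_(l < i.+1) g l) `^ (r - 1).
Proof.
move=> r0; set m := Num.max 1 r; have m1 : 1 <= m by rewrite le_max lexx.
elim: N => [|N IH].
  rewrite !big_ord_recl !big_ord0/= !addr0 mulr_powRB1 ?(ltW (g0 _))//.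
  by rewrite ler_peMl ?powR_ge0.
rewrite [X in _ <= _ * X]big_ord_recr/= mulrDr; apply: le_trans (lerD IH (lexx _)).
set a := \sum_(i < N.+1) g i.
rewrite (_ : \sum_(l < N.+2) g l = a + g N.+1); last by rewrite big_ord_recr.
have a0 : 0 < a := psum_gt0 _; have b0 : 0 < a + g N.+1 by nneg.
have u0 : 0 <= a / (a + g N.+1) by nneg.
set u := a / (a + g N.+1) in u0 *.
have ae : a = u * (a + g N.+1) by rewrite /u mulrAC -mulrA mulfV ?mulr1// gt_eqF.
have ge : g N.+1 = (1 - u) * (a + g N.+1) by rewrite mulrBl -ae; ring.
have u1 : u <= 1 by rewrite /u ler_pdivrMr// mul1r lerDl ltW.
have aE : a `^ r = u `^ r * (a + g N.+1) `^ r by rewrite [in LHS]ae powRM// ltW.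
have gE : g N.+1 * (a + g N.+1) `^ (r - 1) = (1 - u) * (a + g N.+1) `^ r.
  by rewrite -[in RHS](mulr_powRB1 (ltW b0) r0) mulrA -ge.
rewrite aE gE; move: (powR_gt0 r b0); set B := (_ + _) `^ r => B0.
rewrite mulrA -mulrDl -[leLHS]mul1r; apply: ler_wpM2r; first exact: ltW.
have [r1|/ltW r1] := lerP 1 r.
  have := powR_ge_tangent u0 r1; have : r <= m by rewrite le_max lexx orbT.
  nra.
have : u <= u `^ r.
  have [u_gt0|u_le0] := ltP 0 u; first by rewrite ger1_powR// u_gt0.
  by rewrite (le_trans u_le0)// powR_ge0.
nra.
Qed.

End powR_sums.

(** * Averages at dyadic scales *)

Section averages.
Context {R : realType} {n : nat}.
Implicit Types (i j M : nat) (x y z : 'rV[R]_n) (u v : 'rV[R]_n -> R).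

Definition ker j M x y : R := 2 ^+ (j * n) * om j x y ^- M.

Definition Av j M u x : \bar R := (\int[mu]_y (ker j M x y * u y)%:E)%E.

Lemma ker_gt0 j M x y : 0 < ker j M x y.
Proof. by rewrite mulr_gt0 ?invr_gt0 ?exprn_gt0 ?om_gt0. Qed.
Hint Extern 0 (is_true (@Order.lt _ _ _ (ker _ _ _ _))) => by apply: ker_gt0 : nneg.

Lemma ker_ge0 j M x y : 0 <= ker j M x y.
Proof. exact/ltW/ker_gt0. Qed.

Lemma kerC j M x y : ker j M x y = ker j M y x.
Proof. by rewrite /ker omC. Qed.

Lemma meas_om j x : meas (fun y => om j x y).
Proof.
apply: measurable_funD; first exact: measurable_cst.
apply: measurable_funM; first exact: measurable_cst.
under eq_fun do rewrite distrC.
by apply: (measurableT_comp (@meas_rV_norm R n)); exact: meas_rVD.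
Qed.

Lemma meas_om_pow j M x : meas (fun y => om j x y ^- M).
Proof. by apply: meas_funV; apply: measurable_funX; exact: meas_om. Qed.

Lemma meas_ker j M x : meas (ker j M x).
Proof. by apply: measurable_funM; [exact: measurable_cst|exact: meas_om_pow]. Qed.

Lemma meas_omT j :
  measurable_fun [set: 'rV[R]_n * 'rV[R]_n] (fun w => om j w.1 w.2).
Proof.
apply: measurable_funD; first exact: measurable_cst.
apply: measurable_funM; first exact: measurable_cst.
apply: (measurableT_comp (@meas_rV_norm R n)).
apply: measurable_fun_rVP => i; under eq_fun do rewrite !mxE.
apply: measurable_funD.
  exact: (measurableT_comp (measurable_rV_coord _) measurable_fst).
apply: measurable_funN.
exact: (measurableT_comp (measurable_rV_coord _) measurable_snd).
Qed.

Lemma meas_kerT j M :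
  measurable_fun [set: 'rV[R]_n * 'rV[R]_n] (fun w => ker j M w.1 w.2).
Proof.
apply: measurable_funM; first exact: measurable_cst.
by apply: meas_funV; apply: measurable_funX; exact: meas_omT.
Qed.

Lemma meas_ker_mul j M u x : meas u -> meas (fun y => (ker j M x y * u y)%:E).
Proof.
by move=> mu_; apply/measurable_EFinP; apply: measurable_funM => //; exact: meas_ker.
Qed.

Lemma Av_ge0 j M u x : (forall y, 0 <= u y) -> (0 <= Av j M u x)%E.
Proof. by move=> u0; apply: integral_ge0 => y _; rewrite lee_fin mulr_ge0// ker_ge0. Qed.

Lemma le_Av j M u v x : meas u -> meas v -> (forall y, 0 <= u y) ->
  (forall y, u y <= v y) -> (Av j M u x <= Av j M v x)%E.
Proof.
move=> mu_ mv u0 uv; apply: ge0_le_integral => //.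
- by nneg.
- exact: meas_ker_mul.
- exact: meas_ker_mul.
- by move=> y _; rewrite lee_fin ler_wpM2l// ker_ge0.
Qed.

Lemma AvZ j M u x (c : R) : meas u -> (forall y, 0 <= u y) -> 0 <= c ->
  Av j M (fun y => c * u y) x = (c%:E * Av j M u x)%E.
Proof.
move=> mu_ u0 c0; rewrite /Av -ge0_integralZl_EFin//.
- by apply: eq_integral => y _; rewrite -EFinM mulrCA.
- by nneg.
- exact: meas_ker_mul.
Qed.

Lemma AvD j M u v x : meas u -> meas v -> (forall y, 0 <= u y) -> (forall y, 0 <= v y) ->
  Av j M (fun y => u y + v y) x = (Av j M u x + Av j M v x)%E.
Proof.
move=> mu_ mv u0 v0; rewrite /Av -ge0_integralD//.
- by apply: eq_integral => y _; rewrite -EFinD mulrDr.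
- by nneg.
- exact: meas_ker_mul.
- by nneg.
- exact: meas_ker_mul.
Qed.

Lemma meas_Av j M u : meas u -> (forall y, 0 <= u y) -> meas (Av j M u).
Proof.
move=> mu_ u0.
have mf : measurable_fun [set: 'rV[R]_n * 'rV[R]_n] (fun w => (ker j M w.1 w.2 * u w.2)%:E).
  apply/measurable_EFinP; apply: measurable_funM; first exact: meas_kerT.
  exact: (measurableT_comp mu_ measurable_snd).
apply: (measurable_fun_fubini_tonelli_F (m2 := mu) _ mf).
by nneg.
Qed.

(** The kernel is symmetric, so averaging is self-adjoint. *)
Lemma Av_tonelli j M u v : meas u -> meas v -> (forall y, 0 <= u y) -> (forall y, 0 <= v y) ->
  (\int[mu]_x (Av j M u x * (v x)%:E) = \int[mu]_y ((u y)%:E * Av j M v y))%E.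
Proof.
move=> mu_ mv u0 v0.
have mf : measurable_fun [set: 'rV[R]_n * 'rV[R]_n]
    (fun w => (ker j M w.1 w.2 * u w.2 * v w.1)%:E).
  apply/measurable_EFinP; apply: measurable_funM; last exact: (measurableT_comp mv measurable_fst).
  apply: measurable_funM; first exact: meas_kerT.
  exact: (measurableT_comp mu_ measurable_snd).
have f0 (w : 'rV[R]_n * 'rV[R]_n) : (0 <= (ker j M w.1 w.2 * u w.2 * v w.1)%:E)%E.
  by nneg.
have := fubini_tonelli (m1 := mu) (m2 := mu) _ mf f0 => /= E.
under eq_integral => x _.
  rewrite /Av muleC -ge0_integralZl_EFin//; last 2 first.
  - by move=> y _; rewrite lee_fin mulr_ge0// ker_ge0.
  - exact: meas_ker_mul.
  under eq_integral do rewrite -EFinM mulrC.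
  over.
rewrite E; apply: eq_integral => y _.
rewrite /Av -ge0_integralZl_EFin//; last 2 first.
- by move=> x _; rewrite lee_fin mulr_ge0// ker_ge0.
- exact: meas_ker_mul.
by apply: eq_integral => x _; rewrite -EFinM kerC; congr (_%:E); ring.
Qed.

Lemma om_pow_le j M N x y : (N <= M)%N -> om j x y ^- M <= om j x y ^- N.
Proof. by move=> NM; rewrite lef_pV2 ?posrE ?exprn_gt0 ?om_gt0// ler_weXn2l// om_ge1. Qed.

Lemma Av_cst_le j M x (c : R) : 0 <= c -> (2 * n <= M)%N ->
  (Av j M (fun=> c) x <= (c * 2 ^+ n)%:E)%E.
Proof.
move=> c0 nM; pose p : R := 2 ^+ j; have p0 : 0 < p by nneg.
apply: (@le_trans _ _ (\int[mu]_y ((c * p ^+ n)%:E * ((1 + p * `|y - x|) ^- (2 * n))%:E))%E).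
  apply: ge0_le_integral => //.
  - by nneg.
  - by apply: meas_ker_mul; exact: measurable_cst.
  - apply/measurable_EFinP; apply: measurable_funM; first exact: measurable_cst.
    exact: meas_kernel.
  - move=> y _; rewrite -EFinM lee_fin mulrC -mulrA ler_wpM2l//.
    by rewrite /ker exprM ler_wpM2l ?exprn_ge0 ?(ltW p0)// distrC; exact: om_pow_le.
rewrite ge0_integralZl_EFin//; last 3 first.
- by nneg.
- by apply/measurable_EFinP; exact: meas_kernel.
- by nneg.
apply: le_trans (lee_wpmul2l _ (integral_kernel_le x p0)) _.
  by nneg.
by rewrite -EFinM lee_fin expr_div_n -mulrA ler_wpM2l// mulrC mulfVK// expf_neq0// gt_eqF.
Qed.

Lemma Av_total j M u : (2 * n <= M)%N -> meas u -> (forall y, 0 <= u y) ->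
  (\int[mu]_x Av j M u x <= (2 ^+ n)%:E * \int[mu]_y (u y)%:E)%E.
Proof.
move=> nM mu_ u0.
have := @Av_tonelli j M u (fun=> 1) mu_ (measurable_cst _) u0 (fun=> ler01).
under eq_integral do rewrite mule1; move=> ->.
rewrite -ge0_integralZl_EFin//; last 2 first.
- by move=> y _; rewrite lee_fin.
- exact/measurable_EFinP.
apply: ge0_le_integral => //.
- by move=> x _; rewrite mule_ge0 ?lee_fin// Av_ge0.
- apply: emeasurable_funM; first exact/measurable_EFinP.
  by apply: meas_Av => //; exact: measurable_cst.
- by apply: emeasurable_funM; [exact: measurable_cst|exact/measurable_EFinP].
move=> x _; rewrite muleC lee_wpmul2r ?lee_fin//.
by rewrite -[X in (_ <= X%:E)%E]mul1r; exact: Av_cst_le.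
Qed.

Lemma Av_loc j M u x x' : meas u -> (forall y, 0 <= u y) -> `|x - x'| <= 2 ^- j ->
  (Av j M u x <= (2 ^+ M)%:E * Av j M u x')%E.
Proof.
move=> mu_ u0 xx'; rewrite /Av -ge0_integralZl_EFin//; last 2 first.
- by nneg.
- exact: meas_ker_mul.
apply: ge0_le_integral => //.
- by nneg.
- exact: meas_ker_mul.
- by apply: emeasurable_funM; [exact: measurable_cst|exact: meas_ker_mul].
move=> y _; rewrite -EFinM lee_fin mulrA ler_wpM2r// mulrCA ler_wpM2l ?exprn_ge0//.
rewrite -[leLHS]mul1r ler_pdivrMr ?exprn_gt0 ?om_gt0// mulrAC ler_pdivlMr ?exprn_gt0 ?om_gt0// mul1r.
rewrite -exprMn lerXn2r ?nnegrE ?mulr_ge0 ?om_ge0//.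
apply: le_trans (om_tri j x' x y) _; rewrite ler_wpM2r ?om_ge0//.
by apply: om_near; rewrite distrC.
Qed.

Lemma Av_sup j M u x : meas u -> (forall y, 0 <= u y) ->
  (Av j M u x <= (2 ^+ (j * n))%:E * \int[mu]_y (u y)%:E)%E.
Proof.
move=> mu_ u0; rewrite -ge0_integralZl_EFin//; last 2 first.
- by move=> y _; rewrite lee_fin.
- exact/measurable_EFinP.
apply: ge0_le_integral => //.
- by nneg.
- exact: meas_ker_mul.
- by apply: emeasurable_funM; [exact: measurable_cst|exact/measurable_EFinP].
move=> y _; rewrite -EFinM lee_fin ler_wpM2r// /ker ler_piMr ?exprn_ge0//.
by rewrite invf_le1 ?exprn_gt0 ?om_gt0// exprn_ege1// om_ge1.
Qed.

(** Integrating over the cube of [y] at scale [j + d] alone is enough, because the kernel is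
    comparable there to its value at [y]. The loss [2 ^- (d * n)] is the volume of this cube
    relative to the scale [j] of the kernel. *)
Lemma point_le_Av j d M (c : R) u x y : meas u -> (forall y, 0 <= u y) -> 0 <= c ->
  (forall z, cidx (j + d) y = cidx (j + d) z -> u y <= c * u z) ->
  ((2 ^- (d * n) * om j x y ^- M * u y)%:E <= (c * 2 ^+ M)%:E * Av j M u x)%E.
Proof.
move=> mu_ u0 c0 uc; set Q := cubeQ (j + d) (cidx (j + d) y) : set 'rV[R]_n.
have mQ : measurable Q by exact: meas_cubeQ.
have muQ : mu Q = ((2 ^- (j + d)) ^+ n)%:E by exact: measure_cubeQ.
apply: (@le_trans _ _ (\int[mu]_(z in Q) ((c * 2 ^+ M)%:E * (ker j M x z * u z)%:E))%E); last first.
  rewrite -ge0_integralZl_EFin//; last 3 first.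
  - by nneg.
  - exact: meas_ker_mul.
  - by nneg.
  apply: ge0_subset_integral => //.
    by apply: emeasurable_funM; [exact: measurable_cst|exact: meas_ker_mul].
  move=> z _; apply: mule_ge0; rewrite lee_fin; first by nneg.
  by nneg.
have -> : 2 ^- (d * n) * om j x y ^- M * u y =
    (2 ^+ (j * n) * om j x y ^- M * u y) * (2 ^- (j + d)) ^+ n :> R.
  rewrite exprVn -exprM mulnDl exprD invfM.
  have h : 2 ^+ (j * n) != 0 :> R by rewrite expf_neq0.
  by field; rewrite ?h ?expf_neq0 ?gt_eqF ?om_gt0.
rewrite EFinM -muQ -(integral_cst mu mQ).
apply: ge0_le_integral => //.
- by nneg.
- by apply: measurable_funTS; apply: emeasurable_funM; [exact: measurable_cst|exact: meas_ker_mul].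
move=> z /cubeQP Qz; rewrite -EFinM lee_fin /ker.
have uyz : u y <= c * u z by apply: uc.
rewrite (_ : c * _ * _ = 2 ^+ (j * n) * (2 ^+ M * om j x z ^- M) * (c * u z)); last by ring.
rewrite ler_pM ?mulr_ge0 ?invr_ge0 ?exprn_ge0 ?om_ge0// ler_wpM2l ?exprn_ge0//.
rewrite ler_pdivlMr ?exprn_gt0 ?om_gt0// mulrC ler_pdivrMr ?exprn_gt0 ?om_gt0//.
rewrite -exprMn lerXn2r ?nnegrE ?mulr_ge0 ?om_ge0// mulrC.
apply: le_trans (om_tri j x y z) _; rewrite ler_wpM2l ?om_ge0//.
apply: om_near; apply: le_trans (cidx_dist (esym Qz)) _.
by rewrite lef_pV2 ?posrE ?exprn_gt0// ler_weXn2l// ?ler1n// leq_addr.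
Qed.

(* A function that is essentially constant on the cubes of side [2^-i] is
   averaged at the finer scale [j] no worse than at scale [i]. *)
Lemma Av_fine_le i j M (c : R) u x : (i <= j)%N -> (2 * n <= M)%N ->
  meas u -> (forall y, 0 <= u y) -> 0 <= c ->
  (forall y z, cidx i y = cidx i z -> u y <= c * u z) ->
  (Av j M u x <= (c * 2 ^+ (M + n))%:E * Av i (M - 2 * n) u x)%E.
Proof.
move=> ij nM mu_ u0 c0 uc.
set A := Av i (M - 2 * n) u x; have A0 : (0 <= A)%E by exact: Av_ge0.
pose B := ((c * 2 ^+ M)%:E * A)%E.
have B0 : (0 <= B)%E by nneg.
(* A pointwise bound spends [M - 2 * n] powers of the weight; the other [2 * n] keep the kernel at
   scale [j] integrable. *)
have key y : ((om j x y ^- (M - 2 * n) * u y)%:E <= B)%E.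
  apply: (@le_trans _ _ ((c * 2 ^+ (M - 2 * n))%:E * A)%E); last first.
    by rewrite lee_wpmul2r// lee_fin ler_wpM2l// ler_weXn2l ?ler1n// leq_subr.
  have := @point_le_Av i 0 (M - 2 * n) c u x y mu_ u0 c0; rewrite addn0 mul0n expr0 invr1 mul1r.
  move=> /(_ (uc y)); apply: le_trans; rewrite lee_fin ler_wpM2r//.
  rewrite lef_pV2 ?posrE ?exprn_gt0 ?om_gt0// lerXn2r ?nnegrE ?om_ge0//.
  exact: ler_om.
apply: (@le_trans _ _ (\int[mu]_y ((ker j (2 * n) x y * 1)%:E * B))%E).
  apply: ge0_le_integral => //.
  - by nneg.
  - exact: meas_ker_mul.
  - apply: emeasurable_funM; last exact: measurable_cst.
    by apply: meas_ker_mul; exact: measurable_cst.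
  move=> y _; rewrite mulr1.
  rewrite (_ : ker j M x y * u y = ker j (2 * n) x y * (om j x y ^- (M - 2 * n) * u y)).
    by rewrite EFinM lee_wpmul2l// lee_fin ker_ge0.
  by rewrite /ker -{1}(subnKC nM) exprD invfM; ring.
rewrite ge0_integralZr//; last 2 first.
- by apply: meas_ker_mul; exact: measurable_cst.
- by nneg.
apply: le_trans (lee_wpmul2r B0 (@Av_cst_le j (2 * n) x 1 ler01 (leqnn _))) _.
by rewrite mul1r /B muleA -EFinM mulrCA -exprD addnC.
Qed.

End averages.

Hint Extern 0 (is_true (@Order.le _ _ _ (Av _ _ _ _))) => apply: Av_ge0; nneg : nneg.
Hint Extern 0 (is_true (@Order.lt _ _ _ (ker _ _ _ _))) => by apply: ker_gt0 : nneg.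

(** * The majorant and Jensen's inequality *)

Section jensen.
Context {R : realType} {n : nat}.
Variables (tau : 'rV[R]_n -> R) (T : nat).
Hypothesis tau1 : forall x, 1 <= tau x <= T%:R.
Implicit Types (i j d nu M : nat) (x y z : 'rV[R]_n) (u v f g : 'rV[R]_n -> R).

Definition cubewise nu {S} (u : 'rV[R]_n -> S) := forall x y, cidx nu x = cidx nu y -> u x = u y.

Lemma cubewiseW i j (u : 'rV[R]_n -> R) : (i <= j)%N -> cubewise i u -> cubewise j u.
Proof. by move=> /subnKC <- H x y /cidx_coarse; exact: H. Qed.

Lemma cidx_corner nu x : cidx nu (corner nu x) = cidx nu x.
Proof.
apply/rowP => i; rewrite !mxE mulrA mulfV ?mul1r ?expf_neq0//.
by rewrite intrKfloor.
Qed.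

Lemma meas_cubewise nu u : cubewise nu u -> meas u.
Proof.
move=> H; rewrite (_ : u = fun x => (fun m : 'rV[int]_n =>
    u (\row_i (2 ^- nu * (m ord0 i)%:~R))) (cidx nu x)).
  exact: (meas_cidx nu (fun m : 'rV[int]_n => u (\row_i (2 ^- nu * (m ord0 i)%:~R)))).
apply/funext => x; rewrite (_ : (\row_i _) = corner nu x); last first.
  by apply/rowP => i; rewrite !mxE.
by apply: H; rewrite cidx_corner.
Qed.

(* The sum over the subcubes [Q_(j+d,m)] of the values of [f], weighted by
   [2^(-d n tau)] and by the decay in the distance to [x]; written as an integral. *)
Definition hh j d M f x : \bar R :=
  (\int[mu]_y (2 ^+ ((j + d) * n) * om j x y ^- M *
     2 `^ (- (d * n)%:R * tau (corner (j + d) y)) * f y)%:E)%E.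

Lemma meas_hh_integrand j d M f x : meas f ->
  meas (fun y => (2 ^+ ((j + d) * n) * om j x y ^- M *
     2 `^ (- (d * n)%:R * tau (corner (j + d) y)) * f y)%:E).
Proof.
move=> mf; apply/measurable_EFinP; apply: measurable_funM => //.
apply: measurable_funM.
  by apply: measurable_funM; [exact: measurable_cst|exact: meas_om_pow].
by apply: (@meas_cubewise (j + d)) => y z /corner_cidx ->.
Qed.

Lemma hh_integrand_ge0 j d M f x y : (forall y, 0 <= f y) ->
  0 <= 2 ^+ ((j + d) * n) * om j x y ^- M * 2 `^ (- (d * n)%:R * tau (corner (j + d) y)) * f y.
Proof. by nneg. Qed.


Lemma hh_ge0 j d M f x : (forall y, 0 <= f y) -> (0 <= hh j d M f x)%E.
Proof. by move=> f0; apply: integral_ge0 => y _; rewrite lee_fin hh_integrand_ge0. Qed.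

Lemma hhD j d M f g x : meas f -> meas g -> (forall y, 0 <= f y) -> (forall y, 0 <= g y) ->
  hh j d M (fun y => f y + g y) x = (hh j d M f x + hh j d M g x)%E.
Proof.
move=> mf mg f0 g0; rewrite /hh -ge0_integralD//.
- by apply: eq_integral => y _; rewrite -EFinD mulrDr.
- by nneg.
- exact: meas_hh_integrand.
- by nneg.
- exact: meas_hh_integrand.
Qed.

Lemma meas_hh j d M f : meas f -> (forall y, 0 <= f y) -> meas (hh j d M f).
Proof.
move=> mf f0.
have mF : measurable_fun [set: 'rV[R]_n * 'rV[R]_n] (fun w =>
   (2 ^+ ((j + d) * n) * om j w.1 w.2 ^- M *
     2 `^ (- (d * n)%:R * tau (corner (j + d) w.2)) * f w.2)%:E).
  apply/measurable_EFinP; apply: measurable_funM.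
    apply: measurable_funM.
      apply: measurable_funM; first exact: measurable_cst.
      by apply: meas_funV; apply: measurable_funX; exact: meas_omT.
    apply: (measurableT_comp (f := fun y => 2 `^ (- (d * n)%:R * tau (corner (j + d) y)))) => //.
    by apply: (@meas_cubewise (j + d)) => y z /corner_cidx ->.
  exact: (measurableT_comp mf measurable_snd).
apply: (measurable_fun_fubini_tonelli_F (m2 := mu) _ mF).
by nneg.
Qed.

Lemma hh_loc j d M f x x' : meas f -> (forall y, 0 <= f y) -> `|x - x'| <= 2 ^- j ->
  (hh j d M f x <= (2 ^+ M)%:E * hh j d M f x')%E.
Proof.
move=> mf f0 xx'; rewrite /hh -ge0_integralZl_EFin//; last 2 first.
- by nneg.
- exact: meas_hh_integrand.
apply: ge0_le_integral => //.
- by nneg.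
- exact: meas_hh_integrand.
- by apply: emeasurable_funM; [exact: measurable_cst|exact: meas_hh_integrand].
move=> y _; rewrite -EFinM lee_fin !mulrA ler_wpM2r// ler_wpM2r ?powR_ge0//.
rewrite -[leRHS]mulrA [leRHS]mulrCA ler_wpM2l ?exprn_ge0//.
rewrite -[leLHS]mul1r ler_pdivrMr ?exprn_gt0 ?om_gt0// mulrAC ler_pdivlMr ?exprn_gt0 ?om_gt0// mul1r.
rewrite -exprMn lerXn2r ?nnegrE ?mulr_ge0 ?om_ge0//.
apply: le_trans (om_tri j x' x y) _; rewrite ler_wpM2r ?om_ge0//.
by apply: om_near; rewrite distrC.
Qed.

(* The sequence-space form of Jensen's inequality: since each term
   [2^(-d n) om^(-M2) U] is at most the average of [U], raising it to the power
   [tau >= 1] does not increase it, up to constants. *)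
Lemma hh_jensen j d M1 M2 (B : nat) f U (D C0 C1 : R) x : (B + M2 * T <= M1)%N ->
  meas f -> (forall y, 0 <= f y) -> cubewise (j + d) U -> (forall y, 0 <= U y) ->
  0 <= D -> 0 <= C0 -> 1 <= C1 ->
  (forall y, f y <= C0 * om j x y ^+ B * D * U y `^ tau (corner (j + d) y)) ->
  (Av j M2 U x <= C1%:E)%E ->
  (hh j d M1 f x <= (C0 * D * ((2 ^+ M2 * C1) ^+ T * C1))%:E)%E.
Proof.
move=> BM mf f0 ccU U0 D0 C00 C11 fU AvU.
have mU : meas U by exact: meas_cubewise ccU.
set K := 2 ^+ M2 * C1.
have K1 : 1 <= K by rewrite -[leLHS]mul1r ler_pM// exprn_ege1// ler1n.
have K0 : 0 < K by apply: lt_le_trans K1.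
pose c := C0 * D * K ^+ T.
have c0 : 0 <= c by nneg.
apply: (@le_trans _ _ (c%:E * Av j M2 U x)%E); last first.
  apply: le_trans (lee_wpmul2l _ AvU) _; first by rewrite lee_fin.
  by rewrite -EFinM lee_fin /c -!mulrA.
rewrite /Av -ge0_integralZl_EFin//; last 2 first.
- by nneg.
- exact: meas_ker_mul.
apply: ge0_le_integral => //.
- by nneg.
- exact: meas_hh_integrand.
- by apply: emeasurable_funM; [exact: measurable_cst|exact: meas_ker_mul].
move=> y _; rewrite -EFinM lee_fin.
have /andP[t1 tT] := tau1 (corner (j + d) y); set t := tau _ in t1 tT *.
pose rho := 2 ^- (d * n) * om j x y ^- M2 * U y.
have rho0 : 0 <= rho by nneg.
have rhoK : rho <= K.
  have h z : cidx (j + d) y = cidx (j + d) z -> U y <= 1 * U z by rewrite mul1r => /ccU ->.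
  have := @point_le_Av R n j d M2 1 U x y mU U0 ler01 h; rewrite mul1r => H.
  rewrite -lee_fin; apply: le_trans H _.
  by rewrite EFinM lee_wpmul2l// lee_fin exprn_ge0.
have rhot : rho `^ t <= K ^+ T * rho.
  have -> : rho = K * (rho / K) by rewrite mulrC divfK// gt_eqF.
  have k0 : 0 <= rho / K by nneg.
  rewrite powRM ?(ltW K0)//; apply: (@le_trans _ _ (K ^+ T * (rho / K))).
    apply: ler_pM => //; rewrite ?powR_ge0//.
      by rewrite -powR_mulrn ?(ltW K0)// ler_powR.
    have [z0|z0] := ltP 0 (rho / K).
      by apply: ge1r_powR => //; rewrite z0 ler_pdivrMr// mul1r.
    have -> : rho / K = 0 by apply/eqP; rewrite eq_le z0.
    by rewrite powR0// gt_eqF// (lt_le_trans _ t1).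
  by rewrite ler_wpM2l ?exprn_ge0 ?(ltW K0)// ler_peMl.
(* The weight [2 ^ (- d n tau)] in [hh] is exactly what turns [U ^ t] into [rho ^ t]; the price is a
   power of [om] of order [M2 * t], at most [M2 * T]. *)
have E : 2 `^ (- (d * n)%:R * t) * U y `^ t = rho `^ t * (om j x y ^+ M2) `^ t.
  have o0 : 0 <= om j x y ^+ M2 by nneg.
  rewrite -(powRM _ rho0 o0) powRrM powR_invn// -powRM ?invr_ge0 ?exprn_ge0//; congr (_ `^ _).
  by rewrite /rho; field; rewrite !expf_neq0// gt_eqF// om_gt0.
have omt : (om j x y ^+ M2) `^ t <= om j x y ^+ (M2 * T).
  rewrite exprM -[leRHS]powR_mulrn ?exprn_ge0 ?om_ge0// ler_powR//.
  by rewrite exprn_ege1// om_ge1.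
set P := 2 ^+ ((j + d) * n) * om j x y ^- M1.
have P0 : 0 <= P by nneg.
apply: (@le_trans _ _ (P * (C0 * om j x y ^+ B * D) * (K ^+ T * rho * om j x y ^+ (M2 * T)))).
  have CD0 : 0 <= C0 * om j x y ^+ B * D by nneg.
  apply: (@le_trans _ _ (P * (C0 * om j x y ^+ B * D) * (2 `^ (- (d * n)%:R * t) * U y `^ t))).
    rewrite -[leLHS]mulrA -[leRHS]mulrA ler_wpM2l// mulrCA ler_wpM2l ?powR_ge0//.
  rewrite E; apply: ler_wpM2l; first exact: mulr_ge0.
  by apply: ler_pM; rewrite ?powR_ge0.
rewrite /P /rho /ker /c.
have -> : 2 ^+ ((j + d) * n) = 2 ^+ (j * n) * 2 ^+ (d * n) :> R by rewrite mulnDl exprD.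
have omM : om j x y ^- M1 * om j x y ^+ B * om j x y ^+ (M2 * T) <= 1.
  rewrite -mulrA -exprD ler_pdivrMl ?exprn_gt0 ?om_gt0// mulr1.
  by rewrite ler_weXn2l// om_ge1.
set o1 := om j x y ^- M1 in omM *; set o2 := om j x y ^+ B in omM *.
set o3 := om j x y ^+ (M2 * T) in omM *.
have -> : 2 ^+ (j * n) * 2 ^+ (d * n) * o1 * (C0 * o2 * D) *
    (K ^+ T * (2 ^- (d * n) * om j x y ^- M2 * U y) * o3) =
    (o1 * o2 * o3) * (C0 * D * K ^+ T * (2 ^+ (j * n) * om j x y ^- M2 * U y)).
  by field; rewrite !expf_neq0// gt_eqF// om_gt0.
rewrite -[leRHS]mul1r ler_wpM2r// !mulr_ge0 ?invr_ge0 ?exprn_ge0 ?om_ge0//.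
exact: ltW.
Qed.

End jensen.

(** * The modular estimate for the majorants *)

Section core_functions.
Context {R : realType} {n : nat}.
Implicit Types (i j d nu M N : nat) (x y z : 'rV[R]_n) (u v f g : 'rV[R]_n -> R).

Definition av j M u x : R := fine (Av j M u x).

Lemma av_ge0 j M u x : (forall y, 0 <= u y) -> 0 <= av j M u x.
Proof. by move=> u0; rewrite fine_ge0// Av_ge0. Qed.
Hint Extern 0 (is_true (@Order.le _ _ _ (av _ _ _ _))) => apply: av_ge0; nneg : nneg.

Lemma avE j M u x : (forall y, 0 <= u y) -> (Av j M u x < +oo)%E ->
  (av j M u x)%:E = Av j M u x.
Proof. by move=> u0 fin; rewrite /av fineK// ge0_fin_numE// Av_ge0. Qed.

Lemma Av_lty j M u x : meas u -> (forall y, 0 <= u y) ->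
  (\int[mu]_y (u y)%:E < +oo)%E -> (Av j M u x < +oo)%E.
Proof.
move=> mu_ u0 fin; apply: le_lt_trans (Av_sup j M x mu_ u0) _.
by rewrite lte_mul_pinfty// ?lee_fin ?exprn_ge0.
Qed.

Lemma meas_av j M u : meas u -> (forall y, 0 <= u y) -> meas (av j M u).
Proof.
move=> mu_ u0; apply: (measurableT_comp (f := @fine R)) => //.
exact: meas_Av.
Qed.

Definition Fsum (Lam : nat -> 'rV[R]_n -> R) nu x := \sum_(i < nu.+1) Lam i x.

Variables (r : 'rV[R]_n -> R) (A0 C0 rm rM : R).
Hypotheses (A00 : 0 <= A0) (C00 : 0 <= C0) (rm0 : 0 < rm).
Hypotheses (hr : forall x, rm <= r x <= rM) (sr : slow r) (mr : meas r).

(** [Lam] models the q-th powers of weighted coefficients of modular at most 1. The lower bound is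
    asked at level 0 only, since it passes to all partial sums. *)
Record good_data (Lam : nat -> 'rV[R]_n -> R) : Prop := GoodData {
  good_cube : forall nu, cubewise nu (Lam nu);
  good_gt0 : forall nu x, 0 < Lam nu x;
  good_low : forall x, - ln (Lam 0 x) <= A0 * ln (scl 0 x) + C0;
  good_int : forall N, (\int[mu]_x ((Fsum Lam N x) `^ r x)%:E <= 1)%E }.

(** Up to constants the increment of [Fsum ^ r] from one level to the next, in the sense of
    [sum_powR_le] and [powR_sum_le]. *)
Definition aseq Lam nu x := Lam nu x * Fsum Lam nu x `^ (r (corner nu x) - 1).

Definition Psi Lam nu x := \sum_(i < nu.+1) aseq Lam i x.

Lemma r_gt0 x : 0 < r x.
Proof. by have /andP[h _] := hr x; apply: lt_le_trans h. Qed.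

Section good_facts.
Variable Lam : nat -> 'rV[R]_n -> R.
Hypothesis gL : good_data Lam.

Lemma Fsum_gt0 nu x : 0 < Fsum Lam nu x.
Proof. by apply: (psum_gt0 (g := Lam ^~ x)) => i; exact: (good_gt0 gL). Qed.
Hint Extern 0 (is_true (@Order.lt _ _ _ (Fsum _ _ _))) => by apply: Fsum_gt0 : nneg.

Lemma Fsum_cubewise nu : cubewise nu (Fsum Lam nu).
Proof.
move=> x y xy; apply: eq_bigr => i _.
exact: (cubewiseW (leq_ord i) (good_cube gL (nu := i))).
Qed.

Lemma le_Fsum nu nu' x : (nu <= nu')%N -> Fsum Lam nu x <= Fsum Lam nu' x.
Proof. by move=> h; apply: (ler_psum (g := Lam ^~ x)) => // i; exact: (good_gt0 gL). Qed.

Lemma Lam_le_Fsum nu x : Lam nu x <= Fsum Lam nu x.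
Proof.
rewrite /Fsum big_ord_recr/= lerDr; apply: sumr_ge0 => i _; apply: ltW.
exact: (good_gt0 gL).
Qed.

Lemma aseq_gt0 nu x : 0 < aseq Lam nu x.
Proof. by rewrite mulr_gt0 ?(good_gt0 gL)// powR_gt0// Fsum_gt0. Qed.
Hint Extern 0 (is_true (@Order.lt _ _ _ (aseq _ _ _ _))) => by apply: aseq_gt0 : nneg.

Lemma aseq_ge0 nu x : 0 <= aseq Lam nu x.
Proof. exact/ltW/aseq_gt0. Qed.

Lemma aseq_cubewise nu : cubewise nu (aseq Lam nu).
Proof.
move=> x y xy; rewrite /aseq (good_cube gL xy) (Fsum_cubewise xy).
by rewrite (corner_cidx xy).
Qed.

Lemma meas_aseq nu : meas (aseq Lam nu).
Proof. exact: meas_cubewise (@aseq_cubewise nu). Qed.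

Lemma Psi_cubewise nu : cubewise nu (Psi Lam nu).
Proof.
move=> x y xy; apply: eq_bigr => i _.
exact: (cubewiseW (leq_ord i) (@aseq_cubewise i)).
Qed.

Lemma Psi_gt0 nu x : 0 < Psi Lam nu x.
Proof. by apply: (psum_gt0 (g := aseq Lam ^~ x)) => i; exact: aseq_gt0. Qed.
Hint Extern 0 (is_true (@Order.lt _ _ _ (Psi _ _ _ _))) => by apply: Psi_gt0 : nneg.

Lemma meas_Psi nu : meas (Psi Lam nu).
Proof. exact: meas_cubewise (@Psi_cubewise nu). Qed.

Lemma meas_Fsum nu : meas (Fsum Lam nu).
Proof. exact: meas_cubewise (@Fsum_cubewise nu). Qed.

Definition AF := A0 + n%:R / rm.

Lemma AF_ge0 : 0 <= AF.
Proof. by rewrite addr_ge0// divr_ge0// ltW. Qed.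

(** From below by the term of level 0. From above, the integral of [Fsum ^ r] over a single cube is
    at most 1, so [Fsum ^ rm <= 2 ^ (nu * n)] where [Fsum > 1]; this is the origin of [n / rm] in
    [AF]. *)
Lemma Fsum_tame nu x : tame AF C0 nu x (Fsum Lam nu x).
Proof.
have F0 := Fsum_gt0 nu x; split=> //.
have ls := ln_scl_ge0 nu x.
have Anu : A0 * ln (scl 0 x) <= A0 * ln (scl nu x).
  rewrite ler_wpM2l// ler_ln ?posrE ?scl_gt0// ler_wpM2r ?addr_ge0// ler_weXn2l//.
  by rewrite ler1n.
have N0 : 0 <= n%:R / rm * ln (scl nu x) by nneg.
rewrite /AF mulrDl ler_norml; apply/andP; split.
  have : ln (Lam 0 x) <= ln (Fsum Lam nu x).
    rewrite ler_ln ?posrE ?(good_gt0 gL)//.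
    by apply: le_trans (le_Fsum _ (leq0n nu)); exact: Lam_le_Fsum.
  have := good_low gL x; lra.
have [F1|F1] := leP (Fsum Lam nu x) 1.
  apply: le_trans (ln_le0 F1) _; rewrite !addr_ge0//; exact: mulr_ge0.
suff : rm * ln (Fsum Lam nu x) <= n%:R * ln (scl nu x).
  move=> h; have : ln (Fsum Lam nu x) <= n%:R / rm * ln (scl nu x).
    by rewrite mulrAC ler_pdivlMr// mulrC.
  by move=> h2; apply: le_trans h2 _; rewrite addrAC lerDr addr_ge0// mulr_ge0.
have : (Fsum Lam nu x) `^ rm <= 2 ^+ (nu * n).
  set Q := cubeQ nu (cidx nu x) : set 'rV[R]_n.
  have mQ : measurable Q by exact: meas_cubeQ.
  have muQ : mu Q = ((2 ^- nu) ^+ n)%:E by exact: measure_cubeQ.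
  have mFr : meas (fun y => (Fsum Lam nu y `^ r y)%:E).
    apply/measurable_EFinP; apply: meas_fun_powR => //; exact: meas_Fsum.
  suff : (((Fsum Lam nu x) `^ rm)%:E * mu Q <= 1)%E.
    by rewrite muQ -EFinM lee_fin exprVn -exprM ler_pdivrMr ?mul1r// exprn_gt0.
  rewrite -(integral_cst mu mQ); apply: le_trans (good_int gL nu).
  apply: (@le_trans _ _ (\int[mu]_(y in Q) (Fsum Lam nu y `^ r y)%:E)%E); last first.
    by apply: ge0_subset_integral => // y _; rewrite lee_fin powR_ge0.
  apply: ge0_le_integral => //.
  - by nneg.
  - exact: measurable_funTS.
  - move=> y /cubeQP Qy; rewrite lee_fin (Fsum_cubewise Qy).
    by apply: ler_powR; [exact: ltW|case/andP: (hr y)].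
move=> h; have : ln (Fsum Lam nu x `^ rm) <= ln (2 ^+ (nu * n)).
  by rewrite ler_ln ?posrE ?exprn_gt0 ?powR_gt0.
rewrite ln_powR lnXn// => {}h; apply: le_trans h _; rewrite -[ln 2 *+ _]mulr_natl natrM mulrAC mulrC.
rewrite ler_wpM2l// ln_scl; apply: ler_wpDr; first by nneg.
by rewrite ler_wpM2r ?ln_ge0 ?ler1n// ler_nat.
Qed.

End good_facts.

(** As [Fsum] is tame, its exponent moves between [x] and a corner close to [x] at bounded cost.
    What is left are the two halves of the telescoping equivalence. *)
Lemma aseq_bounds : exists2 C, 0 < C & forall Lam, good_data Lam ->
  [/\ forall nu x, aseq Lam nu x <= C * (Lam nu x * Fsum Lam nu x `^ (r x - 1)),
     forall nu x, Lam nu x * Fsum Lam nu x `^ (r x - 1) <= C * aseq Lam nu x,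
     forall N, (\int[mu]_x (Psi Lam N x)%:E <= C%:E)%E &
     forall nu x, Fsum Lam nu x `^ r (corner nu x) <= C * Psi Lam nu x].
Proof.
have sr1 : slow (fun x => r x - 1) by apply: slowD => //; exact: slow_cst.
have [B /(_ C0 C00)[D D0 H]] := slow_exp_change sr1 AF_ge0.
pose E := D * 2 ^+ B; have E0 : 0 < E by nneg.
have H1 Lam (gL : good_data Lam) nu nu' x : (nu <= nu')%N ->
    Fsum Lam nu x `^ (r x - 1) <= E * Fsum Lam nu x `^ (r (corner nu' x) - 1) /\
    Fsum Lam nu x `^ (r (corner nu' x) - 1) <= E * Fsum Lam nu x `^ (r x - 1).
  move=> h; have [] := H nu x x (corner nu' x) _ (corner_near x h) (Fsum_tame gL nu x).
  have : D * om nu x x ^+ B <= E.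
    rewrite ler_pM2l// lerXn2r ?nnegrE ?om_ge0//.
    by rewrite /om subrr normr0 mulr0 addr0 ler1n.
  move=> h0 h1 h2; split; [apply: le_trans h1 _|apply: le_trans h2 _];
    by rewrite ler_wpM2r ?powR_ge0.
pose m1 := Num.max 1 rm^-1; pose m2 := Num.max 1 rM.
have m11 : 1 <= m1 by rewrite le_max lexx.
have m21 : 1 <= m2 by rewrite le_max lexx.
exists (E + E * m1 + m2 * (E * E)).
  have : 0 < E * E by nneg. nra.
move=> Lam gL.
have a1 nu x : aseq Lam nu x <= E * (Lam nu x * Fsum Lam nu x `^ (r x - 1)).
  rewrite /aseq mulrCA ler_wpM2l ?(ltW (good_gt0 gL _ _))//.
  by have [] := H1 _ gL nu nu x (leqnn _).
have a2 nu x : Lam nu x * Fsum Lam nu x `^ (r x - 1) <= E * aseq Lam nu x.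
  rewrite /aseq mulrCA ler_wpM2l ?(ltW (good_gt0 gL _ _))//.
  by have [] := H1 _ gL nu nu x (leqnn _).
have EE : 0 < E * E by nneg.
split.
- move=> nu x; apply: le_trans (a1 nu x) _; rewrite ler_wpM2r//; last nra.
  by rewrite mulr_ge0 ?powR_ge0 ?(ltW (good_gt0 gL _ _)).
- move=> nu x; apply: le_trans (a2 nu x) _; rewrite ler_wpM2r ?aseq_ge0//; nra.
- move=> N; apply: (@le_trans _ _ (\int[mu]_x ((E * m1)%:E * (Fsum Lam N x `^ r x)%:E))%E).
    apply: ge0_le_integral => //.
    + by move=> x _; rewrite lee_fin ltW// Psi_gt0.
    + by apply/measurable_EFinP; exact: meas_Psi.
    + apply/measurable_EFinP; apply: measurable_funM; first exact: measurable_cst.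
      by apply: meas_fun_powR => //; exact: meas_Fsum.
    move=> x _; rewrite -EFinM lee_fin -mulrA.
    apply: (@le_trans _ _ (E * \sum_(i < N.+1) Lam i x * Fsum Lam i x `^ (r x - 1))).
      by rewrite mulr_sumr; apply: ler_sum => i _; exact: a1.
    rewrite ler_pM2l//; apply: le_trans.
      exact: (@sum_powR_le R (Lam ^~ x) (fun i => good_gt0 gL i x) (r x) N (r_gt0 x)).
    rewrite ler_wpM2r ?powR_ge0// ge_max le_max lexx/= le_max; apply/orP; right.
    by rewrite lef_pV2 ?posrE ?r_gt0//; case/andP: (hr x).
  rewrite ge0_integralZl_EFin//; last 3 first.
  + by nneg.
  + by apply/measurable_EFinP; apply: meas_fun_powR => //; exact: meas_Fsum.
  + by nneg.
  apply: le_trans (lee_wpmul2l _ (good_int gL N)) _.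
    by nneg.
  rewrite mule1 lee_fin; nra.
- move=> nu x; have rc := r_gt0 (corner nu x).
  apply: le_trans; first exact: (@powR_sum_le R (Lam ^~ x) (fun i => good_gt0 gL i x) _ nu rc).
  apply: (@le_trans _ _ (m2 * (E * E * Psi Lam nu x))); last first.
    rewrite mulrA ler_wpM2r ?(ltW (Psi_gt0 gL _ _))//; nra.
  apply: ler_pM.
  + by rewrite le_max ler01.
  + apply: sumr_ge0 => i _; rewrite mulr_ge0 ?powR_ge0//; exact/ltW/(good_gt0 gL).
  + by rewrite ge_max le_max lexx/= le_max; apply/orP; right; case/andP: (hr (corner nu x)).
  rewrite /Psi mulr_sumr; apply: ler_sum => i _.
  rewrite /aseq [leRHS]mulrCA ler_wpM2l ?(ltW (good_gt0 gL _ _))//.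
  have [_ h1] := H1 _ gL i nu x (leq_ord i); have [h2 _] := H1 _ gL i i x (leqnn _).
  apply: le_trans h1 _; rewrite -[leRHS]mulrA; apply: ler_wpM2l => //; exact: ltW.
Qed.

End core_functions.

Hint Extern 0 (is_true (@Order.le _ _ _ (av _ _ _ _))) => apply: av_ge0; nneg : nneg.
Hint Extern 0 (is_true (@Order.lt _ _ _ (Fsum _ _ _))) => by apply: Fsum_gt0 : nneg.
Hint Extern 0 (is_true (@Order.lt _ _ _ (aseq _ _ _ _))) => by apply: aseq_gt0 : nneg.
Hint Extern 0 (is_true (@Order.lt _ _ _ (Psi _ _ _ _))) => by apply: Psi_gt0 : nneg.

(** * Averages of the densities over windows of scales *)

Section core_setup.
Context {R : realType} {n : nat}.
Implicit Types (i j d nu M N : nat) (x y z : 'rV[R]_n) (u v f g : 'rV[R]_n -> R).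

Lemma tameD (A C : R) j x t t' : tame A C j x t -> tame A C j x t' ->
  tame A (C + ln 2) j x (t + t').
Proof.
move=> [t0 h] [t0' h']; have l2 : 0 <= ln 2 :> R by nneg.
split; first exact: addr_gt0.
wlog tt : t t' t0 h t0' h' / t <= t'.
  by move=> H; have [tt|/ltW tt] := leP t t'; [exact: H|rewrite addrC; exact: H].
move: h h'; rewrite !ler_norml => /andP[a1 a2] /andP[b1 b2]; apply/andP; split.
  have : ln t <= ln (t + t') by rewrite ler_ln ?posrE ?addr_gt0// lerDl ltW.
  lra.
have : ln (t + t') <= ln (2 * t').
  by rewrite ler_ln ?posrE ?addr_gt0 ?mulr_gt0//; lra.
rewrite lnM ?posrE//; lra.
Qed.

Lemma tame_pow2 (k : nat) j x : tame (k%:R : R) 0 j x (2 ^+ (j * k)).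
Proof.
have l2 : 0 <= ln 2 :> R by nneg.
split; first exact: exprn_gt0.
rewrite addr0 lnXn// -[ln 2 *+ _]mulr_natl ger0_norm ?mulr_ge0// natrM mulrAC mulrC.
rewrite ler_wpM2l// ln_scl; apply: ler_wpDr; first by nneg.
by rewrite ler_wpM2r// ler_nat.
Qed.

Lemma tame_sclV (k : nat) j x : tame (k%:R : R) 0 j x (scl j x ^- k).
Proof.
have := tame_scl (- k%:R : R) j x; rewrite normrN normr_nat powR_invn//.
exact/ltW/scl_gt0.
Qed.

(** Of the [2 * n + 1] powers, one makes the sum over the scales converge and [2 * n] give
    integrability in [x]. *)
Lemma integral_sclV_le N :
  (\int[lebesgue_rV R n]_x (\sum_(j < N.+1) scl j x ^- (2 * n).+1)%:E <= (2 ^+ n)%:E)%E.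
Proof.
apply: (@le_trans _ _ (\int[lebesgue_rV R n]_x ((1 + 1 * `|x - 0|) ^- (2 * n))%:E)%E); last first.
  by have := @integral_kernel_le R n 1 0 ltr01; rewrite divr1.
apply: ge0_le_integral => //.
- by nneg.
- apply/measurable_EFinP; apply: measurable_sum => j.
  apply: meas_funV; apply: measurable_funX; apply: measurable_funM.
    exact: measurable_cst.
  by apply: measurable_funD; [exact: measurable_cst|exact: meas_rV_norm].
- by apply/measurable_EFinP; exact: meas_kernel.
move=> x _; rewrite lee_fin mul1r subr0.
set w := (1 + `|x|); have w1 : 1 <= w by rewrite lerDl.
have w0 : 0 < w by apply: lt_le_trans w1.
apply: (@le_trans _ _ (\sum_(j < N.+1) 2 ^- j.+1 * w ^- (2 * n))).
  apply: ler_sum => j _; rewrite /scl -/w exprMn exprS [w ^+ _.+1]exprS !invfM.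
  apply: ler_pM.
  - by nneg.
  - by nneg.
  - by rewrite ler_piMr ?invr_ge0 ?exprn_ge0// invf_le1 ?exprn_gt0// exprn_ege1// exprn_ege1// ler1n.
  - by rewrite ler_piMl ?invr_ge0 ?exprn_ge0 ?(ltW w0)// invf_le1.
rewrite -mulr_suml ler_piMl ?invr_ge0 ?exprn_ge0 ?(ltW w0)//.
suff -> : \sum_(j < N.+1) 2 ^- j.+1 = 1 - 2 ^- N.+1 :> R by nneg.
elim: N => [|N IH]; first by rewrite big_ord1 expr1; lra.
by rewrite big_ord_recr/= IH [2 ^+ N.+2]exprS invfM; set e := (2 ^+ N.+1)^-1; lra.
Qed.

Variables (p q tau : 'rV[R]_n -> R) (pm qm P A0 C0 : R) (T : nat).
Hypotheses (pm0 : 0 < pm) (qm0 : 0 < qm) (A00 : 0 <= A0) (C00 : 0 <= C0).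
Hypotheses (hp : forall x, pm <= p x <= P) (hq : forall x, qm <= q x <= P).
Hypotheses (sp : slow p) (sq : slow q) (mp : meas p) (mq : meas q).
Hypothesis tau1 : forall x, 1 <= tau x <= T%:R.
Hypotheses (taup : forall x, (p x)^-1 <= tau x) (tauq : forall x, (q x)^-1 <= tau x).

Definition rr x := p x / q x.

Lemma p_gt0 x : 0 < p x. Proof. by have /andP[h _] := hp x; apply: lt_le_trans h. Qed.
Hint Extern 0 (is_true (@Order.lt _ _ _ (p _))) => by apply: p_gt0 : nneg.
Lemma q_gt0 x : 0 < q x. Proof. by have /andP[h _] := hq x; apply: lt_le_trans h. Qed.
Hint Extern 0 (is_true (@Order.lt _ _ _ (q _))) => by apply: q_gt0 : nneg.
Lemma P_gt0 : 0 < P.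
Proof. by have /andP[h h'] := hp 0; apply: lt_le_trans pm0 (le_trans h h'). Qed.
Hint Extern 0 (is_true (@Order.lt _ _ _ P)) => by apply: P_gt0 : nneg.

Lemma rr_bound x : pm / P <= rr x <= P / qm.
Proof.
have /andP[p1 p2] := hp x; have /andP[q1 q2] := hq x; have q0 := q_gt0 x.
apply/andP; split; apply: ler_pM; rewrite ?invr_ge0 ?(ltW (p_gt0 _)) ?(ltW pm0) ?(ltW P_gt0) ?(ltW q0)//;
  by rewrite lef_pV2 ?posrE ?P_gt0.
Qed.

Lemma rm_gt0 : 0 < pm / P. Proof. by nneg. Qed.


Lemma rr_gt0 x : 0 < rr x.
Proof. by rewrite divr_gt0 ?p_gt0 ?q_gt0. Qed.


Lemma slow_pV : slow (fun x => (p x)^-1).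
Proof. by apply: slowV pm0 _ sp => x; case/andP: (hp x). Qed.

Lemma slow_qV : slow (fun x => (q x)^-1).
Proof. by apply: slowV qm0 _ sq => x; case/andP: (hq x). Qed.

Lemma slow_rr : slow rr.
Proof. exact: slowM slow_qV. Qed.

Lemma meas_rr : meas rr.
Proof. by apply: measurable_funM => //; exact: meas_funV. Qed.

Definition good := good_data rr A0 C0.

Local Notation rm := (pm / P).
Local Notation rM := (P / qm).
Local Notation a_ := (aseq rr).
Local Notation Psi_ := (Psi rr).
Local Notation AF_ := (@AF R n A0 rm).

(** The majorant at scale [j] sees coefficients of level [j + d], and the densities of levels [j] to
    [j + d] are those that cannot be averaged at a coarser scale than [j]. A density lies in at most
    [d + 1] such windows, which is where the factor [d + 1] arises. *)
Definition ysum M Lam d j x := av j M (fun y => \sum_(l < d.+1) a_ Lam (j + l) y) x.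

Definition YY M Lam d j x := \sum_(i < j.+1) ysum M Lam d i x.

(** [rM * AF] serves the lower bound of [YY] by its first density, a power of [Fsum] at level 0. In
    the upper bound, [n] is the size of the kernel and 1 accounts for the [j + 1 <= 2 ^ j]
    summands. *)
Definition AY : R := rM * AF_ + n.+1%:R.

Lemma rM0 : 0 < rM. Proof. by nneg. Qed.

Lemma AY_ge0 : 0 <= AY.
Proof. by rewrite addr_ge0// mulr_ge0 ?(ltW rM0)// AF_ge0// rm_gt0. Qed.

Lemma aseq_window_ge0 Lam d j y : good Lam -> 0 <= \sum_(l < d.+1) a_ Lam (j + l) y.
Proof. by move=> gL; apply: sumr_ge0 => l _; exact: (aseq_ge0 gL). Qed.

Lemma aseq_window_le Lam d j y : good Lam ->
  \sum_(l < d.+1) a_ Lam (j + l) y <= Psi_ Lam (j + d) y.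
Proof.
move=> gL; rewrite /Psi -addnS big_split_ord/= lerDr.
by apply: sumr_ge0 => l _; exact: (aseq_ge0 gL).
Qed.

Lemma meas_window Lam d j : good Lam ->
  meas (fun y => \sum_(l < d.+1) a_ Lam (j + l) y).
Proof. by move=> gL; apply: measurable_sum => l; exact: (meas_aseq gL). Qed.

Lemma Psi_int : exists2 C, 0 < C & forall Lam, good Lam ->
  forall N, (\int[mu]_x (Psi_ Lam N x)%:E <= C%:E)%E.
Proof.
have [C C1 H] := aseq_bounds A00 C00 rm_gt0 rr_bound slow_rr meas_rr.
by exists C => // Lam gL; have [] := H _ gL.
Qed.

Lemma window_int : exists2 C, 0 < C & forall Lam, good Lam ->
  forall d j, (\int[mu]_x (\sum_(l < d.+1) a_ Lam (j + l) x)%:E <= C%:E)%E.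
Proof.
have [C C1 H] := Psi_int; exists C => // Lam gL d j; apply: le_trans (H _ gL (j + d)%N).
apply: ge0_le_integral => //.
- by move=> x _; rewrite lee_fin aseq_window_ge0.
- by apply/measurable_EFinP; exact: meas_window.
- by apply/measurable_EFinP; exact: (meas_Psi gL).
- by move=> x _; rewrite lee_fin aseq_window_le.
Qed.

Lemma ysumE M Lam d j x : good Lam ->
  (ysum M Lam d j x)%:E = Av j M (fun y => \sum_(l < d.+1) a_ Lam (j + l) y) x.
Proof.
move=> gL; apply: avE; first by move=> y; exact: aseq_window_ge0.
apply: Av_lty; first exact: meas_window.
- by move=> y; exact: aseq_window_ge0.
- by have [C _ H] := window_int; apply: le_lt_trans (H _ gL d j) _; exact: ltry.
Qed.

Lemma ysum_ge0 M Lam d j x : good Lam -> 0 <= ysum M Lam d j x.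
Proof. by move=> gL; apply: av_ge0 => y; exact: aseq_window_ge0. Qed.
Hint Extern 0 (is_true (@Order.le _ _ _ (ysum _ _ _ _ _))) => by apply: ysum_ge0 : nneg.

Lemma meas_ysum M Lam d j : good Lam -> meas (ysum M Lam d j).
Proof.
move=> gL; apply: meas_av; first exact: meas_window.
by move=> y; exact: aseq_window_ge0.
Qed.

Lemma meas_YY M Lam d j : good Lam -> meas (YY M Lam d j).
Proof. by move=> gL; apply: measurable_sum => i; exact: meas_ysum. Qed.

Lemma YY_le M : exists2 C, 0 < C & forall Lam, good Lam -> forall d j x,
  YY M Lam d j x <= C * 2 ^+ (j * n.+1).
Proof.
have [C C1 H] := window_int; exists C => // Lam gL d j x.
apply: (@le_trans _ _ (\sum_(i < j.+1) (2 ^+ (j * n) * C))).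
  apply: ler_sum => i _; rewrite -lee_fin ysumE//.
  apply: le_trans; first apply: Av_sup.
  - exact: meas_window.
  - by move=> y; exact: aseq_window_ge0.
  apply: le_trans (lee_wpmul2l _ (H _ gL d i)) _; first by nneg.
  by rewrite -EFinM lee_fin ler_pM2r// ler_weXn2l ?ler1n// leq_mul2r -ltnS ltn_ord orbT.
rewrite sumr_const card_ord -[_ *+ j.+1]mulr_natl mulnS exprD mulrC.
rewrite [2 ^+ (j * n) * C]mulrC -!mulrA ler_pM2l// mulrC ler_wpM2r ?exprn_ge0//.
by rewrite -natrX ler_nat ltn_expl.
Qed.

Lemma YY_tame M : exists2 C, 0 <= C & forall Lam, good Lam -> forall d j x,
  tame AY C j x (YY M Lam d j x).
Proof.
have [C C1 H] := YY_le M.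
have rM0 := rM0.
pose K := rM * C0 + `|ln (2 ^- M : R)| + `|ln C|.
exists K => [|Lam gL d j x].
  by nneg.
have AF0 := AF_ge0 A00 rm_gt0 : 0 <= AF_.
apply: (@tame_between _ _ _ _ _ _ (2 ^- M * a_ Lam 0 x) (C * 2 ^+ (j * n.+1))).
- have hk : 0 < 2 ^- M :> R by nneg.
  have ht : tame (rM * AF_) (rM * C0) j x (a_ Lam 0 x).
    have -> : a_ Lam 0 x = Fsum Lam 0 x `^ rr (corner 0 x).
      rewrite /aseq /Fsum big_ord1 mulr_powRB1 ?rr_gt0//; exact/ltW/(good_gt0 gL).
    apply: tame_scale (leq0n j) _; first by nneg.
    apply: tame_powR; last exact: (Fsum_tame A00 C00 rm_gt0 rr_bound meas_rr gL).
    by rewrite gtr0_norm ?rr_gt0//; case/andP: (rr_bound (corner 0 x)).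
  apply: tame_le (tameM (tame_cst j x hk) ht); first by rewrite add0r lerDl.
  by rewrite addrC lerDl.
- apply: tame_le (tameM (tame_cst j x C1) (tame_pow2 n.+1 j x)).
  + by rewrite add0r lerDr mulr_ge0// ltW.
  + by rewrite addr0 lerDr addr_ge0// mulr_ge0// ltW.
apply/andP; split.
  apply: (@le_trans _ _ (ysum M Lam d 0 x)); last first.
    rewrite /YY big_ord_recl/= lerDl; apply: sumr_ge0 => i _; exact: ysum_ge0.
  rewrite ler_pdivrMl ?exprn_gt0// -lee_fin [X in (_ <= X)%E]EFinM ysumE//.
  have h z : cidx (0 + 0) x = cidx (0 + 0) z -> a_ Lam 0 x <= 1 * a_ Lam 0 z.
    by rewrite mul1r => /(aseq_cubewise gL) ->.
  have m0 : meas (a_ Lam 0) by exact: (meas_aseq gL).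
  have p0 y : 0 <= a_ Lam 0 y by exact: (aseq_ge0 gL).
  have := @point_le_Av R n 0 0 M 1 (a_ Lam 0) x x m0 p0 ler01 h.
  rewrite mul0n expr0 invr1 !mul1r /om subrr normr0 mulr0 addr0 expr1n invr1 mul1r => h2.
  apply: le_trans h2 _; rewrite lee_wpmul2l ?lee_fin ?exprn_ge0//.
  apply: le_Av.
  - exact: m0.
  - exact: meas_window.
  - exact: p0.
  move=> y; rewrite big_ord_recl/= lerDl; apply: sumr_ge0 => l _; exact: (aseq_ge0 gL).
exact: H.
Qed.

Lemma YY_gt0 M Lam d j x : good Lam -> 0 < YY M Lam d j x.
Proof. by move=> gL; have [C _ H] := YY_tame M; have [] := H _ gL d j x. Qed.
Hint Extern 0 (is_true (@Order.lt _ _ _ (YY _ _ _ _ _))) => by apply: YY_gt0 : nneg.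

Lemma le_YY M Lam d i j x : good Lam -> (i <= j)%N -> YY M Lam d i x <= YY M Lam d j x.
Proof.
move=> gL /subnKC <-; rewrite /YY -addSn big_split_ord/= lerDl.
by nneg.
Qed.

(** A density of level below [j] is constant on cubes larger than the kernel, so it may be averaged
    at its own scale instead ([Av_fine_le], at the cost of [2 * n] powers of decay). The others form
    the window. *)
Lemma Av_Psi_le M Lam d j x : good Lam -> (2 * n <= M)%N ->
  (Av j M (Psi_ Lam (j + d)) x <= (2 ^+ (M + n) * YY (M - 2 * n) Lam d j x)%:E)%E.
Proof.
move=> gL nM.
have E : Psi_ Lam (j + d) = fun y => \sum_(i < j) a_ Lam i y + \sum_(l < d.+1) a_ Lam (j + l) y.
  by apply/funext => y; rewrite /Psi -addnS big_split_ord.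
have s0 y : 0 <= \sum_(i < j) a_ Lam i y by apply: sumr_ge0 => i _; exact: (aseq_ge0 gL).
have ms k : meas (fun y => \sum_(i < k) a_ Lam i y).
  by apply: measurable_sum => i; exact: (meas_aseq gL).
rewrite E AvD//; last 2 first.
- exact: meas_window.
- by move=> y; exact: aseq_window_ge0.
rewrite /YY big_ord_recr/= mulrDr EFinD; apply: leeD; last first.
  rewrite EFinM ysumE//.
  apply: (@le_trans _ _ (Av j (M - 2 * n) (fun y => \sum_(l < d.+1) a_ Lam (j + l) y) x)).
    apply: ge0_le_integral => //.
    - by move=> y _; rewrite lee_fin mulr_ge0 ?ker_ge0// aseq_window_ge0.
    - by apply: meas_ker_mul; exact: meas_window.
    - by apply: meas_ker_mul; exact: meas_window.
    move=> y _; rewrite lee_fin ler_wpM2r ?aseq_window_ge0// /ker ler_wpM2l ?exprn_ge0//.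
    by apply: om_pow_le; exact: leq_subr.
  rewrite -[leLHS]mul1e lee_wpmul2r//.
    by apply: Av_ge0 => y; exact: aseq_window_ge0.
  by rewrite lee_fin exprn_ege1// ler1n.
rewrite mulr_sumr -sumEFin.
have H k : (k <= j)%N -> (Av j M (fun y => (\sum_(i < k) a_ Lam i y)%R) x <=
    \sum_(i < k) (2 ^+ (M + n) * ysum (M - 2 * n) Lam d i x)%:E)%E.
  elim: k => [|k IH] kj.
    under [fun y => _]eq_fun do rewrite big_ord0.
    rewrite big_ord0 (_ : Av _ _ _ _ = 0%E)//.
    by apply: integral0_eq => y _; rewrite mulr0.
  rewrite big_ord_recr/= (_ : (fun y => _) = fun y => \sum_(i < k) a_ Lam i y + a_ Lam k y); last first.
    by apply/funext => y; rewrite big_ord_recr.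
  rewrite AvD//; last 3 first.
  - exact: (meas_aseq gL).
  - by move=> y; apply: sumr_ge0 => i _; exact: (aseq_ge0 gL).
  - exact: (aseq_ge0 gL).
  apply: leeD; first by apply: IH; exact: ltnW.
  rewrite EFinM ysumE//.
  have hc y z : cidx k y = cidx k z -> a_ Lam k y <= 1 * a_ Lam k z.
    by rewrite mul1r => /(aseq_cubewise gL) ->.
  have mk : meas (a_ Lam k) by exact: (meas_aseq gL).
  have pk y : 0 <= a_ Lam k y by exact: (aseq_ge0 gL).
  apply: le_trans; first exact: (Av_fine_le x (ltnW kj) nM mk pk ler01 hc).
  rewrite mul1r lee_wpmul2l ?lee_fin ?exprn_ge0//; apply: le_Av.
  - exact: (meas_aseq gL).
  - exact: meas_window.
  - exact: (aseq_ge0 gL).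
  move=> y; rewrite big_ord_recl/= addn0 lerDl; apply: sumr_ge0 => l _; exact: (aseq_ge0 gL).
exact: H.
Qed.

Lemma ysum_total M : (2 * n <= M)%N -> exists2 C, 0 < C & forall Lam, good Lam ->
  forall d N, (\int[mu]_x (YY M Lam d N x)%:E <= (C * d.+1%:R)%:E)%E.
Proof.
move=> nM; have [C C1 H] := Psi_int; exists (2 ^+ n * C) => [|Lam gL d N].
  by nneg.
under eq_integral do rewrite /YY -sumEFin.
rewrite ge0_integral_sum//; last 2 first.
- by move=> i; apply/measurable_EFinP; exact: meas_ysum.
- by nneg.
apply: (@le_trans _ _ (\sum_(i < N.+1) (2 ^+ n)%:E *
    \int[mu]_x (\sum_(l < d.+1) a_ Lam (i + l) x)%:E)%E).
  apply: lee_sum => i _; under eq_integral do rewrite ysumE//.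
  apply: Av_total => //; first exact: meas_window.
  by move=> y; exact: aseq_window_ge0.
rewrite -ge0_sume_distrr; last first.
  by move=> i _; apply: integral_ge0 => x _; rewrite lee_fin aseq_window_ge0.
rewrite -mulrA EFinM lee_wpmul2l ?lee_fin ?exprn_ge0//.
under eq_bigr => i _.
  under eq_integral do rewrite -sumEFin.
  rewrite ge0_integral_sum//; last 2 first.
  - by move=> l; apply/measurable_EFinP; exact: (meas_aseq gL).
  - by move=> l x _; rewrite lee_fin (aseq_ge0 gL).
  over.
rewrite exchange_big/= mulrC.
apply: (@le_trans _ _ (\sum_(l < d.+1) C%:E)%E); last first.
  by rewrite sumEFin sumr_const card_ord lee_fin -[C *+ _]mulr_natl.
apply: lee_sum => l _; apply: le_trans (H _ gL (N + l)%N).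
rewrite -ge0_integral_sum//; last 2 first.
- by move=> i; apply/measurable_EFinP; exact: (meas_aseq gL).
- by move=> i x _; rewrite lee_fin (aseq_ge0 gL).
apply: ge0_le_integral => //.
- by move=> x _; apply: sume_ge0 => i _; rewrite lee_fin (aseq_ge0 gL).
- apply: emeasurable_sum => i; apply/measurable_EFinP; exact: (meas_aseq gL).
- by apply/measurable_EFinP; exact: (meas_Psi gL).
move=> x _; rewrite sumEFin lee_fin /Psi -addSn addnC big_split_ord/=.
rewrite (eq_bigr (fun i : 'I_N.+1 => a_ Lam (l + i) x)); last by move=> i _; rewrite addnC.
by rewrite lerDr; apply: sumr_ge0 => i _; exact: (aseq_ge0 gL).
Qed.

(* All the quantities below are powers of [scl j x] up to constants; the
   exponents are kept explicit because they determine the decay [M1], [M2]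
   required of the kernels. *)
Definition AX : R := (3 * n).+1%:R.
Definition AZ : R := AY / rm + (AY / pm) * P + 1.
Definition AXZ : R := AX + (1 + rM) * AZ.
Definition Amax : R := AF_ + AY + AX + (1 + rM) * AZ + 1.

Lemma AX_ge0 : 0 <= AX. Proof. by rewrite ler0n. Qed.
Lemma AZ_ge0 : 0 <= AZ.
Proof.
rewrite !addr_ge0// ?mulr_ge0 ?divr_ge0 ?AY_ge0 ?invr_ge0 ?(ltW rm_gt0) ?(ltW P_gt0) ?(ltW pm0)//.
Qed.
Lemma rAZ_ge0 : 0 <= (1 + rM) * AZ.
Proof. by rewrite mulr_ge0 ?AZ_ge0// addr_ge0// ltW// rM0. Qed.

Lemma Amax_ge : [/\ AF_ <= Amax, AY <= Amax, AXZ <= Amax, AZ <= Amax & 0 <= Amax].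
Proof.
have h1 := AF_ge0 A00 rm_gt0 : 0 <= AF_; have h2 := AY_ge0; have h3 := AX_ge0.
have h4 := rAZ_ge0; have h5 := AZ_ge0.
have h6 : 0 <= rM * AZ by nneg.
have e : (1 + rM) * AZ = AZ + rM * AZ by rewrite mulrDl mul1r.
rewrite /Amax /AXZ; split; lra.
Qed.

(** * The majorants against powers of averages *)

(** On cubes with [r >= 1] the factor [Fsum ^ (1 - r)] relating [Lam] to [aseq] has no upper bound
    by averages, so these coefficients are averaged as they are. [SLam] is the complementary
    part. *)
Definition JLam (Lam : nat -> 'rV[R]_n -> R) d j y := if 1 <= rr (corner (j + d) y) then Lam (j + d)%N y else 0.

Definition hreal M1 (Lam : nat -> 'rV[R]_n -> R) d j x :=
  fine (hh tau j d M1 (fun y => Lam (j + d)%N y `^ (q (corner (j + d) y))^-1) x).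

(** The second summand keeps [Xj] tame from below; by [integral_sclV_le] it costs only a constant
    after summation over [j] and integration. *)
Definition Xj M2 Lam d j x := av j M2 (a_ Lam (j + d)) x + scl j x ^- (2 * n).+1.
Definition Jj M2 Lam d j x := av j M2 (JLam Lam d j) x.

Lemma JLam_ge0 Lam d j y : good Lam -> 0 <= JLam Lam d j y.
Proof. by move=> gL; rewrite /JLam; case: ifP => // _; exact/ltW/(good_gt0 gL). Qed.
Hint Extern 0 (is_true (@Order.le _ _ _ (JLam _ _ _ _))) => by apply: JLam_ge0 : nneg.

Lemma JLam_cubewise Lam d j : good Lam -> cubewise (j + d) (JLam Lam d j).
Proof. by move=> gL x y xy; rewrite /JLam (corner_cidx xy) (good_cube gL xy). Qed.

Lemma meas_JLam Lam d j : good Lam -> meas (JLam Lam d j).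
Proof. by move=> gL; apply: meas_cubewise (JLam_cubewise gL). Qed.

Lemma JLam_le Lam d j y : good Lam -> JLam Lam d j y <= a_ Lam (j + d) y + 1.
Proof.
move=> gL; rewrite /JLam; have a0 := aseq_ge0 gL (j + d) y.
case: ifP => [r1|_]; last by nneg.
have L0 := good_gt0 gL (j + d) y; have [L1|/ltW L1] := lerP (Lam (j + d) y) 1.
  by apply: le_trans L1 _; rewrite lerDr.
apply: (@le_trans _ _ (a_ Lam (j + d) y)); last by rewrite lerDl.
rewrite /aseq ler_peMr ?(ltW L0)// -[leLHS](powRr0 (Fsum Lam (j + d) y)).
apply: ler_powR; last by nneg.
by apply: le_trans L1 _; exact: (Lam_le_Fsum gL).
Qed.

Lemma Av_aseq_lty M2 Lam d j x : good Lam -> (Av j M2 (a_ Lam (j + d)) x < +oo)%E.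
Proof.
move=> gL; apply: Av_lty; [exact: (meas_aseq gL)|exact: (aseq_ge0 gL)|].
have [C _ H] := Psi_int; apply: le_lt_trans (ltry C); apply: le_trans (H _ gL (j + d)%N).
apply: ge0_le_integral => //.
- by move=> y _; rewrite lee_fin (aseq_ge0 gL).
- by apply/measurable_EFinP; exact: (meas_aseq gL).
- by apply/measurable_EFinP; exact: (meas_Psi gL).
- move=> y _; rewrite lee_fin /Psi big_ord_recr/= lerDr.
  by apply: sumr_ge0 => i _; exact: (aseq_ge0 gL).
Qed.

Lemma Av_JLam_le M2 Lam d j x : good Lam -> (2 * n <= M2)%N ->
  (Av j M2 (JLam Lam d j) x <= Av j M2 (a_ Lam (j + d)) x + (2 ^+ n)%:E)%E.
Proof.
move=> gL nM; apply: (@le_trans _ _ (Av j M2 (fun y => a_ Lam (j + d) y + 1) x)).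
  apply: le_Av.
  - exact: meas_JLam.
  - by apply: measurable_funD; [exact: (meas_aseq gL)|exact: measurable_cst].
  - by nneg.
  - by move=> y; exact: JLam_le.
rewrite AvD//; last 2 first.
- exact: (meas_aseq gL).
- exact: (aseq_ge0 gL).
by rewrite leeD2l// -[X in (_ <= X%:E)%E]mul1r; exact: Av_cst_le.
Qed.

Lemma Av_JLam_lty M2 Lam d j x : good Lam -> (2 * n <= M2)%N ->
  (Av j M2 (JLam Lam d j) x < +oo)%E.
Proof.
move=> gL nM; apply: le_lt_trans (Av_JLam_le _ _ _ gL nM) _.
by rewrite lte_add_pinfty ?ltry// Av_aseq_lty.
Qed.

Lemma Xj_tame M2 : exists2 C, 0 <= C & forall Lam, good Lam -> forall d j x,
  tame AX C j x (Xj M2 Lam d j x).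
Proof.
have [C C1 H] := Psi_int; have C11 : 0 < C + 1 by rewrite ltr_wpDr.
exists `|ln (C + 1)| => // Lam gL d j x.
apply: (@tame_between _ _ _ _ _ _ (scl j x ^- (2 * n).+1) ((C + 1) * 2 ^+ (j * n))).
- apply: tame_le (tame_sclV _ _ _) => //; rewrite /AX ler_nat ltnS leq_mul2r; exact/orP/or_intror.
- apply: tame_le (tameM (tame_cst j x C11) (tame_pow2 n j x)); last by rewrite addr0.
  by rewrite add0r /AX ler_nat leqW// leq_pmull.
have a0 : 0 <= av j M2 (a_ Lam (j + d)) x by apply: av_ge0; exact: (aseq_ge0 gL).
rewrite /Xj lerDr a0/= mulrDl lerD//.
  rewrite -lee_fin avE; [|exact: (aseq_ge0 gL)|exact: Av_aseq_lty].
  have mk : meas (a_ Lam (j + d)) by exact: (meas_aseq gL).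
  have pk y : 0 <= a_ Lam (j + d) y by exact: (aseq_ge0 gL).
  apply: le_trans; first exact: (Av_sup j M2 x mk pk).
  rewrite mulrC EFinM lee_wpmul2l ?lee_fin ?exprn_ge0//.
  apply: le_trans (H _ gL (j + d)%N); apply: ge0_le_integral => //.
  - by nneg.
  - by apply/measurable_EFinP; exact: (meas_aseq gL).
  - by apply/measurable_EFinP; exact: (meas_Psi gL).
  - move=> y _; rewrite lee_fin /Psi big_ord_recr/= lerDr.
    by apply: sumr_ge0 => i _; exact: (aseq_ge0 gL).
rewrite mul1r; apply: (@le_trans _ _ 1); last by rewrite exprn_ege1// ler1n.
rewrite invf_le1 ?exprn_gt0 ?scl_gt0// exprn_ege1//.
by apply: le_trans (scl_ge2 _ _); rewrite ler1n.
Qed.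

Lemma Xj_gt0 M2 Lam d j x : good Lam -> 0 < Xj M2 Lam d j x.
Proof. by move=> gL; have [C _ H] := Xj_tame M2; have [] := H _ gL d j x. Qed.
Hint Extern 0 (is_true (@Order.lt _ _ _ (Xj _ _ _ _ _))) => by apply: Xj_gt0 : nneg.

Lemma meas_qcorner Lam d j : good Lam ->
  meas (fun y => Lam (j + d)%N y `^ (q (corner (j + d) y))^-1).
Proof.
move=> gL; apply: (@meas_cubewise _ _ (j + d)) => y z yz.
by rewrite (corner_cidx yz) (good_cube gL yz).
Qed.

(** The exponents that are changed between distant points. A single power [BB] of [om] is chosen for
    all of them, before any additive constant is known. *)
Definition slow_exps : seq ('rV[R]_n -> R) := [:: fun x => (p x)^-1; fun x => (q x)^-1;
  fun x => (1 - rr x) / p x; fun x => rr x - 1; rr].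

Lemma slow_expsP : forall k, exists B, exp_change (nth rr slow_exps k) Amax B.
Proof.
move=> k; apply: slow_exp_change; last by have [] := Amax_ge.
have s1 : slow (fun x => rr x - 1) by apply: slowD; [exact: slow_rr|exact: slow_cst].
have s2 : slow (fun x => 1 - rr x).
  by have := slowN s1; congr slow; apply/funext => x; rewrite opprB.
case: k => [|[|[|[|[|[|k]]]]]] /=.
- exact: slow_pV.
- exact: slow_qV.
- by apply: slowM => //; exact: slow_pV.
- exact: s1.
- exact: slow_rr.
- exact: slow_rr.
- exact: slow_rr.
Qed.

Definition BB : nat := projT1 (cid (slow_expsP 0)) + projT1 (cid (slow_expsP 1)) +
  projT1 (cid (slow_expsP 2)) + projT1 (cid (slow_expsP 3)) + projT1 (cid (slow_expsP 4)).

Lemma BB_change : [/\ exp_change (fun x => (p x)^-1) Amax BB,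
  exp_change (fun x => (q x)^-1) Amax BB,
  exp_change (fun x => (1 - rr x) / p x) Amax BB,
  exp_change (fun x => rr x - 1) Amax BB & exp_change rr Amax BB].
Proof.
rewrite /BB; move: (cid _) (cid _) (cid _) (cid _) (cid _) => -[B4 H4] [B3 H3] [B2 H2] [B1 H1] [B0 H0] /=.
split; [apply: exp_changeW H0|apply: exp_changeW H1|apply: exp_changeW H2|
  apply: exp_changeW H3|apply: exp_changeW H4]; lia.
Qed.

(** [M2] leaves a decay of [4 * n] after the two changes of exponent in [JZ_bound]; [M3] is what
    [Av_Psi_le] leaves of [M2]; [M1] is what [hh_jensen] asks for when two changes of exponent
    occur. *)
Definition M2 : nat := (2 * BB + 4 * n)%N.
Definition M3 : nat := (M2 - 2 * n)%N.
Definition M1 : nat := (2 * BB + M2 * T)%N.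
(** The order of the floor in [ht]: large enough for the floor to stay below the right-hand side of
    [ht_core] and for its p-th power to be integrable, as used in [Hj_powr]. *)
Definition A3 : nat := (Num.truncn (AXZ / qm + (2 * n).+1%:R / pm)).+1.

Local Notation X_ := (Xj M2).
Local Notation Y_ := (YY M3).
Local Notation J_ := (Jj M2).
Local Notation h_ := (hreal M1).

Lemma nM2 : (2 * n <= M2)%N.
Proof. by rewrite /M2; lia. Qed.

Lemma A3_ge : AXZ / qm <= A3%:R /\ (2 * n).+1%:R <= A3%:R * pm.
Proof.
have h : AXZ / qm + (2 * n).+1%:R / pm <= A3%:R.
  by rewrite ltW// /A3 truncnS_gt.
have h1 : 0 <= (2 * n).+1%:R / pm by nneg.
have h2 : 0 <= AXZ / qm by rewrite divr_ge0 ?(ltW qm0)// addr_ge0 ?AX_ge0 ?rAZ_ge0.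
by split; [lra|rewrite -ler_pdivrMr//; lra].
Qed.

Lemma AZr_le : rM * AZ <= Amax.
Proof.
have h1 := AF_ge0 A00 rm_gt0 : 0 <= AF_; have h2 := AY_ge0; have h3 := AX_ge0.
have h5 := AZ_ge0.
have e : (1 + rM) * AZ = AZ + rM * AZ by rewrite mulrDl mul1r.
rewrite /Amax; lra.
Qed.

Lemma Av_onep j M (K c : R) u x : meas u -> (forall y, 0 <= u y) -> 0 < c -> 0 <= K ->
  (2 * n <= M)%N -> (Av j M u x <= (K * c)%:E)%E ->
  (Av j M (fun y => 1 + u y / c)%R x <= (2 ^+ n + K)%:E)%E.
Proof.
move=> mu_ u0 c0 K0 nM h.
have E : (fun y => 1 + u y / c) = (fun y => 1 + c^-1 * u y).
  by apply/funext => y; rewrite mulrC.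
have ci : 0 <= c^-1 by nneg.
rewrite E AvD//; last 2 first.
- by apply: measurable_funM => //; exact: measurable_cst.
- by nneg.
rewrite AvZ// EFinD; apply: leeD.
  by rewrite -[X in (_ <= X%:E)%E]mul1r; exact: Av_cst_le.
apply: le_trans (lee_wpmul2l _ h) _; first by rewrite lee_fin.
by rewrite -EFinM lee_fin mulrCA mulVf ?mulr1// gt_eqF.
Qed.

Lemma Av_Y_le Lam d j x : good Lam ->
  (Av j M2 (fun y => 1 + Psi_ Lam (j + d)%N y / Y_ Lam d j x)%R x <= (2 ^+ n + 2 ^+ (M2 + n))%:E)%E.
Proof.
move=> gL; apply: Av_onep.
- exact: (meas_Psi gL).
- by move=> y; exact/ltW/(Psi_gt0 gL).
- exact: YY_gt0.
- exact: exprn_ge0.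
- exact: nM2.
- by apply: Av_Psi_le => //; exact: nM2.
Qed.

Lemma invp_bound x : `|(p x)^-1| <= pm^-1.
Proof.
have /andP[h _] := hp x.
by rewrite ger0_norm ?invr_ge0 ?(ltW (p_gt0 x))// lef_pV2 ?posrE ?p_gt0.
Qed.

Lemma invq_bound x : `|(q x)^-1| <= qm^-1.
Proof.
have /andP[h _] := hq x.
by rewrite ger0_norm ?invr_ge0 ?(ltW (q_gt0 x))// lef_pV2 ?posrE ?q_gt0.
Qed.

Lemma powR_le1p (t u e T' : R) : 0 <= t -> t <= u -> 1 <= u -> 0 <= e -> e <= T' -> t `^ e <= u `^ T'.
Proof.
move=> t0 tu u1 e0 eT; apply: (@le_trans _ _ (u `^ e)).
  by rewrite ge0_ler_powR// nnegrE// (le_trans t0).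
by rewrite ler_powR.
Qed.

Lemma powRC_le (k e b : R) : 0 < k -> `|e| <= b -> k `^ e <= (1 + k + k^-1) `^ b.
Proof.
move=> k0 eb; have Ci : 0 < k^-1 by nneg.
have h1 : 1 <= 1 + k + k^-1 by rewrite -addrA lerDl addr_ge0// ltW.
have h2 : k <= (1 + k + k^-1) * 1 by rewrite mulr1; lra.
have h3 : 1 <= (1 + k + k^-1) * k.
  by rewrite mulrDl mulVf ?gt_eqF// lerDr mulr_ge0 ?(ltW k0)// addr_ge0// ltW.
by have := powR_near k0 ltr01 h1 eb h2 h3; rewrite powR1 mulr1.
Qed.

(** [Lam ^ (1 / q)] is at most [(Fsum ^ r) ^ (1 / p)], and [Fsum ^ r] is at most a multiple of
    [Psi]. Once [Y ^ (1 / p)] is taken out, Jensen's inequality applies to [1 + Psi / Y], whose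
    average is bounded; the summand 1 allows the exponent [1 / p] to be raised to [tau]. *)
Lemma h_simple : exists2 C, 0 < C & forall Lam, good Lam -> forall d j x,
  (hh tau j d M1 (fun y => Lam (j + d)%N y `^ (q (corner (j + d) y))^-1)%R x
    <= (C * Y_ Lam d j x `^ (p x)^-1)%:E)%E.
Proof.
have [C C1 H] := aseq_bounds A00 C00 rm_gt0 rr_bound slow_rr meas_rr.
have [CY CY0 HY] := YY_tame M3.
have [Bp _ _ _ _] := BB_change; have [D D0 HD] := Bp CY CY0.
pose K1 := (1 + C + C^-1) `^ pm^-1 * D.
have K10 : 0 < K1 by nneg.
pose K2 := 2 ^+ n + 2 ^+ (M2 + n) : R.
have K21 : 1 <= K2 by rewrite ler_wpDr ?exprn_ge0// exprn_ege1// ler1n.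
exists (K1 * ((2 ^+ M2 * K2) ^+ T * K2)) => [|Lam gL d j x].
  by nneg.
set Y := Y_ Lam d j x; have Y0 : 0 < Y by nneg.
have [_ AYm _ _ _] := Amax_ge.
rewrite mulrAC.
apply: (@hh_jensen R n tau T tau1 j d M1 M2 BB _ (fun y => 1 + Psi_ Lam (j + d) y / Y)).
- by rewrite /M1 leq_add2r leq_pmull.
- exact: meas_qcorner.
- by nneg.
- by move=> y z yz; rewrite (Psi_cubewise gL yz).
- by move=> y; rewrite addr_ge0// divr_ge0 ?(ltW Y0)//; exact/ltW/(Psi_gt0 gL).
- exact: powR_ge0.
- exact: ltW.
- exact: K21.
- move=> y; set c := corner (j + d) y.
  have L0 := good_gt0 gL (j + d) y; have F0 := Fsum_gt0 gL (j + d) y.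
  have P0 := Psi_gt0 gL (j + d) y.
  have r0 := rr_gt0 c; have p0 := p_gt0 c; have q0 := q_gt0 c.
  have qi : 0 <= (q c)^-1 by nneg.
  have pi : 0 <= (p c)^-1 by nneg.
  have [_ _ _ H4] := H _ gL.
  apply: (@le_trans _ _ ((C * Psi_ Lam (j + d) y) `^ (p c)^-1)).
    apply: (@le_trans _ _ (Fsum Lam (j + d) y `^ (q c)^-1)).
      by rewrite ge0_ler_powR// ?nnegrE ?(ltW L0) ?(ltW F0)//; exact: (Lam_le_Fsum gL).
    have -> : (q c)^-1 = rr c * (p c)^-1 by rewrite /rr mulrAC divff ?mul1r// gt_eqF.
    by rewrite powRrM ge0_ler_powR// ?nnegrE ?powR_ge0// mulr_ge0 ?(ltW C1)// ltW.
  have -> : C * Psi_ Lam (j + d) y = C * Y * (Psi_ Lam (j + d) y / Y).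
    by rewrite [Psi_ _ _ _ / Y]mulrC mulrA mulfK// gt_eqF.
  set PY := Psi_ Lam (j + d) y / Y.
  have PY0 : 0 <= PY by nneg.
  clearbody PY; rewrite !powRM ?(ltW C1) ?(ltW Y0)// ?mulr_ge0 ?(ltW C1) ?(ltW Y0)//.
  rewrite {1}/K1 -!mulrA; apply: ler_pM; rewrite ?powR_ge0 ?mulr_ge0 ?powR_ge0//.
    exact: powRC_le (invp_bound c).
  rewrite !mulrA; apply: ler_pM; rewrite ?powR_ge0//.
    have tY := tame_le AYm (lexx CY) (HY _ gL d j x).
    by have [_ h] := HD j x y c _ (corner_near y (leq_addr d j)) tY.
  apply: powR_le1p => //.
  + by rewrite lerDr.
  + by rewrite lerDl.
- exact: Av_Y_le.
Qed.

Lemma hrealE : forall Lam, good Lam -> forall d j x,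
  (h_ Lam d j x)%:E = hh tau j d M1 (fun y => Lam (j + d)%N y `^ (q (corner (j + d) y))^-1) x.
Proof.
have [C C1 H] := h_simple; move=> Lam gL d j x; rewrite /hreal fineK// ge0_fin_numE.
  by apply: le_lt_trans (H _ gL d j x) _; exact: ltry.
by apply: hh_ge0 => y; exact: powR_ge0.
Qed.

Lemma hreal_ge0 Lam d j x : 0 <= h_ Lam d j x.
Proof. by apply: fine_ge0; apply: hh_ge0 => y; exact: powR_ge0. Qed.
Hint Extern 0 (is_true (@Order.le _ _ _ (hreal _ _ _ _ _))) => by apply: hreal_ge0 : nneg.

Lemma meas_hreal Lam d j : good Lam -> meas (h_ Lam d j).
Proof.
move=> gL; apply: (measurableT_comp (f := @fine R)) => //.
by apply: meas_hh; [exact: meas_qcorner|move=> y; exact: powR_ge0].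
Qed.

Lemma hreal_le : exists2 C, 0 < C & forall Lam, good Lam -> forall d j x,
  h_ Lam d j x <= C * Y_ Lam d j x `^ (p x)^-1.
Proof.
have [C C1 H] := h_simple; exists C => // Lam gL d j x.
by rewrite -lee_fin hrealE//; exact: H.
Qed.

(* The term [scl ^- A3] keeps the bases of the variable powers tame. *)
Definition ht Lam d j x := h_ Lam d j x + scl j x ^- A3.
Definition Hj Lam d j x := ht Lam d j x `^ q x.
Definition Gj Lam d j x := \sum_(i < j.+1) Hj Lam d i x.
(** [Gj] is the partial sum to be estimated. The summand [Y ^ (1 / r)] ensures [Y <= Zj ^ r], so
    that a power of [Zj] can stand for the averages of [Psi] in [hh_small]. *)
Definition Zj Lam d j x := Y_ Lam d j x `^ (rr x)^-1 + Gj Lam d j x.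

Lemma ht_gt0 Lam d j x : 0 < ht Lam d j x.
Proof. by rewrite ltr_wpDl ?hreal_ge0// invr_gt0 exprn_gt0// scl_gt0. Qed.

Lemma Hj_gt0 Lam d j x : 0 < Hj Lam d j x.
Proof. by rewrite powR_gt0// ht_gt0. Qed.
Hint Extern 0 (is_true (@Order.lt _ _ _ (Hj _ _ _ _))) => by apply: Hj_gt0 : nneg.

Lemma Gj_gt0 Lam d j x : 0 < Gj Lam d j x.
Proof. by apply: (@psum_gt0 _ (fun i => Hj Lam d i x)) => i; exact: Hj_gt0. Qed.
Hint Extern 0 (is_true (@Order.lt _ _ _ (Gj _ _ _ _))) => by apply: Gj_gt0 : nneg.

Lemma Zj_gt0 Lam d j x : 0 < Zj Lam d j x.
Proof. by rewrite ltr_wpDl ?powR_ge0// Gj_gt0. Qed.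
Hint Extern 0 (is_true (@Order.lt _ _ _ (Zj _ _ _ _))) => by apply: Zj_gt0 : nneg.

Lemma meas_ht Lam d j : good Lam -> meas (ht Lam d j).
Proof.
move=> gL; apply: measurable_funD; first exact: meas_hreal.
apply: meas_funV; apply: measurable_funX; apply: measurable_funM.
  exact: measurable_cst.
by apply: measurable_funD; [exact: measurable_cst|exact: meas_rV_norm].
Qed.

Lemma meas_Hj Lam d j : good Lam -> meas (Hj Lam d j).
Proof. by move=> gL; apply: meas_fun_powR => //; exact: meas_ht. Qed.

Lemma meas_Gj Lam d j : good Lam -> meas (Gj Lam d j).
Proof. by move=> gL; apply: measurable_sum => i; exact: meas_Hj. Qed.

Lemma meas_Zj Lam d j : good Lam -> meas (Zj Lam d j).
Proof.
move=> gL; apply: measurable_funD; last exact: meas_Gj.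
by apply: meas_fun_powR; [exact: meas_YY|apply: meas_funV; exact: meas_rr].
Qed.

Lemma invr_bound x : `|(rr x)^-1| <= rm^-1.
Proof.
have /andP[h _] := rr_bound x.
by rewrite ger0_norm ?invr_ge0 ?(ltW (rr_gt0 x))// lef_pV2 ?posrE ?rr_gt0 ?rm_gt0.
Qed.

Lemma q_bound x : `|q x| <= P.
Proof. by rewrite gtr0_norm ?q_gt0//; case/andP: (hq x). Qed.

Lemma sclV_le1 k j x : scl j x ^- k <= 1.
Proof.
rewrite invf_le1 ?exprn_gt0 ?scl_gt0// exprn_ege1//.
by apply: le_trans (scl_ge2 _ _); rewrite ler1n.
Qed.

Lemma ht_upper : exists2 C, 0 < C & exists2 C', 0 <= C' & forall Lam, good Lam -> forall d j x,
  ht Lam d j x <= 1 + C * Y_ Lam d j x `^ (p x)^-1 /\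
  tame (AY / pm) C' j x (1 + C * Y_ Lam d j x `^ (p x)^-1).
Proof.
have [Ch Ch0 Hh] := hreal_le; have [CY CY0 HY] := YY_tame M3.
have l2 : 0 <= ln 2 :> R by nneg.
have pmi : 0 <= pm^-1 by nneg.
have a0 : 0 <= pm^-1 * CY by nneg.
exists Ch => //; exists (pm^-1 * CY + `|ln Ch| + ln 2) => [|Lam gL d j x].
  by nneg.
have Y0 : 0 < Y_ Lam d j x by nneg.
split; first by rewrite /ht addrC lerD ?sclV_le1// Hh.
have tY := tame_powR (invp_bound x) (HY _ gL d j x).
have AYp : 0 <= AY / pm by rewrite mulr_ge0// AY_ge0.
apply: tameD.
  split=> //; rewrite ln1 normr0 addr_ge0//; last by nneg.
  by nneg.
apply: tame_le (tameM (tame_cst j x Ch0) tY); first by rewrite add0r mulrC.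
by rewrite addrC.
Qed.

Lemma ht_tame : exists2 C, 0 <= C & forall Lam, good Lam -> forall d j x,
  tame (A3%:R + AY / pm) C j x (ht Lam d j x).
Proof.
have [C C1 [C' C'0 H]] := ht_upper; exists C' => // Lam gL d j x.
have AYp : 0 <= AY / pm by rewrite mulr_ge0 ?AY_ge0// invr_ge0 ltW.
have [h1 h2] := H _ gL d j x.
apply: (@tame_between _ _ _ _ _ _ (scl j x ^- A3) (1 + C * Y_ Lam d j x `^ (p x)^-1)).
- by apply: tame_le (tame_sclV _ _ _) => //; rewrite lerDl.
- by apply: tame_le h2 => //; rewrite lerDr.
- by rewrite h1 andbT /ht lerDr hreal_ge0.
Qed.

(** The summands of [AZ] are the orders of [Y ^ (1 / r)], of the q-th power of the upper bound for
    [ht], and of the number [j + 1 <= 2 ^ j] of terms in [Gj]. *)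
Lemma Zj_tame : exists2 C, 0 <= C & forall Lam, good Lam -> forall d j x,
  tame AZ C j x (Zj Lam d j x).
Proof.
have [C C1 [C' C'0 H]] := ht_upper; have [CY CY0 HY] := YY_tame M3.
have l2 : 0 <= ln 2 :> R by nneg.
have rmi : 0 <= rm^-1 by nneg.
have pmi : 0 <= pm^-1 by nneg.
have P0 := ltW P_gt0; have AY0 := AY_ge0.
have a1 : 0 <= rm^-1 * CY by nneg.
have a2 : 0 <= P * C' by nneg.
exists (rm^-1 * CY + P * C' + ln 2) => [|Lam gL d j x]; first by nneg.
have Y0 : 0 < Y_ Lam d j x by nneg.
have b1 : 0 <= AY / rm by nneg.
have b2 : 0 <= AY / pm * P by nneg.
have t1 : tame AZ (rm^-1 * CY + P * C') j x (Y_ Lam d j x `^ (rr x)^-1).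
  apply: tame_le (tame_powR (invr_bound x) (HY _ gL d j x)).
    by rewrite mulrC /AZ; move: b1 b2; set e := AY / rm; lra.
  by rewrite lerDl.
set U := 1 + C * Y_ Lam d j x `^ (p x)^-1.
have [h1 h2] := H _ gL d j x.
have t2 : tame AZ (rm^-1 * CY + P * C') j x (2 ^+ (j * 1) * U `^ q x).
  apply: tame_le (tameM (tame_pow2 1 j x) (tame_powR (q_bound x) h2)).
    by rewrite /AZ [P * _]mulrC; move: b1 b2; set e := AY / rm; lra.
  by rewrite add0r lerDr.
apply: (@tame_between _ _ _ _ _ _ (Y_ Lam d j x `^ (rr x)^-1)
   (Y_ Lam d j x `^ (rr x)^-1 + 2 ^+ (j * 1) * U `^ q x)).
- by apply: tame_le t1 => //; rewrite lerDl.
- exact: tameD.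
rewrite /Zj lerDl (ltW (Gj_gt0 _ _ _ _)) lerD2l /Gj muln1.
apply: (@le_trans _ _ (\sum_(i < j.+1) U `^ q x)).
  apply: ler_sum => i _; rewrite /Hj ge0_ler_powR ?(ltW (q_gt0 x))// ?nnegrE ?(ltW (ht_gt0 _ _ _ _))//.
    by nneg.
  have [h3 _] := H _ gL d i x; apply: le_trans h3 _.
  rewrite /U lerD2l ler_wpM2l ?(ltW C1)// ge0_ler_powR ?invr_ge0 ?(ltW (p_gt0 x))// ?nnegrE.
  + by nneg.
  + exact: ltW.
  + by apply: le_YY => //; rewrite -ltnS.
rewrite sumr_const card_ord -[_ *+ _]mulr_natl ler_wpM2r ?powR_ge0//.
by rewrite -natrX ler_nat ltn_expl.
Qed.

Lemma YY_le_Zj Lam d j x : good Lam -> Y_ Lam d j x <= Zj Lam d j x `^ rr x.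
Proof.
move=> gL; have Y0 := YY_gt0 M3 d j x gL; have r0 := rr_gt0 x.
have {1}-> : Y_ Lam d j x = (Y_ Lam d j x `^ (rr x)^-1) `^ rr x.
  by rewrite -powRrM mulVf ?gt_eqF// powRr1// ltW.
apply: ge0_ler_powR; rewrite ?nnegrE ?powR_ge0 ?(ltW r0) ?(ltW (Zj_gt0 _ _ _ _))//.
by rewrite /Zj lerDl ltW// Gj_gt0.
Qed.

Lemma Zj_pow_tame : exists2 C, 0 <= C & forall Lam, good Lam -> forall d j x,
  tame (rM * AZ) C j x (Zj Lam d j x `^ rr x) /\
  tame AXZ C j x (X_ Lam d j x * Zj Lam d j x `^ (1 - rr x)) /\
  tame AXZ C j x (J_ Lam d j x + X_ Lam d j x * Zj Lam d j x `^ (1 - rr x)).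
Proof.
have [CX CX0 HX] := Xj_tame M2; have [CZ CZ0 HZ] := Zj_tame.
have l2 : 0 <= ln 2 :> R by nneg.
have rM0 := ltW rM0; have AX0 := AX_ge0; have AZ0 := rAZ_ge0.
pose C1 := CX + (1 + rM) * CZ; have C10 : 0 <= C1 by nneg.
pose L := `|ln (2 ^+ n : R)|; have L0 : 0 <= L by nneg.
have cz0 : 0 <= rM * CZ by nneg.
exists (CX + L + ln 2 + C1 + ln 2 + rM * CZ) => [|Lam gL d j x]; first lra.
have rb : `|rr x| <= rM by rewrite gtr0_norm ?rr_gt0//; case/andP: (rr_bound x).
have rb' : `|1 - rr x| <= 1 + rM.
  by apply: le_trans (ler_normB _ _) _; rewrite normr1 lerD2l.
have tX := HX _ gL d j x; have tZ := HZ _ gL d j x.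
have t2 := tameM tX (tame_powR rb' tZ); rewrite -/AXZ -/C1 in t2.
have X0 := Xj_gt0 M2 d j x gL; have Z0 := Zj_gt0 Lam d j x.
split; first by apply: tame_le (tame_powR rb tZ) => //; lra.
split; first by apply: tame_le t2 => //; lra.
have J0 : 0 <= J_ Lam d j x by apply: av_ge0 => y; exact: JLam_ge0.
have XZ0 : 0 < X_ Lam d j x * Zj Lam d j x `^ (1 - rr x) by case: t2.
apply: (@tame_between _ _ _ _ _ _ (X_ Lam d j x * Zj Lam d j x `^ (1 - rr x))
  (X_ Lam d j x + 2 ^+ n + X_ Lam d j x * Zj Lam d j x `^ (1 - rr x))).
- by apply: tame_le t2 => //; lra.
- apply: (@tame_le _ _ AXZ _ (CX + L + ln 2 + C1 + ln 2)) => //; first lra.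
  apply: tameD; last by apply: tame_le t2 => //; lra.
  apply: (@tame_le _ _ AX _ (CX + L + ln 2)); [by rewrite lerDl|by rewrite lerDl|].
  apply: tameD; first by apply: tame_le tX => //; lra.
  have p2n : 0 < 2 ^+ n :> R by nneg.
  by apply: tame_le (tame_cst j x p2n) => //; rewrite -/L; lra.
apply/andP; split; first by rewrite lerDr.
rewrite lerD2r -lee_fin avE; last 2 first.
- by nneg.
- by apply: Av_JLam_lty => //; exact: nM2.
apply: le_trans (Av_JLam_le _ _ _ gL nM2) _.
rewrite -(@avE _ _ j M2 (a_ Lam (j + d))); last 2 first.
- exact: (aseq_ge0 gL).
- exact: Av_aseq_lty.
by rewrite -EFinD lee_fin lerD2r /Xj lerDl invr_ge0 exprn_ge0// ltW// scl_gt0.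
Qed.

Lemma powR_scl_low (C b : R) x t : 0 <= C -> 0 <= b -> forall j, tame b C j x t ->
  scl j x ^- A3 <= expR (C / qm) * t `^ (q x)^-1 \/ A3%:R < b / qm.
Proof.
move=> k0 b0 j [t0 h]; have [h1|h1] := ltP A3%:R (b / qm); [by right|left].
have ls := ln_scl_ge0 j x; have s0 := scl_gt0 j x.
rewrite -powR_invn ?(ltW s0)// (powR_expR _ s0) (powR_expR _ t0) -expRD ler_expR.
have qi : 0 <= (q x)^-1 by nneg.
have qmi : 0 <= qm^-1 by nneg.
have qq : (q x)^-1 <= qm^-1 by rewrite -[leLHS]ger0_norm// invq_bound.
move: h; rewrite ler_norml => /andP[h2 _].
have h3 : (q x)^-1 * (b * ln (scl j x) + C) <= qm^-1 * (b * ln (scl j x) + C).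
  by rewrite ler_wpM2r// addr_ge0// mulr_ge0.
have h4 : (q x)^-1 * - (b * ln (scl j x) + C) <= (q x)^-1 * ln t by rewrite ler_wpM2l.
have h5 : b / qm * ln (scl j x) <= A3%:R * ln (scl j x) by rewrite ler_wpM2r.
rewrite mulNr; move: h3 h4 h5; rewrite mulrN mulrDr [b / qm]mulrC mulrA [C / qm]mulrC; lra.
Qed.

Lemma powR_fJ (a b u v e t : R) : 0 <= a -> 0 < b -> 0 <= e -> e <= t ->
  a `^ e <= b `^ e * (1 + a / b) `^ t.
Proof.
move=> a0 b0 e0 et; have {1}-> : a = b * (a / b) by rewrite mulrC divfK// gt_eqF.
rewrite powRM ?(ltW b0) ?divr_ge0 ?(ltW b0)// ler_wpM2l ?powR_ge0//.
by apply: powR_le1p; rewrite ?divr_ge0 ?(ltW b0)// ?lerDr ?lerDl// divr_ge0 ?(ltW b0).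
Qed.

(** Jensen's inequality for [1 + JLam / V], where [V] is the base on the right. Its part [Jj] bounds
    the average of [JLam], and its part with [Xj] keeps it tame when [Jj] is small. *)
Lemma hh_big : exists2 C, 0 < C & forall Lam, good Lam -> forall d j x,
  (hh tau j d M1 (fun y => JLam Lam d j y `^ (q (corner (j + d) y))^-1)%R x <=
   (C * (J_ Lam d j x + X_ Lam d j x * Zj Lam d j x `^ (1 - rr x)) `^ (q x)^-1)%:E)%E.
Proof.
have [CZ CZ0 HZ] := Zj_pow_tame.
have [_ Bq _ _ _] := BB_change; have [D D0 HD] := Bq CZ CZ0.
pose K2 := 2 ^+ n + 1 : R.
have K21 : 1 <= K2 by nneg.
exists (D * ((2 ^+ M2 * K2) ^+ T * K2)) => [|Lam gL d j x].
  by nneg.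
have [_ [_ tV]] := HZ _ gL d j x.
set V := J_ Lam d j x + _ in tV *.
have [_ _ AXZm _ _] := Amax_ge.
have V0 : 0 < V by case: tV.
have mJ := meas_JLam d j gL.
have J0 y : 0 <= JLam Lam d j y by nneg.
rewrite mulrAC.
apply: (@hh_jensen R n tau T tau1 j d M1 M2 BB _ (fun y => 1 + JLam Lam d j y / V)).
- by rewrite /M1 leq_add2r leq_pmull.
- apply: (@meas_cubewise _ _ (j + d)) => y z yz.
  by rewrite (corner_cidx yz) (JLam_cubewise gL yz).
- by nneg.
- by move=> y z yz; rewrite (JLam_cubewise gL yz).
- by nneg.
- exact: powR_ge0.
- exact: ltW.
- exact: K21.
- move=> y; set c := corner (j + d) y.
  have qi : 0 <= (q c)^-1 by nneg.
  apply: le_trans; first exact: (powR_fJ 0 0 (J0 y) V0 qi (tauq c)).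
  rewrite ler_wpM2r ?powR_ge0//.
  have tV' := tame_le AXZm (lexx CZ) tV.
  by have [_] := HD j x y c _ (corner_near y (leq_addr d j)) tV'.
- apply: Av_onep => //; first exact: nM2.
  rewrite mul1r -avE//; last by apply: Av_JLam_lty => //; exact: nM2.
  rewrite lee_fin /V lerDl mulr_ge0 ?powR_ge0//; exact/ltW/Xj_gt0.
Qed.

Definition SLam (Lam : nat -> 'rV[R]_n -> R) d j y :=
  if 1 <= rr (corner (j + d) y) then 0 else Lam (j + d)%N y.

(** On these cubes [Lam ^ (1 / q)] equals [aseq ^ (1 / q) * (Fsum ^ r) ^ ((1 - r) / p)] with both
    exponents nonnegative, and [Fsum ^ r] is bounded by [Psi]. The exponents add up to [1 / p],
    hence to at most [tau], so that Jensen's inequality applies to [1 + aseq / X + Psi / Y]. *)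
Lemma hh_small : exists2 C, 0 < C & forall Lam, good Lam -> forall d j x,
  (hh tau j d M1 (fun y => SLam Lam d j y `^ (q (corner (j + d) y))^-1)%R x <=
   (C * (X_ Lam d j x * Zj Lam d j x `^ (1 - rr x)) `^ (q x)^-1)%:E)%E.
Proof.
have [C C1 H] := aseq_bounds A00 C00 rm_gt0 rr_bound slow_rr meas_rr.
have [CX CX0 HX] := Xj_tame M2; have [CZ CZ0 HZ] := Zj_pow_tame.
have [_ Bq Br _ _] := BB_change.
have [D D0 HD] := Bq CX CX0; have [E E0 HE] := Br CZ CZ0.
pose Kc := (1 + C + C^-1) `^ pm^-1.
have Kc0 : 0 < Kc by nneg.
pose K1 := Kc * D * E.
have K10 : 0 < K1 by nneg.
pose K2 := 2 ^+ n + (1 + 2 ^+ (M2 + n)) : R.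
have K21 : 1 <= K2 by rewrite /K2 addrCA lerDl addr_ge0// exprn_ge0.
exists (K1 * ((2 ^+ M2 * K2) ^+ T * K2)) => [|Lam gL d j x].
  by nneg.
have [tZr _] := HZ _ gL d j x; have tX := HX _ gL d j x.
have X0 := Xj_gt0 M2 d j x gL; have Y0 := YY_gt0 M3 d j x gL; have Z0 := Zj_gt0 Lam d j x.
set X := X_ _ _ _ _ in tX X0 *; set Y := Y_ Lam d j x in Y0 *; set Z := Zj _ _ _ _ in tZr Z0 *.
have YZ : Y <= Z `^ rr x by exact: YY_le_Zj.
have AXm : AX <= Amax.
  have [_ _ + _ _] := Amax_ge; apply: le_trans; rewrite /AXZ lerDl; exact: rAZ_ge0.
have tX' := tame_le AXm (lexx CX) tX; have tZ' := tame_le AZr_le (lexx CZ) tZr.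
have a0 y : 0 <= a_ Lam (j + d) y by exact: (aseq_ge0 gL).
have ma : meas (a_ Lam (j + d)) by exact: (meas_aseq gL).
have P0 y : 0 < Psi_ Lam (j + d) y by exact: (Psi_gt0 gL).
have S0 y : 0 <= SLam Lam d j y.
  by rewrite /SLam; case: ifP => // _; exact/ltW/(good_gt0 gL).
have cS : cubewise (j + d) (SLam Lam d j).
  by move=> y z yz; rewrite /SLam (corner_cidx yz) (good_cube gL yz).
rewrite mulrAC.
apply: (@hh_jensen R n tau T tau1 j d M1 M2 (2 * BB) _
  (fun y => 1 + (a_ Lam (j + d) y / X + Psi_ Lam (j + d) y / Y))).
- by rewrite /M1.
- by apply: (@meas_cubewise _ _ (j + d)) => y z yz; rewrite (corner_cidx yz) (cS _ _ yz).
- by nneg.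
- by move=> y z yz; rewrite (aseq_cubewise gL yz) (Psi_cubewise gL yz).
- move=> y; rewrite addr_ge0// addr_ge0// divr_ge0 ?(ltW X0) ?(ltW Y0)//; exact/ltW.
- exact: powR_ge0.
- exact: ltW.
- exact: K21.
- move=> y; set c := corner (j + d) y.
  have L0 := good_gt0 gL (j + d) y; have F0 := Fsum_gt0 gL (j + d) y.
  have r0 := rr_gt0 c; have p0 := p_gt0 c; have q0 := q_gt0 c.
  have qi : 0 < (q c)^-1 by nneg.
  have pi : 0 < (p c)^-1 by nneg.
  rewrite {1}/SLam -/c; case: ifPn => [r1|].
    rewrite powR0 ?gt_eqF// !mulr_ge0 ?powR_ge0 ?exprn_ge0 ?om_ge0//; exact: ltW.
  rewrite -ltNge => r1.
  set aX := a_ Lam (j + d) y / X; set PY := Psi_ Lam (j + d) y / Y; set U := 1 + (aX + PY).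
  have aX0 : 0 <= aX by nneg.
  have PY0 : 0 <= PY by nneg.
  have r1p : 0 <= (1 - rr c) / p c by nneg.
  have [_ _ _ H4] := H _ gL.
  have eqp : (q c)^-1 = rr c * (p c)^-1 by rewrite /rr mulrAC divff ?mul1r// gt_eqF.
  have -> : Lam (j + d)%N y `^ (q c)^-1 =
      a_ Lam (j + d) y `^ (q c)^-1 * (Fsum Lam (j + d) y `^ rr c) `^ ((1 - rr c) / p c).
    rewrite /aseq -/c powRM ?(ltW L0) ?powR_ge0// -!powRrM -mulrA -powRD.
      rewrite (_ : _ + _ = 0) ?powRr0 ?mulr1//.
      by rewrite eqp; ring.
    by rewrite (gt_eqF F0) implybT.
  apply: (@le_trans _ _ (X `^ (q c)^-1 * aX `^ (q c)^-1 *
      (Kc * (Y `^ ((1 - rr c) / p c) * PY `^ ((1 - rr c) / p c))))).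
    have -> : X `^ (q c)^-1 * aX `^ (q c)^-1 = a_ Lam (j + d) y `^ (q c)^-1.
      by rewrite -powRM ?(ltW X0)// /aX mulrC divfK// gt_eqF.
    rewrite ler_wpM2l ?powR_ge0// -powRM ?(ltW Y0)//.
    have -> : Y * PY = Psi_ Lam (j + d) y by rewrite /PY mulrC divfK// gt_eqF.
    apply: (@le_trans _ _ ((C * Psi_ Lam (j + d) y) `^ ((1 - rr c) / p c))).
      by rewrite ge0_ler_powR// ?nnegrE ?powR_ge0// mulr_ge0 ?(ltW C1)// ltW.
    rewrite powRM ?(ltW C1) ?(ltW (P0 _))// ler_wpM2r ?powR_ge0//.
    apply: powRC_le => //; rewrite ger0_norm//.
    apply: (@le_trans _ _ (p c)^-1); last by rewrite -[leLHS]gtr0_norm// invp_bound.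
    by rewrite ler_piMl ?(ltW pi)//; lra.
  have UU : aX `^ (q c)^-1 * PY `^ ((1 - rr c) / p c) <= U `^ tau c.
    have U1 : 1 <= U by rewrite /U lerDl addr_ge0.
    apply: (@le_trans _ _ (U `^ (q c)^-1 * U `^ ((1 - rr c) / p c))).
      by apply: ler_pM; rewrite ?powR_ge0// ge0_ler_powR ?(ltW qi)// ?nnegrE ?(le_trans ler01 U1)//;
        rewrite /U -/aX -/PY; lra.
    rewrite -powRD; last by rewrite (gt_eqF (lt_le_trans ltr01 U1)) implybT.
    apply: ler_powR => //; rewrite (_ : _ + _ = (p c)^-1); first exact: taup.
    by rewrite eqp; ring.
  have hX : X `^ (q c)^-1 <= D * om j x y ^+ BB * X `^ (q x)^-1.
    by have [_] := HD j x y c _ (corner_near y (leq_addr d j)) tX'.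
  have hY : Y `^ ((1 - rr c) / p c) <= E * om j x y ^+ BB * Z `^ ((1 - rr x) / q x).
    apply: (@le_trans _ _ ((Z `^ rr x) `^ ((1 - rr c) / p c))).
      by rewrite ge0_ler_powR// ?nnegrE ?powR_ge0// ltW.
    have [_ h] := HE j x y c _ (corner_near y (leq_addr d j)) tZ'; apply: le_trans h _.
    rewrite ler_wpM2l ?mulr_ge0 ?(ltW E0) ?exprn_ge0 ?om_ge0// -powRrM.
    rewrite (_ : rr x * _ = (1 - rr x) / q x)// /rr.
    by field; rewrite !gt_eqF ?p_gt0 ?q_gt0.
  rewrite powRM ?(ltW X0) ?powR_ge0// -powRrM.
  rewrite (_ : X `^ _ * _ * _ = Kc * (X `^ (q c)^-1 * Y `^ ((1 - rr c) / p c)) *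
    (aX `^ (q c)^-1 * PY `^ ((1 - rr c) / p c))); last by ring.
  apply: ler_pM; rewrite ?mulr_ge0 ?powR_ge0 ?(ltW Kc0)//.
  rewrite (_ : K1 * _ * _ = Kc * ((D * om j x y ^+ BB * X `^ (q x)^-1) *
     (E * om j x y ^+ BB * Z `^ ((1 - rr x) / q x)))); last first.
    rewrite /K1 mulnC exprM expr2; move: (om j x y ^+ BB) (X `^ _) (Z `^ _) => o u v.
    by clear; ring.
  by rewrite ler_pM2l// ler_pM ?powR_ge0.
- have -> : (fun y => 1 + (a_ Lam (j + d) y / X + Psi_ Lam (j + d) y / Y)) =
     (fun y => (X^-1 * a_ Lam (j + d) y) + (1 + Psi_ Lam (j + d) y / Y)).
    by apply/funext => y; rewrite addrCA [_ / X]mulrC.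
  have mP : meas (fun y => 1 + Psi_ Lam (j + d) y / Y).
    apply: measurable_funD; first exact: measurable_cst.
    by apply: measurable_funM; [exact: (meas_Psi gL)|exact: measurable_cst].
  have X0i : 0 <= X^-1 by nneg.
  rewrite AvD//; last 3 first.
  + by apply: measurable_funM => //; exact: measurable_cst.
  + by nneg.
  + by nneg.
  have -> : K2 = 1 + (2 ^+ n + 2 ^+ (M2 + n)) by rewrite /K2 addrCA.
  rewrite [X in (_ <= X)%E]EFinD; apply: leeD; last exact: Av_Y_le.
  rewrite AvZ// -avE//; last exact: Av_aseq_lty.
  rewrite -EFinM lee_fin mulrC ler_pdivrMr// mul1r /X /Xj lerDl.
  by nneg.
Qed.

(** The coefficients split into [JLam] and [SLam], and the floor in [ht] is dominated thanks to the
    choice of [A3]. *)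
Lemma ht_core : exists2 C, 0 < C & forall Lam, good Lam -> forall d j x,
  Hj Lam d j x <= C * (J_ Lam d j x + X_ Lam d j x * Zj Lam d j x `^ (1 - rr x)).
Proof.
have [C1 C10 h1] := hh_big; have [C2 C20 h2] := hh_small.
have [CZ CZ0 HZ] := Zj_pow_tame.
pose K := C1 + C2 + expR (CZ / qm).
have K0 : 0 < K by nneg.
exists ((1 + K + K^-1) `^ P) => [|Lam gL d j x].
  by nneg.
have [_ [tV1 tV]] := HZ _ gL d j x.
set V1 := X_ _ _ _ _ * _ in tV1 *; set V := J_ _ _ _ _ + _ in tV *.
have V10 : 0 < V1 by case: tV1. 
have V0 : 0 < V by case: tV.
have qi : 0 <= (q x)^-1 by nneg.
have VV : V1 `^ (q x)^-1 <= V `^ (q x)^-1.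
  rewrite ge0_ler_powR// ?nnegrE ?(ltW V10) ?(ltW V0)// /V -/V1 lerDr.
  by apply: av_ge0 => y; exact: JLam_ge0.
have hK : ht Lam d j x <= K * V `^ (q x)^-1.
  rewrite /ht /K mulrDl lerD//; last first.
    have AXZ0 : 0 <= AXZ by rewrite addr_ge0 ?AX_ge0 ?rAZ_ge0.
    have [h|] := powR_scl_low CZ0 AXZ0 tV; first exact: h.
    by have [h _] := A3_ge; rewrite ltNge h.
  rewrite -lee_fin hrealE//.
  have -> : (fun y => Lam (j + d)%N y `^ (q (corner (j + d) y))^-1) =
      fun y => JLam Lam d j y `^ (q (corner (j + d) y))^-1 + SLam Lam d j y `^ (q (corner (j + d) y))^-1.
    apply/funext => y; rewrite /JLam /SLam; set c := corner _ _.
    have q0 : (q c)^-1 != 0 by rewrite invr_eq0 gt_eqF// q_gt0.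
    by case: ifP => _; rewrite powR0// ?addr0 ?add0r.
  have cS : cubewise (j + d) (SLam Lam d j).
    by move=> y z yz; rewrite /SLam (corner_cidx yz) (good_cube gL yz).
  rewrite hhD; [|..|by nneg|by nneg].
  - rewrite mulrDl EFinD; apply: leeD; first exact: h1.
    by apply: le_trans (h2 _ gL d j x) _; rewrite lee_fin ler_wpM2l ?(ltW C20).
  - apply: (@meas_cubewise _ _ (j + d)) => y z yz.
    by rewrite (corner_cidx yz) (JLam_cubewise gL yz).
  - by apply: (@meas_cubewise _ _ (j + d)) => y z yz; rewrite (corner_cidx yz) (cS _ _ yz).
rewrite /Hj; apply: (@le_trans _ _ ((K * V `^ (q x)^-1) `^ q x)).
  rewrite ge0_ler_powR ?(ltW (q_gt0 x))// ?nnegrE ?(ltW (ht_gt0 _ _ _ _))//.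
  by nneg.
rewrite powRM ?powR_ge0 ?(ltW K0)// -powRrM mulVf ?gt_eqF ?q_gt0// powRr1 ?(ltW V0)//.
by rewrite ler_pM2r//; apply: powRC_le (q_bound x).
Qed.

(** If [Gj <= Y ^ (1 / r)], the term [Y] suffices. Otherwise [Zj <= 2 * Gj]. For [r >= 1] the
    telescoping of [Gj] is used together with [Gj <= Zj]; for [r < 1] the powers [Zj ^ (r - 1)]
    decrease in [j], so all are at least the last one, which is comparable to that of [Gj]. *)
Lemma Zj_sum : exists2 C, 0 < C & forall Lam, good Lam -> forall d N x,
  Zj Lam d N x `^ rr x <= C * (Y_ Lam d N x + \sum_(j < N.+1) Hj Lam d j x * Zj Lam d j x `^ (rr x - 1)).
Proof.
have rM0 := rM0.
exists (2 `^ rM * (1 + rM) + 4) => [|Lam gL d N x].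
  by nneg.
have Y0 := YY_gt0 M3 d N x gL; have Z0 j := Zj_gt0 Lam d j x; have G0 := Gj_gt0 Lam d N x.
have H0 j := Hj_gt0 Lam d j x; have r0 := rr_gt0 x.
set S := \sum_(j < N.+1) _.
have S0 : 0 <= S by nneg.
have /andP[_ rM1] := rr_bound x.
have two : 2 `^ rr x <= 2 `^ rM by rewrite ler_powR// ler1n.
have p2 : 0 <= 2 `^ rM :> R by nneg.
have ph : (Y_ Lam d N x `^ (rr x)^-1) `^ rr x = Y_ Lam d N x.
  by rewrite -powRrM mulVf ?gt_eqF// powRr1// ltW.
set W := Y_ Lam d N x `^ (rr x)^-1 in ph.
have W0 : 0 <= W by exact: powR_ge0.
have [GW|/ltW WG] := leP (Gj Lam d N x) W.
  apply: (@le_trans _ _ ((2 * W) `^ rr x)).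
    rewrite ge0_ler_powR ?(ltW r0)// ?nnegrE ?(ltW (Z0 _)) ?mulr_ge0// /Zj -/W; lra.
  rewrite powRM// ph; apply: ler_pM; rewrite ?powR_ge0 ?(ltW Y0)//; last by rewrite lerDl.
  by apply: le_trans two _; rewrite mulrDr mulr1 -addrA lerDl addr_ge0// mulr_ge0// ltW.
have Z2 : Zj Lam d N x <= 2 * Gj Lam d N x by rewrite /Zj -/W; lra.
have ZG : Zj Lam d N x `^ rr x <= (2 * Gj Lam d N x) `^ rr x.
  by rewrite ge0_ler_powR ?(ltW r0)// ?nnegrE ?(ltW (Z0 _)) ?mulr_ge0// ltW.
have [r1|/ltW r1] := leP 1 (rr x).
  apply: le_trans ZG _; rewrite powRM ?(ltW G0)// mulrDl ler_wpDr ?mulr_ge0 ?addr_ge0 ?(ltW Y0)//.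
  rewrite -mulrA; apply: ler_pM; rewrite ?powR_ge0//.
  apply: le_trans; first exact: (@powR_sum_le _ (fun i => Hj Lam d i x) H0 _ N r0).
  apply: ler_pM.
  - by rewrite le_max ler01.
  - by apply: sumr_ge0 => j _; rewrite mulr_ge0 ?powR_ge0// ltW.
  - by rewrite ge_max lerDl (ltW rM0)/= (le_trans rM1)// lerDr.
  apply: (@le_trans _ _ S); last by rewrite lerDr ltW.
  apply: ler_sum => j _; rewrite ler_wpM2l ?(ltW (H0 _))//.
  rewrite ge0_ler_powR ?subr_ge0// ?nnegrE ?(ltW (Z0 _)) ?(ltW (Gj_gt0 _ _ _ _))//.
  by rewrite /Zj lerDr powR_ge0.
have ZN j : (j <= N)%N -> Zj Lam d j x <= Zj Lam d N x.
  move=> jN; rewrite /Zj lerD//; last by apply: (ler_psum (g := fun i => Hj Lam d i x)).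
  have Yj := YY_gt0 M3 d j x gL.
  by rewrite ge0_ler_powR ?invr_ge0 ?(ltW r0)// ?nnegrE ?(ltW Yj) ?(ltW Y0)// le_YY.
have r1' : rr x - 1 <= 0 by rewrite subr_le0.
have SG : Gj Lam d N x * (2 * Gj Lam d N x) `^ (rr x - 1) <= S.
  rewrite /Gj mulr_suml; apply: ler_sum => j _; rewrite ler_wpM2l ?(ltW (H0 _))//.
  rewrite -/(Gj Lam d N x) -[rr x - 1]opprK !(powRN _ (- _)).
  rewrite lef_pV2 ?posrE ?powR_gt0// ?mulr_gt0//.
  rewrite ge0_ler_powR ?oppr_ge0// ?nnegrE ?(ltW (Z0 _)) ?mulr_ge0 ?(ltW G0)//.
  by apply: le_trans Z2; apply: ZN; rewrite -ltnS.
apply: le_trans ZG _.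
have -> : (2 * Gj Lam d N x) `^ rr x = 2 * (Gj Lam d N x * (2 * Gj Lam d N x) `^ (rr x - 1)).
  by rewrite mulrA mulr_powRB1// mulr_ge0// ltW.
apply: (@le_trans _ _ (2 * S)); first by rewrite ler_pM2l.
have : 0 <= 2 `^ rM * (1 + rM) * (Y_ Lam d N x + S).
  by nneg.
rewrite mulrDl; lra.
Qed.

(** The densities on the output side: by [Zj_sum] their partial sums dominate [Zj ^ r], as those of
    [aseq] dominate [Fsum ^ r]. *)
Definition kj Lam d i x := ysum M3 Lam d i x + Hj Lam d i x * Zj Lam d i x `^ (rr x - 1).

Lemma kj_ge0 Lam d i x : good Lam -> 0 <= kj Lam d i x.
Proof. by move=> gL; rewrite addr_ge0 ?ysum_ge0// mulr_ge0 ?powR_ge0// ltW// Hj_gt0. Qed.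
Hint Extern 0 (is_true (@Order.le _ _ _ (kj _ _ _ _))) => by apply: kj_ge0 : nneg.

Lemma meas_rr1 : meas (fun x => rr x - 1).
Proof. by apply: measurable_funB; [exact: meas_rr|exact: measurable_cst]. Qed.

Lemma meas_HZ Lam d i : good Lam -> meas (fun x => Hj Lam d i x * Zj Lam d i x `^ (rr x - 1)).
Proof.
move=> gL; apply: measurable_funM; first exact: meas_Hj.
by apply: meas_fun_powR; [exact: meas_Zj|exact: meas_rr1].
Qed.

Lemma meas_kj Lam d i : good Lam -> meas (kj Lam d i).
Proof. by move=> gL; apply: measurable_funD; [exact: meas_ysum|exact: meas_HZ]. Qed.

Lemma sclV_near k j x x' : `|x - x'| <= 2 ^- j -> scl j x ^- k <= 2 ^+ k * scl j x' ^- k.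
Proof.
move=> xx'.
have h : scl j x' <= 2 * scl j x.
  apply: scl_near; rewrite distrC; apply: le_trans xx' _.
  by rewrite invf_le1 ?exprn_gt0// exprn_ege1// ler1n.
have s0 := scl_gt0 j x; have s0' := scl_gt0 j x'.
rewrite -(ler_pM2r (exprn_gt0 k s0)) mulVf ?gt_eqF ?exprn_gt0//.
rewrite mulrAC -exprMn -[leLHS](mulfV (lt0r_neq0 (exprn_gt0 k s0'))).
rewrite ler_wpM2r ?invr_ge0 ?exprn_ge0 ?(ltW s0')//.
by rewrite lerXn2r ?nnegrE ?mulr_ge0 ?(ltW s0) ?(ltW s0').
Qed.

(* [t x ^ e x] is essentially constant at scale [2^-j] when [t] is tame and
   essentially constant at that scale and [e] is slow. *)
Lemma powR_loc (A b : R) (e : 'rV[R]_n -> R) (C c : R) : slow e -> 0 <= A -> 0 <= C -> 1 <= c ->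
  (forall x, `|e x| <= b) ->
  exists2 D, 1 <= D & forall j x x' t t', `|x - x'| <= 2 ^- j ->
    tame A C j x t -> tame A C j x' t' -> t <= c * t' -> t' <= c * t -> t `^ e x <= D * t' `^ e x'.
Proof.
move=> se k0 k0' c1 eb; have [B /(_ C k0')[D D0 H]] := slow_exp_change se k0.
exists (1 + c `^ b * (D * 2 ^+ B)) => [|j x x' t t' xx' tt tt' h1 h2].
  by rewrite lerDl !mulr_ge0 ?powR_ge0 ?exprn_ge0 ?(ltW D0).
have t0 : 0 < t by case: tt.
have t0' : 0 < t' by case: tt'.
have h3 := powR_near t0 t0' c1 (eb x) h1 h2.
have xx0 : `|x - x| <= 2 ^- j by rewrite subrr normr0 invr_ge0 exprn_ge0.
have [_ h4] := H j x' x x t' xx0 tt'.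
apply: (le_trans h3); rewrite mulrDl mul1r; apply: ler_wpDl; first exact: powR_ge0.
rewrite -mulrA ler_wpM2l ?powR_ge0//; apply: (le_trans h4).
rewrite ler_wpM2r ?powR_ge0// ler_wpM2l ?(ltW D0)// lerXn2r ?nnegrE ?om_ge0//.
by apply: om_near; rewrite distrC.
Qed.

Lemma lerDM (k k' u u' v v' : R) : 0 <= k -> 0 <= k' -> 0 <= v -> 0 <= v' ->
  u <= k * v -> u' <= k' * v' -> u + u' <= (k + k') * (v + v').
Proof.
move=> k0 k0' v0 v0' h h'; apply: (le_trans (lerD h h')).
by rewrite mulrDl lerD// mulrDr ?lerDl ?lerDr mulr_ge0.
Qed.

(** This makes [Av_fine_le] applicable to [kj], which unlike [aseq] is not constant on cubes but
    only comparable on them. *)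
Lemma kj_loc : exists2 C, 0 <= C & forall Lam, good Lam -> forall d i x x',
  `|x - x'| <= 2 ^- i -> kj Lam d i x <= C * kj Lam d i x'.
Proof.
have [Ct Ct0 Ht] := ht_tame; have [CY CY0 HY] := YY_tame M3; have [CZ CZ0 HZ] := Zj_tame.
pose c1 : R := 2 ^+ M1 + 2 ^+ A3.
have c11 : 1 <= c1 by rewrite ler_wpDr ?exprn_ge0// exprn_ege1// ler1n.
have At : 0 <= A3%:R + AY / pm by rewrite addr_ge0// mulr_ge0 ?AY_ge0// invr_ge0 ltW.
have [D1 D11 H1] := powR_loc sq At Ct0 c11 q_bound.
have c21 : 1 <= 2 ^+ M3 :> R by rewrite exprn_ege1// ler1n.
have sri : slow (fun x => (rr x)^-1).
  by apply: slowV rm_gt0 _ slow_rr => x; case/andP: (rr_bound x).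
have [D2 D21 H2] := powR_loc sri AY_ge0 CY0 c21 invr_bound.
have sr1 : slow (fun x => rr x - 1) by apply: slowD; [exact: slow_rr|exact: slow_cst].
have rb x : `|rr x - 1| <= rM + 1.
  apply: le_trans (ler_normB _ _) _; rewrite normr1 lerD2r gtr0_norm ?rr_gt0//.
  by case/andP: (rr_bound x).
have D121 : 1 <= D1 + D2 by rewrite ler_wpDr// (le_trans ler01).
have [D3 D31 H3] := powR_loc sr1 AZ_ge0 CZ0 D121 rb.
exists (2 ^+ M3 + D1 * D3) => [|Lam gL d i x x' xx'].
  by rewrite addr_ge0 ?exprn_ge0// mulr_ge0// (le_trans ler01).
have sub l : (l <= i)%N -> `|x - x'| <= 2 ^- l.
  move=> li; apply: le_trans xx' _.
  by rewrite lef_pV2 ?posrE ?exprn_gt0// ler_weXn2l// ler1n.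
have sub' l : (l <= i)%N -> `|x' - x| <= 2 ^- l by move=> /sub; rewrite distrC.
have hy l y y' : `|y - y'| <= 2 ^- l -> ysum M3 Lam d l y <= 2 ^+ M3 * ysum M3 Lam d l y'.
  move=> yy'; rewrite -lee_fin EFinM !ysumE//; apply: Av_loc => //.
    exact: meas_window.
  by move=> z; exact: aseq_window_ge0.
have hh' l y y' : `|y - y'| <= 2 ^- l -> ht Lam d l y <= c1 * ht Lam d l y'.
  move=> yy'; rewrite /ht /c1.
  have a1 : h_ Lam d l y <= 2 ^+ M1 * h_ Lam d l y'.
    rewrite -lee_fin EFinM !hrealE//; apply: hh_loc => //; first exact: meas_qcorner.
    by nneg.
  have a2 := sclV_near A3 yy'.
  have b1 := hreal_ge0 Lam d l y'.
  have b2 : 0 <= scl l y' ^- A3 by nneg.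
  by apply: lerDM; rewrite ?exprn_ge0.
have hH l y y' : `|y - y'| <= 2 ^- l -> Hj Lam d l y <= D1 * Hj Lam d l y'.
  move=> yy'; have y'y : `|y' - y| <= 2 ^- l by rewrite distrC.
  exact: H1 yy' (Ht _ gL d l y) (Ht _ gL d l y') (hh' _ _ _ yy') (hh' _ _ _ y'y).
have hYY y y' : `|y - y'| <= 2 ^- i -> Y_ Lam d i y <= 2 ^+ M3 * Y_ Lam d i y'.
  move=> yy'; rewrite /YY mulr_sumr; apply: ler_sum => l _; apply: hy.
  apply: le_trans yy' _; rewrite lef_pV2 ?posrE ?exprn_gt0// ler_weXn2l ?ler1n//.
  by rewrite -ltnS.
have hZ y y' : `|y - y'| <= 2 ^- i -> Zj Lam d i y <= (D1 + D2) * Zj Lam d i y'.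
  move=> yy'; have y'y : `|y' - y| <= 2 ^- i by rewrite distrC.
  have a1 : Y_ Lam d i y `^ (rr y)^-1 <= D2 * Y_ Lam d i y' `^ (rr y')^-1.
    exact: H2 yy' (HY _ gL d i y) (HY _ gL d i y') (hYY _ _ yy') (hYY _ _ y'y).
  have a2 : Gj Lam d i y <= D1 * Gj Lam d i y'.
    rewrite /Gj mulr_sumr; apply: ler_sum => l _; apply: hH.
    apply: le_trans yy' _; rewrite lef_pV2 ?posrE ?exprn_gt0// ler_weXn2l ?ler1n//.
    by rewrite -ltnS.
  have G0 := ltW (Gj_gt0 Lam d i y').
  by rewrite /Zj [D1 + D2]addrC; apply: lerDM; rewrite ?powR_ge0// (le_trans ler01).
have x'x : `|x' - x| <= 2 ^- i by rewrite distrC.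
have e1 := hy i x x' xx'.
have e2 : Hj Lam d i x * Zj Lam d i x `^ (rr x - 1) <=
   (D1 * D3) * (Hj Lam d i x' * Zj Lam d i x' `^ (rr x' - 1)).
  rewrite mulrACA; apply: ler_pM; rewrite ?powR_ge0 ?(ltW (Hj_gt0 _ _ _ _))//.
    exact: hH.
  exact: H3 xx' (HZ _ gL d i x) (HZ _ gL d i x') (hZ _ _ xx') (hZ _ _ x'x).
apply: lerDM => //.
- by rewrite mulr_ge0// (le_trans ler01).
- exact: ysum_ge0.
- by nneg.
Qed.

Lemma kj_sum Lam d N x : good Lam ->
  \sum_(i < N.+1) kj Lam d i x =
  Y_ Lam d N x + \sum_(i < N.+1) Hj Lam d i x * Zj Lam d i x `^ (rr x - 1).
Proof. by move=> gL; rewrite /kj big_split. Qed.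

Lemma Av_kj : exists2 C, 0 <= C & forall Lam, good Lam -> forall d i j x, (i <= j)%N ->
  (Av j (4 * n) (kj Lam d i) x <= C%:E * Av i (2 * n) (kj Lam d i) x)%E.
Proof.
have [C C1 H] := kj_loc; exists (C * 2 ^+ (4 * n + n)) => [|Lam gL d i j x ij].
  by nneg.
have n4 : (2 * n <= 4 * n)%N by rewrite leq_mul2r orbT.
have -> : (2 * n = 4 * n - 2 * n)%N by lia.
apply: Av_fine_le => //.
- exact: meas_kj.
- by nneg.
- by move=> y z yz; apply: H => //; exact: cidx_dist.
Qed.

Lemma Zj_HZ Lam d j x : Hj Lam d j x * Zj Lam d j x `^ (rr x - 1) <= Zj Lam d j x `^ rr x.
Proof.
have Z0 := Zj_gt0 Lam d j x; rewrite -(mulr_powRB1 (ltW Z0) (rr_gt0 x)).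
rewrite ler_wpM2r ?powR_ge0// /Zj; apply: ler_wpDl; first exact: powR_ge0.
rewrite /Gj big_ord_recr/= lerDr; apply: sumr_ge0 => i _; exact/ltW/Hj_gt0.
Qed.

Lemma powR_sum_crude (r : R) N (g : nat -> R) : 0 < r -> (forall i, 0 <= g i) ->
  (\sum_(i < N.+1) g i) `^ r <= N.+1%:R `^ r * \sum_(i < N.+1) g i `^ r.
Proof.
move=> r0 g0.
have [k _ hk] : exists2 k : 'I_N.+1, true & forall i : 'I_N.+1, g i <= g k.
  by case: (@Order.TotalTheory.arg_maxP _ _ _ (ord0 : 'I_N.+1) predT (fun i : 'I_N.+1 => g i) isT) => k _ hk;
    exists k => // i; exact: hk.
apply: (@le_trans _ _ ((N.+1%:R * g k) `^ r)).
  rewrite ge0_ler_powR ?(ltW r0)// ?nnegrE ?mulr_ge0//; first by nneg.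
  have -> : N.+1%:R * g k = \sum_(i < N.+1) g k by rewrite sumr_const card_ord mulr_natl.
  by apply: ler_sum => i _.
rewrite powRM// ler_wpM2l ?powR_ge0// (bigD1 k)//= lerDl.
by nneg.
Qed.

(** [Hj ^ r] is the p-th power of [ht], so [hreal_le] gives [Y], and the choice of [A3] an
    integrable floor. *)
Lemma Hj_powr : exists2 C, 0 <= C & forall Lam, good Lam -> forall d j x,
  Hj Lam d j x `^ rr x <= C * (Y_ Lam d j x + scl j x ^- (2 * n).+1).
Proof.
have [C C1 H] := hreal_le.
exists (2 `^ P * (1 + C + C^-1) `^ P + 2 `^ P) => [|Lam gL d j x].
  by nneg.
have p0 := p_gt0 x; have q0 := q_gt0 x; have Y0 := YY_gt0 M3 d j x gL.
have /andP[pm1 pP] := hp x.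
have s0 := scl_gt0 j x; have s1 : 1 <= scl j x by apply: le_trans (scl_ge2 _ _); rewrite ler1n.
have b0 : 0 <= scl j x ^- A3 by nneg.
have -> : Hj Lam d j x `^ rr x = ht Lam d j x `^ p x.
  by rewrite /Hj -powRrM /rr mulrCA divff ?mulr1// gt_eqF.
set u := C * Y_ Lam d j x `^ (p x)^-1.
have u0 : 0 <= u by nneg.
have hu : ht Lam d j x <= u + scl j x ^- A3 by rewrite lerD2r H.
have m2 : u + scl j x ^- A3 <= 2 * Num.max u (scl j x ^- A3).
  rewrite mulr_natl mulr2n lerD// le_max lexx ?orbT//.
have up : u `^ p x <= (1 + C + C^-1) `^ P * Y_ Lam d j x.
  rewrite /u powRM ?powR_ge0 ?(ltW C1)// -powRrM mulVf ?gt_eqF// powRr1 ?(ltW Y0)//.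
  by rewrite ler_wpM2r ?(ltW Y0)//; apply: powRC_le; rewrite ?gtr0_norm.
have sp' : (scl j x ^- A3) `^ p x <= scl j x ^- (2 * n).+1.
  rewrite -!powR_invn ?(ltW s0)// -powRrM; apply: ler_powR => //.
  rewrite mulNr lerN2; have [_ h] := A3_ge; apply: le_trans h _.
  by rewrite ler_wpM2l.
have two : 2 `^ p x <= 2 `^ P by rewrite ler_powR// ler1n.
apply: (@le_trans _ _ ((2 * Num.max u (scl j x ^- A3)) `^ p x)).
  by rewrite ge0_ler_powR ?(ltW p0)// ?nnegrE ?(ltW (ht_gt0 _ _ _ _))
    ?(le_trans hu m2)// mulr_ge0// le_max u0.
rewrite powRM// ?le_max ?u0//.
have P20 : 0 <= 2 `^ P :> R by nneg.
have S0 : 0 <= scl j x ^- (2 * n).+1 by nneg.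
have K0 : 0 <= (1 + C + C^-1) `^ P * Y_ Lam d j x by nneg.
apply: (@le_trans _ _ (2 `^ P * ((1 + C + C^-1) `^ P * Y_ Lam d j x + scl j x ^- (2 * n).+1))).
  apply: ler_pM; rewrite ?powR_ge0//; have [_|_] := leP u (scl j x ^- A3).
    by rewrite ler_wpDl.
  by rewrite ler_wpDr.
rewrite mulrDr mulrDl [X in _ <= X + _]mulrDr -!mulrA lerD//.
  by rewrite lerDl !mulr_ge0 ?powR_ge0.
by rewrite mulrDr lerDr mulr_ge0// ltW.
Qed.

(** * Integration, Young's inequality and absorption *)

Lemma YYint : exists2 C, 0 < C & forall Lam, good Lam ->
  forall d N, (\int[mu]_x (Y_ Lam d N x)%:E <= (C * d.+1%:R)%:E)%E.
Proof. by apply: ysum_total; rewrite /M3 /M2; lia. Qed.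

(** The bound obtained depends on [j], through a crude estimate of the power of a sum; finiteness is
    all that the absorption in [HZ_total] asks for. *)
Lemma HZ_fin Lam d j : good Lam ->
  (\int[mu]_x (Hj Lam d j x * Zj Lam d j x `^ (rr x - 1))%:E < +oo)%E.
Proof.
have [C C1 H] := Hj_powr; have [CY CY0 HYi] := YYint.
move=> gL; have rM0 := rM0.
pose K : R := 2 `^ rM * (1 + j.+1%:R `^ rM * (j.+1%:R * C)).
have K0 : 0 <= K by nneg.
have pw x : Hj Lam d j x * Zj Lam d j x `^ (rr x - 1) <=
    K * (Y_ Lam d j x + \sum_(i < j.+1) scl i x ^- (2 * n).+1).
  apply: le_trans (Zj_HZ _ _ _ _) _.
  have Y0 := YY_gt0 M3 d j x gL; have r0 := rr_gt0 x; have /andP[_ rx] := rr_bound x.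
  have two : 2 `^ rr x <= 2 `^ rM by rewrite ler_powR// ler1n.
  set W := Y_ Lam d j x `^ (rr x)^-1; set G := Gj Lam d j x.
  have W0 : 0 <= W by nneg.
  have G0 : 0 <= G by nneg.
  have S0 i : 0 <= scl i x ^- (2 * n).+1 by nneg.
  have WE : W `^ rr x = Y_ Lam d j x by rewrite -powRrM mulVf ?gt_eqF// powRr1// ltW.
  have GE : G `^ rr x <= j.+1%:R `^ rM * (j.+1%:R * C) * (Y_ Lam d j x + \sum_(i < j.+1) scl i x ^- (2 * n).+1).
    apply: le_trans; first by apply: (powR_sum_crude j r0 (fun i => ltW (Hj_gt0 Lam d i x))).
    rewrite -mulrA; apply: ler_pM; rewrite ?powR_ge0//.
    - by nneg.
    - by rewrite ler_powR// ler1n.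
    rewrite -mulrA; set V := _ + _; have -> : j.+1%:R * (C * V) = \sum_(i < j.+1) C * V.
      by rewrite sumr_const card_ord mulr_natl.
    apply: ler_sum => i _.
    apply: le_trans (H _ gL d i x) _; rewrite ler_wpM2l// lerD//.
      by apply: le_YY => //; rewrite -ltnS.
    by rewrite (bigD1 i)//= lerDl; apply: sumr_ge0.
  have SS : 0 <= \sum_(i < j.+1) scl i x ^- (2 * n).+1 by nneg.
  apply: (@le_trans _ _ ((2 * Num.max W G) `^ rr x)).
    rewrite ge0_ler_powR ?(ltW r0)// ?nnegrE ?(ltW (Zj_gt0 _ _ _ _)) ?mulr_ge0 ?le_max ?W0//.
    by rewrite mulr_natl mulr2n lerD// le_max lexx ?orbT.
  rewrite powRM ?le_max ?W0// /K -mulrA; apply: ler_pM; rewrite ?powR_ge0//.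
  rewrite mulrDl mul1r; have [_|_] := leP W G; first by rewrite ler_wpDl// addr_ge0// ltW.
  by rewrite WE ler_wpDr ?ler_wpDr// !mulr_ge0 ?powR_ge0 ?addr_ge0// ltW.
have sm : meas (fun x => \sum_(i < j.+1) scl i x ^- (2 * n).+1).
  apply: measurable_sum => i; apply: meas_funV; apply: measurable_funX; apply: measurable_funM.
    exact: measurable_cst.
  by apply: measurable_funD; [exact: measurable_cst|exact: meas_rV_norm].
have ss x : 0 <= \sum_(i < j.+1) scl i x ^- (2 * n).+1.
  by nneg.
apply: (@le_lt_trans _ _ (\int[mu]_x (K%:E * (Y_ Lam d j x + \sum_(i < j.+1) scl i x ^- (2 * n).+1)%:E))%E).
  apply: ge0_le_integral => //.
  - by nneg.
  - by apply/measurable_EFinP; exact: meas_HZ.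
  - apply/measurable_EFinP; apply: measurable_funM; first exact: measurable_cst.
    by apply: measurable_funD => //; exact: meas_YY.
  - by move=> x _; rewrite -EFinM lee_fin.
rewrite ge0_integralZl_EFin//; last 2 first.
- by nneg.
- by apply/measurable_EFinP; apply: measurable_funD => //; exact: meas_YY.
apply: (@le_lt_trans _ _ (K%:E * ((CY * d.+1%:R) + 2 ^+ n)%:E)%E); last by rewrite -EFinM ltry.
rewrite lee_wpmul2l ?lee_fin//; under eq_integral do rewrite EFinD.
rewrite ge0_integralD//; last 4 first.
- by nneg.
- by apply/measurable_EFinP; exact: meas_YY.
- by move=> x _; rewrite lee_fin.
- exact/measurable_EFinP.
by rewrite EFinD; apply: leeD; [exact: HYi|exact: integral_sclV_le].
Qed.

(** Young's inequality with constants uniform for exponents between 1 and [K], by comparison of [u]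
    with [e * v]. *)
Lemma young_powR (u v e a K : R) : 0 < u -> 0 < v -> 0 < e -> e <= 1 -> 1 <= a -> a <= K ->
  u * v `^ (a - 1) <= e `^ (- K) * u `^ a + e * v `^ a.
Proof.
move=> u0 v0 e0 e1 a1 aK; have a0 : 0 < a by lra.
have k0 : 0 <= e `^ (- K) * u `^ a by nneg.
have k1 : 0 <= e * v `^ a by nneg.
have [uv|uv] := leP u (e * v).
  apply: ler_wpDl => //; rewrite -(mulr_powRB1 (ltW v0) a0) mulrA.
  by rewrite ler_wpM2r ?powR_ge0.
apply: ler_wpDr => //.
have vu : v <= e^-1 * u by rewrite ler_pdivlMl// ltW.
apply: (@le_trans _ _ (u * (e^-1 * u) `^ (a - 1))).
  rewrite ler_wpM2l ?(ltW u0)// ge0_ler_powR ?subr_ge0// ?nnegrE ?(ltW v0)//.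
  by nneg.
rewrite powRM ?invr_ge0 ?(ltW e0) ?(ltW u0)// mulrCA mulr_powRB1 ?(ltW u0)//.
rewrite ler_wpM2r ?powR_ge0// -powR_inv1 ?(ltW e0)// -powRrM.
rewrite !powR_expR// ler_expR; have l0 : ln e <= 0 by rewrite ln_le0.
by rewrite ler_wnM2r//; lra.
Qed.

(** The case in which [r] crosses 1 between [y] and its corner. If [Z <= F], the exponent of [Z] is
    moved to the corner, where the power is increasing. Otherwise it is moved to [y], where the
    exponent is negative, and [Z] is lowered to the minimum of [F] and 1: this one is tame at scale
    [j], while [F], which lives at level [j + d], need not be. *)
Lemma exp_change_JZ : exists2 C, 0 < C & forall Lam, good Lam -> forall d j x y,
  1 <= rr (corner (j + d) y) -> rr y < 1 ->
  Lam (j + d)%N y * Zj Lam d j x `^ (rr x - 1) <= C * om j x y ^+ (2 * BB) * a_ Lam (j + d) y.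
Proof.
have [CZ CZ0 HZ] := Zj_tame; have [AFm _ _ AZm _] := Amax_ge.
have [_ _ _ Br _] := BB_change; have [D D0 HD] := Br CZ CZ0; have [E E0 HE] := Br C0 C00.
exists (D * (1 + E)) => [|Lam gL d j x y rc1 ry1]; first by nneg.
set c := corner (j + d) y in rc1 *.
have L0 := good_gt0 gL (j + d) y; have F0 := Fsum_gt0 gL (j + d) y.
have Z0 := Zj_gt0 Lam d j x; have tZ := tame_le AZm (lexx CZ) (HZ _ gL d j x).
set Z := Zj _ _ _ _ in Z0 tZ *; set F := Fsum Lam (j + d) y in F0.
have cy := corner_near y (leq_addr d j); rewrite -/c in cy.
have o1 : 1 <= om j x y ^+ BB by rewrite exprn_ege1// om_ge1.
have o2 : om j x y ^+ BB <= om j x y ^+ (2 * BB).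
  by rewrite ler_weXn2l ?om_ge1// leq_pmull.
rewrite /aseq -/c -/F [_ * (_ * _)]mulrCA ler_pM2l//.
suff h : Z `^ (rr x - 1) <= D * (1 + E) * om j x y ^+ BB * F `^ (rr c - 1).
  apply: le_trans h _; rewrite ler_wpM2r ?powR_ge0// ler_wpM2l// mulr_ge0 ?(ltW D0)//.
  by nneg.
have DE : D <= D * (1 + E) by rewrite ler_peMr ?(ltW D0)// lerDl ltW.
have F1 := powR_ge0 F (rr c - 1).
have [ZF|/ltW FZ] := leP Z F.
  have [h _] := HD j x y c _ cy tZ; apply: le_trans h _.
  apply: ler_pM; rewrite ?powR_ge0 ?mulr_ge0 ?(ltW D0) ?(le_trans ler01 o1)//.
    by rewrite ler_wpM2r// (le_trans ler01 o1).
  by rewrite ge0_ler_powR ?subr_ge0// ?nnegrE ltW.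
have yy : `|y - y| <= 2 ^- j by rewrite subrr normr0 invr_ge0 exprn_ge0.
have [h _] := HD j x y y _ yy tZ; apply: le_trans h _.
pose t := Num.min F 1; have t0 : 0 < t by rewrite lt_min F0 ltr01.
have tt : tame Amax C0 j y t.
  split=> //; have t1 : t <= 1 by rewrite ge_min lexx orbT.
  rewrite ler0_norm ?ln_le0//.
  have s0 := ln_scl_ge0 j y.
  have A1 : 0 <= Amax by have [_ _ _ _] := Amax_ge.
  have [FF|FF] := leP F 1; last first.
    by rewrite /t (min_idPr (ltW FF)) ln1 oppr0 addr_ge0// mulr_ge0.
  rewrite /t (min_idPl FF).
  have : ln (Lam 0 y) <= ln F.
    rewrite ler_ln ?posrE//; last exact: (good_gt0 gL).
    apply: le_trans (le_Fsum gL y (leq0n (j + d))).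
    by rewrite /Fsum big_ord1.
  have := good_low gL y.
  have : A0 * ln (scl 0 y) <= Amax * ln (scl j y).
    apply: ler_pM; rewrite ?ln_scl_ge0//.
      by apply: le_trans AFm; rewrite /AF lerDl divr_ge0// ltW// rm_gt0.
    by rewrite ler_ln ?posrE ?scl_gt0// /scl ler_wpM2r ?addr_ge0// ler_weXn2l// ler1n.
  move=> h1 h2 h3; apply: (@le_trans _ _ (- ln (Lam 0%N y))); first by rewrite lerN2.
  by apply: (le_trans h2); rewrite lerD2r.
have [h2 _] := HE j y y c _ cy tt.
have oyy : om j y y = 1 by rewrite /om subrr normr0 mulr0 addr0.
rewrite oyy expr1n mulr1 in h2.
have h1 : Z `^ (rr y - 1) <= t `^ (rr y - 1).
  rewrite !powR_expR// ler_expR ler_wnM2l ?subr_le0 ?(ltW ry1)//.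
  by rewrite ler_ln ?posrE// ge_min FZ.
have h3 : t `^ (rr c - 1) <= F `^ (rr c - 1).
  by rewrite ge0_ler_powR ?subr_ge0// ?nnegrE ?(ltW t0) ?(ltW F0)// ge_min lexx.
have h4 : Z `^ (rr y - 1) <= E * F `^ (rr c - 1).
  by apply: le_trans h1 _; apply: le_trans h2 _; rewrite ler_wpM2l ?(ltW E0).
apply: (@le_trans _ _ (D * om j x y ^+ BB * (E * F `^ (rr c - 1)))).
  by rewrite ler_wpM2l// mulr_ge0 ?(ltW D0) ?(le_trans ler01 o1).
rewrite mulrA ler_wpM2r// mulrAC ler_wpM2r ?(le_trans ler01 o1)//.
by rewrite ler_wpM2l ?(ltW D0)// lerDr.
Qed.

(** [Lam] is written as [(Lam / F) * F] with [F] the partial sum of the last level, and Young's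
    inequality is applied to [F * Z ^ (r - 1)] with the exponent at [y]. The powers of [Z] are
    carried from [x] to [y] and back, hence [2 * BB]. *)
Lemma young_JZ : exists2 C, 0 < C & forall Lam, good Lam -> forall d N j x y e,
  0 < e -> e <= 1 -> 1 <= rr y ->
  Lam (j + d)%N y * Zj Lam d j x `^ (rr x - 1) <= C * om j x y ^+ (2 * BB) *
    (Lam (j + d)%N y / Fsum Lam (N + d) y *
     (e `^ (- rM) * Fsum Lam (N + d) y `^ rr y + e * Zj Lam d j x `^ rr x)).
Proof.
have [CZ CZ0 HZ] := Zj_tame; have [_ _ _ AZm _] := Amax_ge.
have [_ _ _ Br1 Br] := BB_change; have [D D0 HD] := Br1 CZ CZ0; have [E E0 HE] := Br CZ CZ0.
exists (D * (1 + E)) => [|Lam gL d N j x y e e0 e1 ry1]; first by nneg.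
have L0 := good_gt0 gL (j + d) y; have F0 := Fsum_gt0 gL (N + d) y.
have Z0 := Zj_gt0 Lam d j x; have tZ := tame_le AZm (lexx CZ) (HZ _ gL d j x).
set Z := Zj _ _ _ _ in Z0 tZ *; set F := Fsum Lam _ y in F0 *; set L := Lam _ y in L0 *.
have yy : `|y - y| <= 2 ^- j by rewrite subrr normr0 invr_ge0 exprn_ge0.
have [h1 _] := HD j x y y _ yy tZ; have [_ h2] := HE j x y y _ yy tZ.
have o1 : 1 <= om j x y ^+ BB by rewrite exprn_ege1// om_ge1.
have -> : om j x y ^+ (2 * BB) = om j x y ^+ BB * om j x y ^+ BB by rewrite mul2n -addnn exprD.
move: (om j x y ^+ BB) o1 h1 h2 => o o1 h1 h2; have o0 : 0 <= o by apply: le_trans o1.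
have /andP[_ rM1] := rr_bound y.
have h3 := young_powR F0 Z0 e0 e1 ry1 rM1.
set W := e `^ (- rM) * F `^ rr y in h3 *.
have W0 : 0 <= W by rewrite mulr_ge0 ?powR_ge0.
have h4 : W + e * Z `^ rr y <= (1 + E) * o * (W + e * Z `^ rr x).
  have EO : 1 <= (1 + E) * o by rewrite -[leLHS]mulr1 ler_pM// lerDl ltW.
  rewrite mulrDr lerD//; first by rewrite ler_peMl.
  rewrite mulrCA ler_wpM2l ?(ltW e0)//; apply: le_trans h2 _.
  by rewrite ler_wpM2r ?powR_ge0// ler_wpM2r// lerDr.
have LF : L = L / F * F by rewrite divfK// gt_eqF.
rewrite {1}LF -mulrA (_ : D * _ * _ * _ = L / F * (D * o * ((1 + E) * o * (W + e * Z `^ rr x)))); last by ring.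
rewrite ler_wpM2l ?divr_ge0 ?(ltW L0) ?(ltW F0)//.
apply: (@le_trans _ _ (D * o * (F * Z `^ (rr y - 1)))).
  by rewrite mulrCA ler_wpM2l// ltW.
by rewrite ler_wpM2l ?mulr_ge0 ?(ltW D0)//; apply: le_trans h3 h4.
Qed.

Lemma JZ_bound : exists2 C, 0 < C & forall Lam, good Lam -> forall d N j x y e, (j <= N)%N ->
  0 < e -> e <= 1 ->
  JLam Lam d j y * Zj Lam d j x `^ (rr x - 1) <= C * om j x y ^+ (2 * BB) *
    (a_ Lam (j + d) y + Lam (j + d)%N y / Fsum Lam (N + d) y *
     (e `^ (- rM) * Fsum Lam (N + d) y `^ rr y + e * Zj Lam d j x `^ rr x)).
Proof.
have [C1 C10 H1] := exp_change_JZ; have [C2 C20 H2] := young_JZ.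
exists (C1 + C2) => [|Lam gL d N j x y e jN e0 e1]; first exact: addr_gt0.
have L0 := good_gt0 gL (j + d) y; have F0 := Fsum_gt0 gL (N + d) y.
have a0 := aseq_ge0 gL (j + d) y.
set V := Lam _ _ / _ * _.
have V0 : 0 <= V.
  by nneg.
have o0 : 0 <= om j x y ^+ (2 * BB) by nneg.
rewrite /JLam; case: ifP => rc; last first.
  by rewrite mul0r !mulr_ge0 ?addr_ge0 ?(ltW C10) ?(ltW C20).
rewrite [X in _ <= X]mulrAC.
have [ry|ry] := leP 1 (rr y).
  apply: (@le_trans _ _ (C2 * om j x y ^+ (2 * BB) * V)); first exact: H2.
  rewrite [C2 * _ * V]mulrAC; apply: ler_wpM2r => //.
  by apply: ler_pM; rewrite ?(ltW C20)// ?lerDr// ltW.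
apply: (@le_trans _ _ (C1 * om j x y ^+ (2 * BB) * a_ Lam (j + d) y)); first exact: H1.
rewrite [C1 * _ * _]mulrAC; apply: ler_wpM2r => //.
by apply: ler_pM; rewrite ?(ltW C10)// ?lerDl// ltW.
Qed.

Lemma meas_Zr Lam d j : good Lam -> meas (fun x => Zj Lam d j x `^ rr x).
Proof. by move=> gL; apply: meas_fun_powR; [exact: meas_Zj|exact: meas_rr]. Qed.

Lemma meas_Zr1 Lam d j : good Lam -> meas (fun x => Zj Lam d j x `^ (rr x - 1)).
Proof. by move=> gL; apply: meas_fun_powR; [exact: meas_Zj|exact: meas_rr1]. Qed.

Definition VN Lam d N y := (\sum_(i < N.+1) Av i (2 * n) (kj Lam d i) y)%E.

Lemma VN_ge0 Lam d N y : good Lam -> (0 <= VN Lam d N y)%E.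
Proof. by move=> gL; apply: sume_ge0 => i _; apply: Av_ge0 => z; exact: kj_ge0. Qed.

Lemma meas_VN Lam d N : good Lam -> meas (VN Lam d N).
Proof.
move=> gL; apply: emeasurable_sum => i; apply: meas_Av; first exact: meas_kj.
by nneg.
Qed.

(** [Zj ^ r] is dominated by the densities [kj] of levels up to [j], each averaged no worse at its
    own scale. The resulting bound is the same for all [j <= N], as the summation in [JZ_total]
    requires. *)
Lemma AvZ_le : exists2 C, 0 <= C & forall Lam, good Lam -> forall d N j y, (j <= N)%N ->
  (Av j (4 * n) (fun x => Zj Lam d j x `^ rr x)%R y <= C%:E * VN Lam d N y)%E.
Proof.
have [C1 C10 H1] := Zj_sum; have [C2 C20 H2] := Av_kj.
exists (C1 * C2) => [|Lam gL d N j y jN]; first by nneg.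
have msum k : meas (fun x => \sum_(i < k) kj Lam d i x).
  by apply: measurable_sum => i; exact: meas_kj.
have sum0 k x : 0 <= \sum_(i < k) kj Lam d i x by nneg.
apply: (@le_trans _ _ (Av j (4 * n) (fun x => C1 * \sum_(i < j.+1) kj Lam d i x)%R y)).
  apply: le_Av.
  - exact: meas_Zr.
  - by apply: measurable_funM => //; exact: measurable_cst.
  - by nneg.
  - by move=> x; rewrite kj_sum//; exact: H1.
rewrite AvZ ?(ltW C10)// EFinM -muleA lee_wpmul2l ?lee_fin ?(ltW C10)//.
apply: (@le_trans _ _ (C2%:E * VN Lam d j y)%E); last first.
  rewrite lee_wpmul2l ?lee_fin//; rewrite /VN -(subnKC jN) -addSn big_split_ord/= leeDl//.
  by nneg.
have H k : (k <= j.+1)%N -> (Av j (4 * n) (fun x => \sum_(i < k) kj Lam d i x)%R y <=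
    C2%:E * \sum_(i < k) Av i (2 * n) (kj Lam d i) y)%E.
  elim: k => [|k IH] kj'.
    rewrite big_ord0 mule0 (_ : Av _ _ _ _ = 0%E)//.
    by apply: integral0_eq => x _; rewrite big_ord0 mulr0.
  rewrite (_ : (fun x => _) = fun x => \sum_(i < k) kj Lam d i x + kj Lam d k x); last first.
    by apply/funext => x; rewrite big_ord_recr.
  rewrite AvD//; last 2 first.
  - exact: meas_kj.
  - by nneg.
  rewrite big_ord_recr/= ge0_muleDr; last 2 first.
  - by nneg.
  - by nneg.
  by apply: leeD; [apply: IH; exact: ltnW|exact: H2].
exact: H.
Qed.

Lemma JAv_bound : exists2 C, 0 < C & forall Lam, good Lam -> forall d N j y e, (j <= N)%N ->
  0 < e -> e <= 1 ->
  ((JLam Lam d j y)%:E * Av j M2 (fun x => Zj Lam d j x `^ (rr x - 1))%R y <=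
   (C * (a_ Lam (j + d) y + Lam (j + d)%N y / Fsum Lam (N + d) y *
      (e `^ (- rM) * Fsum Lam (N + d) y `^ rr y)))%:E +
   (C * (Lam (j + d)%N y / Fsum Lam (N + d) y * e))%:E * VN Lam d N y)%E.
Proof.
have [C1 C10 H1] := JZ_bound; have [C2 C20 H2] := AvZ_le.
exists (C1 * (2 ^+ n + C2)) => [|Lam gL d N j y e jN e0 e1].
  by nneg.
have L0 := good_gt0 gL (j + d) y; have F0 := Fsum_gt0 gL (N + d) y.
have a0 := aseq_ge0 gL (j + d) y; have J0 := JLam_ge0 d j y gL.
set al := (X in (C1 * _ * X)%:E); pose be := Lam (j + d)%N y / Fsum Lam (N + d) y * e; rewrite -/be.
have al0 : 0 <= al.
  by nneg.
have be0 : 0 <= be by nneg.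
have mZ := meas_Zr d j gL.
have mR : meas (fun x => al + be * Zj Lam d j x `^ rr x).
  apply: measurable_funD; first exact: measurable_cst.
  by apply: measurable_funM => //; exact: measurable_cst.
have R0 x : 0 <= al + be * Zj Lam d j x `^ rr x by nneg.
rewrite -AvZ//; last 2 first.
- exact: meas_Zr1.
- by nneg.
apply: (@le_trans _ _ (C1%:E * Av j (4 * n) (fun x => al + be * Zj Lam d j x `^ rr x)%R y)%E).
  rewrite -AvZ// ?(ltW C10)//; apply: ge0_le_integral => //.
  - by nneg.
  - apply: meas_ker_mul; apply: measurable_funM; first exact: measurable_cst.
    exact: meas_Zr1.
  - by apply: meas_ker_mul; apply: measurable_funM => //; exact: measurable_cst.
  move=> x _; rewrite lee_fin.
  have o0 : 0 < om j y x ^+ (2 * BB) by nneg.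
  have -> : ker j (4 * n) y x = ker j M2 y x * om j y x ^+ (2 * BB).
    by rewrite /ker -mulrA /M2 exprD invfM mulrAC mulVf ?mul1r// gt_eqF.
  rewrite -mulrA ler_wpM2l ?ker_ge0//.
  apply: le_trans (H1 _ gL d N j x y e jN e0 e1) _.
  have -> : om j x y = om j y x by exact: omC.
  move: (om j y x ^+ (2 * BB)) o0 => o o0.
  rewrite [C1 * o]mulrC -(mulrA o) ler_wpM2l ?(ltW o0)// ler_wpM2l ?(ltW C10)//.
  by rewrite mulrDr addrA -/al lerD2l /be mulrA.
have n4 : (2 * n <= 4 * n)%N by rewrite leq_mul2r orbT.
rewrite AvD//; last 2 first.
- by apply: measurable_funM => //; exact: measurable_cst.
- by nneg.
rewrite AvZ//; last by nneg.
have V0 := VN_ge0 d N y gL.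
apply: (@le_trans _ _ (C1%:E * ((al * 2 ^+ n)%:E + be%:E * (C2%:E * VN Lam d N y)))%E).
  rewrite lee_wpmul2l ?lee_fin ?(ltW C10)//; apply: leeD; first exact: Av_cst_le.
  by rewrite lee_wpmul2l ?lee_fin//; exact: H2.
rewrite ge0_muleDr ?lee_fin ?mulr_ge0 ?exprn_ge0//; last by nneg.
apply: leeD.
  rewrite -EFinM lee_fin -mulrA ler_wpM2l ?(ltW C10)// mulrC ler_wpM2r// lerDl//.
rewrite !muleA -!EFinM lee_wpmul2r// lee_fin [C1 * be * C2]mulrAC ler_wpM2r//.
by rewrite ler_wpM2l ?(ltW C10)// lerDr exprn_ge0.
Qed.

Lemma Xj_total : exists2 C, 0 < C & forall Lam, good Lam -> forall d N,
  (\sum_(j < N.+1) \int[mu]_x (X_ Lam d j x)%:E <= C%:E)%E.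
Proof.
have [C C1 H] := Psi_int; exists (2 ^+ n * C + 2 ^+ n) => [|Lam gL d N].
  by nneg.
have ma k : meas (a_ Lam k) by exact: (meas_aseq gL).
have a0 k y : 0 <= a_ Lam k y by exact: (aseq_ge0 gL).
have ms j : meas (fun x => scl j x ^- (2 * n).+1).
  apply: meas_funV; apply: measurable_funX; apply: measurable_funM.
    exact: measurable_cst.
  by apply: measurable_funD; [exact: measurable_cst|exact: meas_rV_norm].
have s0 j x : 0 <= scl j x ^- (2 * n).+1 by nneg.
have -> : (\sum_(j < N.+1) \int[mu]_x (X_ Lam d j x)%:E)%E =
  (\sum_(j < N.+1) \int[mu]_x (av j M2 (a_ Lam (j + d)) x)%:E +
   \int[lebesgue_rV R n]_x (\sum_(j < N.+1) scl j x ^- (2 * n).+1)%:E)%E.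
  under [X in (_ = _ + X)%E]eq_integral do rewrite -sumEFin.
  rewrite ge0_integral_sum//; last 2 first.
  - by move=> j; exact/measurable_EFinP.
  - by move=> j x _; rewrite lee_fin.
  rewrite -big_split/=; apply: eq_bigr => j _.
  rewrite -ge0_integralD//.
  - by nneg.
  - by apply/measurable_EFinP; exact: meas_av.
  - by move=> x _; rewrite lee_fin.
  - exact/measurable_EFinP.
rewrite EFinD; apply: leeD; last exact: integral_sclV_le.
apply: (@le_trans _ _ (\sum_(j < N.+1) (2 ^+ n)%:E * \int[mu]_x (a_ Lam (j + d) x)%:E)%E).
  apply: lee_sum => j _.
  rewrite (eq_integral (Av j M2 (a_ Lam (j + d)))).
    by apply: Av_total => //; exact: nM2.
  by move=> x _; rewrite avE//; exact: Av_aseq_lty.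
rewrite -ge0_sume_distrr; last by nneg.
rewrite EFinM lee_wpmul2l ?lee_fin ?exprn_ge0//.
apply: le_trans (H _ gL (N + d)%N).
rewrite -ge0_integral_sum//; last 2 first.
- by move=> j; exact/measurable_EFinP.
- by move=> j x _; rewrite lee_fin.
apply: ge0_le_integral => //.
- by nneg.
- by apply: emeasurable_sum => j; exact/measurable_EFinP.
- by apply/measurable_EFinP; exact: (meas_Psi gL).
move=> x _; rewrite sumEFin lee_fin /Psi -addSn addnC big_split_ord/=.
by under eq_bigr do rewrite addnC; rewrite lerDr sumr_ge0.
Qed.

(** The sum on the right is the very quantity that [HZ_total] estimates; it returns through the part
    of [kj] that comes from [Hj]. *)
Lemma kj_total : exists2 C, 0 < C & forall Lam, good Lam -> forall d N,
  (\int[mu]_y VN Lam d N y <= (C * d.+1%:R)%:E +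
    (2 ^+ n)%:E * \sum_(j < N.+1) \int[mu]_x (Hj Lam d j x * Zj Lam d j x `^ (rr x - 1))%:E)%E.
Proof.
have [C C1 H] := YYint; exists (2 ^+ n * C) => [|Lam gL d N].
  by nneg.
have HZ0 j x : 0 <= Hj Lam d j x * Zj Lam d j x `^ (rr x - 1).
  by nneg.
rewrite /VN ge0_integral_sum//; last 2 first.
- move=> i; apply: meas_Av; first exact: meas_kj.
  by nneg.
- by nneg.
apply: (@le_trans _ _ (\sum_(i < N.+1) (2 ^+ n)%:E * \int[mu]_x (kj Lam d i x)%:E)%E).
  apply: lee_sum => i _; apply: Av_total => //; first exact: meas_kj.
  by nneg.
rewrite -ge0_sume_distrr; last by nneg.
rewrite -mulrA EFinM -ge0_muleDr; last 2 first.
- by nneg.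
- by nneg.
rewrite lee_wpmul2l ?lee_fin ?exprn_ge0//.
apply: (@le_trans _ _ (\int[mu]_x (Y_ Lam d N x)%:E +
   \sum_(j < N.+1) \int[mu]_x (Hj Lam d j x * Zj Lam d j x `^ (rr x - 1))%:E)%E); last first.
  by apply: leeD => //; exact: H.
rewrite le_eqVlt; apply/orP; left; apply/eqP.
have -> : (\int[mu]_x (Y_ Lam d N x)%:E = \sum_(i < N.+1) \int[mu]_x (ysum M3 Lam d i x)%:E)%E.
  rewrite -ge0_integral_sum//.
  - by apply: eq_integral => x _; rewrite sumEFin.
  - by move=> i; apply/measurable_EFinP; exact: meas_ysum.
  - by nneg.
rewrite -big_split/=; apply: eq_bigr => i _; rewrite -ge0_integralD//.
- by nneg.
- by apply/measurable_EFinP; exact: meas_ysum.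
- by move=> x _; rewrite lee_fin.
- by apply/measurable_EFinP; exact: meas_HZ.
Qed.

Lemma JZ_total : exists2 C, 0 < C & exists2 C', 0 < C' & forall Lam, good Lam -> forall d N e,
  0 < e -> e <= 1 ->
  (\sum_(j < N.+1) \int[mu]_y ((JLam Lam d j y)%:E * Av j M2 (fun x => Zj Lam d j x `^ (rr x - 1))%R y)
   <= (C * (1 + e `^ (- rM)))%:E + (C' * e)%:E * \int[mu]_y VN Lam d N y)%E.
Proof.
have [C C1 H] := JAv_bound; have [K K0 HK] := Psi_int.
exists (C * (K + 1)); first by nneg.
exists C => // Lam gL d N e e0 e1.
have L0 k y := good_gt0 gL k y; have F0 y := Fsum_gt0 gL (N + d) y.
have a0 k y : 0 <= a_ Lam k y by exact: (aseq_ge0 gL).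
have ma k : meas (a_ Lam k) by exact: (meas_aseq gL).
have mF : meas (fun x => Fsum Lam (N + d) x `^ rr x).
  by apply: meas_fun_powR; [exact: (meas_Fsum gL)|exact: meas_rr].
have V0 y : (0 <= VN Lam d N y)%E by exact: VN_ge0.
have mV := meas_VN d N gL.
have m1 j : meas (fun y => (JLam Lam d j y)%:E * Av j M2 (fun x => Zj Lam d j x `^ (rr x - 1))%R y)%E.
  apply: emeasurable_funM; first by apply/measurable_EFinP; exact: meas_JLam.
  by apply: meas_Av; [exact: meas_Zr1|move=> x; exact: powR_ge0].
rewrite -ge0_integral_sum//; last first.
  move=> j y _; apply: mule_ge0; first by nneg.
  by nneg.
pose W y := C * (Psi_ Lam (N + d) y + e `^ (- rM) * Fsum Lam (N + d) y `^ rr y).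
have W0 y : 0 <= W y.
  by rewrite mulr_ge0 ?addr_ge0 ?(ltW C1) ?mulr_ge0 ?powR_ge0// ltW// (Psi_gt0 gL).
have mW : meas W.
  apply: measurable_funM; first exact: measurable_cst.
  apply: measurable_funD; first exact: (meas_Psi gL).
  by apply: measurable_funM => //; exact: measurable_cst.
have Ce0 : 0 <= C * e by nneg.
apply: (@le_trans _ _ (\int[mu]_y ((W y)%:E + (C * e)%:E * VN Lam d N y))%E).
  apply: ge0_le_integral => //.
  - move=> y _; apply: sume_ge0 => j _; apply: mule_ge0; first by nneg.
    by nneg.
  - exact: emeasurable_sum.
  - apply: emeasurable_funD; first exact/measurable_EFinP.
    by apply: emeasurable_funM => //; exact: measurable_cst.
  move=> y _.
  (* These weights have sum at most 1 over [j], so the number of scales does not multiply the terms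
     that are common to all [j]. *)
  pose w j := Lam (j + d)%N y / Fsum Lam (N + d) y.
  have w0 j : 0 <= w j by rewrite divr_ge0 ?(ltW (L0 _ _)) ?(ltW (F0 _)).
  have sw : \sum_(j < N.+1) w j <= 1.
    rewrite /w -mulr_suml ler_pdivrMr// mul1r /Fsum -addSn addnC big_split_ord/=.
    under eq_bigr do rewrite addnC.
    by rewrite lerDr; apply: sumr_ge0 => i _; exact: ltW.
  apply: (@le_trans _ _ (\sum_(j < N.+1) ((C * (a_ Lam (j + d) y + w j *
      (e `^ (- rM) * Fsum Lam (N + d) y `^ rr y)))%:E + (C * (w j * e))%:E * VN Lam d N y))%E).
    by apply: lee_sum => j _; apply: H => //; rewrite -ltnS.
  rewrite big_split/=; apply: leeD.
    rewrite sumEFin lee_fin /W -mulr_sumr ler_wpM2l ?(ltW C1)// big_split/= lerD//.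
      rewrite /Psi -addSn addnC big_split_ord/=.
      by under eq_bigr do rewrite addnC; rewrite lerDr sumr_ge0.
    by rewrite -mulr_suml ler_piMl// mulr_ge0 ?powR_ge0.
  rewrite -ge0_sume_distrl; last first.
    move=> j _; rewrite lee_fin; apply: mulr_ge0; first exact: ltW.
    by nneg.
  rewrite lee_wpmul2r// sumEFin lee_fin -mulr_sumr ler_wpM2l ?(ltW C1)// -mulr_suml.
  by rewrite ler_piMl ?(ltW e0).
rewrite ge0_integralD//; last 3 first.
- exact/measurable_EFinP.
- by nneg.
- by apply: emeasurable_funM => //; exact: measurable_cst.
apply: leeD; last by rewrite ge0_integralZl_EFin.
under eq_integral do rewrite /W EFinM.
have P0 y : 0 <= Psi_ Lam (N + d) y + e `^ (- rM) * Fsum Lam (N + d) y `^ rr y.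
  by rewrite addr_ge0 ?mulr_ge0 ?powR_ge0// ltW// (Psi_gt0 gL).
rewrite ge0_integralZl_EFin//; last 3 first.
- by move=> y _; rewrite lee_fin.
- apply/measurable_EFinP; apply: measurable_funD; first exact: (meas_Psi gL).
  by apply: measurable_funM => //; exact: measurable_cst.
- exact: ltW.
rewrite -mulrA EFinM lee_wpmul2l ?lee_fin ?(ltW C1)//.
under eq_integral do rewrite EFinD EFinM.
rewrite ge0_integralD//; last 4 first.
- by move=> y _; rewrite lee_fin ltW// (Psi_gt0 gL).
- by apply/measurable_EFinP; exact: (meas_Psi gL).
- by nneg.
- apply: emeasurable_funM; [exact: measurable_cst|exact/measurable_EFinP].
rewrite ge0_integralZl_EFin//; last 3 first.
- by nneg.
- exact/measurable_EFinP.
- exact: powR_ge0.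
apply: (@le_trans _ _ (K%:E + (e `^ (- rM))%:E * 1)%E).
  apply: leeD; first exact: HK.
  by rewrite lee_wpmul2l ?lee_fin ?powR_ge0//; exact: (good_int gL).
  rewrite mule1 -EFinD lee_fin; have := powR_ge0 e (- rM); move: (e `^ _) => u u0.
  rewrite mulrDl mul1r lerD//; last by rewrite lerDr.
  by rewrite ler_peMr ?(ltW K0)// lerDl.
by move=> y _; rewrite lee_fin.
Qed.

(** Multiplying [ht_core] by [Zj ^ (r - 1)] leaves [Xj] alone in one summand; in the other,
    [Av_tonelli] puts the average on the weight, where [JZ_total] applies. *)
Lemma HZ_total : exists2 C, 0 < C & forall Lam, good Lam -> forall d N,
  (\sum_(j < N.+1) \int[mu]_x (Hj Lam d j x * Zj Lam d j x `^ (rr x - 1))%:E <= (C * d.+1%:R)%:E)%E.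
Proof.
have [C1 C10 H1] := ht_core; have [C2 C20 H2] := Xj_total; have [C3 C30 H3] := kj_total.
have [C4 C40 [C5 C50 H4]] := JZ_total.
pose k : R := C1 * C5 * 2 ^+ n; have k0 : 0 < k by nneg.
(* In [step] the sum [S] comes back with the factor [k * e], which this choice makes at most one
   half. *)
pose e : R := (1 + 2 * k)^-1; have ed : 0 < 1 + 2 * k by nneg.
have e0 : 0 < e by nneg.
have e1 : e <= 1 by rewrite invf_le1// lerDl mulr_ge0 ?ltW.
have ke : k * e <= 2^-1.
  by rewrite /e ler_pdivrMr// mulrDr mulr1 mulrA mulVf ?mul1r ?lerDr ?invr_ge0// pnatr_eq0.
pose c0 : R := C1 * (C4 * (1 + e `^ (- rM)) + C5 * e * C3 + C2).
have ep : 0 <= e `^ (- rM) by nneg.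
have c00 : 0 < c0.
  by nneg.
exists (2 * c0) => [|Lam gL d N]; first by nneg.
set S := (\sum_(j < N.+1) _)%E.
have HZ0 j x : 0 <= Hj Lam d j x * Zj Lam d j x `^ (rr x - 1).
  by nneg.
have S0 : (0 <= S)%E.
  by apply: sume_ge0 => j _; apply: integral_ge0 => x _; rewrite lee_fin.
have Sfin : S \is a fin_num.
  by apply/sum_fin_numP => j _ _; rewrite ge0_fin_numE ?HZ_fin// integral_ge0// => x _; rewrite lee_fin.
have nM := nM2.
have J0 j x : 0 <= JLam Lam d j x by nneg.
have mJ j := meas_JLam d j gL.
have mX j : meas (X_ Lam d j).
  apply: measurable_funD.
    by apply: meas_av; [exact: (meas_aseq gL)|exact: (aseq_ge0 gL)].
  apply: meas_funV; apply: measurable_funX; apply: measurable_funM.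
    exact: measurable_cst.
  by apply: measurable_funD; [exact: measurable_cst|exact: meas_rV_norm].
have key : (S <= C1%:E * (\sum_(j < N.+1) \int[mu]_y ((JLam Lam d j y)%:E *
     Av j M2 (fun x => Zj Lam d j x `^ (rr x - 1))%R y) + \sum_(j < N.+1) \int[mu]_x (X_ Lam d j x)%:E))%E.
  rewrite -big_split/= ge0_sume_distrr; last first.
    move=> j _; apply: adde_ge0; apply: integral_ge0 => x _.
      apply: mule_ge0; [by rewrite lee_fin|by nneg].
    by nneg.
  apply: lee_sum => j _.
  rewrite -Av_tonelli//; last 2 first.
  - exact: meas_Zr1.
  - by nneg.
  have mA : meas (fun x => (Av j M2 (JLam Lam d j) x * (Zj Lam d j x `^ (rr x - 1))%:E)%E).
    apply: emeasurable_funM; first exact: meas_Av.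
    by apply/measurable_EFinP; exact: meas_Zr1.
  have A0' x : (0 <= Av j M2 (JLam Lam d j) x * (Zj Lam d j x `^ (rr x - 1))%:E)%E.
    by nneg.
  have X0 x : (0 <= (X_ Lam d j x)%:E)%E by nneg.
  rewrite -ge0_integralD//; last exact/measurable_EFinP.
  rewrite -ge0_integralZl_EFin//; last 3 first.
  - by move=> x _; rewrite adde_ge0.
  - by apply: emeasurable_funD => //; exact/measurable_EFinP.
  - exact: ltW.
  apply: ge0_le_integral => //.
  - by move=> x _; rewrite lee_fin.
  - by apply/measurable_EFinP; exact: meas_HZ.
  - apply: emeasurable_funM; first exact: measurable_cst.
    by apply: emeasurable_funD => //; exact/measurable_EFinP.
  move=> x _.
  have -> : Av j M2 (JLam Lam d j) x = (J_ Lam d j x)%:E.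
    by rewrite /Jj avE//; exact: Av_JLam_lty.
  rewrite -!(EFinM, EFinD) lee_fin.
  have Z0 := Zj_gt0 Lam d j x.
  apply: (@le_trans _ _ (C1 * (J_ Lam d j x + X_ Lam d j x * Zj Lam d j x `^ (1 - rr x)) * Zj Lam d j x `^ (rr x - 1))).
    by rewrite ler_wpM2r ?powR_ge0//; exact: H1.
  rewrite -mulrA ler_wpM2l ?(ltW C10)// mulrDl lerD2l -mulrA -powRD.
    by rewrite addrA subrK subrr powRr0 mulr1.
  by rewrite (gt_eqF Z0) implybT.
have d1 : 1 <= d.+1%:R :> R by rewrite ler1n.
have step : (S <= (c0 * d.+1%:R)%:E + (k * e)%:E * S)%E.
  apply: le_trans key _.
  apply: (@le_trans _ _ (C1%:E * (((C4 * (1 + e `^ (- rM)))%:E + (C5 * e)%:E *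
     ((C3 * d.+1%:R)%:E + (2 ^+ n)%:E * S)) + C2%:E))%E).
    rewrite lee_wpmul2l ?lee_fin ?(ltW C10)//; apply: leeD; last exact: H2.
    apply: le_trans (H4 _ gL d N e e0 e1) _; rewrite leeD2l//.
    apply: lee_wpmul2l; last exact: H3.
    by nneg.
  rewrite -(fineK Sfin) -!(EFinM, EFinD) lee_fin.
  move: (fine S) => s.
  have -> : C1 * (C4 * (1 + e `^ (- rM)) + C5 * e * (C3 * d.+1%:R + 2 ^+ n * s) + C2) =
    C1 * (C4 * (1 + e `^ (- rM)) + C5 * e * (C3 * d.+1%:R) + C2) + k * e * s.
    by rewrite /k; ring.
  rewrite lerD2r /c0 -(mulrA C1) ler_wpM2l ?(ltW C10)// !(mulrDl _ _ d.+1%:R) !lerD//.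
  - by rewrite ler_peMr// mulr_ge0 ?addr_ge0 ?(ltW C40).
  - by rewrite mulrA.
  - by rewrite ler_peMr ?(ltW C20).
move: step S0; rewrite -(fineK Sfin) -EFinM -EFinD !lee_fin; move: (fine S) => s hs s0.
have : k * e * s <= 2^-1 * s by rewrite ler_wpM2r.
rewrite -(mulrA 2); move: hs; move: (k * e * s) (c0 * d.+1%:R) => u v hs hu; lra.
Qed.

Lemma core_bound : exists2 C, 0 < C & forall Lam, good Lam -> forall d N,
  (\int[mu]_x ((\sum_(j < N.+1) h_ Lam d j x `^ q x) `^ rr x)%:E <= (C * d.+1%:R)%:E)%E.
Proof.
have [C1 C10 H1] := Zj_sum; have [C2 C20 H2] := YYint; have [C3 C30 H3] := HZ_total.
exists (C1 * (C2 + C3)) => [|Lam gL d N]; first by nneg.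
have HZ0 j x : 0 <= Hj Lam d j x * Zj Lam d j x `^ (rr x - 1).
  by nneg.
have mHZ j := meas_HZ d j gL.
have sHZ x : 0 <= \sum_(j < N.+1) Hj Lam d j x * Zj Lam d j x `^ (rr x - 1) by nneg.
have mS : meas (fun x => \sum_(j < N.+1) Hj Lam d j x * Zj Lam d j x `^ (rr x - 1)).
  by apply: measurable_sum.
have mY := meas_YY M3 d N gL.
have Y0 x := ltW (YY_gt0 M3 d N x gL).
apply: (@le_trans _ _ (\int[mu]_x (C1%:E * (Y_ Lam d N x + \sum_(j < N.+1) Hj Lam d j x * Zj Lam d j x `^ (rr x - 1))%:E))%E).
  apply: ge0_le_integral => //.
  - by nneg.
  - apply/measurable_EFinP; apply: meas_fun_powR; last exact: meas_rr.
    by apply: measurable_sum => j; apply: meas_fun_powR => //; exact: meas_hreal.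
  - apply/measurable_EFinP; apply: measurable_funM; first exact: measurable_cst.
    exact: measurable_funD.
  move=> x _; rewrite -EFinM lee_fin; apply: le_trans (H1 _ gL d N x).
  rewrite ge0_ler_powR ?(ltW (rr_gt0 x))// ?nnegrE ?(ltW (Zj_gt0 _ _ _ _))//.
    by nneg.
  rewrite /Zj; apply: ler_wpDl; first exact: powR_ge0.
  apply: ler_sum => j _; rewrite ge0_ler_powR ?(ltW (q_gt0 x))// ?nnegrE ?hreal_ge0 ?(ltW (ht_gt0 _ _ _ _))//.
  by rewrite /ht lerDl invr_ge0 exprn_ge0// ltW// scl_gt0.
rewrite ge0_integralZl_EFin//; last 3 first.
- by nneg.
- by apply/measurable_EFinP; exact: measurable_funD.
- exact: ltW.
rewrite -mulrA EFinM lee_wpmul2l ?lee_fin ?(ltW C10)//.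
under eq_integral do rewrite EFinD.
rewrite ge0_integralD//; last 4 first.
- by move=> x _; rewrite lee_fin.
- exact/measurable_EFinP.
- by move=> x _; rewrite lee_fin.
- exact/measurable_EFinP.
rewrite mulrDl EFinD; apply: leeD; first exact: H2.
under eq_integral do rewrite -sumEFin.
rewrite ge0_integral_sum//.
- exact: H3.
- by move=> j; exact/measurable_EFinP.
- by move=> j x _; rewrite lee_fin.
Qed.

(** Not uniform in [j], but uniform in [d] and [x]: this is what makes the series over the levels
    converge absolutely for each fixed [j]. *)
Lemma hreal_sup j : exists2 C, 0 < C & forall Lam, good Lam -> forall d x, h_ Lam d j x <= C.
Proof.
have [C Cp H] := hreal_le; have [C' C'p H'] := YY_le M3.
pose D := Num.max 1 (C' * 2 ^+ (j * n.+1)).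
have D1 : 1 <= D by rewrite le_max lexx.
exists (C * D `^ pm^-1) => [|Lam gL d x]; first by nneg.
apply: le_trans (H _ gL d j x) _; rewrite ler_pM2l//.
have px : 0 <= (p x)^-1 by nneg.
have Y0 := ltW (YY_gt0 M3 d j x gL).
apply: (@le_trans _ _ (D `^ (p x)^-1)).
  rewrite ge0_ler_powR ?nnegrE// ?(le_trans ler01)//.
  by apply: le_trans (H' _ gL d j x) _; rewrite le_max lexx orbT.
by rewrite ler_powR// lef_pV2 ?posrE ?p_gt0//; case/andP: (hp x).
Qed.

End core_setup.

(** * Oscillatory integrals *)

Section real_analysis.
Context {R : realType} {n : nat}.
Implicit Types (x y z v xi : 'rV[R]_n) (f g G : 'rV[R]_n -> R).

Lemma Rint_bound f (B : R) : meas f -> (\int[mu]_x `|(f x)%:E| <= B%:E)%E ->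
  intg f /\ `|\int[mu]_x f x| <= B.
Proof.
move=> mf fB; have If : intg f.
  apply/integrableP; split; first exact/measurable_EFinP.
  by apply: le_lt_trans fB _; exact: ltry.
split=> //; apply: le_trans (le_normr_Rintegral _ If) _ => //.
rewrite -lee_fin /Rintegral fineK.
  exact: fB.
by apply: integrable_fin_num => //; exact: (integrable_abse If).
Qed.

Lemma int_ball f c (B r : R) : meas f -> 0 < r -> 0 <= B -> (forall x, `|f x| <= B) ->
  (forall x, r < `|x - c| -> f x = 0) -> (\int[mu]_x `|(f x)%:E| <= (B * (8 * r) ^+ n)%:E)%E.
Proof.
move=> mf r0 B0 fB f0; have ri : 0 < r^-1 by nneg.
apply: (@le_trans _ _ (\int[mu]_x ((B * 4 ^+ n)%:E * ((1 + r^-1 * `|x - c|) ^- (2 * n))%:E))%E).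
  apply: ge0_le_integral => //.
  - by apply/measurable_EFinP; apply: measurableT_comp.
  - apply/measurable_EFinP; apply: measurable_funM; first exact: measurable_cst.
    exact: meas_kernel.
  move=> x _; rewrite -EFinM lee_fin.
  have o0 : 0 < 1 + r^-1 * `|x - c| by nneg.
  have [xr|xr] := ltP r `|x - c|.
    by rewrite f0// normr0 !mulr_ge0 ?invr_ge0 ?exprn_ge0 ?(ltW o0).
  apply: le_trans (fB x) _; rewrite -mulrA ler_peMr// -[4](_ : 2 ^+ 2 = 4 :> R); last first.
    by rewrite -natrX.
  rewrite -exprM -exprVn -exprMn; apply: exprn_ege1.
  rewrite -(@ler_pM2r _ (1 + r^-1 * `|x - c|))// mul1r divfK ?gt_eqF//.
  rewrite (_ : 2 = 1 + 1)// lerD2l mulrC ler_pdivrMr// mul1r//.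
rewrite ge0_integralZl_EFin//; last 3 first.
- by nneg.
- by apply/measurable_EFinP; exact: meas_kernel.
- by nneg.
apply: (@le_trans _ _ ((B * 4 ^+ n)%:E * ((2 / r^-1) ^+ n)%:E)%E).
  by rewrite lee_wpmul2l ?integral_kernel_le// lee_fin mulr_ge0// exprn_ge0.
rewrite -EFinM lee_fin invrK -mulrA ler_wpM2l// -exprMn.
by rewrite mulrA -natrM.
Qed.

Lemma Rint_ball f c (B r : R) : meas f -> 0 < r -> 0 <= B -> (forall x, `|f x| <= B) ->
  (forall x, r < `|x - c| -> f x = 0) -> intg f /\ `|\int[mu]_x f x| <= B * (8 * r) ^+ n.
Proof. by move=> *; apply: Rint_bound => //; apply: (@int_ball f c). Qed.

Lemma Rintegral_translate f v : meas f -> \int[mu]_x f (x + v) = \int[mu]_x f x.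
Proof.
move=> mf; have mE : meas (EFin \o f) by exact/measurable_EFinP.
rewrite /Rintegral integralE [in RHS]integralE; congr (fine (_ - _)).
  rewrite -[RHS](@ge0_integral_translate _ _ _ v); last 2 first.
  - exact: measurable_funepos.
  - by nneg.
  by apply: eq_integral => w _; rewrite !funeposE.
rewrite -[RHS](@ge0_integral_translate _ _ _ v); last 2 first.
- exact: measurable_funeneg.
- by nneg.
by apply: eq_integral => w _; rewrite !funenegE.
Qed.

Lemma is_derive_line f x v (t df : R) :
  is_derive (x + t *: v) v f df <-> is_derive t 1 (fun s => f (x + s *: v)) df.
Proof.
have E : (fun h : R => h^-1 *: ((f \o shift (x + t *: v)) (h *: v) - f (x + t *: v))) =
    (fun h : R => h^-1 *: (((fun s => f (x + s *: v)) \o shift t) (h *: 1) - f (x + t *: v))).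
  apply/funext => h; rewrite /= /shift /=; congr (_ *: (f _ - _)).
  by rewrite addrCA -scalerDl [h *: 1]mulr1.
split=> -[d e]; split.
- by move: d; rewrite /derivable E.
- by rewrite -e /derive E.
- by move: d; rewrite /derivable E.
- by rewrite -e /derive E.
Qed.

Lemma MVT_bound (F dF : R -> R) (t C : R) : (forall u : R, is_derive u (1 : R) F (dF u)) ->
  (forall s, `|s| <= `|t| -> `|dF s| <= C) -> `|F t - F 0| <= C * `|t|.
Proof.
move=> H Df.
have cf (a b : R) : {within `[a, b], continuous F}.
  apply: continuous_subspaceT => u; apply/differentiable_continuous/derivable1_diffP.
  by case: (H u).
have [t0|t0|->] := ltgtP t 0; last by rewrite subrr normr0 mulr0.
  have [u ut] := @MVT _ _ dF _ _ t0 (fun u _ => H u) (cf _ _).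
  rewrite distrC => ->; rewrite sub0r normrM normrN ler_wpM2r//; apply: Df.
  move: ut; rewrite in_itv/= => /andP[u1 u2].
  by rewrite (ltr0_norm u2) (ltr0_norm t0) lerN2 ltW.
have [u ut] := @MVT _ _ dF _ _ t0 (fun u _ => H u) (cf _ _).
move=> ->; rewrite subr0 normrM ler_wpM2r//; apply: Df.
move: ut; rewrite in_itv/= => /andP[u1 u2].
by rewrite (gtr0_norm u1) (gtr0_norm t0) ltW.
Qed.

Lemma MVT_line f x v (t C : R) : (forall y, derivable f y v) ->
  (forall s, `|s| <= `|t| -> `|'D_v f (x + s *: v)| <= C) -> `|f (x + t *: v) - f x| <= C * `|t|.
Proof.
move=> df Df; rewrite -[f x](_ : f (x + 0 *: v) = _); last by rewrite scale0r addr0.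
apply: (@MVT_bound (fun s => f (x + s *: v)) (fun s => 'D_v f (x + s *: v)) t) => // u.
by apply/is_derive_line; exact: derivableP.
Qed.

Lemma diff_quot_cvg f x v : derivable f x v ->
  (fun k => k.+1%:R * (f (x + k.+1%:R^-1 *: v) - f x)) @ \oo --> ('D_v f x : R).
Proof.
move=> df.
have u0 : (fun k => k.+1%:R^-1 : R) @ \oo --> (0 : R)^'.
  move=> A A0.
  have hA : \forall k \near \oo, (k.+1%:R^-1 : R) != 0 -> A k.+1%:R^-1 := @cvg_harmonic R _ A0.
  rewrite nbhs_simpl /=; apply: filterS hA => k; apply.
  by rewrite invr_eq0 pnatr_eq0.
have := cvg_comp _ _ u0 df; apply: cvg_trans; apply: near_eq_cvg.
by apply: nearW => k /=; rewrite invrK [x + _]addrC.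
Qed.

(* The difference quotients in the direction [v] have integral 0 by translation
   invariance, and converge boundedly to the derivative. *)
Lemma Rintegral_derive0 G v (B r : R) : meas G -> (forall x, derivable G x v) ->
  (forall x, `|G x| <= B) -> (forall x, `|'D_v G x| <= B) -> (forall x, r < `|x| -> G x = 0) ->
  meas ('D_v G) /\ \int[mu]_x 'D_v G x = 0.
Proof.
move=> mG dG GB DB G0.
pose D k x := k.+1%:R * (G (x + k.+1%:R^-1 *: v) - G x).
have mGv w : meas (fun x => G (x + w)) by apply: (measurableT_comp mG); exact: meas_rVD.
have mD k : meas (D k).
  apply: measurable_funM; first exact: measurable_cst.
  by apply: measurable_funB.
have cD x : D ^~ x @ \oo --> 'D_v G x by exact: diff_quot_cvg.
have mDG : meas ('D_v G) by apply: (measurable_fun_cvg (h := D)).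
split=> //.
have B0 : 0 <= B by apply: le_trans (GB 0).
pose r' := 1 + `|r| + `|v|; have r'0 : 0 < r' by nneg.
have Dr k x : r' < `|x - 0| -> D k x = 0.
  rewrite subr0 => xr; rewrite /D !G0 ?subrr ?mulr0//.
    by apply: le_lt_trans xr; apply: le_trans (ler_norm r) _; rewrite /r' -addrA addrCA lerDl addr_ge0.
  have h1 : `|k.+1%:R^-1 *: v| <= `|v|.
    by rewrite normrZ ler_piMl// ger0_norm ?invr_ge0// invf_le1// ler1n.
  have := ler_normB (x + k.+1%:R^-1 *: v) (k.+1%:R^-1 *: v); rewrite addrK.
  have := ler_norm r; move: xr h1; rewrite /r'.
  move: (`|x|) (`|_ *: v|) (`|x + _|) (`|r|) (`|v|) => u1 u2 u3 u4 u5 a1 a2 a3 a4; lra.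
have DB' k x : `|D k x| <= B.
  have h := MVT_line (x := x) (t := k.+1%:R^-1) dG (fun s _ => DB (x + s *: v)).
  rewrite normrM; apply: le_trans (ler_wpM2l (normr_ge0 _) h) _.
  by rewrite mulrCA -normrM mulfV ?pnatr_eq0// normr1 mulr1.
have intD k : intg (D k) by have [] := Rint_ball (mD k) r'0 B0 (DB' k) (Dr k).
have intG : intg G.
  have [|//] := Rint_ball (c := 0) mG r'0 B0 GB.
  move=> x; rewrite subr0 => xr; apply: G0; apply: le_lt_trans xr.
  by apply: le_trans (ler_norm r) _; rewrite /r' -addrA addrCA lerDl addr_ge0.
have D0 k : (\int[mu]_x (D k x)%:E)%E = 0%E.
  have -> : (\int[mu]_x (D k x)%:E)%E = (\int[mu]_x D k x)%:E.
    by rewrite /Rintegral fineK//; exact: integrable_fin_num (intD k).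
  congr EFin.
  have iGv w : intg (fun x => G (x + w)).
    have [|//] := Rint_ball (c := - w) (mGv w) r'0 B0 (fun x => GB (x + w)).
    move=> x; rewrite opprK => xr; apply: G0; apply: le_lt_trans xr.
    by apply: le_trans (ler_norm r) _; rewrite /r' -addrA addrCA lerDl addr_ge0.
  rewrite RintegralZl//; last exact: (integrableB _ (iGv _) intG).
  by rewrite RintegralB// Rintegral_translate// subrr mulr0.
(* An integrable majorant of the quotients: they are bounded by [B] and vanish outside a ball of
   radius [r'], on which the kernel is at least [4 ^- n]. *)
pose g x := B * 4 ^+ n * (1 + r'^-1 * `|x - 0|) ^- (2 * n).
have Dg k x : `|D k x| <= g x.
  have o0 : 0 < 1 + r'^-1 * `|x - 0| by nneg.
  rewrite /g; have [xr|xr] := ltP r' `|x - 0|.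
    by rewrite Dr// normr0 !mulr_ge0 ?invr_ge0 ?exprn_ge0 ?(ltW o0).
  apply: le_trans (DB' k x) _; rewrite -mulrA ler_peMr// -[4](_ : 2 ^+ 2 = 4 :> R); last first.
    by rewrite -natrX.
  rewrite -exprM -exprVn -exprMn; apply: exprn_ege1.
  rewrite -(@ler_pM2r _ (1 + r'^-1 * `|x - 0|))// mul1r divfK ?gt_eqF//.
  by rewrite (_ : 2 = 1 + 1)// lerD2l mulrC ler_pdivrMr// mul1r.
have mg : meas g by apply: measurable_funM; [exact: measurable_cst|exact: meas_kernel].
have g0 x : 0 <= g x by apply: le_trans (Dg 0%N x).
have ig : intg g.
  apply/integrableP; split; first exact/measurable_EFinP.
  apply: (@le_lt_trans _ _ ((B * 4 ^+ n)%:E * ((2 / r'^-1) ^+ n)%:E)%E); last by rewrite -EFinM ltry.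
  under eq_integral => x _ do rewrite gee0_abs ?lee_fin//.
  rewrite /g; under eq_integral do rewrite /= EFinM.
  rewrite ge0_integralZl_EFin//; last 3 first.
  - by nneg.
  - by apply/measurable_EFinP; exact: meas_kernel.
  - by nneg.
  rewrite lee_wpmul2l ?lee_fin ?mulr_ge0 ?exprn_ge0//.
  by apply: integral_kernel_le; rewrite invr_gt0.
have [|||||_ _] := @dominated_convergence _ _ _ mu setT measurableT (fun k x => (D k x)%:E)
  (fun x => ('D_v G x)%:E) (fun x => (g x)%:E).
- by move=> k; exact/measurable_EFinP.
- exact/measurable_EFinP.
- by apply/aeW => x _; apply/fine_cvgP; split; [exact: nearW|exact: cD].
- exact: ig.
- by apply/aeW => x k _; rewrite lee_fin.
under eq_fun do rewrite D0.
move=> /(cvg_lim (@ereal_hausdorff R)); rewrite lim_cst; last exact: ereal_hausdorff.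
by rewrite /Rintegral => <-.
Qed.

Lemma cos_lip (s t : R) : `|cos s - cos t| <= `|s - t|.
Proof.
wlog st : s t / t < s.
  move=> H; have [/H//|st|->] := ltgtP t s; last by rewrite !subrr.
  by rewrite distrC [leRHS]distrC; exact: H.
have [|u _ ->] := @MVT _ cos (fun w : R => - sin w) _ _ st (fun (w : R) _ => is_derive_cos w).
  exact/continuous_subspaceT/continuous_cos.
rewrite normrM normrN ler_piMl// ler_norml; apply/andP; split; [exact: sin_geN1|exact: sin_le1].
Qed.

Lemma cos_taylor1 (s t : R) : `|cos (s + t) - cos s + t * sin s| <= t ^+ 2.
Proof.
pose phi (w : R) := cos (s + w) - cos s + w * sin s.
have D (w : R) : is_derive w 1 phi (sin s - sin (s + w)).
  by apply: is_derive_eq; rewrite scaler0 !add0r mulr1 subr0 [_%:A]mulr1 addrC.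
have Dw (w : R) : `|sin s - sin (s + w)| <= `|w|.
  have -> : sin s = cos (s - pi / 2) by rewrite cosB cos_pihalf sin_pihalf mulr0 mulr1 add0r.
  have -> : sin (s + w) = cos (s + w - pi / 2).
    by rewrite [cos (s + w - _)]cosB cos_pihalf sin_pihalf mulr0 mulr1 add0r.
  apply: le_trans (cos_lip _ _) _.
  by rewrite (_ : _ - _ - _ = - w) ?normrN//; lra.
have cphi (a b : R) : {within `[a, b], continuous phi}.
  apply: continuous_subspaceT => w; apply/differentiable_continuous/derivable1_diffP.
  by case: (D w).
have p0 : phi 0 = 0 by rewrite /phi addr0 subrr mul0r addr0.
rewrite -/(phi t) expr2 -[t * t]ger0_norm -?expr2 ?sqr_ge0// expr2 normrM.
have [t0|t0|->] := ltgtP t 0; last by rewrite p0 normr0.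
  have [w wt] := @MVT _ _ (fun w : R => sin s - sin (s + w)) _ _ t0 (fun w _ => D w) (cphi _ _).
  rewrite p0 !sub0r => e; rewrite -normrN e normrM normrN ler_wpM2r//; apply: le_trans (Dw w) _.
  move: wt; rewrite in_itv/= => /andP[u1 u2].
  by rewrite (ltr0_norm u2) (ltr0_norm t0) lerN2 ltW.
have [w wt] := @MVT _ _ (fun w : R => sin s - sin (s + w)) _ _ t0 (fun w _ => D w) (cphi _ _).
rewrite p0 !subr0 => ->; rewrite normrM ler_wpM2r//; apply: le_trans (Dw w) _.
move: wt; rewrite in_itv/= => /andP[u1 u2].
by rewrite (gtr0_norm u1) (gtr0_norm t0) ltW.
Qed.

Lemma dotvDl x y z : dotv (x + y) z = dotv x z + dotv y z.
Proof. by rewrite /dotv -big_split; apply: eq_bigr => i _; rewrite mxE mulrDl. Qed.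

Lemma dotvZl (c : R) x z : dotv (c *: x) z = c * dotv x z.
Proof. by rewrite /dotv mulr_sumr; apply: eq_bigr => i _; rewrite mxE mulrA. Qed.

Lemma dotv_evecl i x : dotv (evec i) x = x ord0 i.
Proof.
rewrite /dotv (bigD1 i)//= mxE !eqxx mul1r big1 ?addr0// => k ki.
by rewrite mxE (negPf ki) andbF mul0r.
Qed.

Lemma dotvC x y : dotv x y = dotv y x.
Proof. by apply: eq_bigr => i _; rewrite mulrC. Qed.

Lemma dotv_le x y : `|dotv x y| <= n%:R * (`|x| * `|y|).
Proof.
apply: le_trans (ler_norm_sum _ _ _) _.
have -> : n%:R * (`|x| * `|y|) = \sum_(i < n) `|x| * `|y|.
  by rewrite sumr_const card_ord mulr_natl.
by apply: ler_sum => i _; rewrite normrM ler_pM// ler_coord.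
Qed.

Lemma meas_dotv x : meas (dotv x).
Proof.
apply: measurable_sum => i; apply: measurable_funM; first exact: measurable_cst.
exact: measurable_rV_coord.
Qed.

(** A Fourier integral in real form. Thanks to the phase [tau] the family is closed under
    differentiation, which adds [pi / 2] to the phase, and contains real and imaginary parts as well
    as reflections. *)
Definition KK (tau : R) g z := \int[mu]_xi (cos (dotv z xi + tau) * g xi).

Section kernel_of.
Variables (g : 'rV[R]_n -> R) (B r : R).
Hypotheses (mg : meas g) (r0 : 0 < r) (B0 : 0 <= B) (gB : forall x, `|g x| <= B)
  (g0 : forall x, r < `|x| -> g x = 0).

Lemma meas_cosdot tau z : meas (fun xi => cos (dotv z xi + tau)).
Proof.
apply: (measurableT_comp (f := @cos R)).
  by apply: continuous_measurable_fun; exact: continuous_cos.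
by apply: measurable_funD; [exact: meas_dotv|exact: measurable_cst].
Qed.

Lemma cos_le1' (t : R) : `|cos t| <= 1.
Proof. by rewrite ler_norml cos_geN1 cos_le1. Qed.

Lemma sin_le1' (t : R) : `|sin t| <= 1.
Proof. by rewrite ler_norml sin_geN1 sin_le1. Qed.

Lemma KK_bound tau z : intg (fun xi => cos (dotv z xi + tau) * g xi) /\
  `|KK tau g z| <= B * (8 * r) ^+ n.
Proof.
apply: (@Rint_ball _ 0) => //.
- by apply: measurable_funM => //; exact: meas_cosdot.
- by move=> x; rewrite normrM -[B]mul1r ler_pM// cos_le1'.
- by move=> x; rewrite subr0 => xr; rewrite g0// mulr0.
Qed.

Lemma KK_lip tau x y : `|KK tau g x - KK tau g y| <= n%:R * r * B * (8 * r) ^+ n * `|x - y|.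
Proof.
have [i1 _] := KK_bound tau x; have [i2 _] := KK_bound tau y.
rewrite -RintegralB//.
have -> : n%:R * r * B * (8 * r) ^+ n * `|x - y| = (n%:R * r * B * `|x - y|) * (8 * r) ^+ n.
  by rewrite mulrAC.
have [] // := @Rint_ball (fun xi => cos (dotv x xi + tau) * g xi - cos (dotv y xi + tau) * g xi)
  0 (n%:R * r * B * `|x - y|) r.
- by apply: measurable_funB; apply: measurable_funM => //; exact: meas_cosdot.
- by nneg.
- move=> xi; have [xr|xr] := ltP r `|xi|.
    by rewrite g0// !mulr0 subrr normr0 !mulr_ge0// ltW.
  rewrite -mulrBl normrM.
  have h : `|cos (dotv x xi + tau) - cos (dotv y xi + tau)| <= n%:R * (`|x - y| * r).
    apply: le_trans (cos_lip _ _) _; rewrite opprD addrACA subrr addr0.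
    have -> : dotv x xi - dotv y xi = dotv (x - y) xi.
      by rewrite dotvDl -[- y]scaleN1r dotvZl mulN1r.
    by apply: le_trans (dotv_le _ _) _; rewrite ler_wpM2l// ler_wpM2l.
  apply: le_trans (ler_pM _ _ h (gB xi)) _ => //.
  by rewrite [leLHS](_ : _ = n%:R * r * B * `|x - y|)//; ring.
- by move=> xi; rewrite subr0 => xr; rewrite g0// !mulr0 subrr.
Qed.

Lemma continuous_KK tau : continuous (KK tau g).
Proof.
move=> x; have FF := nbhs_filter x; apply/cvgrPdist_le => e e0.
pose L := n%:R * r * B * (8 * r) ^+ n.
have L0 : 0 <= L by nneg.
near=> y.
apply: le_trans (KK_lip tau x y) _; rewrite -/L.
apply: (@le_trans _ _ (L * (e / (L + 1)))).
  by rewrite ler_wpM2l//; near: y; apply: cvgr_dist_le; rewrite ?divr_gt0// ltr_wpDl.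
by rewrite mulrCA ler_piMr ?(ltW e0)// ler_pdivrMr ?ltr_wpDl// mul1r lerDl.
Unshelve. all: by end_near. Qed.

Lemma mulX_bound i : [/\ meas (fun xi => xi ord0 i * g xi), forall xi, `|xi ord0 i * g xi| <= r * B &
  forall xi, r < `|xi| -> xi ord0 i * g xi = 0].
Proof.
split.
- by apply: measurable_funM => //; exact: measurable_rV_coord.
- move=> xi; have [xr|xr] := ltP r `|xi|; first by rewrite g0// mulr0 normr0 mulr_ge0// ltW.
  by rewrite normrM ler_pM// (le_trans (ler_coord _ _)).
- by move=> xi xr; rewrite g0// mulr0.
Qed.

Lemma KK_diff tau z i (h : R) :
  `|KK tau g (h *: evec i + z) - KK tau g z - h * KK (tau + pi / 2) (fun xi => xi ord0 i * g xi) z|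
    <= h ^+ 2 * (r ^+ 2 * B * (8 * r) ^+ n).
Proof.
have [i1 _] := KK_bound tau z; have [i2 _] := KK_bound tau (h *: evec i + z).
have [m3 b3 z3] := mulX_bound i.
have rB0 : 0 <= r * B by nneg.
have i3 : intg (fun xi => cos (dotv z xi + (tau + pi / 2)) * (xi ord0 i * g xi)).
  have [] // := @Rint_ball (fun xi => cos (dotv z xi + (tau + pi / 2)) * (xi ord0 i * g xi)) 0 (r * B) r.
  - by apply: measurable_funM => //; exact: meas_cosdot.
  - by move=> x; rewrite normrM -[r * B]mul1r ler_pM// cos_le1'.
  - by move=> x; rewrite subr0 => xr; rewrite z3// mulr0.
rewrite {3}/KK -RintegralZl// /KK -RintegralB// -RintegralB//; last 2 first.
- exact: (integrableB _ i2 i1).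
- exact: (integrableZl _ _ i3).
rewrite mulrA.
set F := (fun xi => _).
have [] // := @Rint_ball F 0 (h ^+ 2 * (r ^+ 2 * B)) r.
- apply: measurable_funB; last first.
    apply: measurable_funM; first exact: measurable_cst.
    by apply: measurable_funM => //; exact: meas_cosdot.
  by apply: measurable_funB; apply: measurable_funM => //; exact: meas_cosdot.
- by rewrite mulr_ge0 ?sqr_ge0// mulr_ge0 ?sqr_ge0.
- move=> xi; have [xr|xr] := ltP r `|xi|.
    by rewrite /F g0// !mulr0 !subr0 normr0 mulr_ge0 ?sqr_ge0// mulr_ge0 ?sqr_ge0.
  have -> : F xi = (cos (dotv z xi + tau + h * xi ord0 i) - cos (dotv z xi + tau) +
      (h * xi ord0 i) * sin (dotv z xi + tau)) * g xi.
    rewrite /F dotvDl dotvZl dotv_evecl addrA cosDpihalf.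
    by rewrite (_ : h * xi ord0 i + dotv z xi + tau = dotv z xi + tau + h * xi ord0 i); [ring|ring].
  rewrite normrM [h ^+ 2 * _]mulrA; apply: ler_pM => //.
  apply: le_trans (cos_taylor1 _ _) _; rewrite exprMn ler_wpM2l ?sqr_ge0//.
  rewrite -[leLHS]ger0_norm ?sqr_ge0// normrX lerXn2r ?nnegrE ?(ltW r0)//.
  by apply: le_trans (ler_coord _ _) xr.
- by move=> xi; rewrite subr0 => xr; rewrite /F g0// !mulr0 !subr0.
Qed.

Lemma is_derive_KK tau z i :
  is_derive z (evec i) (KK tau g) (KK (tau + pi / 2) (fun xi => xi ord0 i * g xi) z).
Proof.
set D := KK (tau + _) _ z.
pose L := r ^+ 2 * B * (8 * r) ^+ n.
have L0 : 0 <= L.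
  rewrite mulr_ge0 ?exprn_ge0//; first by nneg.
  by nneg.
have H : (fun h : R => h^-1 *: ((KK tau g \o shift z) (h *: evec i) - KK tau g z)) @ 0^' --> D.
  apply/cvgrPdist_le => e e0; near=> h.
  have h0 : h != 0 by near: h; exact: nbhs_dnbhs_neq.
  have hp : 0 < `|h| by rewrite normr_gt0.
  rewrite /= -(ler_pM2l hp) -normrM mulrBr [h * (_ *: _)]mulrA mulfV// mul1r distrC.
  apply: le_trans (KK_diff _ _ _ _) _; rewrite -/L -real_normK ?num_real// expr2 -mulrA.
  rewrite ler_pM2l//.
  apply: (@le_trans _ _ (e / (L + 1) * L)).
    rewrite ler_wpM2r//; near: h; apply: dnbhs0_le; rewrite divr_gt0// ltr_wpDl//.
  by rewrite mulrAC ler_pdivrMr ?ltr_wpDl// ler_pM2l// lerDl.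
have e : 'D_(evec i) (KK tau g) z = D by apply/cvg_lim.
by split=> //; apply/cvg_ex; exists D.
Unshelve. all: by end_near. Qed.

End kernel_of.

Lemma is_derive_sindot tau z i xi :
  is_derive xi (evec i) (fun xi => sin (dotv z xi + tau)) (z ord0 i * cos (dotv z xi + tau)).
Proof.
rewrite -{1}[xi]addr0 -{1}(scale0r (evec i)); apply/is_derive_line.
rewrite (_ : (fun s : R => _) = fun s : R => sin (dotv z xi + tau + s * z ord0 i)); last first.
  apply/funext => s; congr sin; rewrite [dotv z (_ + _)]dotvC dotvDl dotvZl dotv_evecl.
  by rewrite dotvC addrAC.
apply: is_derive_eq; rewrite /GRing.scale/= !(mul0r, mulr0, addr0, add0r, mulr1).
by rewrite mul1r mulrC.
Qed.

(** The derivative of [sin (dotv z xi + tau) * g xi] along [i] has integral 0 by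
    [Rintegral_derive0]. *)
Lemma KK_ibp g (B r tau : R) z i : meas g -> 0 < r -> (forall xi, derivable g xi (evec i)) ->
  (forall xi, `|g xi| <= B) -> (forall xi, `|'D_(evec i) g xi| <= B) ->
  (forall xi, r < `|xi| -> g xi = 0) -> (forall xi, r < `|xi| -> 'D_(evec i) g xi = 0) ->
  z ord0 i * KK tau g z = KK (tau + pi / 2) ('D_(evec i) g) z.
Proof.
move=> mg r0 dg gB DB g0 D0.
have B0 : 0 <= B by apply: le_trans (gB 0).
pose G xi := sin (dotv z xi + tau) * g xi.
have [iK _] := KK_bound mg r0 B0 gB g0 tau z.
have [mD _] := Rintegral_derive0 mg dg gB DB g0.
have [iD _] := KK_bound mD r0 B0 DB D0 (tau + pi / 2) z.
have dG xi : is_derive xi (evec i) G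
   (z ord0 i * (cos (dotv z xi + tau) * g xi) - cos (dotv z xi + (tau + pi / 2)) * 'D_(evec i) g xi).
  have h := is_deriveM (is_derive_sindot tau z i xi) (derivableP (dg xi)).
  rewrite (_ : G = (fun xi => sin (dotv z xi + tau)) * g)//.
  apply: is_derive_eq; rewrite addrA cosDpihalf mulNr opprK.
  by rewrite /GRing.scale/=; ring.
have DE xi : 'D_(evec i) G xi = z ord0 i * (cos (dotv z xi + tau) * g xi) -
    cos (dotv z xi + (tau + pi / 2)) * 'D_(evec i) g xi by case: (dG xi).
have mG : meas G.
  apply: measurable_funM => //; apply: (measurableT_comp (f := @sin R)).
    by apply: continuous_measurable_fun; exact: continuous_sin.
  by apply: measurable_funD; [exact: meas_dotv|exact: measurable_cst].
have zB : 0 <= `|z ord0 i| * B by nneg.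
have [||||_] := @Rintegral_derive0 G (evec i) (B + `|z ord0 i| * B) r mG.
- by move=> xi; case: (dG xi).
- move=> xi; apply: le_trans (_ : B <= _); last by rewrite lerDl.
  by rewrite normrM -[B]mul1r ler_pM// sin_le1'.
- move=> xi; rewrite DE.
  apply: le_trans (ler_normB _ _) _; rewrite !normrM addrC; apply: lerD.
    by rewrite -[B]mul1r ler_pM// cos_le1'.
  by rewrite ler_wpM2l// -[B]mul1r ler_pM// cos_le1'.
- by move=> xi xr; rewrite /G g0// mulr0.
have -> : ('D_(evec i) G) = fun xi => z ord0 i * (cos (dotv z xi + tau) * g xi) -
    cos (dotv z xi + (tau + pi / 2)) * 'D_(evec i) g xi.
  by apply/funext => xi; rewrite DE.
rewrite RintegralB//; last exact: (integrableZl _ _ iK).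
by rewrite RintegralZl// => /eqP; rewrite subr_eq0 => /eqP.
Qed.
End real_analysis.

(** * Decay of the kernels *)

Section kernel_decay.
Context {R : realType} {n : nat}.
Implicit Types (x y z v xi : 'rV[R]_n) (f g m : 'rV[R]_n -> R).

Definition iD (i : 'I_n) k f : 'rV[R]_n -> R := iter k (fun g => 'D_(evec i) g) f.

Lemma is_derive_powX (x : R) a : is_derive x 1 (fun s : R => s ^+ a) (a%:R * x ^+ a.-1).
Proof.
elim: a => [|a IH]; first by rewrite mul0r; exact: is_derive_cst.
have h := is_deriveM (is_derive_id x 1) IH.
rewrite (_ : a.+1%:R * _ = x *: (a%:R * x ^+ a.-1) + x ^+ a *: 1).
  have -> : (fun s : R => s ^+ a.+1) = id * (fun s : R => s ^+ a).
    by apply/funext => s; rewrite exprS.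
  exact: h.
rewrite /GRing.scale/= mulr1; case: a {IH h} => [|a]; first by rewrite mul0r mulr0 add0r mul1r.
by rewrite mulrCA -exprS -natr1 mulrDl mul1r.
Qed.

Lemma is_derive_powV (f : R -> R) (x df : R) b : (b == 0%N) || (f x != 0) -> is_derive x 1 f df ->
  is_derive x 1 (fun s => f s ^- b) (- (b%:R * df * f x ^- b.+1)).
Proof.
have [->|b0] := eqVneq b 0%N.
  move=> _ _; rewrite !mul0r oppr0 (_ : (fun s => _) = cst 1); first exact: is_derive_cst.
  by apply/funext => s; rewrite expr0 invr1.
move=> /= fx Df.
have D1 : is_derive x 1 (fun s => f s ^+ b) (b%:R * f x ^+ b.-1 * df).
  exact: (@is_derive1_comp _ (fun s : R => s ^+ b) f x _ _ (is_derive_powX (f x) b) Df).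
have fb : f x ^+ b != 0 by rewrite expf_neq0.
have h := is_deriveV (f := fun s => f s ^+ b) fb D1.
rewrite (_ : - _ = - (f x ^+ b) ^- 2 *: (b%:R * f x ^+ b.-1 * df)); first exact: h.
rewrite /GRing.scale/= mulNr; congr (- _).
case: b b0 fb {D1 h} => [//|b] _ fb; rewrite /= !exprS; field.
by rewrite fx/= expf_neq0.
Qed.

Lemma rV_norm_arg z : (0 < n)%N -> exists i, `|z| = `|z ord0 i|.
Proof.
move=> n0; pose i0 := Ordinal n0.
have [i _ hi] := @Order.TotalTheory.arg_maxP _ _ _ i0 predT (fun i => `|z ord0 i|) isT.
exists i; apply/eqP; rewrite eq_le ler_coord andbT; apply: ler_rV_norm => // k; exact: hi.
Qed.

Variables (i : 'I_n) (K : nat) (al : R) (c : nat -> R).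
Hypotheses (K0 : (0 < K)%N) (al0 : 0 < al) (c0 : forall k, 0 <= c k).

(** A smooth substitute for [|xi| ^ (2 * K)]. As a sum of powers of single coordinates it has
    monomials as partial derivatives, which keeps the class [term] stable. *)
Definition rho xi : R := \sum_k xi ord0 k ^+ (2 * K).

(** The properties of one member of a system in [in_Phi] along one direction, with [t = 2 ^ j];
    [ann] separates the annuli from the ball of [j = 0], which is not kept away from the origin. *)
Record bump (t : R) (ann : bool) (th : 'rV[R]_n -> R) : Prop := Bump {
  bump_der : forall k xi, derivable (iD i k th) xi (evec i);
  bump_meas : forall k, meas (iD i k th);
  bump_le : forall k xi, `|iD i k th xi| <= c k * t ^- k;
  bump_supp : forall k xi, 2 * t < `|xi| -> iD i k th xi = 0;
  bump_ann : ann -> forall k xi, `|xi| < al * t -> iD i k th xi = 0 }.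

(** The functions met when integrating by parts repeatedly along [i]; the factors that do not
    involve the coordinate [i] are collected in [m]. *)
Definition term th k a m b xi : R := iD i k th xi * (xi ord0 i ^+ a * m xi) * rho xi ^- b.

Definition inv_along m := forall xi (s : R), m (xi + s *: evec i) = m xi.

Lemma rho_ge xi : `|xi| ^+ (2 * K) <= rho xi.
Proof.
have [n0|] := ltnP 0 n; last first.
  move=> n0; rewrite (_ : xi = 0) ?normr0 ?expr0n ?muln_eq0/= ?gtn_eqF//.
    by apply: sumr_ge0 => k _; rewrite mulnC exprM sqr_ge0.
  by apply/rowP => k; have := leq_trans (ltn_ord k) n0.
have [k ->] := rV_norm_arg xi n0; rewrite /rho (bigD1 k)//= -normrX ger0_norm.
  by rewrite lerDl; apply: sumr_ge0 => l _; rewrite mulnC exprM sqr_ge0.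
by rewrite mulnC exprM sqr_ge0.
Qed.

Lemma rho_neq0 xi : xi != 0 -> rho xi != 0.
Proof.
move=> x0; rewrite gt_eqF//; apply: lt_le_trans (rho_ge xi).
by rewrite exprn_gt0// normr_gt0.
Qed.

Lemma rho_line xi (s : R) : rho (xi + s *: evec i) =
  (xi ord0 i + s) ^+ (2 * K) + \sum_(k | k != i) xi ord0 k ^+ (2 * K).
Proof.
rewrite /rho (bigD1 i)//=; congr (_ + _).
  by rewrite !mxE !eqxx mulr1.
by apply: eq_bigr => k ki; rewrite !mxE (negPf ki) andbF mulr0 addr0.
Qed.

Lemma is_derive_term t ann th k a m b xi : bump t ann th -> 0 < t -> inv_along m ->
  (b == 0%N) || ann ->
  is_derive xi (evec i) (term th k a m b)
    (term th k.+1 a m b xi + a%:R * term th k a.-1 m b xi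
     - (2 * K * b)%:R * term th k (a + (2 * K).-1) m b.+1 xi).
Proof.
move=> bt t0 im hb.
(* At the origin [rho ^- b] with [b != 0] is singular, but then the annulus condition makes the
   bump, hence the whole product, vanish nearby. *)
have [/andP[b0 /eqP x0]|hx] := boolP ((b != 0%N) && (xi == 0)).
  have an : ann by move: hb; rewrite (negPf b0).
  have z0 l y : `|y| < al * t -> iD i l th y = 0 by move=> h; exact: (bump_ann bt).
  have at0 : 0 < al * t by nneg.
  have zx l : iD i l th xi = 0 by apply: z0; rewrite x0 normr0.
  rewrite /term !zx !mul0r !mulr0 !addr0 subr0.
  have hc := is_derive_cst (0 : R) xi (evec i); apply: near_eq_is_derive hc.
  rewrite x0; near=> y; rewrite z0 ?mul0r//; near: y; exact: nbhs0_lt.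
have rb : (b == 0%N) || (rho xi != 0).
  by move: hx; rewrite negb_and negbK => /orP[->//|/rho_neq0 ->]; rewrite orbT.
rewrite -[X in is_derive X]addr0 -(scale0r (evec i)); apply/is_derive_line.
pose x : R := xi ord0 i; pose rc : R := \sum_(k | k != i) xi ord0 k ^+ (2 * K).
pose u (s : R) := iD i k th (xi + s *: evec i).
pose v (s : R) := (x + s) ^+ a * m xi.
pose w (s : R) := ((x + s) ^+ (2 * K) + rc) ^- b.
have rE : rho xi = (x + 0) ^+ (2 * K) + rc by rewrite -rho_line scale0r addr0.
have -> : (fun s : R => term th k a m b (xi + s *: evec i)) = u * v * w.
  by apply/funext => s; rewrite /term im rho_line !mxE !eqxx mulr1.
have hu : is_derive (0 : R) (1 : R) u (iD i k.+1 th xi).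
  apply/is_derive_line; rewrite scale0r addr0; exact/derivableP/(bump_der bt).
have hs (e : nat) : is_derive (0 : R) 1 (fun s => (x + s) ^+ e) (e%:R * x ^+ e.-1).
  have xs : is_derive (0 : R) (1 : R) (cst x + id : R -> R) 1.
    rewrite -[X in is_derive _ _ _ X]add0r; apply: is_deriveD.
  have pw := is_derive_powX (x + 0) e.
  have := @is_derive1_comp _ (fun s : R => s ^+ e) (cst x + id : R -> R) 0 _ _ pw xs.
  by rewrite mulr1 addr0.
have hv : is_derive (0 : R) (1 : R) v (a%:R * x ^+ a.-1 * m xi).
  have e := is_deriveM (hs a) (is_derive_cst (m xi) (0 : R) 1).
  rewrite (_ : v = (fun s => (x + s) ^+ a) * cst (m xi))//; apply: is_derive_eq.
  by rewrite /GRing.scale/= mulr0 add0r mulrC.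
have hw : is_derive (0 : R) (1 : R) w (- (b%:R * ((2 * K)%:R * x ^+ (2 * K).-1) * rho xi ^- b.+1)).
  rewrite rE; apply: (@is_derive_powV (fun s => (x + s) ^+ (2 * K) + rc)).
    by rewrite -rE.
  have e := is_deriveD (hs (2 * K)%N) (is_derive_cst rc (0 : R) 1).
  rewrite (_ : (fun s => _) = (fun s => (x + s) ^+ (2 * K)) + cst rc)//.
  by apply: is_derive_eq; rewrite addr0.
have h := is_deriveM (is_deriveM hu hv) hw.
have u0 : u 0 = iD i k th xi by rewrite /u scale0r addr0.
have v0 : v 0 = x ^+ a * m xi by rewrite /v addr0.
have w0 : w 0 = rho xi ^- b by rewrite /w -rE.
have uv0 : (u * v) 0 = iD i k th xi * (x ^+ a * m xi) by rewrite mulrfctE u0 v0.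
apply: is_derive_eq; rewrite uv0 u0 v0 w0 /GRing.scale/= /term -/x exprD !natrM.
rewrite -[iD i k.+1 th xi]/('D_(evec i) (iD i k th) xi).
move: ('D_(evec i) (iD i k th) xi) (iD i k th xi) (m xi) => d1 d2 d3.
move: (rho xi ^- b) (rho xi ^- b.+1) (x ^+ a) (x ^+ a.-1) (x ^+ (2 * K).-1) => u1 u2 u3 u4 u5.
ring.
Unshelve. all: by end_near. Qed.

Lemma term_bound t ann th k a m (mm : R) b : bump t ann th -> 0 < t -> 0 <= mm ->
  (forall xi, `|xi| <= 2 * t -> `|m xi| <= mm) -> (b == 0%N) || ann -> forall xi,
  `|term th k a m b xi| <= c k * t ^- k * ((2 * t) ^+ a * mm) * (al * t) ^- (2 * K * b).
Proof.
move=> bt t0 mm0 hm hb xi.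
have at0 : 0 < al * t by nneg.
have R0 : 0 <= c k * t ^- k * ((2 * t) ^+ a * mm) * (al * t) ^- (2 * K * b).
  have t00 := ltW t0; have at00 := ltW at0.
  apply: mulr_ge0; last by nneg.
  apply: mulr_ge0; first by nneg.
  by nneg.
have [xt|xt] := ltP (2 * t) `|xi|.
  by rewrite /term (bump_supp bt)// !mul0r normr0.
have [/andP[an xa]|hx] := boolP (ann && (`|xi| < al * t)).
  by rewrite /term (bump_ann bt)// !mul0r normr0.
rewrite /term !normrM; apply: ler_pM; rewrite ?mulr_ge0//.
  apply: ler_pM; rewrite ?mulr_ge0//; first exact: (bump_le bt).
  apply: ler_pM => //; last exact: hm.
  by rewrite normrX lerXn2r ?nnegrE ?mulr_ge0 ?(ltW t0)// (le_trans (ler_coord _ _)).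
have [b0|b0] := eqVneq b 0%N; first by rewrite b0 muln0 !expr0 invr1 normr1.
have an : ann by move: hb; rewrite (negPf b0).
move: hx; rewrite an -leNgt/= => hx.
have r0 : (al * t) ^+ (2 * K) <= rho xi.
  by apply: le_trans (rho_ge xi); rewrite lerXn2r ?nnegrE ?(ltW at0).
have rp : 0 < rho xi by apply: lt_le_trans r0; rewrite exprn_gt0.
rewrite gtr0_norm ?invr_gt0 ?exprn_gt0// exprM lef_pV2 ?posrE ?exprn_gt0// ?exprn_gt0//.
by rewrite lerXn2r ?nnegrE ?(ltW rp) ?exprn_ge0// ltW.
Qed.

Lemma meas_rho : meas rho.
Proof. by apply: measurable_sum => k; apply: measurable_funX; exact: measurable_rV_coord. Qed.

Lemma meas_term t ann th k a m b : bump t ann th -> meas m -> meas (term th k a m b).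
Proof.
move=> bt mm; apply: measurable_funM.
  apply: measurable_funM; first exact: (bump_meas bt).
  by apply: measurable_funM => //; apply: measurable_funX; exact: measurable_rV_coord.
by apply: meas_funV; apply: measurable_funX; exact: meas_rho.
Qed.

Lemma KK_lin3 (g1 g2 g3 : 'rV[R]_n -> R) (B r u v tau : R) z : meas g1 -> meas g2 -> meas g3 ->
  0 < r -> 0 <= B -> (forall xi, `|g1 xi| <= B) -> (forall xi, `|g2 xi| <= B) ->
  (forall xi, `|g3 xi| <= B) -> (forall xi, r < `|xi| -> g1 xi = 0) ->
  (forall xi, r < `|xi| -> g2 xi = 0) -> (forall xi, r < `|xi| -> g3 xi = 0) ->
  KK tau (fun xi => g1 xi + u * g2 xi - v * g3 xi) z =
  KK tau g1 z + u * KK tau g2 z - v * KK tau g3 z.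
Proof.
move=> m1 m2 m3 r0 B0 b1 b2 b3 z1 z2 z3.
have [i1 _] := KK_bound m1 r0 B0 b1 z1 tau z; have [i2 _] := KK_bound m2 r0 B0 b2 z2 tau z.
have [i3 _] := KK_bound m3 r0 B0 b3 z3 tau z.
rewrite /KK -!RintegralZl// -RintegralD//; last exact: (integrableZl _ _ i2).
rewrite -RintegralB//.
- by congr Rintegral; apply/funext => xi; ring.
- exact: (integrableD _ i1 (integrableZl _ _ i2)).
- exact: (integrableZl _ _ i3).
Qed.

Lemma ler_norm3 (u1 u2 u3 a v B1 B2 B3 : R) : 0 <= a -> 0 <= v -> `|u1| <= B1 -> `|u2| <= B2 ->
  `|u3| <= B3 -> `|u1 + a * u2 - v * u3| <= B1 + a * B2 + v * B3.
Proof.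
move=> a0 v0 h1 h2 h3; apply: le_trans (ler_normB _ _) _.
rewrite lerD// ?normrM ?(ger0_norm v0) ?ler_wpM2l//.
apply: le_trans (ler_normD _ _) _.
by rewrite normrM (ger0_norm a0) lerD// ler_wpM2l.
Qed.

(** Each integration by parts along [i] trades one factor [z_i] for a derivative of [term], a
    combination of three terms that are all smaller by the factor [1 / t] on the support. *)
Lemma KK_decay M k a b : exists2 C, 0 <= C & forall t ann th m (mm : R) tau z, 0 < t ->
  bump t ann th -> inv_along m -> meas m -> 0 <= mm ->
  (forall xi, `|xi| <= 2 * t -> `|m xi| <= mm) -> (b == 0%N) || ann ->
  (t * `|z ord0 i|) ^+ M * `|KK tau (term th k a m b) z| <=
    C * mm * (t ^+ n * t ^+ a * t ^- k * t ^- (2 * K * b)).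
Proof.
elim: M k a b => [|M IH] k a b.
  exists (c k * 2 ^+ a * al ^- (2 * K * b) * 16 ^+ n).
    by nneg.
  move=> t ann th m mm tau z t0 bt im mm_ mm0 hm hb; rewrite expr0 mul1r.
  have t20 : 0 < 2 * t by nneg.
  have B0 : 0 <= c k * t ^- k * ((2 * t) ^+ a * mm) * (al * t) ^- (2 * K * b).
    by apply: le_trans (term_bound k a bt t0 mm0 hm hb 0).
  have [|_] := KK_bound (meas_term k a b bt mm_) t20 B0 (term_bound k a bt t0 mm0 hm hb) _ tau z.
    by move=> xi xt; rewrite /term (bump_supp bt)// !mul0r.
  move/le_trans; apply; rewrite le_eqVlt; apply/orP; left; apply/eqP.
  have -> : 8 * (2 * t) = 16 * t by ring.
  rewrite !exprMn invfM; move: (t ^+ n) (t ^+ a) (t ^- k) (t ^- (2 * K * b)) (16 ^+ n) => u1 u2 u3 u4 u5.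
  by ring.
have [C1 C10 H1] := IH k.+1 a b; have [C2 C20 H2] := IH k a.-1 b.
have [C3 C30 H3] := IH k (a + (2 * K).-1)%N b.+1.
exists (C1 + a%:R * C2 + (2 * K * b)%:R * C3) => [|t ann th m mm tau z t0 bt im mm_ mm0 hm hb].
  by nneg.
have t20 : 0 < 2 * t by nneg.
set g := term th k a m b; set g1 := term th k.+1 a m b; set g2 := term th k a.-1 m b.
pose v : R := (2 * K * b)%:R.
(* For [b = 0] the third summand carries the coefficient 0; it is replaced by the zero function,
   since a [term] with a positive power of [1 / rho] is only controlled on an annulus. *)
pose g3 := if b == 0%N then cst 0 else term th k (a + (2 * K).-1) m b.+1.
have hb3 : b != 0%N -> (b.+1 == 0%N) || ann by move: hb; case: (b == 0%N).
have vE xi : v * term th k (a + (2 * K).-1) m b.+1 xi = v * g3 xi.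
  by rewrite /g3 /v; case: eqVneq => [->|//]; rewrite muln0 !mul0r.
have Dg : 'D_(evec i) g = fun xi => g1 xi + a%:R * g2 xi - v * g3 xi.
  apply/funext => xi; rewrite -vE.
  by case: (@is_derive_term t ann th k a m b xi bt t0 im hb).
have dg xi : derivable g xi (evec i) by case: (@is_derive_term t ann th k a m b xi bt t0 im hb).
have z_ k' a' b' xi : 2 * t < `|xi| -> term th k' a' m b' xi = 0.
  by move=> xt; rewrite /term (bump_supp bt)// !mul0r.
have z3 xi : 2 * t < `|xi| -> g3 xi = 0 by rewrite /g3; case: ifP => // _; exact: z_.
have m3 : meas g3.
  by rewrite /g3; case: ifP => _; [exact: measurable_cst|exact: meas_term bt mm_].
have m_ k' a' : meas (term th k' a' m b) by exact: meas_term bt mm_.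
have [B [B0 bg bg1 bg2 bg3]] : exists B : R, [/\ 0 <= B, forall xi, `|g xi| <= B,
    forall xi, `|g1 xi| <= B, forall xi, `|g2 xi| <= B & forall xi, `|g3 xi| <= B].
  have ex k' a' b' : (b' == 0%N) || ann -> exists u : R, forall xi, `|term th k' a' m b' xi| <= u.
    by move=> hb'; eexists => xi; exact: (term_bound k' a' bt t0 mm0 hm hb').
  have [u0 h0'] := ex k a b hb; have [u1 h1'] := ex k.+1 a b hb; have [u2 h2'] := ex k a.-1 b hb.
  have [u hu] : exists u : R, forall xi, `|g3 xi| <= u.
    rewrite /g3; case: eqVneq => [_|bn]; first by exists 0 => xi; rewrite normr0.
    exact: ex (hb3 bn).
  exists (u0 + u1 + u2 + u).
  have p0 : 0 <= u0 by apply: le_trans (h0' 0).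
  have p1 : 0 <= u1 by apply: le_trans (h1' 0).
  have p2 : 0 <= u2 by apply: le_trans (h2' 0).
  have p3 : 0 <= u by apply: le_trans (hu 0).
  split=> [|xi|xi|xi|xi]; first by nneg.
  - by apply: le_trans (h0' xi) _; lra.
  - by apply: le_trans (h1' xi) _; lra.
  - by apply: le_trans (h2' xi) _; lra.
  - by apply: le_trans (hu xi) _; lra.
have v0 : 0 <= v by rewrite ler0n.
pose B' := B + a%:R * B + v * B.
have BB' : B <= B' by rewrite /B' -addrA lerDl addr_ge0// mulr_ge0.
have DgE xi : 'D_(evec i) g xi = g1 xi + a%:R * g2 xi - v * g3 xi := congr1 (@^~ xi) Dg.
have DB xi : `|'D_(evec i) g xi| <= B'.
  by rewrite DgE; apply: ler_norm3.
have ibp := KK_ibp tau z (m_ k a) t20 dg (fun xi => le_trans (bg xi) BB') DB (z_ k a b) _.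
have zK : `|z ord0 i| * `|KK tau g z| =
    `|KK (tau + pi / 2) g1 z + a%:R * KK (tau + pi / 2) g2 z - v * KK (tau + pi / 2) g3 z|.
  rewrite -normrM ibp; last by move=> xi xt; rewrite DgE /g1 /g2 !z_// z3// !mulr0 addr0 subr0.
  rewrite -/g Dg (KK_lin3 _ _ _ _ (m_ _ _) (m_ _ _) m3 t20 B0 bg1 bg2 bg3 _ _ z3)//; exact: z_.
have -> : (t * `|z ord0 i|) ^+ M.+1 * `|KK tau g z| =
    t * ((t * `|z ord0 i|) ^+ M * (`|z ord0 i| * `|KK tau g z|)) by rewrite exprS; ring.
rewrite zK.
set tM := (t * `|z ord0 i|) ^+ M.
have tM0 : 0 <= tM by nneg.
have t00 := ltW t0.
pose W := t ^+ n * t ^+ a * t ^- k * t ^- (2 * K * b).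
have W0 : 0 <= W by rewrite /W !mulr_ge0 ?invr_ge0 ?exprn_ge0.
have q1 : t * (tM * `|KK (tau + pi / 2) g1 z|) <= C1 * mm * W.
  have h := H1 t ann th m mm (tau + pi / 2) z t0 bt im mm_ mm0 hm hb.
  apply: le_trans (ler_wpM2l t00 h) _; rewrite le_eqVlt; apply/orP; left; apply/eqP.
  rewrite /W [t ^+ k.+1]exprS invfM mulrCA; congr (_ * _).
  move: (t ^- (2 * K * b)) (t ^+ n) (t ^+ a) (t ^- k) => u1 u2 u3 u4.
  by field; rewrite gt_eqF.
have q2 : t * (tM * (a%:R * `|KK (tau + pi / 2) g2 z|)) <= a%:R * C2 * mm * W.
  have h := H2 t ann th m mm (tau + pi / 2) z t0 bt im mm_ mm0 hm hb; rewrite -/g2 -/tM in h.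
  case: (eqVneq a 0%N) => [->|an0]; first by rewrite !mul0r !mulr0.
  have aE : t ^+ a = t * t ^+ a.-1 by rewrite -exprS prednK// lt0n.
  rewrite [tM * _]mulrCA [t * _]mulrCA -(mulrA a%:R) -(mulrA a%:R) ler_wpM2l//.
  apply: le_trans (ler_wpM2l t00 h) _; rewrite /W aE.
  rewrite le_eqVlt; apply/orP; left; apply/eqP.
  by move: (t ^+ a.-1) (t ^+ n) (t ^- k) (t ^- _) => u1 u2 u3 u4; ring.
have q3 : t * (tM * (v * `|KK (tau + pi / 2) g3 z|)) <= v * C3 * mm * W.
  case: (eqVneq b 0%N) => [b0|bn0]; first by rewrite /v b0 muln0 !mul0r !mulr0.
  have h := H3 t ann th m mm (tau + pi / 2) z t0 bt im mm_ mm0 hm (hb3 bn0); rewrite -/tM in h.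
  rewrite /g3 (negPf bn0) [tM * _]mulrCA [t * _]mulrCA -(mulrA v) -(mulrA v) ler_wpM2l//.
  apply: le_trans (ler_wpM2l t00 h) _.
  rewrite le_eqVlt; apply/orP; left; apply/eqP; rewrite /W.
  have -> : t ^+ (a + (2 * K).-1) = t ^+ a * (t ^+ (2 * K) / t).
    rewrite exprD; congr (_ * _); rewrite -[in RHS](prednK (_ : 0 < 2 * K)%N) ?muln_gt0//.
    by rewrite exprS mulrC mulKf// gt_eqF.
  have -> : t ^- (2 * K * b.+1) = t ^- (2 * K) * t ^- (2 * K * b) by rewrite mulnS exprD invfM.
  have tK : t ^+ (2 * K) != 0 by rewrite expf_neq0// gt_eqF.
  move: (t ^+ (2 * K)) (t ^+ a) (t ^+ n) (t ^- k) (t ^- (2 * K * b)) tK => u0 u1 u2 u3 u4 u00.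
  by field; rewrite u00 gt_eqF.
have tri : `|KK (tau + pi / 2) g1 z + a%:R * KK (tau + pi / 2) g2 z - v * KK (tau + pi / 2) g3 z| <=
  `|KK (tau + pi / 2) g1 z| + a%:R * `|KK (tau + pi / 2) g2 z| + v * `|KK (tau + pi / 2) g3 z|.
  by apply: ler_norm3.
rewrite -/W; apply: le_trans (ler_wpM2l t00 (ler_wpM2l tM0 tri)) _.
move: q1 q2 q3; rewrite -/v !mulrDr !mulrDl => q1 q2 q3.
by rewrite !lerD.
Qed.

End kernel_decay.

Section kernel_estimates.
Context {R : realType} {n : nat}.
Implicit Types (x y z v xi : 'rV[R]_n) (f g m : 'rV[R]_n -> R).

(** For [t * |z| <= 1] the undecayed bound suffices; otherwise the sup norm is attained at some
    coordinate, whose bound is used. *)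
Lemma om_decay M (t k D : R) z : (0 < n)%N -> 0 <= t -> 0 <= k -> k <= D ->
  (forall i, (t * `|z ord0 i|) ^+ M * k <= D) -> k <= 2 ^+ M * D * (1 + t * `|z|) ^- M.
Proof.
move=> n0 t0 k0 kD H.
have o1 : 0 < 1 + t * `|z| by nneg.
rewrite ler_pdivlMr ?exprn_gt0// mulrC.
have D0 : 0 <= D by apply: le_trans kD.
have [tz|/ltW tz] := leP (t * `|z|) 1.
  by apply: ler_pM; rewrite ?exprn_ge0 ?(ltW o1)// lerXn2r ?nnegrE ?(ltW o1)//; lra.
have [i zi] := rV_norm_arg z n0.
apply: (@le_trans _ _ (2 ^+ M * ((t * `|z ord0 i|) ^+ M * k))); last by rewrite ler_wpM2l ?exprn_ge0.
rewrite mulrA ler_wpM2r// -exprMn lerXn2r ?nnegrE ?(ltW o1)//.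
  by nneg.
by rewrite -zi; lra.
Qed.

Lemma fin_bound (P : 'I_n -> R -> Prop) : (forall i a b, a <= b -> P i a -> P i b) ->
  (forall i, exists2 C, 0 <= C & P i C) -> exists2 C, 0 <= C & forall i, P i C.
Proof.
move=> mP H; have /choice[C hC] : forall i, exists C, 0 <= C /\ P i C.
  by move=> i; have [C] := H i; exists C.
exists (\sum_i C i) => [|i]; first by apply: sumr_ge0 => i _; case: (hC i).
have [_] := hC i; apply: mP; rewrite (bigD1 i)//= lerDl.
by apply: sumr_ge0 => k _; case: (hC k).
Qed.

(** Monomials as words in the coordinates, suited to inductions that treat one factor at a time;
    [mon_mpow] links them to multi-indices. *)
Definition mon (be : seq 'I_n) xi : R := \prod_(i <- be) xi ord0 i.

Lemma meas_mon be : meas (mon be).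
Proof.
rewrite /mon; elim: be => [|i be IH].
  by under eq_fun do rewrite big_nil; exact: measurable_cst.
under eq_fun do rewrite big_cons.
by apply: measurable_funM => //; exact: measurable_rV_coord.
Qed.

Lemma mon_le be (r : R) xi : `|xi| <= r -> `|mon be xi| <= r ^+ size be.
Proof.
move=> xr; have r0 : 0 <= r by apply: le_trans xr.
rewrite /mon; elim: be => [|i be IH]; first by rewrite big_nil normr1 expr0.
by rewrite big_cons normrM /= exprS ler_pM// (le_trans (ler_coord _ _)).
Qed.

Lemma mon_split i be xi :
  mon be xi = xi ord0 i ^+ count_mem i be * mon [seq k <- be | k != i] xi.
Proof.
rewrite /mon; elim: be => [|k be IH]; first by rewrite !big_nil mulr1.
rewrite big_cons IH /=; have [->|ki] /= := eqVneq k i; first by rewrite add1n exprS mulrA.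
by rewrite add0n big_cons mulrCA.
Qed.

Lemma mon_inv i be : inv_along i (mon [seq k <- be | k != i]).
Proof.
move=> xi s; rewrite /mon !big_filter; apply: eq_bigr => k ki.
by rewrite !mxE (negPf ki) andbF mulr0 addr0.
Qed.

Hypothesis n0 : (0 < n)%N.
Variables (th : nat -> 'rV[R]_n -> R) (al : R) (c : 'I_n -> nat -> R).
Hypotheses (al0 : 0 < al) (c0 : forall i k, 0 <= c i k).
Hypothesis hth : forall j i, bump i al (c i) (2 ^+ j) (0 < j)%N (th j).

(** A factor [mon be] represents derivatives of the kernel. For each direction [i] it splits into a
    power of [xi_i] and a factor free of [xi_i], the shape that [KK_decay] accepts. *)
Lemma kern1 M be : exists2 C, 0 <= C & forall j tau z,
  `|KK tau (fun xi => mon be xi * th j xi) z| <= C * 2 ^+ (j * (n + size be)) * (1 + 2 ^+ j * `|z|) ^- M.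
Proof.
pose P M' i (C : R) := forall j tau z, (2 ^+ j * `|z ord0 i|) ^+ M' *
   `|KK tau (fun xi => mon be xi * th j xi) z| <= C * 2 ^+ (j * (n + size be)).
have H M' i : exists2 C, 0 <= C & P M' i C.
  have [C C0 HC] := KK_decay i (ltn0Sn 0) al0 (c0 i) M' 0 (count_mem i be) 0.
  exists (C * 2 ^+ size [seq k <- be | k != i]) => [|j tau z]; first by nneg.
  have t0 : 0 < 2 ^+ j :> R by nneg.
  have r0 : 0 <= (2 * 2 ^+ j : R) ^+ size [seq k <- be | k != i] by nneg.
  have := HC _ _ _ (mon [seq k <- be | k != i]) _ tau z t0 (hth j i) (mon_inv i be)
    (meas_mon _) r0 (fun xi h => mon_le _ h) isT.
  have -> : term i 1 (th j) 0 (count_mem i be) (mon [seq k <- be | k != i]) 0 =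
      (fun xi => mon be xi * th j xi).
    by apply/funext => xi; rewrite /term expr0 invr1 mulr1 -mon_split mulrC.
  move/le_trans; apply; rewrite !muln0 !expr0 !invr1 !mulr1 exprMn -!mulrA.
  rewrite ler_wpM2l// ler_wpM2l ?exprn_ge0// mulrCA -!exprM -!exprD.
  rewrite le_eqVlt; apply/orP; left; apply/eqP; congr (_ ^+ _).
  have <- : (size [seq k <- be | k != i] + count_mem i be = size be)%N.
    by rewrite size_filter addnC; exact: count_predC.
  by rewrite !mulnDr.
have mono M' i (a b : R) : a <= b -> P M' i a -> P M' i b.
  by move=> ab h j tau z; apply: le_trans (h j tau z) _; rewrite ler_wpM2r ?exprn_ge0.
have [C C0 HC] := fin_bound (mono M) (H M); have [D D0 HD] := fin_bound (mono 0%N) (H 0%N).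
exists (2 ^+ M * (C + D)) => [|j tau z]; first by nneg.
have p0 : 0 <= 2 ^+ (j * (n + size be)) :> R by nneg.
rewrite -(mulrA (2 ^+ M)); apply: om_decay => //.
  have := HD (Ordinal n0) j tau z; rewrite expr0 mul1r => /le_trans; apply.
  by rewrite ler_wpM2r// lerDr.
by move=> i; apply: le_trans (HC i j tau z) _; rewrite ler_wpM2r// lerDl.
Qed.

(** On the annulus [rho] has size [2 ^ (2 j K)], against [2 ^ (j K)] for the numerator; the gain
    [2 ^- (j * K)] is what the smoothness of the atoms will be measured against. *)
Lemma kern2 M K : (0 < K)%N -> exists2 C, 0 <= C & forall l j tau z, (0 < j)%N ->
  `|KK tau (fun xi => xi ord0 l ^+ K * th j xi / rho K xi) z| <=
     C * (2 ^+ (j * n) * 2 ^- (j * K)) * (1 + 2 ^+ j * `|z|) ^- M.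
Proof.
move=> K0; pose P M' l (C : R) := forall i j tau z, (0 < j)%N -> (2 ^+ j * `|z ord0 i|) ^+ M' *
   `|KK tau (fun xi => xi ord0 l ^+ K * th j xi / rho K xi) z| <= C * (2 ^+ (j * n) * 2 ^- (j * K)).
have t2 j : 0 < 2 ^+ j :> R by nneg.
have mono M' l (a b : R) : a <= b -> P M' l a -> P M' l b.
  move=> ab h i j tau z j0; apply: le_trans (h i j tau z j0) _.
  by rewrite ler_wpM2r// mulr_ge0 ?invr_ge0 ?exprn_ge0.
have H M' l : exists2 C, 0 <= C & P M' l C.
  pose Q i (C : R) := forall j tau z, (0 < j)%N -> (2 ^+ j * `|z ord0 i|) ^+ M' *
     `|KK tau (fun xi => xi ord0 l ^+ K * th j xi / rho K xi) z| <= C * (2 ^+ (j * n) * 2 ^- (j * K)).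
  suff [C C0 HC] : exists2 C, 0 <= C & forall i, Q i C by exists C => // i; exact: HC.
  apply: fin_bound => [i a b ab h j tau z j0|i].
    apply: le_trans (h j tau z j0) _; by rewrite ler_wpM2r// mulr_ge0 ?invr_ge0 ?exprn_ge0.
  have [->|il] := eqVneq i l.
    have [C C0 HC] := KK_decay l K0 al0 (c0 l) M' 0 K 1.
    exists C => // j tau z j0.
    have h1 xi : `|xi| <= 2 * 2 ^+ j -> `|(cst 1 : 'rV[R]_n -> R) xi| <= 1 by rewrite normr1.
    have := HC _ _ _ (cst 1) 1 tau z (t2 j) (hth j l) (fun _ _ => erefl) (measurable_cst _) ler01 h1 j0.
    have -> : term l K (th j) 0 K (cst 1) 1 = (fun xi => xi ord0 l ^+ K * th j xi / rho K xi).
      by apply/funext => xi; rewrite /term expr1 mulr1 [iD _ _ _ _ * _]mulrC.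
    move/le_trans; apply; rewrite mulr1 ler_wpM2l// expr0 invr1 mulr1 muln1 -!exprM mul2n -addnn mulnDr exprD.
    by rewrite invfM -mulrA [_ ^+ (j * K) * _]mulrA divff ?mul1r// expf_neq0// pnatr_eq0.
  have [C C0 HC] := KK_decay i K0 al0 (c0 i) M' 0 0 1.
  exists (C * 2 ^+ K) => [|j tau z j0]; first by nneg.
  have im : inv_along i (fun xi : 'rV[R]_n => xi ord0 l ^+ K).
    by move=> xi s; rewrite !mxE eq_sym (negPf il) andbF mulr0 addr0.
  have mm : meas (fun xi : 'rV[R]_n => xi ord0 l ^+ K).
    by apply: measurable_funX; exact: measurable_rV_coord.
  have r0 : 0 <= (2 * 2 ^+ j : R) ^+ K by nneg.
  have hm xi : `|xi| <= 2 * 2 ^+ j -> `|xi ord0 l ^+ K| <= (2 * 2 ^+ j) ^+ K.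
    by move=> h; rewrite normrX lerXn2r ?nnegrE// ?(le_trans _ h)// (le_trans (ler_coord _ _)).
  have := HC _ _ _ _ _ tau z (t2 j) (hth j i) im mm r0 hm j0.
  have -> : term i K (th j) 0 0 (fun xi : 'rV[R]_n => xi ord0 l ^+ K) 1 =
      (fun xi => xi ord0 l ^+ K * th j xi / rho K xi).
    by apply/funext => xi; rewrite /term expr1 expr0 mul1r [iD _ _ _ _ * _]mulrC.
  move/le_trans; apply; rewrite exprMn -!mulrA ler_wpM2l// ler_wpM2l ?exprn_ge0//.
  rewrite !expr0 invr1 !mul1r muln1 -!exprM mul2n -addnn mulnDr exprD invfM mulrCA ler_wpM2l ?exprn_ge0//.
  by rewrite mulrA divff ?mul1r// expf_neq0// pnatr_eq0.
have [C C0 HC] := fin_bound (mono M) (H M); have [D D0 HD] := fin_bound (mono 0%N) (H 0%N).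
exists (2 ^+ M * (C + D)) => [|l j tau z j0]; first by nneg.
have p0 : 0 <= 2 ^+ (j * n) * 2 ^- (j * K) :> R by nneg.
rewrite -(mulrA (2 ^+ M)); apply: om_decay => //.
  have := HD l (Ordinal n0) j tau z j0; rewrite expr0 mul1r => /le_trans; apply.
  by rewrite ler_wpM2r// lerDr.
by move=> i; apply: le_trans (HC l i j tau z j0) _; rewrite ler_wpM2r// lerDl.
Qed.

End kernel_estimates.

(** * Kernels tested against atoms *)

Section taylor.
Context {R : realType} {n : nat}.
Implicit Types (x y z v xi : 'rV[R]_n) (f g b : 'rV[R]_n -> R) (be : seq 'I_n).

Lemma is_derive_tpoly N (c : nat -> R) (s : R) :
  is_derive s 1 (fun s => \sum_(k < N.+1) s ^+ k / k`!%:R * c k)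
    (\sum_(k < N) s ^+ k / k`!%:R * c k.+1).
Proof.
elim: N => [|N IH].
  rewrite big_ord0 (_ : (fun s => _) = cst (c 0%N)); first exact: is_derive_cst.
  by apply/funext => u; rewrite big_ord1 expr0 fact0 divr1 mul1r.
have -> : (fun s : R => \sum_(k < N.+2) s ^+ k / k`!%:R * c k) =
    (fun s => \sum_(k < N.+1) s ^+ k / k`!%:R * c k) + (c N.+1 / N.+1`!%:R) *: (fun s : R => s ^+ N.+1).
  apply/funext => u; rewrite big_ord_recr/= fctE; congr (_ + _).
  by rewrite -[RHS]/(_ * _) mulrC mulrAC mulrA.
rewrite big_ord_recr/=; apply: is_deriveD.
have H := is_derive_powX s N.+1.
apply: (is_derive_eq (is_deriveZ (c N.+1 / N.+1`!%:R) H)).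
rewrite -[LHS]/(_ * _) /= factS natrM; field.
by rewrite !pnatr_eq0 -lt0n fact_gt0 /= addrC natr1 pnatr_eq0.
Qed.

(** The remainder is stated without the factor [1 / N!], so that each step of the induction is one
    application of the mean value inequality. *)
Lemma taylor1 N f x i (h B : R) : (forall k y, (k < N)%N -> derivable (iD i k f) y (evec i)) ->
  (forall s, `|s| <= h -> `|iD i N f (x + s *: evec i)| <= B) -> forall t : R, `|t| <= h ->
  `|f (x + t *: evec i) - \sum_(k < N) t ^+ k / k`!%:R * iD i k f x| <= B * h ^+ N.
Proof.
elim: N f => [|N IH] f df Bf t th.
  by rewrite big_ord0 subr0 expr0 mulr1; exact: Bf.
have h0 : 0 <= h by apply: le_trans th.
have B0 : 0 <= B by apply: le_trans (Bf 0 _); rewrite ?normr0.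
pose F (s : R) := f (x + s *: evec i) - \sum_(k < N.+1) s ^+ k / k`!%:R * iD i k f x.
pose dF (s : R) := iD i 1 f (x + s *: evec i) - \sum_(k < N) s ^+ k / k`!%:R * iD i k (iD i 1 f) x.
have F0 : F 0 = 0.
  rewrite /F scale0r addr0 big_ord_recl expr0 fact0 divr1 mul1r big1 ?addr0 ?subrr// => k _.
  by rewrite exprS mul0r !mul0r.
have := @MVT_bound _ F dF t (B * h ^+ N).
rewrite F0 subr0 => H; apply: le_trans (H _ _) _.
- move=> u; apply: is_deriveB.
    by apply/is_derive_line; apply: derivableP; exact: (df 0%N).
  apply: is_derive_eq; first exact: (is_derive_tpoly N (fun k => iD i k f x)).
  by apply: eq_bigr => k _; rewrite /iD iterSr.
- move=> s sh; apply: IH.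
  + by move=> k y kN; have := df k.+1 y kN; rewrite /iD iterSr.
  + by move=> u uh; have := Bf u uh; rewrite /iD iterSr.
  + exact: le_trans sh th.
by rewrite exprSr mulrA ler_wpM2l// mulr_ge0// exprn_ge0.
Qed.

Variables (c : 'rV[R]_n).

(** Taylor's polynomial at [c] expanded one coordinate at a time; an order [k] spent on a coordinate
    is deducted for the following ones, so that the total degree stays below [N]. *)
Fixpoint tay (rl : seq 'I_n) N f y : R :=
  if rl is i :: rl' then
    \sum_(k < N) (y - c) ord0 i ^+ k / k`!%:R * tay rl' (N - k)%N (iD i k f) y
  else f c.

Lemma tay_line rl N f y i (t : R) : i \notin rl -> tay rl N f (y + t *: evec i) = tay rl N f y.
Proof.
elim: rl N f => [|k rl IH] N f //=; rewrite inE negb_or => /andP[ik irl].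
apply: eq_bigr => l _; rewrite IH//; congr (_ ^+ _ / _ * _).
by rewrite !mxE eq_sym (negPf ik) andbF mulr0 addr0.
Qed.

(* [FF rl m f]: f is a derivative of order m, still to be differentiated along
   the coordinates in rl, in that order. *)
Variables (FF : seq 'I_n -> nat -> ('rV[R]_n -> R) -> Prop) (h bb : R) (N0 : nat).
Hypotheses
  (FFd : forall i rl m f, FF (i :: rl) m f ->
     (forall y, derivable f y (evec i)) /\ FF (i :: rl) m.+1 ('D_(evec i) f))
  (FFw : forall i rl m f, FF (i :: rl) m f -> FF rl m f)
  (FFb : forall rl f, FF rl N0 f -> forall y, `|y - c| <= h -> `|f y| <= bb)
  (h0 : 0 <= h) (bb0 : 0 <= bb).

Lemma FF_iD i rl m f k : FF (i :: rl) m f -> FF (i :: rl) (m + k) (iD i k f).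
Proof.
by move=> Ff; elim: k => [|k IH]; rewrite ?addn0// addnS; case: (FFd IH).
Qed.

Lemma tay_le rl N m f y : uniq rl -> FF rl m f -> (m + N)%N = N0 -> `|y - c| <= h ->
  (forall i, i \notin rl -> y ord0 i = c ord0 i) ->
  `|f y - tay rl N f y| <= N.+1%:R ^+ size rl * h ^+ N * bb.
Proof.
elim: rl N m f y => [|i rl IH] N m f y /=.
  move=> _ _ _ _ yc; rewrite (_ : y = c); last by apply/rowP => i; rewrite yc.
  by rewrite subrr normr0 !mulr_ge0 ?exprn_ge0.
move=> /andP[irl url] Ff mN yh yc.
(* [y'] has the coordinate [i] of [c]. The expansion along [i] goes from [y'] to [y]; the
   derivatives at [y'] are then expanded by induction, and their polynomials do not see the
   coordinate [i]. *)
pose t := (y - c) ord0 i; pose y' := y - t *: evec i.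
have th : `|t| <= h by apply: le_trans yh; exact: ler_coord.
have yE : y = y' + t *: evec i by rewrite subrK.
have y'i s : (y' + s *: evec i - c) ord0 i = s.
  by rewrite /y' /t !mxE !eqxx /=; ring.
have y'k s k : k != i -> (y' + s *: evec i) ord0 k = y ord0 k.
  by move=> ki; rewrite !mxE (negPf ki) andbF !mulr0 subr0 addr0.
have y'h s : `|s| <= h -> `|y' + s *: evec i - c| <= h.
  move=> sh; apply: ler_rV_norm => // k; have [->|ki] := eqVneq k i; first by rewrite y'i.
  rewrite [X in `|X|](_ : _ = (y - c) ord0 k); first by apply: le_trans yh; exact: ler_coord.
  by rewrite [LHS]mxE [RHS]mxE y'k.
have y'0 : y' = y' + 0 *: evec i by rewrite scale0r addr0.
have T1 : `|f y - \sum_(k < N) t ^+ k / k`!%:R * iD i k f y'| <= bb * h ^+ N.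
  rewrite [in f y]yE; apply: taylor1 => //.
    by move=> k z kN; case: (FFd (FF_iD k Ff)) => + _; exact.
  by move=> s sh; apply: (FFb (rl := i :: rl)); [rewrite -mN; exact: FF_iD|exact: y'h].
have T2 (k : 'I_N) : `|t ^+ k / k`!%:R * iD i k f y' - t ^+ k / k`!%:R * tay rl (N - k)%N (iD i k f) y|
    <= N.+1%:R ^+ size rl * h ^+ N * bb.
  have kN := ltnW (ltn_ord k).
  rewrite -mulrBr normrM -[in tay _ _ _ _](_ : y' + t *: evec i = y)// tay_line//.
  apply: (@le_trans _ _ (h ^+ k * ((N - k).+1%:R ^+ size rl * h ^+ (N - k) * bb))).
    apply: ler_pM => //.
      rewrite normrM normrX normfV -[leRHS]mulr1; apply: ler_pM => //.
        by rewrite lerXn2r ?nnegrE.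
      by rewrite invf_le1 normr_nat ?ler1n ?fact_gt0// ltr0n fact_gt0.
    apply: (IH _ (m + k)%N).
    - by [].
    - by apply: (FFw (i := i)); exact: FF_iD.
    - by rewrite -addnA subnKC.
    - by rewrite y'0; apply: y'h; rewrite normr0.
    move=> l lrl; have [->|li] := eqVneq l i.
      by apply/eqP; rewrite -subr_eq0; have := y'i 0; rewrite -y'0 !mxE => ->.
    by rewrite y'0 y'k// yc// inE negb_or li.
  rewrite mulrA mulrCA mulrA ler_wpM2r// -mulrA -exprD subnKC//.
  by rewrite ler_wpM2r ?exprn_ge0// lerXn2r ?nnegrE ?ler0n// ler_nat ltnS leq_subr.
have -> : f y - \sum_(k < N) t ^+ k / k`!%:R * tay rl (N - k)%N (iD i k f) y =
  (f y - \sum_(k < N) t ^+ k / k`!%:R * iD i k f y') + \sum_(k < N)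
   (t ^+ k / k`!%:R * iD i k f y' - t ^+ k / k`!%:R * tay rl (N - k)%N (iD i k f) y).
  by rewrite sumrB; ring.
apply: le_trans (ler_normD _ _) _.
apply: (@le_trans _ _ (h ^+ N * bb + \sum_(k < N) (N.+1%:R ^+ size rl * h ^+ N * bb))).
  apply: lerD; first by rewrite mulrC.
  by apply: le_trans (ler_norm_sum _ _ _) _; apply: ler_sum => k _; exact: T2.
have S1 : 1 <= N.+1%:R ^+ size rl :> R by rewrite exprn_ege1// ler1n.
rewrite sumr_const card_ord exprS; set S := _ ^+ size rl in S1 *.
rewrite -subr_ge0 -(mulr_natl _ N) -(natr1 N) (_ : _ - _ = (S - 1) * (h ^+ N * bb)); last by ring.
by rewrite !mulr_ge0 ?subr_ge0// exprn_ge0.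
Qed.

Variable b : 'rV[R]_n -> R.
Hypotheses (mb : meas b) (b1 : forall y, `|b y| <= 1) (b0 : forall y, h < `|y - c| -> b y = 0)
  (hgt0 : 0 < h).

Definition pc be y : R := \prod_(i <- be) (y - c) ord0 i.

Definition null_int f := intg f /\ \int[mu]_x f x = 0.

Lemma null_int_lin (r s : R) f g : null_int f -> null_int g -> null_int (fun y => r * f y + s * g y).
Proof.
move=> [If f0] [Ig g0].
have Irf : intg (fun y => r * f y).
  have -> : EFin \o (fun y => r * f y) = (fun y => r%:E * (EFin \o f) y)%E.
    by apply/funext => y; rewrite /= EFinM.
  exact: integrableZl.
have Isg : intg (fun y => s * g y).
  have -> : EFin \o (fun y => s * g y) = (fun y => s%:E * (EFin \o g) y)%E.
    by apply/funext => y; rewrite /= EFinM.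
  exact: integrableZl.
split.
  exact: (integrableD measurableT Irf Isg).
by rewrite RintegralD// !RintegralZl// f0 g0 !mulr0 addr0.
Qed.

Lemma intg_mon be be' : intg (fun y => pc be y * mon be' y * b y).
Proof.
pose B := h ^+ size be * (`|c| + h) ^+ size be'.
have B0 : 0 <= B by nneg.
have pcE y : pc be y = mon be (y - c) by [].
have mpc : meas (pc be).
  rewrite (_ : pc be = mon be \o (fun y => y - c)); last exact/funext.
  by apply: measurableT_comp; [exact: meas_mon|exact: meas_rVD].
apply: (proj1 (@Rint_ball _ _ (fun y => pc be y * mon be' y * b y) c B h _ hgt0 B0 _ _)).
- by apply: measurable_funM => //; apply: measurable_funM => //; exact: meas_mon.
- move=> y; have [yh|yh] := leP `|y - c| h; last by rewrite b0// mulr0 normr0.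
  rewrite normrM -[B]mulr1; apply: ler_pM => //; rewrite normrM; apply: ler_pM => //.
    by rewrite pcE; exact: mon_le.
  apply: mon_le; rewrite -[y in `|y|](subrK c) addrC.
  by apply: le_trans (ler_normD _ _) _; rewrite lerD2l.
- by move=> y yh; rewrite b0// mulr0.
Qed.

Hypothesis mom : forall be, (size be < N0)%N -> \int[mu]_x (mon be x * b x) = 0.

(** The moments are given about the origin and needed about [c]; the factors [y_i - c_i] are split
    one at a time. *)
Lemma null_pc be be' : (size be + size be' < N0)%N -> null_int (fun y => pc be y * mon be' y * b y).
Proof.
elim: be be' => [|i be IH] be' sbe.
  split; first exact: intg_mon.
  by under eq_Rintegral do rewrite /pc big_nil mul1r; exact: mom.
have -> : (fun y => pc (i :: be) y * mon be' y * b y) = (fun y =>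
    1 * (pc be y * mon (i :: be') y * b y) + - c ord0 i * (pc be y * mon be' y * b y)).
  by apply/funext => y; rewrite /pc /mon !big_cons !mxE; ring.
apply: null_int_lin; apply: IH; first by rewrite /= addnS.
by apply: leq_ltn_trans sbe; rewrite /= addSn leqnSn.
Qed.

Lemma tay_null rl N f be : (0 < N)%N || (rl != [::]) -> (size be + N <= N0)%N ->
  null_int (fun y => pc be y * tay rl N f y * b y).
Proof.
elim: rl N f be => [|i rl IH] N f be /= N1 sN.
  have := @null_pc be [::]; rewrite addn0 => H.
  have {}H := H _; have sb : (size be < N0)%N.
    by apply: leq_trans sN; rewrite -[X in (X < _)%N]addn0 ltn_add2l; case/orP: N1.
  have -> : (fun y => pc be y * f c * b y) =
     (fun y => f c * (pc be y * mon [::] y * b y) + 0 * (pc be y * mon [::] y * b y)).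
    by apply/funext => y; rewrite /mon big_nil; ring.
  by apply: null_int_lin; exact: H.
suff H M : (M <= N)%N -> null_int (fun y => pc be y * (\sum_(k < M)
    (y - c) ord0 i ^+ k / k`!%:R * tay rl (N - k)%N (iD i k f) y) * b y) by exact: H.
elim: M => [|M IHM] MN.
  have -> : (fun y => pc be y * (\sum_(k < 0) (y - c) ord0 i ^+ k / k`!%:R *
      tay rl (N - k)%N (iD i k f) y) * b y) = cst 0.
    by apply/funext => y; rewrite big_ord0 mulr0 mul0r.
  split; first exact: integrable0.
  by rewrite /Rintegral integral0.
have -> : (fun y => pc be y * (\sum_(k < M.+1) (y - c) ord0 i ^+ k / k`!%:R *
      tay rl (N - k)%N (iD i k f) y) * b y) = (fun y =>
    1 * (pc be y * (\sum_(k < M) (y - c) ord0 i ^+ k / k`!%:R * tay rl (N - k)%N (iD i k f) y) * b y)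
    + (M`!%:R)^-1 * (pc (nseq M i ++ be) y * tay rl (N - M)%N (iD i M f) y * b y)).
  apply/funext => y; rewrite big_ord_recr/= {3}/pc big_cat/= -/(pc be y).
  by rewrite big_nseq iter_mulr_1; ring.
apply: null_int_lin; first by apply: IHM; exact: ltnW.
apply: IH; first by rewrite subn_gt0 MN.
by rewrite size_cat size_nseq addnAC subnKC ?(ltnW MN)// addnC.
Qed.

(** The moments annihilate Taylor's polynomial, so only the remainder over the support is
    integrated. The coordinates are taken in reverse because [mderive] applies the derivatives along
    the last coordinate first. *)
Lemma taylor_atom f : (0 < n)%N -> FF (rev (enum 'I_n)) 0 f -> meas f -> 
  intg (fun y => f y * b y) ->
  `|\int[mu]_y (f y * b y)| <= N0.+1%:R ^+ n * h ^+ N0 * bb * (8 * h) ^+ n.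
Proof.
move=> n0 Ff mf If; set rl := rev (enum 'I_n) in Ff.
have srl : size rl = n by rewrite size_rev size_enum_ord.
have B0 : 0 <= N0.+1%:R ^+ n * h ^+ N0 * bb by rewrite !mulr_ge0// exprn_ge0.
have [It t0] : null_int (fun y => tay rl N0 f y * b y).
  have := @tay_null rl N0 f [::]; rewrite add0n leqnn => H.
  have {}H := H _ isT.
  have -> : (fun y => tay rl N0 f y * b y) = (fun y => pc [::] y * tay rl N0 f y * b y).
    by apply/funext => y; rewrite /pc big_nil mul1r.
  by apply: H; rewrite -size_eq0 srl -lt0n n0 orbT.
have -> : \int[mu]_y (f y * b y) = \int[mu]_y (f y * b y - tay rl N0 f y * b y).
  by rewrite RintegralB// t0 subr0.
apply: (proj2 (@Rint_ball _ _ (fun y => f y * b y - tay rl N0 f y * b y) c _ h _ hgt0 B0 _ _)).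
- apply: measurable_funB; apply/measurable_EFinP; by [exact: measurable_int If|exact: measurable_int It].
- move=> y; rewrite -mulrBl normrM; have [yh|yh] := leP `|y - c| h; last first.
    by rewrite (b0 yh) normr0 mulr0.
  rewrite -[leRHS]mulr1; apply: ler_pM => //; rewrite -{1}srl; apply: (@tay_le _ _ 0%N) => //.
    by rewrite /rl rev_uniq enum_uniq.
  by move=> i; rewrite /rl mem_rev mem_enum.
- by move=> y yh; rewrite b0// !mulr0 subrr.
Qed.

End taylor.

Section atom_kernels.
Context {R : realType} {n : nat}.
Implicit Types (x y z c xi : 'rV[R]_n) (f g b : 'rV[R]_n -> R) (be : seq 'I_n) (tau : R).

Definition bdsupp f := exists B r : R, [/\ meas f, 0 < r, 0 <= B, forall x, `|f x| <= B &
  forall x, r < `|x| -> f x = 0].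

Lemma bdsuppX i g : bdsupp g -> bdsupp (fun xi => xi ord0 i * g xi).
Proof.
move=> [B [r [mg r0 B0 gB g0]]]; have [m h s] := mulX_bound mg r0 B0 gB g0 i.
by exists (r * B), r; split => //; rewrite mulr_ge0// ltW.
Qed.

Lemma bdsupp_mon be g : bdsupp g -> bdsupp (fun xi => mon be xi * g xi).
Proof.
move=> bg; elim: be => [|i be IH].
  by rewrite (_ : (fun xi => _) = g)//; apply/funext => xi; rewrite /mon big_nil mul1r.
rewrite (_ : (fun xi => _) = fun xi => xi ord0 i * (mon be xi * g xi)); first exact: bdsuppX.
by apply/funext => xi; rewrite /mon big_cons mulrA.
Qed.

Section kernel_shift.
Variables (g : 'rV[R]_n -> R) (x : 'rV[R]_n).
Hypothesis bg : bdsupp g.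

Lemma is_derive_KKshift tau y i : is_derive y (evec i) (fun y => KK tau g (y - x))
  (KK (tau + pi / 2) (fun xi => xi ord0 i * g xi) (y - x)).
Proof.
have [B [r [mg r0 B0 gB g0]]] := bg.
have := is_derive_KK mg r0 B0 gB g0 tau (y - x) i.
rewrite -[X in is_derive X](addr0 (y - x)) -[X in _ + X](scale0r (evec i)) => /is_derive_line H.
rewrite -[X in is_derive X](addr0 y) -[X in _ + X](scale0r (evec i)); apply/is_derive_line.
rewrite (_ : (fun s => _) = fun s => KK tau g (y - x + s *: evec i))//.
by apply/funext => s; rewrite addrAC.
Qed.

Lemma KKshift_bound tau : exists2 B, 0 <= B & forall y, `|KK tau g (y - x)| <= B.
Proof.
have [B [r [mg r0 B0 gB g0]]] := bg; exists (B * (8 * r) ^+ n).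
  by nneg.
by move=> y; have [] := KK_bound mg r0 B0 gB g0 tau (y - x).
Qed.

Lemma meas_KKshift tau : meas (fun y => KK tau g (y - x)).
Proof.
have [B [r [mg r0 B0 gB g0]]] := bg.
apply: (@measurableT_comp _ _ _ _ _ _ (KK tau g)); last exact: meas_rVD.
by apply: meas_cont; exact: (continuous_KK mg r0 B0 gB g0).
Qed.

Lemma intg_KKshift tau b c (r B : R) : meas b -> 0 < r -> 0 <= B -> (forall y, `|b y| <= B) ->
  (forall y, r < `|y - c| -> b y = 0) -> intg (fun y => KK tau g (y - x) * b y).
Proof.
move=> mb r0 B0 bB b0; have [D D0 hD] := KKshift_bound tau.
have DB : 0 <= D * B by nneg.
apply: (proj1 (@Rint_ball _ _ _ c _ r _ r0 DB _ _)).
- by apply: measurable_funM => //; exact: meas_KKshift.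
- by move=> y; rewrite normrM ler_pM.
- by move=> y yr; rewrite b0// mulr0.
Qed.

End kernel_shift.

Lemma KK_refl tau g x y : KK tau g (x - y) = KK (- tau) g (y - x).
Proof.
apply: eq_Rintegral => xi _; congr (_ * _).
by rewrite -(opprB y x) -scaleN1r dotvZl mulN1r -cosN opprD opprK.
Qed.

(** One real component of an atom. Only unmixed derivatives are recorded, as integration by parts
    proceeds along one direction at a time. *)
Record ratom (ga : R) (nu : nat) c K b : Prop := RAtom {
  ra_der : forall i k y, (k < K)%N -> derivable (iD i k b) y (evec i);
  ra_meas : forall i k, (k <= K)%N -> meas (iD i k b);
  ra_le : forall i k y, (k <= K)%N -> `|iD i k b y| <= 2 ^+ (nu * k);
  ra_supp : forall i k y, (k <= K)%N -> ga * 2 ^- nu < `|y - c| -> iD i k b y = 0 }.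

(** Each factor [xi_l] is a derivative of the kernel up to a shift of the phase by [pi / 2], and can
    be transferred to the atom. *)
Lemma KK_atom_ibp ga nu c K b g l x k m tau : 0 < ga -> ratom ga nu c K b -> bdsupp g ->
  (m + k <= K)%N ->
  `|\int[mu]_y (KK tau (fun xi => xi ord0 l ^+ k * g xi) (y - x) * iD l m b y)| =
  `|\int[mu]_y (KK (tau - k%:R * (pi / 2)) g (y - x) * iD l (m + k) b y)|.
Proof.
move=> ga0 ab bg; have r0 : 0 < ga * 2 ^- nu by nneg.
elim: k m tau => [|k IH] m tau mK.
  rewrite mul0r subr0 addn0 (_ : (fun xi => xi ord0 l ^+ 0 * g xi) = g)//.
  by apply/funext => xi; rewrite expr0 mul1r.
pose h xi := xi ord0 l ^+ k * g xi.
have bh : bdsupp h.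
  have := bdsupp_mon (nseq k l) bg; rewrite (_ : (fun xi => _) = h)//.
  by apply/funext => xi; rewrite /mon big_nseq iter_mulr_1.
have mK1 : (m < K)%N by apply: leq_trans mK; rewrite -addn1 leq_add2l.
have tauE : tau - pi / 2 + pi / 2 = tau by rewrite subrK.
pose F y := KK (tau - pi / 2) h (y - x).
pose dF y := KK tau (fun xi => xi ord0 l ^+ k.+1 * g xi) (y - x).
have hX : (fun xi => xi ord0 l * h xi) = (fun xi => xi ord0 l ^+ k.+1 * g xi).
  by apply/funext => xi; rewrite /h exprS mulrA.
have DF y : is_derive y (evec l) F (dF y).
  by have := is_derive_KKshift x bh (tau - pi / 2) y l; rewrite tauE hX.
pose G y := F y * iD l m b y.
have DG y : is_derive y (evec l) G (F y *: iD l m.+1 b y + iD l m b y *: dF y).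
  have Db : is_derive y (evec l) (iD l m b) (iD l m.+1 b y).
    by apply: derivableP; exact: (ra_der ab).
  have H := is_deriveM (DF y) Db; exact: H.
have [B1 B10 FB] := KKshift_bound x bh (tau - pi / 2).
have [B2 B20 dFB] : exists2 B2, 0 <= B2 & forall y, `|dF y| <= B2.
  by have := KKshift_bound x (bdsuppX l bh) tau; rewrite hX.
have bK i y : (i <= K)%N -> `|iD l i b y| <= 2 ^+ (nu * K).
  move=> iK; apply: le_trans (ra_le ab l y iK) _; rewrite ler_weXn2l ?ler1n//.
  by rewrite leq_mul2l iK orbT.
have p0 : 0 <= 2 ^+ (nu * K) :> R by rewrite exprn_ge0.
have I1 : intg (fun y => F y * iD l m.+1 b y).
  apply: (intg_KKshift x bh _ (c := c) _ r0 p0) => //; [exact: (ra_meas ab)|by move=> y; exact: bK|].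
  by move=> y; exact: (ra_supp ab).
have I2 : intg (fun y => dF y * iD l m b y).
  have := intg_KKshift x (bdsuppX l bh) tau (ra_meas ab l (ltnW mK1)) r0 p0.
  by rewrite hX; apply; [move=> y; apply: bK; exact: ltnW|move=> y; apply: (ra_supp ab); exact: ltnW].
have DGE y : 'D_(evec l) G y = F y * iD l m.+1 b y + dF y * iD l m b y.
  by case: (DG y) => _ ->; rewrite [_ *: dF y]mulrC.
have mG : meas G.
  by apply: measurable_funM; [exact: meas_KKshift|apply: (ra_meas ab); exact: ltnW].
have GB y : `|G y| <= B1 * 2 ^+ (nu * K) + B2 * 2 ^+ (nu * K).
  rewrite /G normrM; apply: (@le_trans _ _ (B1 * 2 ^+ (nu * K))).
    by apply: ler_pM; [by []|by []|exact: FB|apply: bK; exact: ltnW].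
  by rewrite lerDl mulr_ge0.
have DGB y : `|'D_(evec l) G y| <= B1 * 2 ^+ (nu * K) + B2 * 2 ^+ (nu * K).
  rewrite DGE; apply: le_trans (ler_normD _ _) _; rewrite !normrM; apply: lerD.
    by apply: ler_pM; [by []|by []|exact: FB|exact: bK].
  by apply: ler_pM; [by []|by []|exact: dFB|apply: bK; exact: ltnW].
have G0 y : `|c| + ga * 2 ^- nu < `|y| -> G y = 0.
  move=> yr; rewrite /G (ra_supp ab l (ltnW mK1)) ?mulr0//.
  by rewrite -(ltrD2l `|c|); apply: lt_le_trans yr _; rewrite -lerBlDl lerB_dist.
have dG y : derivable G y (evec l) by case: (DG y).
have [_ H0] := Rintegral_derive0 mG dG GB DGB G0.
have : \int[mu]_y (F y * iD l m.+1 b y + dF y * iD l m b y) = 0.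
  by rewrite -H0; apply: eq_Rintegral => y _; rewrite DGE.
rewrite RintegralD// => /eqP; rewrite addrC addr_eq0 => /eqP ->; rewrite normrN.
have mK' : (m.+1 + k <= K)%N by rewrite addSnnS.
apply: etrans (IH m.+1 (tau - pi / 2) mK') _; rewrite addSnnS.
rewrite (_ : tau - k.+1%:R * (pi / 2) = tau - pi / 2 - k%:R * (pi / 2))// -natr1.
by move: (pi / 2) => t; ring.
Qed.

(** All [K] derivatives are put on the atom. Of the decay [2 * n + M] of the kernel, [2 * n] gives
    integrability at scale [j], and [M] becomes a weight at the coarser scale [nu] about the centre
    of the atom. *)
Lemma KK_atom_le ga nu j c K b g l x tau M (D : R) : 0 < ga -> ratom ga nu c K b -> bdsupp g ->
  (nu <= j)%N -> 0 <= D ->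
  (forall tau z, `|KK tau g z| <= D * 2 ^+ (j * n) * (1 + 2 ^+ j * `|z|) ^- (2 * n + M)) ->
  `|\int[mu]_y (KK tau (fun xi => xi ord0 l ^+ K * g xi) (y - x) * b y)| <=
    D * (1 + ga) ^+ M * 2 ^+ n * 2 ^+ (nu * K) * om nu x c ^- M.
Proof.
move=> ga0 ab bg nuj D0 hD; have r0 : 0 < ga * 2 ^- nu by nneg.
have := @KK_atom_ibp ga nu c K b g l x K 0 tau ga0 ab bg (leqnn K); rewrite /= add0n => ->.
pose W := D * 2 ^+ (nu * K) * ((1 + ga) ^+ M * om nu x c ^- M).
have W0 : 0 <= W by nneg.
rewrite (_ : _ * om nu x c ^- M = W * 2 ^+ n); last by rewrite /W; ring.
apply: (proj2 (Rint_bound _ _)).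
  by apply: measurable_funM; [exact: meas_KKshift|exact: (ra_meas ab)].
apply: le_trans (Av_cst_le j x W0 (leqnn _)); apply: ge0_le_integral => //.
- apply/measurable_EFinP; apply: measurableT_comp => //; apply: measurable_funM.
    exact: meas_KKshift.
  exact: (ra_meas ab).
- by apply: meas_ker_mul; exact: measurable_cst.
move=> y _; rewrite lee_fin normrM.
have [yr|yr] := ltP (ga * 2 ^- nu) `|y - c|.
  by rewrite (ra_supp ab l (leqnn K) yr) normr0 mulr0 mulr_ge0// ker_ge0.
apply: (@le_trans _ _ (D * 2 ^+ (j * n) * om j y x ^- (2 * n + M) * 2 ^+ (nu * K))).
  by apply: ler_pM; [by []|by []|exact: hD|exact: (ra_le ab)].
rewrite /ker /W (omC _ y) exprD invfM.
have h : om j x y ^- M <= (1 + ga) ^+ M * om nu x c ^- M.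
  rewrite -[leLHS]mul1r ler_pdivrMr ?exprn_gt0 ?om_gt0// mulrAC ler_pdivlMr ?exprn_gt0 ?om_gt0//.
  rewrite mul1r -exprMn lerXn2r ?nnegrE ?om_ge0//; first by nneg.
  apply: le_trans (om_tri nu x y c) _; rewrite mulrC; apply: ler_pM; rewrite ?om_ge0//.
    by rewrite /om lerD2l mulrC -ler_pdivlMr ?exprn_gt0.
  exact: ler_om.
have q0 : 0 <= 2 ^+ (j * n) * om j x y ^- (2 * n) * (D * 2 ^+ (nu * K)).
  by nneg.
move: (ler_wpM2l q0 h); set a1 := om j x y ^- (2 * n); set a2 := om j x y ^- M; set a3 := om nu x c ^- M => H0; rewrite (_ : D * _ * (a1 * a2) * _ = 2 ^+ (j * n) * a1 * (D * 2 ^+ (nu * K)) * a2); last by ring.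
by rewrite [leRHS]mulrA.
Qed.

Lemma KK_sum (I : Type) (s : seq I) tau (g : I -> 'rV[R]_n -> R) z : (forall i, bdsupp (g i)) ->
  KK tau (fun xi => \sum_(i <- s) g i xi) z = \sum_(i <- s) KK tau (g i) z.
Proof.
move=> bg; have Ig i : intg (fun xi => cos (dotv z xi + tau) * g i xi).
  by have [B [r [mg r0 B0 gB g0]]] := bg i; case: (KK_bound mg r0 B0 gB g0 tau z).
rewrite /KK; transitivity (fine (\int[mu]_xi \sum_(i <- s) (cos (dotv z xi + tau) * g i xi)%:E)).
  by rewrite /Rintegral; congr fine; apply: eq_integral => xi _; rewrite mulr_sumr -sumEFin.
rewrite integral_sum// -sum_fine// => i _; by apply: integrable_fin_num => //; exact: Ig.
Qed.

Hypothesis n0 : (0 < n)%N.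
Variables (th : nat -> 'rV[R]_n -> R) (al : R) (cc : 'I_n -> nat -> R).
Hypotheses (al0 : 0 < al) (cc0 : forall i k, 0 <= cc i k).
Hypothesis hth : forall j i, bump i al (cc i) (2 ^+ j) (0 < j)%N (th j).

Lemma bdsupp_th j : bdsupp (th j).
Proof.
have i := Ordinal n0; have B := hth j i; have p0 : 0 < 2 ^+ j :> R by nneg.
exists (cc i 0), (2 * 2 ^+ j); split => //.
- exact: (bump_meas B 0).
- by move=> xi; have := bump_le B 0 xi; rewrite expr0 invr1 mulr1.
- exact: (bump_supp B 0).
Qed.

Definition thd K j l xi := xi ord0 l ^+ K * th j xi / rho K xi.

Lemma bdsupp_thd K j l : (0 < K)%N -> (0 < j)%N -> bdsupp (thd K j l).
Proof.
move=> K0 j0; have B := hth j l; have p0 : 0 < 2 ^+ j :> R by nneg.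
have E : thd K j l = term l K (th j) 0 K (cst 1) 1.
  by apply/funext => xi; rewrite /thd /term expr1 mulr1 [iD _ _ _ _ * _]mulrC.
have h1 xi : `|xi| <= 2 * 2 ^+ j -> `|(cst 1 : 'rV[R]_n -> R) xi| <= 1 by rewrite normr1.
have j0' : ((1 : nat) == 0%N) || (0 < j)%N by rewrite j0 orbT.
exists (cc l 0 * 2 ^+ j ^- 0 * ((2 * 2 ^+ j) ^+ K * 1) * (al * 2 ^+ j) ^- (2 * K * 1)), (2 * 2 ^+ j); split.
- by rewrite E; exact: (meas_term _ _ _ _ B (measurable_cst _)).
- by nneg.
- by nneg.
- by move=> xi; rewrite E; exact: (term_bound K0 al0 (cc0 l) _ _ B p0 ler01 h1).
- by move=> xi xr; rewrite /thd (bump_supp B 0 xr : th j xi = 0) mulr0 mul0r.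
Qed.

(** Multiplication and division by [rho] exhibits the kernel as a sum of [K]-th derivatives of
    kernels of the type in [kern2]; away from the origin the division is legitimate, and at the
    origin the function vanishes. *)
Lemma th_decomp K j xi : (0 < K)%N -> (0 < j)%N ->
  th j xi = \sum_l xi ord0 l ^+ K * thd K j l xi.
Proof.
move=> K0 j0; have i := Ordinal n0; have p0 : 0 < 2 ^+ j :> R by nneg.
under eq_bigr do rewrite /thd !mulrA -exprD addnn -mul2n -mulrA.
rewrite -mulr_suml -/(rho K xi); have [->|x0] := eqVneq xi 0.
  have -> : th j 0 = 0 by apply: (bump_ann (hth j i) j0 0); rewrite normr0 mulr_gt0.
  by rewrite mul0r mulr0.
by rewrite mulrCA mulfV ?mulr1// rho_neq0.
Qed.

(** For [K > 0] the derivatives provided by [th_decomp] go to the atom, at a cost of [2 ^ (nu * K)]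
    against the gain [2 ^- (j * K)] from [kern2]. *)
Lemma atom_fine M K ga : 0 < ga -> exists2 C, 0 <= C & forall nu j c b x tau, (nu < j)%N ->
  ratom ga nu c K b ->
  `|\int[mu]_y (KK tau (th j) (y - x) * b y)| <= C * 2 ^- ((j - nu) * K) * om nu x c ^- M.
Proof.
move=> ga0; have g0 : 0 <= 1 + ga by nneg.
case: (posnP K) => [->|K0].
  have [C C0 HC] := kern1 n0 al0 cc0 hth (2 * n + M) [::].
  exists (C * (1 + ga) ^+ M * 2 ^+ n) => [|nu j c b x tau nuj ab].
    by nneg.
  rewrite muln0 expr0 invr1 mulr1.
  have thE : (fun xi => mon [::] xi * th j xi) = th j.
    by apply/funext => xi; rewrite /mon big_nil mul1r.
  have := @KK_atom_le ga nu j c 0 b (th j) (Ordinal n0) x tau M C ga0 ab (bdsupp_th j) (ltnW nuj) C0.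
  rewrite muln0 expr0 mulr1 (_ : (fun xi => _) = th j); last first.
    by apply/funext => xi; rewrite expr0 mul1r.
  by apply => t z; have := HC j t z; rewrite thE addn0.
have [C C0 HC] := kern2 n0 al0 cc0 hth (2 * n + M) K0.
exists (n%:R * (C * (1 + ga) ^+ M * 2 ^+ n)) => [|nu j c b x tau nuj ab].
  by nneg.
have j0 : (0 < j)%N by apply: leq_ltn_trans nuj.
have r0 : 0 < ga * 2 ^- nu by rewrite mulr_gt0 ?invr_gt0 ?exprn_gt0.
have bX l : bdsupp (fun xi => xi ord0 l ^+ K * thd K j l xi).
  have := bdsupp_mon (nseq K l) (bdsupp_thd l K0 j0); rewrite (_ : (fun xi => _) = (fun xi => xi ord0 l ^+ K * thd K j l xi))//.
  by apply/funext => xi; rewrite /mon big_nseq iter_mulr_1.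
have E y : KK tau (th j) (y - x) = \sum_l KK tau (fun xi => xi ord0 l ^+ K * thd K j l xi) (y - x).
  by rewrite -KK_sum//; congr (KK _ _ _); apply/funext => xi; exact: th_decomp.
have I l : intg (fun y => KK tau (fun xi => xi ord0 l ^+ K * thd K j l xi) (y - x) * b y).
  apply: (intg_KKshift x (bX l) tau (ra_meas ab l (leq0n K)) r0 (exprn_ge0 (nu * 0) (ler0n R 2))).
    by move=> y; exact: (ra_le ab l y (leq0n K)).
  by move=> y; exact: (ra_supp ab l (leq0n K)).
have -> : \int[mu]_y (KK tau (th j) (y - x) * b y) =
    \sum_l \int[mu]_y (KK tau (fun xi => xi ord0 l ^+ K * thd K j l xi) (y - x) * b y).
  transitivity (fine (\int[mu]_y \sum_l
      (KK tau (fun xi => xi ord0 l ^+ K * thd K j l xi) (y - x) * b y)%:E)).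
    by rewrite /Rintegral; congr fine; apply: eq_integral => y _; rewrite E mulr_suml -sumEFin.
  rewrite integral_sum// -sum_fine// => l _; by apply: integrable_fin_num => //; exact: I.
apply: le_trans (ler_norm_sum _ _ _) _.
apply: (@le_trans _ _ (\sum_(l < n) (C * (1 + ga) ^+ M * 2 ^+ n * 2 ^- ((j - nu) * K) * om nu x c ^- M))).
  apply: ler_sum => l _.
  have D0 : 0 <= C * 2 ^- (j * K) by nneg.
  have := @KK_atom_le ga nu j c K b _ l x tau M _ ga0 ab (bdsupp_thd l K0 j0) (ltnW nuj) D0.
  move/(_ _)/le_trans; apply.
    by move=> t z; apply: le_trans (HC l j t z j0) _; rewrite [C * (_ / _)]mulrA [C * _ / 2 ^+ (j * K)]mulrAC.
  rewrite ler_wpM2r ?invr_ge0 ?exprn_ge0 ?om_ge0//.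
  have -> : 2 ^+ (j * K) = 2 ^+ ((j - nu) * K) * 2 ^+ (nu * K) :> R.
    by rewrite -exprD -mulnDl subnK// ltnW.
  have p1 : 2 ^+ ((j - nu) * K) != 0 :> R by rewrite expf_neq0// pnatr_eq0.
  have p2 : 2 ^+ (nu * K) != 0 :> R by rewrite expf_neq0// pnatr_eq0.
  by rewrite le_eqVlt; apply/orP; left; apply/eqP; field; rewrite p1 p2.
by rewrite sumr_const card_ord -[leLHS]mulr_natl !mulrA.
Qed.

(** [N] moments pay for [N] derivatives of the kernel: the remainder carries [2 ^ (j * N)] times
    [2 ^- ((j + d) * N)]. The other factor [2 ^- (d * n)] is the volume of the support relative to
    the scale [j]. *)
Lemma atom_coarse M N ga : 0 < ga -> exists2 C, 0 <= C & forall j d c b x tau, meas b ->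
  (forall y, `|b y| <= 1) -> (forall y, ga * 2 ^- (j + d) < `|y - c| -> b y = 0) ->
  (forall be, (size be < N)%N -> \int[mu]_x (mon be x * b x) = 0) ->
  `|\int[mu]_y (KK tau (th j) (y - x) * b y)| <= C * 2 ^- (d * N) * 2 ^- (d * n) * om j x c ^- M.
Proof.
move=> ga0; have g0 : 0 <= 1 + ga by nneg.
have /choice[C0 hC0] : forall be, exists C, 0 <= C /\ forall j tau z,
    `|KK tau (fun xi => mon be xi * th j xi) z| <=
      C * 2 ^+ (j * (n + size be)) * (1 + 2 ^+ j * `|z|) ^- M.
  by move=> be; have [C C0 HC] := kern1 n0 al0 cc0 hth M be; exists C.
pose C := \sum_(be : N.-tuple 'I_n) C0 be.
have CC be : size be = N -> C0 be <= C.
  move=> /eqP sb; rewrite /C (bigD1 (Tuple sb))//= lerDl; apply: sumr_ge0 => t _.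
  by case: (hC0 t).
have C_ge0 : 0 <= C by apply: sumr_ge0 => t _; case: (hC0 t).
pose C1 := N.+1%:R ^+ n * ga ^+ N * (C * (1 + ga) ^+ M) * (8 * ga) ^+ n.
exists C1 => [|j d c b x tau mb b1 b0 mom].
  by nneg.
pose h := ga * 2 ^- (j + d); have h0 : 0 < h by nneg.
pose bb := C * (1 + ga) ^+ M * 2 ^+ (j * (n + N)) * om j x c ^- M.
have bb0 : 0 <= bb by nneg.
pose FF (rl : seq 'I_n) m f := exists be t, size be = m /\ f = fun y => KK t (fun xi => mon be xi * th j xi) (y - x).
have bm be : bdsupp (fun xi => mon be xi * th j xi) by apply: bdsupp_mon; exact: bdsupp_th.
have := @taylor_atom _ _ c FF h bb N _ _ _ (ltW h0) bb0 b mb b1 b0 h0 mom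
  (fun y => KK tau (th j) (y - x)) n0 _ _ _.
have H1 i rl m f : FF (i :: rl) m f -> (forall y, derivable f y (evec i)) /\
    FF (i :: rl) m.+1 ('D_(evec i) f).
  move=> [be [t [sb ->]]]; have D y := is_derive_KKshift x (bm be) t y i.
  split; first by move=> y; case: (D y).
  exists (i :: be), (t + pi / 2); split; first by rewrite /= sb.
  apply/funext => y; case: (D y) => _ ->; congr (KK _ _ _).
  by apply/funext => xi; rewrite /mon big_cons mulrA.
have H2 i rl m f : FF (i :: rl) m f -> FF rl m f by [].
have H3 rl f : FF rl N f -> forall y, `|y - c| <= h -> `|f y| <= bb.
  move=> [be [t [sb ->]]] y yc; have [Cb hb] := hC0 be.
  apply: le_trans (hb j t (y - x)) _; rewrite sb /bb -/(om j y x).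
  rewrite -!mulrA [X in _ <= C * X]mulrCA ler_pM ?CC//.
    by nneg.
  rewrite ler_wpM2l ?exprn_ge0// ler_pdivlMr ?exprn_gt0 ?om_gt0// mulrC.
  rewrite ler_pdivrMr ?exprn_gt0 ?om_gt0// -exprMn lerXn2r ?nnegrE ?om_ge0//.
    by nneg.
  apply: le_trans (om_tri j x y c) _; rewrite mulrC (omC j x y); apply: ler_pM; rewrite ?om_ge0//.
  rewrite /om lerD2l mulrC -ler_pdivlMr ?exprn_gt0//; apply: le_trans yc _.
  by rewrite /h ler_wpM2l ?(ltW ga0)// lef_pV2 ?posrE ?exprn_gt0// ler_weXn2l ?ler1n// leq_addr.
have H4 : FF (rev (enum 'I_n)) 0%N (fun y => KK tau (th j) (y - x)).
  exists [::], tau; split=> //; apply/funext => y; congr (KK _ _ _).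
  by apply/funext => xi; rewrite /mon big_nil mul1r.
move/(_ H1 H2 H3 H4 (meas_KKshift x (bdsupp_th j) tau)
  (intg_KKshift x (bdsupp_th j) tau mb h0 ler01 b1 b0))/le_trans; apply.
rewrite le_eqVlt; apply/orP; left; apply/eqP.
have p0 : 2 ^+ (j * n) != 0 :> R by rewrite expf_neq0// pnatr_eq0.
have p1 : 2 ^+ (j * N) != 0 :> R by rewrite expf_neq0// pnatr_eq0.
have p2 : 2 ^+ (d * n) != 0 :> R by rewrite expf_neq0// pnatr_eq0.
have p3 : 2 ^+ (d * N) != 0 :> R by rewrite expf_neq0// pnatr_eq0.
have p4 : om j x c ^+ M != 0 by rewrite expf_neq0// gt_eqF// om_gt0.
rewrite /bb /h /C1 !exprMn !exprVn -!exprM !mulnDl !mulnDr !exprD.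
by field; rewrite p0 p1 p2 p3 p4.
Qed.

End atom_kernels.

(** * Complex integrals *)

Local Open Scope complex_scope.
Local Open Scope ring_scope.

Section complex_integrals.
Context {R : realType} {n : nat}.
Local Notation Re := complex.Re.
Local Notation Im := complex.Im.
Implicit Types (x y w : 'rV[R]_n) (u v : 'rV[R]_n -> R) (f g : 'rV[R]_n -> R[i]) (z : R[i]).

Lemma ReD z z' : Re (z + z') = Re z + Re z'. Proof. by case: z; case: z'. Qed.
Lemma ImD z z' : Im (z + z') = Im z + Im z'. Proof. by case: z; case: z'. Qed.
Lemma ReN z : Re (- z) = - Re z. Proof. by case: z. Qed.
Lemma ImN z : Im (- z) = - Im z. Proof. by case: z. Qed.
Lemma ReM z z' : Re (z * z') = Re z * Re z' - Im z * Im z'. Proof. by case: z; case: z'. Qed.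
Lemma ImM z z' : Im (z * z') = Re z * Im z' + Im z * Re z'. Proof. by case: z; case: z'. Qed.

Lemma eq_ReIm z z' : Re z = Re z' -> Im z = Im z' -> z = z'.
Proof. by case: z; case: z' => a b c d /= -> ->. Qed.

Lemma Re_sum (I : Type) (s : seq I) (F : I -> R[i]) : Re (\sum_(i <- s) F i) = \sum_(i <- s) Re (F i).
Proof. by elim/big_rec2: _ => // i a b _ <-; rewrite ReD. Qed.

Lemma Im_sum (I : Type) (s : seq I) (F : I -> R[i]) : Im (\sum_(i <- s) F i) = \sum_(i <- s) Im (F i).
Proof. by elim/big_rec2: _ => // i a b _ <-; rewrite ImD. Qed.

Lemma cmodM z z' : cmod (z * z') = cmod z * cmod z'. Proof. exact: Normc.normcM. Qed.
Lemma cmodD z z' : cmod (z + z') <= cmod z + cmod z'. Proof. exact: le_normcD. Qed.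
Lemma cmod0 : cmod (0 : R[i]) = 0. Proof. exact: Normc.normc0. Qed.

Lemma cmodE z : cmod z = Num.sqrt (Re z ^+ 2 + Im z ^+ 2). Proof. by case: z. Qed.

Lemma cmod_ge0 z : 0 <= cmod z. Proof. by rewrite cmodE sqrtr_ge0. Qed.
Hint Extern 0 (is_true (@Order.le _ _ _ (cmod _))) => by apply: cmod_ge0 : nneg.

Lemma cmod_real (r : R) : cmod r%:C = `|r|.
Proof. by rewrite cmodE/= expr0n addr0 sqrtr_sqr. Qed.

Lemma Re_le z : `|Re z| <= cmod z.
Proof. by rewrite cmodE -sqrtr_sqr ler_sqrt ?addr_ge0 ?sqr_ge0// lerDl sqr_ge0. Qed.

Lemma Im_le z : `|Im z| <= cmod z.
Proof. by rewrite cmodE -sqrtr_sqr ler_sqrt ?addr_ge0 ?sqr_ge0// lerDr sqr_ge0. Qed.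

Lemma cmod_le z : cmod z <= `|Re z| + `|Im z|.
Proof.
have h : 0 <= `|Re z| + `|Im z| by nneg.
rewrite cmodE -[leRHS]ger0_norm// -sqrtr_sqr ler_sqrt ?sqr_ge0//.
rewrite sqrrD !real_normK ?num_real// addrAC lerDl mulrn_wge0//; exact: mulr_ge0.
Qed.

Lemma Rint_lin (r s : R) u v : intg u -> intg v -> intg (fun x => r * u x + s * v x) /\
  \int[mu]_x (r * u x + s * v x) = r * \int[mu]_x u x + s * \int[mu]_x v x.
Proof.
move=> Iu Iv.
have H (t : R) (w : 'rV[R]_n -> R) : intg w -> intg (fun x => t * w x).
  move=> Iw; have -> : EFin \o (fun x => t * w x) = (fun x => t%:E * (EFin \o w) x)%E.
    by apply/funext => x; rewrite /= EFinM.
  exact: integrableZl.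
split; first exact: (integrableD measurableT (H r u Iu) (H s v Iv)).
by rewrite RintegralD ?RintegralZl//; exact: H.
Qed.

Lemma intg_le u v : meas u -> intg v -> (forall x, `|u x| <= v x) -> intg u.
Proof.
move=> mu_ Iv uv; apply: (le_integrable _ _ _ Iv) => //; first exact/measurable_EFinP.
by move=> x _; rewrite /= lee_fin (le_trans (uv x))// ler_norm.
Qed.

Lemma meas_intg u : intg u -> meas u.
Proof. by move=> Iu; apply/measurable_EFinP; exact: measurable_int Iu. Qed.

Lemma cmeas_mod f : cmeasurable f -> meas (fun x => cmod (f x)).
Proof.
move=> [m1 m2]; have -> : (fun x => cmod (f x)) = (fun x => (Re (f x) ^+ 2 + Im (f x) ^+ 2) `^ 2^-1).
  by apply/funext => x; rewrite cmodE powR12_sqrt// addr_ge0 ?sqr_ge0.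
apply: meas_fun_powR; last exact: measurable_cst.
by apply: measurable_funD; apply: measurable_funX.
Qed.

Lemma cintegrableP f : cmeasurable f -> (\int[mu]_x (cmod (f x))%:E < +oo)%E -> cintegrable f.
Proof.
move=> mf fi; have [m1 m2] := mf; have /measurable_EFinP mm := cmeas_mod mf.
split; apply/integrableP; split; try exact/measurable_EFinP.
  apply: le_lt_trans fi; apply: ge0_le_integral => //.
    by apply/measurable_EFinP; exact: measurableT_comp.
  by move=> x _; rewrite lee_fin Re_le.
apply: le_lt_trans fi; apply: ge0_le_integral => //.
  by apply/measurable_EFinP; exact: measurableT_comp.
by move=> x _; rewrite lee_fin Im_le.
Qed.

Lemma cintegrable_le f v : cmeasurable f -> intg v -> (forall x, cmod (f x) <= v x) -> cintegrable f.
Proof.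
move=> [m1 m2] Iv fv; split.
  by apply: (intg_le m1 Iv) => x; apply: le_trans (fv x); exact: Re_le.
by apply: (intg_le m2 Iv) => x; apply: le_trans (fv x); exact: Im_le.
Qed.

Lemma cmeasurableM f g : cmeasurable f -> cmeasurable g -> cmeasurable (fun x => f x * g x).
Proof.
move=> [m1 m2] [m3 m4]; split.
  under eq_fun do rewrite ReM.
  by apply: measurable_funB; apply: measurable_funM.
under eq_fun do rewrite ImM.
by apply: measurable_funD; apply: measurable_funM.
Qed.

Lemma cmeas_real u : meas u -> cmeasurable (fun x => (u x)%:C).
Proof. by move=> mu_; split => //=; exact: measurable_cst. Qed.

Lemma cintegral_le f (B : R) : cmeasurable f -> (\int[mu]_x (cmod (f x))%:E <= B%:E)%E ->
  cintegrable f /\ cmod (cintegral f) <= 2 * B.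
Proof.
move=> mf fB; have If : cintegrable f by apply: cintegrableP => //; exact: le_lt_trans fB (ltry _).
split=> //; apply: le_trans (cmod_le _) _; rewrite mulr_natl mulr2n.
have [m1 m2] := mf; have mm := cmeas_mod mf.
apply: lerD; apply: (proj2 (Rint_bound _ _)) => //; apply: le_trans fB; apply: ge0_le_integral => //.
- by apply/measurable_EFinP; exact: measurableT_comp.
- exact/measurable_EFinP.
- by move=> x _; rewrite lee_fin Re_le.
- by apply/measurable_EFinP; exact: measurableT_comp.
- exact/measurable_EFinP.
- by move=> x _; rewrite lee_fin Im_le.
Qed.

Lemma cintegralD f g : cintegrable f -> cintegrable g ->
  cintegrable (fun x => f x + g x) /\ cintegral (fun x => f x + g x) = cintegral f + cintegral g.
Proof.
move=> [f1 f2] [g1 g2]; have [I1 E1] := Rint_lin 1 1 f1 g1; have [I2 E2] := Rint_lin 1 1 f2 g2.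
have H1 : (fun x => 1 * Re (f x) + 1 * Re (g x)) = (fun x => Re (f x + g x)).
  by apply/funext => x; rewrite ReD !mul1r.
have H2 : (fun x => 1 * Im (f x) + 1 * Im (g x)) = (fun x => Im (f x + g x)).
  by apply/funext => x; rewrite ImD !mul1r.
rewrite H1 !mul1r in I1 E1; rewrite H2 !mul1r in I2 E2; split; first by split.
by rewrite /cintegral E1 E2.
Qed.

Lemma cintegralZ z f : cintegrable f ->
  cintegrable (fun x => z * f x) /\ cintegral (fun x => z * f x) = z * cintegral f.
Proof.
move=> [f1 f2]; have [I1 E1] := Rint_lin (Re z) (- Im z) f1 f2.
have [I2 E2] := Rint_lin (Re z) (Im z) f2 f1.
have H1 : (fun x => Re z * Re (f x) + - Im z * Im (f x)) = (fun x => Re (z * f x)).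
  by apply/funext => x; rewrite ReM mulNr.
have H2 : (fun x => Re z * Im (f x) + Im z * Re (f x)) = (fun x => Im (z * f x)).
  by apply/funext => x; rewrite ImM.
rewrite H1 in I1 E1; rewrite H2 in I2 E2; split; first by split.
by apply: eq_ReIm; rewrite ?ReM ?ImM /= ?E1 ?E2 ?mulNr.
Qed.

Lemma eq_cintegral f g : f =1 g -> cintegral f = cintegral g.
Proof. by move=> fg; congr cintegral; exact/funext. Qed.

Section fubini.
Variable F : 'rV[R]_n -> 'rV[R]_n -> R.
Hypothesis jF : jmeas F.

Lemma meas_Rint : meas (fun x => \int[mu]_w F w x) /\ meas (fun w => \int[mu]_x F w x).
Proof.
have mF : measurable_fun [set: 'rV[R]_n * 'rV[R]_n] (fun t => (F t.1 t.2)%:E) by exact/measurable_EFinP.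
have mp := measurable_funepos mF; have mn := measurable_funeneg mF.
have p0 t : (0 <= (fun t => (F t.1 t.2)%:E)^\+ t)%E by nneg.
have q0 t : (0 <= (fun t => (F t.1 t.2)%:E)^\- t)%E by nneg.
split; rewrite /Rintegral; apply: measurableT_comp => //.
  have m1 := measurable_fun_fubini_tonelli_G (m1 := mu) _ mp p0.
  have m2 := measurable_fun_fubini_tonelli_G (m1 := mu) _ mn q0.
  rewrite (_ : (fun x => _) = (fun x => fubini_G mu ((fun t => (F t.1 t.2)%:E)^\+)%E x -
    fubini_G mu ((fun t => (F t.1 t.2)%:E)^\-)%E x)%E); first exact: emeasurable_funB.
  apply/funext => x; rewrite integralE /fubini_G; congr (_ - _)%E; apply: eq_integral => w _.
    by rewrite !funeposE.
  by rewrite !funenegE.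
have m1 := measurable_fun_fubini_tonelli_F (m2 := mu) _ mp p0.
have m2 := measurable_fun_fubini_tonelli_F (m2 := mu) _ mn q0.
rewrite (_ : (fun x => _) = (fun x => fubini_F mu ((fun t => (F t.1 t.2)%:E)^\+)%E x -
  fubini_F mu ((fun t => (F t.1 t.2)%:E)^\-)%E x)%E); first exact: emeasurable_funB.
apply/funext => x; rewrite integralE /fubini_F; congr (_ - _)%E; apply: eq_integral => w _.
  by rewrite !funeposE.
by rewrite !funenegE.
Qed.

Variable v : 'rV[R]_n -> R.
Hypotheses (Fv : forall x, (\int[mu]_w `|(F w x)%:E| <= (v x)%:E)%E) (Iv : intg v)
  (IF : forall w, intg (F w)).

Lemma Rfub : [/\ \int[mu]_w \int[mu]_x F w x = \int[mu]_x \int[mu]_w F w x,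
  intg (fun w => \int[mu]_x F w x), intg (fun x => \int[mu]_w F w x) &
  forall x, intg (fun w => F w x)].
Proof.
have mF : measurable_fun [set: 'rV[R]_n * 'rV[R]_n] (fun t => (F t.1 t.2)%:E) by exact/measurable_EFinP.
have mFx x : meas (fun w => F w x).
  by apply: (measurableT_comp (g := fun w => (w, x)) jF); exact: measurable_pair2.
have IFx x : intg (fun w => F w x) by apply: (proj1 (Rint_bound (mFx x) (Fv x))).
have mv := meas_intg Iv.
have v0 x : 0 <= v x.
  by rewrite -lee_fin; apply: le_trans (Fv x); exact: integral_ge0.
have I2 : (mu \x mu)%E.-integrable setT (fun t : 'rV[R]_n * 'rV[R]_n => (F t.1 t.2)%:E).
  apply/(integrable21ltyP mu mu mF).
  have /integrableP[_] := Iv; apply: le_lt_trans; apply: ge0_le_integral => //.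
  - by move=> x _; apply: integral_ge0.
  - have m := measurable_fun_fubini_tonelli_G (m1 := mu) (fun t => `|(F t.1 t.2)%:E|)%E.
    by apply: m => //; exact: measurableT_comp.
  - by apply/measurable_EFinP; exact: measurableT_comp.
  - by move=> x _; rewrite gee0_abs ?lee_fin//; exact: Fv.
have Ew w : (\int[mu]_x (F w x)%:E)%E = (\int[mu]_x F w x)%:E.
  by rewrite /Rintegral fineK//; apply: integrable_fin_num => //; exact: IF.
have Ex x : (\int[mu]_w (F w x)%:E)%E = (\int[mu]_w F w x)%:E.
  by rewrite /Rintegral fineK//; apply: integrable_fin_num => //; exact: IFx.
have Iw : intg (fun w => \int[mu]_x F w x).
  by have := integrable_fubini_F I2; apply: eq_integrable => // w _; rewrite /fubini_F /= Ew.
split; [|exact: Iw| |exact: IFx].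
  rewrite /Rintegral; congr fine; have /= E := Fubini I2.
  under eq_integral do rewrite -/(Rintegral _ _ _) -Ew.
  by rewrite E; apply: eq_integral => x _; rewrite Ex.
apply: (intg_le _ Iv); first by have [] := meas_Rint.
by move=> x; apply: (proj2 (Rint_bound (mFx x) (Fv x))).
Qed.

End fubini.

Lemma cfub (F : 'rV[R]_n -> 'rV[R]_n -> R[i]) v :
  jmeas (fun w x => Re (F w x)) -> jmeas (fun w x => Im (F w x)) ->
  (forall x, (\int[mu]_w (cmod (F w x))%:E <= (v x)%:E)%E) -> intg v ->
  (forall w, cintegrable (F w)) ->
  [/\ cintegral (fun w => cintegral (F w)) = cintegral (fun x => cintegral (fun w => F w x)),
   cintegrable (fun w => cintegral (F w)), cintegrable (fun x => cintegral (fun w => F w x)) &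
   forall x, cintegrable (fun w => F w x)].
Proof.
move=> j1 j2 Fv Iv IF.
have mc x : meas (fun w => cmod (F w x)).
  apply: cmeas_mod; split.
    by apply: (measurableT_comp (g := fun w => (w, x)) j1); exact: measurable_pair2.
  by apply: (measurableT_comp (g := fun w => (w, x)) j2); exact: measurable_pair2.
have b1 x : (\int[mu]_w `|(Re (F w x))%:E| <= (v x)%:E)%E.
  apply: le_trans (Fv x); apply: ge0_le_integral => //.
  - apply/measurable_EFinP; apply: measurableT_comp => //.
    by apply: (measurableT_comp (g := fun w => (w, x)) j1); exact: measurable_pair2.
  - exact/measurable_EFinP.
  - by move=> w _; rewrite lee_fin Re_le.
have b2 x : (\int[mu]_w `|(Im (F w x))%:E| <= (v x)%:E)%E.
  apply: le_trans (Fv x); apply: ge0_le_integral => //.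
  - apply/measurable_EFinP; apply: measurableT_comp => //.
    by apply: (measurableT_comp (g := fun w => (w, x)) j2); exact: measurable_pair2.
  - exact/measurable_EFinP.
  - by move=> w _; rewrite lee_fin Im_le.
have [E1 W1 X1 P1] := Rfub j1 b1 Iv (fun w => proj1 (IF w)).
have [E2 W2 X2 P2] := Rfub j2 b2 Iv (fun w => proj2 (IF w)).
by split; [by apply: eq_ReIm; [exact: E1|exact: E2]|by split|by split|by move=> x; split; [exact: P1|exact: P2]].
Qed.

(** Each cube of level [nu] has measure [2 ^- (nu * n)], so a sum over cubes is an integral and
    Fubini's theorem can be used for both. Unconditional convergence comes from dominated
    convergence along the finite sets [A k] of indices with code below [k]. *)
Lemma cube_csum nu (u : 'rV[int]_n -> R[i]) :
  cintegrable (fun w => (2 ^+ (nu * n))%:C * u (cidx nu w)) ->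
  csummable_to u (cintegral (fun w => (2 ^+ (nu * n))%:C * u (cidx nu w))).
Proof.
pose f w := (2 ^+ (nu * n))%:C * u (cidx nu w); rewrite -/f => If.
pose A k : {fset 'rV[int]_n} := [fset m in pmap choice.unpickle (iota 0 k)]%fset.
pose ind (b : bool) : R[i] := (b%:R : R)%:C.
have mf : cmeasurable f by case: If => /meas_intg m1 /meas_intg m2.
have mB (h : 'rV[int]_n -> bool) : cmeasurable (fun w => ind (h (cidx nu w)) * f w).
  apply: cmeasurableM => //.
  exact: (@cmeas_real (fun w => (h (cidx nu w))%:R) (meas_cidx nu (fun m => (h m)%:R : R))).
have cB (h : bool) w : cmod (ind h * f w) = h%:R * cmod (f w) by rewrite cmodM cmod_real normr_nat.
have Ic : intg (fun w => cmod (f w)).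
  case: If => i1 i2; have [] := Rint_lin 1 1 (integrable_norm i1) (integrable_norm i2) => I _.
  apply: (intg_le _ I); first exact: cmeas_mod.
  by move=> w; rewrite !mul1r ger0_norm ?cmod_ge0//; exact: cmod_le.
have mA k : meas (fun w => (cidx nu w \notin A k)%:R * cmod (f w)).
  by apply: measurable_funM; [exact: (meas_cidx nu (fun m => (m \notin A k)%:R : R))|exact: cmeas_mod].
have nA k w : 0 <= (cidx nu w \notin A k)%:R * cmod (f w) by nneg.
have hb k w : (cidx nu w \notin A k)%:R * cmod (f w) <= cmod (f w).
  by rewrite ler_piMl ?cmod_ge0//; case: (_ \notin _).
have IA k : intg (fun w => (cidx nu w \notin A k)%:R * cmod (f w)).
  by apply: (intg_le (mA k) Ic) => w; rewrite ger0_norm.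
have cv : (fun k => \int[mu]_w ((cidx nu w \notin A k)%:R * cmod (f w))) @ \oo --> (0 : R).
  have h w : (fun k => ((cidx nu w \notin A k)%:R * cmod (f w))%:E) @ \oo --> 0%E.
    apply: cvg_near_cst; exists (choice.pickle (cidx nu w)).+1 => // k /= kw.
    rewrite (_ : cidx nu w \in A k) ?mul0r// inE mem_pmap; apply/mapP; exists (choice.pickle (cidx nu w)).
      by rewrite mem_iota.
    by rewrite choice.pickleK.
  have mE k : measurable_fun setT (fun w => ((cidx nu w \notin A k)%:R * cmod (f w))%:E).
    exact/measurable_EFinP.
  have hE : \forall w \ae mu, forall k, setT w ->
      (`|((cidx nu w \notin A k)%:R * cmod (f w))%:E| <= (cmod (f w))%:E)%E.
    by apply: aeW => w k _; rewrite /= lee_fin ger0_norm.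
  have [_ _] := @dominated_convergence _ _ _ mu setT measurableT
    (fun k w => ((cidx nu w \notin A k)%:R * cmod (f w))%:E) (cst 0%E) (fun w => (cmod (f w))%:E)
    mE (measurable_cst _) (aeW _ (fun w _ => h w)) Ic hE.
  by rewrite integral0 => /fine_cvg.
have Bf (s : seq 'rV[int]_n) : uniq s -> cintegrable (fun w => ind (cidx nu w \in s) * f w) /\
    cintegral (fun w => ind (cidx nu w \in s) * f w) = \sum_(m <- s) u m.
  elim: s => [_|m s IH /= /andP[ms us]].
    rewrite big_nil; have [I0 E0] := cintegralZ 0 If.
    rewrite (_ : (fun w => _) = (fun w => 0 * f w)); last first.
      by apply/funext => w; rewrite in_nil /ind.
    by rewrite E0 mul0r.
  have [I1 E1] := IH us.
  have Q w : (cidx nu w == m)%:R = \1_(cubeQ nu m) w :> R.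
    rewrite indicE; congr ((nat_of_bool _)%:R); apply/eqP/idP => h.
      by rewrite inE; apply/cubeQP.
    by move: h; rewrite inE => /cubeQP.
  have mQ : (\int[lebesgue_rV R n]_w (\1_(cubeQ nu m) w)%:E = ((2 ^- nu) ^+ n)%:E)%E.
    rewrite integral_indic//; last exact: meas_cubeQ.
    by rewrite setIT; exact: measure_cubeQ.
  have I2 : cintegrable (fun w => ind (cidx nu w == m)).
    apply: (@cintegrableP (fun w => ind (cidx nu w == m))).
      exact: (@cmeas_real (fun w => (cidx nu w == m)%:R)
        (meas_cidx nu (fun k => (k == m)%:R : R))).
    under eq_integral do rewrite cmod_real normr_nat Q.
    by rewrite mQ ltry.
  have [I3 E3] := cintegralZ ((2 ^+ (nu * n))%:C * u m) I2.
  have e w : ind (cidx nu w \in m :: s) * f w =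
      (2 ^+ (nu * n))%:C * u m * ind (cidx nu w == m) + ind (cidx nu w \in s) * f w.
    rewrite in_cons /f; have [->|_] /= := eqVneq (cidx nu w) m; last by rewrite mulr0 add0r.
    by rewrite (negPf ms) /ind mul0r addr0 mulrC.
  have [I4 E4] := cintegralD I3 I1; move/funext: e => ->; split=> //; rewrite E4 E3 E1 big_cons; congr (_ + _).
  have -> : cintegral (fun w : 'rV[R]_n => ind (cidx nu w == m)) = (2 ^- (nu * n))%:C.
    apply: eq_ReIm => /=; last by rewrite /Rintegral integral0.
    rewrite /Rintegral; under eq_integral do rewrite Q.
    by rewrite mQ /= exprVn -exprM.
  by rewrite mulrAC -rmorphM /= divff ?mul1r// expf_neq0// pnatr_eq0.
(* One third, since [cintegral_le] loses a factor 2 for the real and the imaginary part. *)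
move=> e e0; have e3 : 0 < e / 3 by nneg.
have /cvgrPdist_lt/(_ _ e3)[k _ /(_ k (leqnn k)) hk] := cv.
exists (A k) => B /fsubsetP AB.
have [I1 E1] := Bf (enum_fset B) (fset_uniq B).
have -> : \sum_(i <- B) u i - cintegral f = - cintegral (fun w => ind (cidx nu w \notin B) * f w).
  have [J1 F1] := cintegralZ (-1) I1; have [J F] := cintegralD If J1.
  rewrite -E1 -[LHS]opprB; congr (- _).
  rewrite -mulN1r -F1 -F; apply: eq_cintegral => w; rewrite mulN1r /ind.
  by case: (_ \in B); rewrite ?mul1r ?mul0r ?subrr ?subr0.
rewrite -mulN1r cmodM (_ : cmod (-1) = 1) ?mul1r; last first.
  by rewrite cmodE /= sqrrN expr1n oppr0 expr0n addr0 sqrtr1.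
have H : (\int[mu]_w (cmod (ind (cidx nu w \notin B) * f w))%:E <=
    (\int[mu]_w ((cidx nu w \notin A k)%:R * cmod (f w)))%:E)%E.
  rewrite /Rintegral fineK; last by apply: integrable_fin_num => //; exact: IA.
  apply: ge0_le_integral => //.
  - by nneg.
  - by apply/measurable_EFinP; exact: (cmeas_mod (mB (fun m => m \notin B))).
  - exact/measurable_EFinP.
  - move=> w _; rewrite lee_fin cB ler_wpM2r ?cmod_ge0// ler_nat.
    have [wA|_] := boolP (cidx nu w \in A k); last by case: (_ \in B).
    by rewrite AB.
have [_ h] := cintegral_le (mB (fun m => m \notin B)) H.
apply: le_lt_trans h _; move: hk; rewrite sub0r normrN.
set c := \int[mu]_w _; move=> hk; have := ler_norm c; lra.
Qed.

End complex_integrals.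

Hint Extern 0 (is_true (@Order.le _ _ _ (cmod _))) => by apply: cmod_ge0 : nneg.

(** * Real components of the system, the atoms and the test functions *)

Section components.
Context {R : realType} {n : nat}.
Implicit Types (x y w : 'rV[R]_n) (u v : 'rV[R]_n -> R) (f g : 'rV[R]_n -> R[i]) (z : R[i])
  (al be : {ffun 'I_n -> nat}).

Definition part (b : bool) z : R := if b then complex.Re z else complex.Im z.

Definition pt b f : 'rV[R]_n -> R := fun x => part b (f x).

Lemma part_le b z : `|part b z| <= cmod z.
Proof. by case: b; [exact: Re_le|exact: Im_le]. Qed.

Lemma pt_pderive b i f : pt b (pderive i f) = 'D_(evec i) (pt b f).
Proof. by case: b. Qed.

Lemma pt_iter b i k f : pt b (iter k (pderive i) f) = iD i k (pt b f).
Proof. by elim: k => // k IH; rewrite iterS pt_pderive IH. Qed.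

Lemma pt_continuous b f : ccontinuous f -> continuous (pt b f).
Proof. by case=> c1 c2; case: b. Qed.

Lemma pt_derivable b i f x : pderivable i f -> derivable (pt b f) x (evec i).
Proof. by case: b => /(_ x)[h1 h2]; [exact: h1|exact: h2]. Qed.

Lemma classC_cont k f : classC k f -> ccontinuous f.
Proof. by case: k => [|k] []. Qed.

Lemma classC_iter k m i f : classC (k + m) f -> classC m (iter k (pderive i) f).
Proof.
elim: k m => // k IH m; rewrite addSnnS => /IH /=.
by case=> _ /(_ i)[].
Qed.

Lemma classC_pder k m i f : (m < k)%N -> classC k f -> pderivable i (iter m (pderive i) f).
Proof.
move=> mk cf; have : classC (m + (k - m.+1).+1) f by rewrite addnS -addSn subnKC.
by move/classC_iter => /(_ i)/= [_ /(_ i)[]].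
Qed.

Definition single i k : {ffun 'I_n -> nat} := [ffun l => if l == i then k else 0%N].

Lemma mderive_single i k f : mderive (single i k) f = iter k (pderive i) f.
Proof.
rewrite /mderive; have : i \in enum 'I_n by rewrite mem_enum.
elim: (enum 'I_n) (enum_uniq 'I_n) => // l s IH /= /andP[ls us].
have H (t : seq 'I_n) : i \notin t ->
    foldr (fun i0 g => iter (single i k i0) (pderive i0) g) f t = f.
  elim: t => // l' t IH' /=; rewrite inE negb_or eq_sym => /andP[li it].
  by rewrite IH'// ffunE (negPf li).
rewrite inE; have [il _|il] := eqVneq i l; first by rewrite -il ffunE eqxx H// il.
by rewrite ffunE eq_sym (negPf il) => /(IH us) ->.
Qed.

Lemma mdeg_single i k : mdeg (single i k) = k.
Proof.
rewrite /mdeg (bigD1 i)//= ffunE eqxx big1 ?addn0// => l li.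
by rewrite ffunE (negPf li).
Qed.

Lemma mpow_single i k x : mpow x (single i k) = x ord0 i ^+ k.
Proof.
rewrite /mpow (bigD1 i)//= ffunE eqxx big1 ?mulr1// => l li.
by rewrite ffunE (negPf li) expr0.
Qed.

Lemma mon_mpow (s : seq 'I_n) x : mon s x = mpow x [ffun i => count_mem i s].
Proof.
rewrite /mon /mpow; elim: s => [|i s IH].
  by rewrite big_nil big1// => l _; rewrite ffunE expr0.
rewrite big_cons IH -(expr1 (x ord0 i)) -(mpow_single i 1 x) /mpow -big_split/=.
by apply: eq_bigr => l _; rewrite !ffunE /= -exprD eq_sym; case: (_ == _).
Qed.

Lemma mdeg_count (s : seq 'I_n) : mdeg [ffun i => count_mem i s] = size s.
Proof.
rewrite /mdeg; elim: s => [|i s IH].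
  by rewrite big1// => l _; rewrite ffunE.
rewrite /= -IH -[X in _ = X.+1]add0n -addSn -(mdeg_single i 1) /mdeg -big_split/=.
by apply: eq_bigr => l _; rewrite !ffunE /= eq_sym; case: (_ == _).
Qed.

Lemma iD_csupp b i k f y : ~ csupp f y -> iD i k (pt b f) y = 0.
Proof.
move=> fy; have U : \forall z \near y, ~ csupp f z.
  have /closed_openC oU : closed (csupp f) by exact: closed_closure.
  exact: (open_nbhs_nbhs (conj oU fy)).
elim: k y fy U => [|k IH] y fy U.
  have [f0|/eqP f0] := pselect (f y = 0); first by rewrite /= /pt f0; case: b.
  by exfalso; apply: fy; exact: subset_closure.
have -> : iD i k.+1 (pt b f) y = 'D_(evec i) (cst 0 : 'rV[R]_n -> R) y.
  rewrite /iD iterS; apply: near_eq_derive.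
  have : \forall z \near y, \forall t \near z, ~ csupp f t by exact/nbhs_interior.
  apply: filterS => t Ut; apply: IH => //; exact: nbhs_singleton Ut.
exact: derive_cst.
Qed.

Section annuli.
Variable theta : nat -> 'rV[R]_n -> R[i].
Hypotheses (n0 : (0 < n)%N) (htheta : in_Phi theta).

(** The inner radius [2 ^ (j - 1)] refers to the Euclidean norm, which is at most [n] times the sup
    norm; hence the constant [1 / (2 n)]. *)
Lemma theta_bump : exists2 c : 'I_n -> nat -> R, (forall i k, 0 <= c i k) &
  forall b j i, bump i (2 * n%:R)^-1 (c i) (2 ^+ j) (0 < j)%N (pt b (theta j)).
Proof.
have [sch s0 s1 bd _] := htheta.
have nr : 0 < n%:R :> R by rewrite ltr0n.
have /choice[c hc] : forall ik : 'I_n * nat, exists c : R, 0 <= c /\ forall j x,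
    2 ^+ (j * ik.2) * cmod (iter ik.2 (pderive ik.1) (theta j) x) <= c.
  move=> [i k]; have [c hc] := bd (single i k); exists c.
  have H j x : 2 ^+ (j * k) * cmod (iter k (pderive i) (theta j) x) <= c.
    by have := hc j x; rewrite mdeg_single mderive_single.
  by split=> //; apply: le_trans (H 0%N 0); rewrite mulr_ge0 ?exprn_ge0// cmod_ge0.
exists (fun i k => c (i, k)) => [i k|b j i]; first by case: (hc (i, k)).
have cl k : classC k (theta j) by case: (sch j).
split.
- by move=> k xi; rewrite -pt_iter; apply: pt_derivable; exact: classC_pder (leqnn _) (cl _).
- move=> k; rewrite -pt_iter; apply: meas_cont; apply: pt_continuous.
  apply: (@classC_cont 0); apply: classC_iter; exact: cl.
- move=> k xi; rewrite -pt_iter -exprM ler_pdivlMr ?exprn_gt0// mulrC.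
  have [_ h] := hc (i, k); apply: le_trans (h j xi).
  by rewrite ler_wpM2l ?exprn_ge0// part_le.
- move=> k xi xr; apply: iD_csupp => sx.
  have e := lt_le_trans xr (enorm_ge xi).
  case: (posnP j) => j0.
    by move: sx e; rewrite j0 => /s0 /= h; rewrite expr0 mulr1 ltNge h.
  by have /= /andP[_ h] := s1 j j0 _ sx; move: e; rewrite -exprS ltNge h.
- move=> j0 k xi xr; apply: iD_csupp => sx; have /= /andP[h _] := s1 j j0 _ sx.
  have := le_lt_trans (le_trans h (enorm_le xi)) _; move/(_ (2 ^+ j.-1)); rewrite ltxx => C.
  suff : false by []. apply: C.
  rewrite mulrC -ltr_pdivlMr//; apply: lt_le_trans xr _.
  have -> : 2 ^+ j = 2 * 2 ^+ j.-1 :> R by rewrite -exprS prednK.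
  by rewrite le_eqVlt; apply/orP; left; apply/eqP; field; rewrite gt_eqF.
Qed.

End annuli.

Section atoms.
Variables (ga : R) (K : nat) (L : int) (nu : nat) (m : 'rV[int]_n) (f : 'rV[R]_n -> R[i]).
Hypotheses (ga1 : 1 < ga) (af : is_atom ga K L nu m f).

Lemma cube_center_dist w : cidx nu w = m -> `|w - cube_center nu m| <= 2 ^- nu.
Proof.
move=> /cubeQP wm; apply: ler_rV_norm => [|i]; first by nneg.
have /andP[h1 h2] := wm i; rewrite !mxE.
have p0 : 0 < 2 ^- nu :> R by nneg.
move: h1 h2; rewrite intrD; set t := _%:~R; set p := 2 ^- nu in p0 *; set r := w ord0 i => h1 h2.
by rewrite ler_norml; apply/andP; split; nra.
Qed.

Lemma atom_csupp y : ga * 2 ^- nu < `|y - cube_center nu m| -> ~ csupp f y.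
Proof.
move=> yr /(let: And4 _ h _ _ := af in h) [w /cubeQP wm E]; move: yr; rewrite -E addrC addKr.
rewrite normrZ gtr0_norm ?(lt_trans ltr01)// ltr_pM2l ?(lt_trans ltr01)//.
by rewrite ltNge cube_center_dist.
Qed.

Lemma atom_ratom b : ratom ga nu (cube_center nu m) K (pt b f).
Proof.
have [cl _ bd _] := af; split.
- by move=> i k y kK; rewrite -pt_iter; apply: pt_derivable; exact: classC_pder kK cl.
- move=> i k kK; rewrite -pt_iter; apply: meas_cont; apply: pt_continuous.
  by apply: (@classC_cont (K - k)); apply: classC_iter; rewrite subnKC.
- move=> i k y kK; rewrite -pt_iter; apply: le_trans (part_le _ _) _.
  by have := bd (single i k); rewrite mdeg_single mderive_single => /(_ kK).
- by move=> i k y kK yr; apply: iD_csupp; exact: atom_csupp.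
Qed.

Lemma atom_meas b : meas (pt b f).
Proof. by have [cl _ _ _] := af; apply: meas_cont; apply: pt_continuous; exact: classC_cont cl. Qed.

Lemma atom_le y : cmod (f y) <= 1.
Proof.
have [_ _ + _] := af => /(_ [ffun=> 0%N]); rewrite /mdeg big1 => [|i _]; last by rewrite ffunE.
move=> /(_ isT y); rewrite muln0 expr0 (_ : mderive _ f = f)//.
rewrite /mderive; elim: (enum 'I_n) => //= i s ->; by rewrite ffunE.
Qed.

Lemma atom_mom b (s : seq 'I_n) : (1 <= nu)%N -> (size s)%:Z <= L ->
  \int[mu]_x (mon s x * pt b f x) = 0.
Proof.
move=> nu1 sL; have [_ _ _ h] := af; have := h nu1 [ffun i => count_mem i s].
rewrite mdeg_count => /(_ sL); rewrite /cintegral => /eqP.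
rewrite eq_complex /= => /andP[/eqP h1 /eqP h2]; case: b.
  rewrite -[RHS]h1; apply: eq_Rintegral => x _.
  by rewrite mon_mpow /pt /= ReM /= mul0r subr0.
rewrite -[RHS]h2; apply: eq_Rintegral => x _.
by rewrite mon_mpow /pt /= ImM /= mul0r addr0.
Qed.

End atoms.

(** [mderive] differentiates in a fixed order, the last coordinate first. A further derivative along
    [i] merges with it when none has been taken along the coordinates [l1] preceding [i], so that no
    interchange of mixed derivatives occurs. *)
Lemma mderive_add (l1 l2 : seq 'I_n) i al f : enum 'I_n = l1 ++ i :: l2 ->
  (forall l, l \in l1 -> al l = 0%N) ->
  pderive i (mderive al f) = mderive [ffun l => al l + (l == i)]%N f.
Proof.
move=> E a0; have := enum_uniq 'I_n; rewrite /mderive E cat_uniq /= => /and3P[u1 h /andP[il2 u2]].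
have il1 : i \notin l1 by move: h; rewrite negb_or => /andP[].
have H (be : {ffun 'I_n -> nat}) g (s : seq 'I_n) : (forall l, l \in s -> be l = 0%N) ->
    foldr (fun i0 g => iter (be i0) (pderive i0) g) g s = g.
  elim: s => // l s IH hs /=; rewrite IH ?hs ?inE ?eqxx// => k ks.
  by rewrite hs// inE ks orbT.
have a1 l : l \in l1 -> [ffun l => al l + (l == i)]%N l = 0%N.
  move=> ll1; rewrite ffunE a0// (_ : l == i = false)//.
  by apply: contraNF il1 => /eqP <-.
rewrite !foldr_cat (H al _ l1)// (H _ _ l1)//=.
rewrite ffunE eqxx addn1 iterS; congr (pderive _ (iter _ _ _)).
elim: l2 {E h u2} il2 => //= l s IH; rewrite inE negb_or => /andP[il /IH ->].
by rewrite ffunE eq_sym (negPf il) addn0.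
Qed.

(** The analogue of [atom_coarse] at scale 0 with a test function in place of the kernel; it makes
    the pairings with the atoms summable. *)
Lemma schwartz_atom (ga : R) N M : (0 < n)%N -> 0 < ga -> exists2 C, 0 <= C &
  forall (phi : 'rV[R]_n -> R[i]) (dd : R) b nu c u, schwartz phi ->
  (forall al be, (mdeg al <= maxn N M)%N -> (mdeg be <= maxn N M)%N ->
     forall x, cmod ((mpow x be)%:C * mderive al phi x) <= dd) ->
  meas u -> (forall y, `|u y| <= 1) -> (forall y, ga * 2 ^- nu < `|y - c| -> u y = 0) ->
  (forall s, (size s < N)%N -> \int[mu]_x (mon s x * u x) = 0) ->
  `|\int[mu]_y (pt b phi y * u y)| <= C * dd * 2 ^- (nu * N) * 2 ^- (nu * n) * om 0 0 c ^- M.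
Proof.
move=> n0 ga0; have g0 : 0 <= 1 + ga by nneg.
exists (N.+1%:R ^+ n * ga ^+ N * (2 ^+ M * (1 + ga) ^+ M) * (8 * ga) ^+ n).
  by nneg.
move=> phi dd b nu c u sphi sem mu_ u1 u0 mom.
have cl k : classC k phi by case: sphi.
have m0 : mdeg ([ffun=> 0%N] : {ffun 'I_n -> nat}) = 0%N by rewrite /mdeg big1// => i _; rewrite ffunE.
have md0 : mderive [ffun=> 0%N] phi = phi.
  by rewrite /mderive; elim: (enum 'I_n) => //= i s ->; rewrite ffunE.
have mp0 y : mpow y ([ffun=> 0%N] : {ffun 'I_n -> nat}) = 1.
  by rewrite /mpow big1// => i _; rewrite ffunE.
have p0 al y : (mdeg al <= maxn N M)%N -> cmod (mderive al phi y) <= dd.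
  by move=> ha; have := sem al [ffun=> 0%N] ha; rewrite m0 => /(_ (leq0n _) y); rewrite mp0 mul1r.
have dd0 : 0 <= dd by apply: le_trans (p0 [ffun=> 0%N] 0 _); rewrite ?cmod_ge0// m0.
have pM al y : (mdeg al <= maxn N M)%N ->
    cmod (mderive al phi y) <= 2 ^+ M * dd * (1 + 1 * `|y|) ^- M.
  move=> ha; apply: om_decay => //; [exact: cmod_ge0|exact: p0|move=> i].
  have := sem al (single i M) ha; rewrite mdeg_single leq_maxr => /(_ isT y).
  by rewrite mpow_single cmodM cmod_real normrX mul1r.
pose h := ga * 2 ^- nu; have h0 : 0 < h by nneg.
pose bb := 2 ^+ M * dd * (1 + ga) ^+ M * om 0 0 c ^- M.
have bb0 : 0 <= bb by nneg.
(* [don] lists the coordinates already dealt with; no derivative has yet been taken along those in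
   [behead rl], which is the condition of [mderive_add]. *)
pose FF (rl : seq 'I_n) k (v : 'rV[R]_n -> R) := exists al (don : seq 'I_n),
  [/\ rev (enum 'I_n) = don ++ rl, mdeg al = k, forall l, l \in behead rl -> al l = 0%N &
   v = pt b (mderive al phi)].
have clm al : forall k, classC k (mderive al phi).
  rewrite /mderive; elim: (enum 'I_n) => [|l s IH] k //=; exact: classC_iter.
have H1 i rl k v : FF (i :: rl) k v -> (forall y, derivable v y (evec i)) /\
    FF (i :: rl) k.+1 ('D_(evec i) v).
  move=> [al [don [E mk a0 ->]]]; split.
    by move=> y; apply: pt_derivable; have [_ /(_ i)[]] := clm al 1%N.
  exists [ffun l => al l + (l == i)]%N, don; split=> //.
  - have -> : mdeg ([ffun l => al l + (l == i)]%N : {ffun 'I_n -> nat}) = (mdeg al + mdeg (single i 1))%N.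
      rewrite /mdeg -big_split/=; apply: eq_bigr => l _; rewrite !ffunE; by case: eqP.
    by rewrite mdeg_single mk addn1.
  - move=> l /= lrl; rewrite ffunE a0// (_ : l == i = false)//.
    apply: contraTF lrl => /eqP ->.
    have := enum_uniq 'I_n; rewrite -rev_uniq E cat_uniq /= => /and3P[_ _ /andP[]].
    by [].
  - rewrite -pt_pderive (@mderive_add (rev rl) (rev don))//.
      by rewrite -[LHS]revK E rev_cat rev_cons cat_rcons.
    by move=> l; rewrite mem_rev; exact: a0.
have H2 i rl k v : FF (i :: rl) k v -> FF rl k v.
  move=> [al [don [E mk a0 ->]]]; exists al, (rcons don i); split=> //.
    by rewrite cat_rcons.
  by move=> l /mem_behead; exact: a0.
have H3 rl v : FF rl N v -> forall y, `|y - c| <= h -> `|v y| <= bb.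
  move=> [al [don [E mk a0 ->]]] y yc; apply: le_trans (part_le _ _) _.
  apply: le_trans (pM _ _ _) _; first by rewrite mk leq_maxl.
  rewrite /bb -!mulrA ler_wpM2l ?exprn_ge0// ler_wpM2l// ler_pdivlMr ?exprn_gt0 ?om_gt0// mulrC.
  have o1 : 0 < 1 + 1 * `|y| by nneg.
  rewrite ler_pdivrMr ?exprn_gt0// -exprMn lerXn2r ?nnegrE ?om_ge0//.
    by nneg.
  apply: le_trans (om_tri 0 0 y c) _; rewrite mulrC; apply: ler_pM; rewrite ?om_ge0//.
    rewrite /om lerD2l expr0 mul1r; apply: le_trans yc _.
    by rewrite /h ler_piMr ?(ltW ga0)// invf_le1 ?exprn_gt0// exprn_ege1// ler1n.
  by rewrite /om sub0r normrN expr0.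
have H4 : FF (rev (enum 'I_n)) 0%N (pt b phi).
  by exists [ffun=> 0%N], [::]; split=> //; [move=> l _; rewrite ffunE|rewrite md0].
have mph : meas (pt b phi) by apply: meas_cont; apply: pt_continuous; exact: classC_cont (cl 0%N).
have Ip : intg (fun y => pt b phi y * u y).
  apply: (proj1 (@Rint_ball _ _ _ c dd h _ h0 dd0 _ _)).
  - exact: measurable_funM.
  - move=> y; rewrite normrM -[leRHS]mulr1; apply: ler_pM => //.
    by apply: le_trans (part_le _ _) _; rewrite -md0; apply: p0; rewrite m0.
  - by move=> y yr; rewrite u0// mulr0.
have := @taylor_atom _ _ c FF h bb N H1 H2 H3 (ltW h0) bb0 u mu_ u1 u0 h0 mom (pt b phi) n0 H4 mph Ip.
move/le_trans; apply; rewrite le_eqVlt; apply/orP; left; apply/eqP.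
rewrite /bb /h !exprMn !exprVn -!exprM.
have q1 : 2 ^+ (nu * n) != 0 :> R by rewrite expf_neq0// pnatr_eq0.
have q2 : 2 ^+ (nu * N) != 0 :> R by rewrite expf_neq0// pnatr_eq0.
have q3 : om 0 0 c ^+ M != 0 by rewrite expf_neq0// gt_eqF// om_gt0.
by field; rewrite q1 q2 q3.
Qed.

End components.

(** * Normalisation of the coefficients *)

Section geometric_sums.
Context {R : realType}.
Implicit Types (rho e : R).

Lemma geo_sum_le rho D : 0 <= rho -> rho < 1 -> \sum_(k < D) rho ^+ k <= (1 - rho)^-1.
Proof.
move=> r0 r1; have h : 0 < 1 - rho by rewrite subr_gt0.
rewrite -(ler_pM2l h) mulfV ?gt_eqF//.
suff -> : (1 - rho) * \sum_(k < D) rho ^+ k = 1 - rho ^+ D by rewrite gerBl exprn_ge0.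
elim: D => [|D IH]; first by rewrite big_ord0 mulr0 expr0 subrr.
by rewrite big_ord_recr/= mulrDr IH exprS; ring.
Qed.

Lemma geo_sum2_le rho D : 0 <= rho -> rho < 1 ->
  \sum_(k < D) rho ^+ k * k.+1%:R <= (1 - rho) ^- 2.
Proof.
move=> r0 r1; have h : 0 < 1 - rho by rewrite subr_gt0.
suff E : (1 - rho) ^+ 2 * \sum_(k < D) rho ^+ k * k.+1%:R =
    1 - rho ^+ D * (D.+1%:R * (1 - rho) + rho).
  rewrite -(ler_pM2l (exprn_gt0 2 h)) mulfV ?expf_neq0 ?gt_eqF// E gerBl.
  by rewrite mulr_ge0 ?exprn_ge0// addr_ge0// mulr_ge0// ltW.
elim: D => [|D IH]; first by rewrite big_ord0 mulr0 expr0 mul1r mul1r subrK subrr.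
by rewrite big_ord_recr/= mulrDr IH [rho ^+ D.+1]exprS -(natr1 D.+1) -(natr1 D); ring.
Qed.

Lemma powR_sum2 (eM a b e : R) : 0 <= a -> 0 <= b -> 0 <= e -> e <= eM ->
  (a + b) `^ e <= 2 `^ eM * (a `^ e + b `^ e).
Proof.
move=> a0 b0 e0 eM_; wlog ab : a b a0 b0 / a <= b.
  move=> H; have [ab|ba] := leP a b; first exact: H.
  by rewrite addrC [X in _ * X]addrC; apply: H => //; exact: ltW.
apply: (@le_trans _ _ ((2 * b) `^ e)).
  rewrite ge0_ler_powR ?nnegrE ?mulr_ge0 ?addr_ge0//.
  by rewrite mulr_natl mulr2n lerD2r.
rewrite powRM// ler_pM ?powR_ge0//; first by rewrite ler_powR// ler1n.
by rewrite lerDr powR_ge0.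
Qed.

(* With [s] the square root of [rho], the sum is at most the geometric sum of
   [s] times the largest [s ^+ k * v k]. *)
Lemma powR_geo_sum rho (em eM : R) : 0 < rho < 1 -> 0 < em -> exists C rho' : R,
  [/\ 0 < C, 0 < rho' < 1 & forall D (v : nat -> R) e, (forall k, 0 <= v k) -> em <= e <= eM ->
   (\sum_(k < D) rho ^+ k * v k) `^ e <= C * \sum_(k < D) rho' ^+ k * v k `^ e].
Proof.
move=> /andP[r0 r1] em0; pose s := Num.sqrt rho.
have s0 : 0 < s by rewrite sqrtr_gt0.
have s1 : s < 1 by rewrite -sqrtr1 ltr_sqrt.
have ss : s * s = rho by rewrite -expr2 sqr_sqrtr// ltW.
have G1 : 1 <= (1 - s)^-1 by rewrite invf_ge1 ?subr_gt0// gerBl ltW.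
have G0 : 0 < (1 - s)^-1 by apply: lt_le_trans G1.
exists ((1 - s)^-1 `^ eM), (s `^ em); split; first exact: powR_gt0.
  have := gt0_ltr_powR em0 (_ : s \in Num.nneg) (_ : 1 \in Num.nneg) s1.
  by rewrite powR1 powR_gt0// !nnegrE (ltW s0) ler01 => ->.
move=> D v e v0 /andP[e1 e2]; have e0 : 0 < e by apply: lt_le_trans e1.
case: D => [|D]; first by rewrite !big_ord0 powR0 ?gt_eqF// mulr0.
have [k _ hk] := @Order.TotalTheory.arg_maxP _ _ _ (ord0 : 'I_D.+1) predT (fun k => s ^+ k * v k) isT.
have m0 : 0 <= s ^+ k * v k by nneg.
have H : \sum_(i < D.+1) rho ^+ i * v i <= (1 - s)^-1 * (s ^+ k * v k).
  apply: (@le_trans _ _ (\sum_(i < D.+1) s ^+ i * (s ^+ k * v k))).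
    by apply: ler_sum => i _; rewrite -ss exprMn -mulrA ler_wpM2l ?exprn_ge0 ?(ltW s0)//; exact: hk.
  by rewrite -mulr_suml ler_wpM2r//; exact: geo_sum_le (ltW s0) s1.
apply: (@le_trans _ _ (((1 - s)^-1 * (s ^+ k * v k)) `^ e)).
  rewrite ge0_ler_powR ?nnegrE ?(ltW e0)//.
    by apply: sumr_ge0 => i _; rewrite mulr_ge0 ?exprn_ge0// ltW.
  by rewrite mulr_ge0// ltW.
rewrite powRM ?(ltW G0)//; apply: ler_pM; rewrite ?powR_ge0//; first by rewrite ler_powR.
rewrite (bigD1 k)//= powRM ?exprn_ge0 ?(ltW s0)// ler_wpDr//.
  by apply: sumr_ge0 => i _; rewrite mulr_ge0 ?powR_ge0// exprn_ge0// powR_ge0.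
apply: (ler_wpM2r (powR_ge0 _ _)).
have <- : s `^ k%:R = s ^+ k :> R by rewrite powR_mulrn ?(ltW s0).
rewrite -[leRHS]powR_mulrn ?powR_ge0// -!powRrM.
by rewrite ger_powR ?s0 ?(ltW s1)// mulrC ler_wpM2l.
Qed.

Lemma sum_shift_le (w : nat -> R) N i : (forall j, 0 <= w j) ->
  \sum_(j < N) (i <= j)%N%:R * w (j - i)%N <= \sum_(j < N) w j.
Proof.
move=> w0; have -> : \sum_(j < N) (i <= j)%N%:R * w (j - i)%N = \sum_(j < N - i) w j.
  elim: N => [|N IH]; first by rewrite sub0n !big_ord0.
  rewrite big_ord_recr /= IH; have [iN|Ni] := leqP i N.
    by rewrite subSn// big_ord_recr/= mul1r.
  by rewrite mul0r addr0 (eqP (ltnW Ni : N - i == 0)%N) (eqP (Ni : N.+1 - i == 0)%N).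
rewrite -[in leRHS](subnK (leq_subr i N)) addnC big_split_ord/= -(big_mkord predT w).
by rewrite big_mkord lerDl; apply: sumr_ge0.
Qed.

(** The shape of the bound for [theta_j(D)] of the atomic sum: the first sum comes from the levels
    [j + d], the second from the levels [j - i], whose majorants are taken at their own scale with
    [d = 0]. *)
Definition twosum rho N (h : nat -> nat -> R) j :=
  \sum_(d < N.+1) rho ^+ d * h d j + \sum_(i < j.+1) rho ^+ i * h 0%N (j - i)%N.

Lemma twosum_ge0 rho N h j : 0 <= rho -> (forall d j, 0 <= h d j) -> 0 <= twosum rho N h j.
Proof.
by move=> r0 h0; rewrite addr_ge0//; apply: sumr_ge0 => i _; rewrite mulr_ge0// exprn_ge0.
Qed.

(** [powR_geo_sum] is used once for each of the two powers, which only worsens the ratio; the shift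
    [j - i] in the second sum of [twosum] disappears on summing over [j]. *)
Lemma modular_pt rho (qm qM rm rM : R) : 0 < rho < 1 -> 0 < qm -> 0 < rm -> exists C rho' : R,
  [/\ 0 < C, 0 < rho' < 1 & forall N h a b, (forall d j, 0 <= h d j) -> qm <= a <= qM -> rm <= b <= rM ->
    (\sum_(j < N.+1) twosum rho N h j `^ a) `^ b <= C * \sum_(d < N.+1) rho' ^+ d *
      ((\sum_(j < N.+1) h d j `^ a) `^ b + (\sum_(j < N.+1) h 0%N j `^ a) `^ b)].
Proof.
move=> r01 qm0 rm0; have /andP[r0 r1] := r01.
have [C1 [rho1 [C10 r11 H1]]] := powR_geo_sum qM r01 qm0.
have [C2 [rho2 [C20 r21 H2]]] := powR_geo_sum rM r11 rm0.
have /andP[r10 _] := r11; have /andP[r20 _] := r21.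
pose c := Num.max 1 (2 `^ qM * C1); have c1 : 1 <= c by rewrite le_max lexx.
have c0 : 0 < c by apply: lt_le_trans c1.
exists (c `^ rM * (C2 * 2 `^ rM)), rho2; split=> //; first by nneg.
move=> N h a b h0 qa rb; have /andP[qa1 qa2] := qa; have /andP[rb1 rb2] := rb.
have a0 : 0 <= a by apply: le_trans qa1; exact: ltW.
have b0 : 0 <= b by apply: le_trans rb1; exact: ltW.
pose W d := \sum_(j < N.+1) h d j `^ a + \sum_(j < N.+1) h 0%N j `^ a.
have W0 d : 0 <= W d by rewrite addr_ge0//; apply: sumr_ge0 => j _; exact: powR_ge0.
have S0 j : 0 <= twosum rho N h j by exact: twosum_ge0 (ltW r0) h0.
have key : \sum_(j < N.+1) twosum rho N h j `^ a <= c * \sum_(d < N.+1) rho1 ^+ d * W d.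
  apply: (@le_trans _ _ (c * \sum_(j < N.+1) (\sum_(d < N.+1) rho1 ^+ d * h d j `^ a +
      \sum_(d < N.+1) rho1 ^+ d * ((d <= j)%N%:R * h 0%N (j - d)%N `^ a)))).
    rewrite mulr_sumr; apply: ler_sum => j _.
    apply: le_trans (powR_sum2 _ _ a0 qa2) _; try by apply: sumr_ge0 => i _; rewrite mulr_ge0 ?exprn_ge0// ltW.
    apply: (@le_trans _ _ (2 `^ qM * (C1 * \sum_(d < N.+1) rho1 ^+ d * h d j `^ a +
        C1 * \sum_(i < j.+1) rho1 ^+ i * h 0%N (j - i)%N `^ a))).
      rewrite ler_wpM2l ?powR_ge0// lerD//.
        exact: (H1 N.+1 (fun d => h d j) a (fun d => h0 d j) qa).
      exact: (H1 j.+1 (fun i => h 0%N (j - i)%N) a (fun i => h0 _ _) qa).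
    rewrite -mulrDr mulrA; apply: ler_pM.
    - by nneg.
    - by rewrite addr_ge0//; apply: sumr_ge0 => i _; rewrite mulr_ge0 ?powR_ge0// exprn_ge0// ltW.
    - by rewrite le_max lexx orbT.
    rewrite lerD2l (@big_ord_widen _ _ _ j.+1 N.+1 (fun i => rho1 ^+ i * h 0%N (j - i)%N `^ a))// big_mkcond.
    apply: ler_sum => i _; rewrite ltnS; case: (leqP i j) => _; first by rewrite mul1r.
    by rewrite mul0r mulr0.
  rewrite ler_wpM2l ?(ltW c0)// big_split/= /W.
  under [leRHS]eq_bigr do rewrite mulrDr.
  rewrite big_split/=; apply: lerD.
    by rewrite exchange_big/=; apply: ler_sum => d _; rewrite mulr_sumr.
  rewrite exchange_big/=; apply: ler_sum => d _; rewrite -mulr_sumr ler_wpM2l ?exprn_ge0 ?(ltW r10)//.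
  by apply: (@sum_shift_le (fun j => h 0%N j `^ a)) => j; exact: powR_ge0.
have sW : 0 <= \sum_(d < N.+1) rho1 ^+ d * W d.
  by apply: sumr_ge0 => d _; rewrite mulr_ge0 ?exprn_ge0// ltW.
apply: (@le_trans _ _ ((c * \sum_(d < N.+1) rho1 ^+ d * W d) `^ b)).
  rewrite ge0_ler_powR ?nnegrE//; last by nneg.
  by apply: sumr_ge0 => j _; exact: powR_ge0.
rewrite powRM ?(ltW c0)// -mulrA; apply: ler_pM; rewrite ?powR_ge0//; first by rewrite ler_powR.
apply: le_trans (H2 _ _ _ W0 rb) _; rewrite -mulrA ler_wpM2l ?(ltW C20)//.
rewrite mulr_sumr; apply: ler_sum => d _; rewrite mulrCA ler_wpM2l ?exprn_ge0 ?(ltW r20)//.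
by apply: powR_sum2 => //; apply: sumr_ge0 => j _; exact: powR_ge0.
Qed.

Context {n : nat}.

Lemma modular_sum rho (qm qM rm rM C0 : R) : 0 < rho < 1 -> 0 < qm -> 0 < rm -> 0 < C0 ->
  exists2 C, 0 < C & forall (q r : 'rV[R]_n -> R) (h : nat -> nat -> 'rV[R]_n -> R),
  meas q -> meas r -> (forall x, qm <= q x <= qM) -> (forall x, rm <= r x <= rM) ->
  (forall d j x, 0 <= h d j x) -> (forall d j, meas (h d j)) ->
  (forall d N, (\int[mu]_x ((\sum_(j < N.+1) h d j x `^ q x) `^ r x)%:E <= (C0 * d.+1%:R)%:E)%E) ->
  forall N, (\int[mu]_x ((\sum_(j < N.+1) twosum rho N (fun d j => h d j x) j `^ q x) `^ r x)%:E <= C%:E)%E.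
Proof.
move=> r01 qm0 rm0 C00; have [C [rho' [Cp r1 H]]] := modular_pt qM rM r01 qm0 rm0.
have /andP[r'0 r'1] := r1.
have k0 : 0 < (1 - rho') ^- 2 by rewrite invr_gt0 exprn_gt0// subr_gt0.
exists (C * (2 * C0 * (1 - rho') ^- 2)) => [|q r h mq mr hq hr h0 mh hI N].
  by rewrite !mulr_gt0.
pose g d x := (\sum_(j < N.+1) h d j x `^ q x) `^ r x.
have mg d : meas (g d).
  by apply: meas_fun_powR => //; apply: measurable_sum => j; exact: meas_fun_powR.
have g0 d x : 0 <= g d x by exact: powR_ge0.
have mS : meas (fun x => \sum_(d < N.+1) rho' ^+ d * (g d x + g 0%N x)).
  apply: measurable_sum => d; apply: measurable_funM; first exact: measurable_cst.
  exact: measurable_funD.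
have S0 x : 0 <= \sum_(d < N.+1) rho' ^+ d * (g d x + g 0%N x).
  by apply: sumr_ge0 => d _; rewrite mulr_ge0 ?exprn_ge0 ?(ltW r'0)// addr_ge0.
apply: (@le_trans _ _ (\int[mu]_x (C%:E * (\sum_(d < N.+1) rho' ^+ d * (g d x + g 0%N x))%:E))%E).
  apply: ge0_le_integral => //.
  - by nneg.
  - apply/measurable_EFinP; apply: meas_fun_powR => //; apply: measurable_sum => j.
    apply: meas_fun_powR => //; apply: measurable_funD; apply: measurable_sum => k;
      by apply: measurable_funM => //; exact: measurable_cst.
  - by apply/measurable_EFinP; apply: measurable_funM => //; exact: measurable_cst.
  - by move=> x _; rewrite -EFinM lee_fin; exact: (H N (fun d j => h d j x)).
rewrite ge0_integralZl_EFin ?(ltW Cp)//; last 2 first.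
- by move=> x _; rewrite lee_fin.
- exact/measurable_EFinP.
rewrite EFinM lee_wpmul2l ?lee_fin ?(ltW Cp)//.
under eq_integral do rewrite -sumEFin.
rewrite ge0_integral_sum//; last 2 first.
- move=> d; apply/measurable_EFinP; apply: measurable_funM; first exact: measurable_cst.
  exact: measurable_funD.
- by nneg.
apply: (@le_trans _ _ (\sum_(d < N.+1) (2 * C0 * (rho' ^+ d * d.+1%:R))%:E)%E).
  apply: lee_sum => d _; under eq_integral do rewrite EFinM.
  rewrite ge0_integralZl_EFin ?exprn_ge0 ?(ltW r'0)//; last 2 first.
  - by nneg.
  - by apply/measurable_EFinP; exact: measurable_funD.
  under eq_integral do rewrite EFinD.
  rewrite ge0_integralD//; last 4 first.
  - by move=> x _; rewrite lee_fin.
  - exact/measurable_EFinP.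
  - by move=> x _; rewrite lee_fin.
  - exact/measurable_EFinP.
  apply: (@le_trans _ _ ((rho' ^+ d)%:E * ((C0 * d.+1%:R)%:E + (C0 * 1%:R)%:E))%E).
    by rewrite lee_wpmul2l ?lee_fin ?exprn_ge0 ?(ltW r'0)//; apply: leeD; exact: hI.
  have t1 : 1 <= d.+1%:R :> R by rewrite ler1n.
  rewrite -EFinD -EFinM lee_fin -subr_ge0.
  rewrite (_ : _ - _ = rho' ^+ d * (C0 * (d.+1%:R - 1))); last by ring.
  by nneg.
rewrite sumEFin lee_fin -mulr_sumr ler_wpM2l ?mulr_ge0 ?(ltW C00)//.
exact: geo_sum2_le (ltW r'0) r'1.
Qed.

End geometric_sums.

(** * Coefficients of modular at most 1 *)

Section normalisation.
Context {R : realType} {n : nat}.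
Implicit Types (x y z w : 'rV[R]_n).
Variables (p q s : 'rV[R]_n -> R) (pm qm P : R).
Hypotheses (pm0 : 0 < pm) (qm0 : 0 < qm) (hp : forall x, pm <= p x <= P)
  (hq : forall x, qm <= q x <= P) (sq : slow q) (ss : slow s)
  (mp : meas p) (mq : meas q) (ms : meas s).

Local Notation r := (fun x => p x / q x).

Let P0 : 0 < P.
Proof. by have /andP[h1 h2] := hp 0; apply: lt_le_trans pm0 (le_trans h1 h2). Qed.

Let q0 x : 0 < q x.
Proof. by have /andP[h _] := hq x; apply: lt_le_trans h. Qed.

Let p0 x : 0 < p x.
Proof. by have /andP[h _] := hp x; apply: lt_le_trans h. Qed.

Let rm := pm / P.

Let rm0 : 0 < rm. Proof. by nneg. Qed.

Let r_bound x : rm <= p x / q x <= P / qm.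
Proof.
have /andP[p1 p2] := hp x; have /andP[q1 q2] := hq x.
apply/andP; split; apply: ler_pM; rewrite ?invr_ge0 ?(ltW pm0) ?(ltW P0) ?(ltW (p0 x)) ?(ltW (q0 x))//.
  by rewrite lef_pV2 ?posrE.
by rewrite lef_pV2 ?posrE.
Qed.

Let r0 x : 0 < p x / q x. Proof. by rewrite divr_gt0. Qed.

Definition wt nu (c : 'rV[int]_n -> R) x := 2 `^ (nu%:R * s x) * c (cidx nu x).

(** The variant of [wt] that is constant on cubes, as [good_data] requires. *)
Definition wtc nu (c : 'rV[int]_n -> R) x := 2 `^ (nu%:R * s (corner nu x)) * c (cidx nu x).

Lemma powR_ge1 (a e : R) : 1 <= a -> 0 <= e -> 1 <= a `^ e.
Proof. by move=> a1 e0; rewrite -[leLHS](powRr0 a) ler_powR. Qed.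

Lemma powR_mono (a b e : R) : 0 <= e -> 0 <= a -> a <= b -> a `^ e <= b `^ e.
Proof. by move=> e0 a0 ab; rewrite ge0_ler_powR// nnegrE// (le_trans a0). Qed.

Lemma pow2_powR nu (a : R) : 2 `^ (nu%:R * a) = (2 ^+ nu) `^ a.
Proof. by rewrite powRrM powR_mulrn. Qed.

Lemma wt_wtc : exists2 D, 1 <= D & forall nu c x, (forall m, 0 <= c m) ->
  wt nu c x <= D * wtc nu c x /\ wtc nu c x <= D * wt nu c x.
Proof.
have [B H] := slow_exp_change ss ler01; have [D D0 {}H] := H 0 (lexx 0).
exists (Num.max 1 D) => [|nu c x c0]; first by rewrite le_max lexx.
have tt : tame (1 : R) 0 nu x (2 ^+ nu) by have := tame_pow2 1 nu x; rewrite muln1.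
have [h1 h2] := H nu x x (corner nu x) (2 ^+ nu) (corner_dist nu x) tt.
have o1 : om nu x x = 1 by rewrite /om subrr normr0 mulr0 addr0.
rewrite o1 expr1n mulr1 in h1 h2.
have DM : D <= Num.max 1 D by rewrite le_max lexx orbT.
rewrite /wt /wtc !pow2_powR !mulrA; split; rewrite ler_wpM2r//.
  by apply: le_trans h1 _; rewrite ler_wpM2r ?powR_ge0.
by apply: le_trans h2 _; rewrite ler_wpM2r ?powR_ge0.
Qed.

Lemma meas_wt nu c : meas (wt nu c).
Proof.
apply: measurable_funM; last exact: meas_cidx.
apply: meas_fun_powR; first exact: measurable_cst.
by apply: measurable_funM => //; exact: measurable_cst.
Qed.

Definition modular_le (u : nat -> 'rV[int]_n -> R) := (forall nu m, 0 <= u nu m) /\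
  forall N, (\int[mu]_x ((\sum_(j < N.+1) wt j (u j) x `^ q x) `^ (p x / q x))%:E <= 1)%E.

(* Otherwise the integral over the cube of [w] alone would exceed 1. *)
Lemma wtc_le : exists2 D, 1 <= D & forall u nu w, modular_le u ->
  wtc nu (u nu) w <= D * (2 ^+ nu) `^ (n%:R / pm).
Proof.
have [D D1 H] := wt_wtc; exists D => // u nu w [u0 Hu].
have D0 : 0 < D by apply: lt_le_trans D1.
rewrite leNgt; apply/negP; rewrite mulrC -ltr_pdivlMr// => h.
set t := _ / D in h; pose T : R := (2 ^+ nu) `^ (n%:R / pm).
have T1 : 1 <= T by rewrite powR_ge1 ?exprn_ege1 ?ler1n// divr_ge0// ltW.
have t1 : 1 < t by apply: le_lt_trans h.
have tp : 2 ^+ (nu * n) < t `^ pm.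
  have -> : 2 ^+ (nu * n) = T `^ pm.
    by rewrite /T -powRrM divfK ?gt_eqF// powR_mulrn ?exprn_ge0// -exprM.
  by rewrite gt0_ltr_powR// ?nnegrE ?(le_trans ler01)// ltW// (lt_trans ltr01).
have wE x : cidx nu x = cidx nu w -> wtc nu (u nu) x = wtc nu (u nu) w.
  by move=> e; rewrite /wtc e (corner_cidx e).
have key : ((t `^ pm * 2 ^- (nu * n))%:E <= 1)%E.
  apply: le_trans (Hu nu).
  apply: (@le_trans _ _ (\int[mu]_x ((t `^ pm)%:E * (\1_(cubeQ nu (cidx nu w)) x)%:E))%E).
    rewrite ge0_integralZl_EFin ?powR_ge0//; last first.
      by apply/measurable_EFinP; apply: measurable_indic; exact: meas_cubeQ.
    rewrite integral_indic//; last exact: meas_cubeQ.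
    by rewrite setIT [X in (_ * X)%E](measure_cubeQ nu (cidx nu w)) EFinM exprVn -exprM.
  have mI : meas (\1_(cubeQ nu (cidx nu w)) : 'rV[R]_n -> R).
    by apply: measurable_indic; exact: meas_cubeQ.
  apply: ge0_le_integral => //.
  - by move=> x _; rewrite lee_fin mulr_ge0 ?powR_ge0.
  - by apply/measurable_EFinP; apply: measurable_funM => //; exact: measurable_cst.
  - apply/measurable_EFinP; apply: meas_fun_powR; last first.
      by apply: measurable_funM => //; exact: meas_funV.
    by apply: measurable_sum => j; apply: meas_fun_powR => //; exact: meas_wt.
  move=> x _; rewrite -EFinM lee_fin indicE.
  have [|_] := boolP (x \in cubeQ nu (cidx nu w)); last by rewrite mulr0 powR_ge0.
  rewrite inE => /cubeQP e; rewrite mulr1.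
  have tv : t <= wt nu (u nu) x.
    by rewrite ler_pdivrMr// mulrC -(wE x e); case: (H nu (u nu) x (u0 nu)).
  apply: (@le_trans _ _ (wt nu (u nu) x `^ p x)).
    have /andP[px _] := hp x; apply: (@le_trans _ _ (t `^ p x)); first by rewrite ler_powR// ltW.
    rewrite ge0_ler_powR ?nnegrE ?(ltW (p0 x))// ?(le_trans _ tv)// ltW//;
      by apply: lt_trans t1.
  have v0 : 0 <= wt nu (u nu) x by rewrite mulr_ge0 ?powR_ge0.
  have -> : wt nu (u nu) x `^ p x = (wt nu (u nu) x `^ q x) `^ (p x / q x).
    by rewrite -powRrM mulrC divfK// gt_eqF.
  rewrite ge0_ler_powR ?nnegrE ?powR_ge0 ?(ltW (r0 x))//.
    by apply: sumr_ge0 => j _; exact: powR_ge0.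
  by rewrite (bigD1 (ord_max : 'I_nu.+1))//= lerDl; apply: sumr_ge0 => j _; exact: powR_ge0.
move: key; rewrite lee_fin ler_pdivrMr ?exprn_gt0// mul1r leNgt => /negP; exact.
Qed.

(** [a0] makes the r-th power of the floor [flr] integrable; [A2] makes the q-th power of the
    auxiliary floor in [wtc_powR_le] at most a multiple of [flr]. *)
Let a0 : nat := (Num.trunc ((2 * n)%:R / rm)).+1.
Let A2 : nat := (Num.trunc (a0.+1%:R / qm)).+1.

(** Summable over [nu]; it depends on the position through the unit cube only, and is therefore
    constant on the dyadic cubes of every level. *)
Definition flr nu x : R := 2 ^- nu * scl 0 (corner 0 x) ^- a0.

Let flr_gt0 nu x : 0 < flr nu x.
Proof. by rewrite mulr_gt0 ?invr_gt0 ?exprn_gt0 ?scl_gt0. Qed.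

Let flr_cubewise nu : cubewise nu (flr nu).
Proof. by move=> x y e; rewrite /flr (corner_cidx (@cidx_coarse _ _ 0 nu x y e)). Qed.

Lemma scl_scale nu x : scl nu x = 2 ^+ nu * scl 0 x.
Proof. by rewrite /scl exprS expr1 mulrCA !mulrA. Qed.

Let scl1 nu x : 1 <= scl nu x.
Proof. by apply: le_trans (scl_ge2 nu x); rewrite ler1n. Qed.

(** A coefficient may vanish and is then not tame. The exponent is moved from the corner to [x]
    after adding [scl ^- A2], which leaves the term [flr] behind. *)
Lemma wtc_powR_le : exists2 C, 0 < C & forall u nu x, modular_le u ->
  wtc nu (u nu) x `^ q (corner nu x) <= C * (wt nu (u nu) x `^ q x + flr nu x).
Proof.
have [D D1 Hw] := wt_wtc; have [D' D'1 Hu] := wtc_le.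
have D0 : 0 < D by apply: lt_le_trans D1.
pose A : R := A2%:R + n%:R / pm; have A0 : 0 <= A by nneg.
pose C1 := A2%:R * ln 2 + `|ln (D' + 1)|.
have [B H] := slow_exp_change sq A0.
have l2 : 0 <= ln 2 :> R by nneg.
have C10 : 0 <= C1 by nneg.
have {H}[E E0 H] := H C1 C10.
exists (E * 2 `^ P * (D `^ P + 2 ^+ a0)) => [|u nu x mu_].
  by nneg.
have u0 := proj1 mu_; set z := corner nu x; set t := wtc nu (u nu) x.
have t0 : 0 <= t by rewrite mulr_ge0 ?powR_ge0.
pose k := scl nu z ^- A2; have k0 : 0 < k by nneg.
have zx : `|z - x| <= 1.
  by rewrite distrC; apply: le_trans (corner_dist nu x) _; rewrite invf_le1 ?exprn_gt0// exprn_ege1// ler1n.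
have pn : 1 <= (2 ^+ nu) `^ (n%:R / pm) :> R.
  by rewrite powR_ge1 ?exprn_ege1 ?ler1n// divr_ge0// ltW.
have k1 : k <= 1 by rewrite invf_le1 ?exprn_gt0 ?scl_gt0// exprn_ege1.
have tt : tame A C1 nu x (t + k).
  apply: (@tame_between _ _ _ _ _ _ k ((D' + 1) * (2 ^+ nu) `^ (n%:R / pm))).
  - apply: tame_le (tame_near (ler0n R A2) zx (tame_sclV A2 nu z)).
      by rewrite /A lerDl divr_ge0// ltW.
    by rewrite add0r /C1 lerDl.
  - have D'0 : 0 < D' + 1 by rewrite addr_gt0// (lt_le_trans ltr01).
    have t1 : tame (1 : R) 0 nu x (2 ^+ nu) by have := tame_pow2 1 nu x; rewrite muln1.
    have npm : `|n%:R / pm| <= n%:R / pm :> R by rewrite ger0_norm// divr_ge0// ltW.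
    apply: tame_le (tameM (tame_cst nu x D'0) (tame_powR npm t1)).
      by rewrite mulr1 add0r /A lerDr.
    by rewrite mulr0 addr0 /C1 lerDr mulr_ge0.
  - rewrite lerDr t0 /= mulrDl mul1r; apply: lerD; first exact: Hu.
    exact: le_trans pn.
have [_ h] := H nu x x z (t + k) (corner_dist nu x) tt.
have o1 : om nu x x = 1 by rewrite /om subrr normr0 mulr0 addr0.
rewrite o1 expr1n mulr1 in h.
have q00 y : 0 <= q y := ltW (q0 y).
have /andP[q1 q2] := hq x.
have v0 : 0 <= wt nu (u nu) x by rewrite mulr_ge0 ?powR_ge0.
apply: (@le_trans _ _ ((t + k) `^ q z)).
  by rewrite ge0_ler_powR ?nnegrE ?addr_ge0 ?(ltW k0)// lerDl ltW.
apply: le_trans h _; rewrite -!mulrA ler_wpM2l ?(ltW E0)//.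
apply: le_trans (powR_sum2 t0 (ltW k0) (q00 x) q2) _; rewrite ler_wpM2l ?powR_ge0//.
have h1 : t `^ q x <= D `^ P * wt nu (u nu) x `^ q x.
  have [_ tv] := Hw nu (u nu) x (u0 nu).
  apply: (@le_trans _ _ ((D * wt nu (u nu) x) `^ q x)).
    by rewrite ge0_ler_powR ?nnegrE ?mulr_ge0// ltW.
  by rewrite powRM ?(ltW D0)// ler_wpM2r ?powR_ge0// ler_powR.
have h2 : k `^ q x <= 2 ^+ a0 * flr nu x.
  have s0 := scl_gt0 nu z; have z0 := scl_gt0 0 z; have c0 := scl_gt0 0 (corner 0 x).
  apply: (@le_trans _ _ (scl nu z ^- a0.+1)).
    rewrite /k -!powR_invn ?(ltW s0)// -powRrM ler_powR// mulNr lerN2.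
    apply: (@le_trans _ _ (A2%:R * qm)); last by rewrite ler_wpM2l.
    by rewrite -ler_pdivrMr// ltW// truncnS_gt.
  rewrite /flr mulrCA scl_scale exprMn invfM; apply: ler_pM; rewrite ?invr_ge0 ?exprn_ge0 ?(ltW z0)//.
    by rewrite lef_pV2 ?posrE ?exprn_gt0// exprS ler_peMr ?exprn_ge0// exprn_ege1// exprn_ege1// ler1n.
  have dz : `|corner 0 x - z| <= 1.
    have e : cidx 0 x = cidx 0 z by apply: (@cidx_coarse _ _ 0 nu); rewrite add0n cidx_corner.
    by rewrite (corner_cidx e) distrC; apply: le_trans (corner_dist 0 z) _; rewrite expr0 invr1.
  rewrite ler_pdivlMr ?exprn_gt0// ler_pdivrMl ?exprn_gt0// mulrC.
  apply: (@le_trans _ _ ((2 * scl 0 z) ^+ a0)).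
    by rewrite lerXn2r ?nnegrE ?mulr_ge0 ?(ltW c0) ?(ltW z0)//; exact: scl_near.
  by rewrite exprMn ler_wpM2l ?exprn_ge0// ler_weXn2l//; exact: scl1.
rewrite mulrDr; apply: lerD.
  apply: le_trans h1 _; rewrite ler_wpM2r ?powR_ge0// lerDl exprn_ge0//.
by apply: le_trans h2 _; rewrite ler_wpM2r ?(ltW (flr_gt0 _ _))// lerDr powR_ge0.
Qed.

Lemma flr_sum_le N x : \sum_(j < N) flr j x <= 2 * scl 0 (corner 0 x) ^- a0.
Proof.
rewrite /flr -mulr_suml ler_wpM2r ?invr_ge0 ?exprn_ge0 ?(ltW (scl_gt0 _ _))//.
have h : (2^-1 : R) < 1 by rewrite invf_lt1// ltr1n.
have h0 : 0 <= 2^-1 :> R by rewrite invr_ge0.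
under eq_bigr do rewrite -exprVn.
apply: le_trans (geo_sum_le N h0 h) _.
by rewrite (_ : 1 - 2^-1 = 2^-1) ?invrK// -[X in X - _](@divff _ 2)//; field.
Qed.

(* Adding the floor [flr] makes the normalised coefficients bounded below, at
   the cost of an integrable term in the modular. *)
Lemma normalise : exists A0 C0 k : R, [/\ 0 <= A0, 0 <= C0, 0 < k &
  forall u, modular_le u -> exists2 Lam, good_data (fun x => p x / q x) A0 C0 Lam &
    forall nu w, wtc nu (u nu) w <= k * Lam nu w `^ (q (corner nu w))^-1].
Proof.
have [C Cp HC] := wtc_powR_le.
pose C1 := C + 1; have C10 : 0 < C1 by nneg.
pose rM := P / qm; pose C3 := 2 `^ rM * (1 + 2 `^ rM * 2 ^+ n).
have rM0 : 0 <= rM by nneg.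
have C31 : 1 <= C3.
  rewrite -[leLHS]mulr1 ler_pM//; first by rewrite powR_ge1// ler1n.
  by rewrite lerDl mulr_ge0 ?powR_ge0// exprn_ge0.
have C30 : 0 < C3 by apply: lt_le_trans C31.
(* [C1] undoes the constant of [wtc_powR_le]. The other factor raised to the power [r >= rm] is at
   most [1 / C3], and [C3] bounds the modular that results from adding the floors. *)
pose k1 := C1^-1 * C3 `^ (- rm^-1).
have k10 : 0 < k1 by rewrite mulr_gt0 ?invr_gt0// powR_gt0.
pose k := Num.max 1 k1^-1 `^ qm^-1.
have l2 : 0 <= ln 2 :> R by nneg.
exists a0%:R, (`|ln k1| + a0%:R * ln 2), k; split.
- by [].
- by nneg.
- by nneg.
move=> u mu_; have u0 := proj1 mu_.
have t0 nu x : 0 <= wtc nu (u nu) x by rewrite mulr_ge0 ?powR_ge0.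
pose Lam nu x := k1 * (wtc nu (u nu) x `^ q (corner nu x) + flr nu x).
have L0 nu x : 0 < Lam nu x by rewrite mulr_gt0// ltr_wpDl ?powR_ge0.
exists Lam; last first.
  move=> nu w; set z := corner nu w; have qz := q0 z.
  have h : wtc nu (u nu) w `^ q z <= k1^-1 * Lam nu w.
    by rewrite /Lam mulKf ?gt_eqF// lerDl ltW.
  rewrite -[leLHS]powRr1// -(@mulfV _ (q z)) ?gt_eqF// powRrM.
  apply: (@le_trans _ _ ((k1^-1 * Lam nu w) `^ (q z)^-1)).
    by rewrite ge0_ler_powR ?nnegrE ?powR_ge0 ?invr_ge0 ?(ltW qz)// mulr_ge0 ?invr_ge0 ?ltW.
  rewrite powRM ?invr_ge0 ?(ltW k10) ?(ltW (L0 _ _))// ler_wpM2r ?powR_ge0//.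
  have M1 : 1 <= Num.max 1 k1^-1 by rewrite le_max lexx.
  apply: (@le_trans _ _ (Num.max 1 k1^-1 `^ (q z)^-1)).
    rewrite ge0_ler_powR ?nnegrE ?invr_ge0 ?(ltW qz) ?(ltW k10) ?(le_trans ler01)//.
    by rewrite le_max lexx orbT.
  by rewrite ler_powR// lef_pV2 ?posrE//; case/andP: (hq z).
split.
- move=> nu x y e; rewrite /Lam /wtc e (corner_cidx e); congr (_ * (_ + _)).
  exact: flr_cubewise.
- exact: L0.
- move=> x; have c0 := scl_gt0 0 (corner 0 x).
  have h : k1 * scl 0 (corner 0 x) ^- a0 <= Lam 0%N x.
    rewrite /Lam ler_pM2l// /flr expr0 invr1 mul1r lerDr powR_ge0//.
  have kc : 0 < k1 * scl 0 (corner 0 x) ^- a0 by nneg.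
  apply: (@le_trans _ _ (- ln (k1 * scl 0 (corner 0 x) ^- a0))).
    by rewrite lerN2 ler_ln ?posrE.
  rewrite lnM ?posrE ?invr_gt0 ?exprn_gt0// lnV ?posrE ?exprn_gt0// lnXn// opprD opprK.
  have d1 : `|corner 0 x - x| <= 1.
    by rewrite distrC; apply: le_trans (corner_dist 0 x) _; rewrite expr0 invr1.
  have : ln (scl 0 (corner 0 x)) <= ln 2 + ln (scl 0 x).
    by rewrite -lnM ?posrE ?scl_gt0// ler_ln ?posrE ?mulr_gt0 ?scl_gt0//; exact: scl_near.
  move=> /(ler_wpM2l (ler0n R a0)); rewrite mulrDr -[ln _ *+ a0]mulr_natl.
  have := ler_norm (- ln k1); rewrite normrN; lra.
move=> N; pose S x := \sum_(j < N.+1) wt j (u j) x `^ q x.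
have S0 x : 0 <= S x by apply: sumr_ge0 => j _; exact: powR_ge0.
have mS : meas S.
  by apply: measurable_sum => j; apply: meas_fun_powR => //; exact: meas_wt.
have mr : meas (fun x => p x / q x) by apply: measurable_funM => //; exact: meas_funV.
pose T x := 2 * scl 0 (corner 0 x) ^- a0.
have T0 x : 0 <= T x by rewrite mulr_ge0 ?invr_ge0 ?exprn_ge0 ?(ltW (scl_gt0 _ _)).
have FL x : Fsum Lam N x <= C3 `^ (- rm^-1) * (S x + T x).
  rewrite /Fsum /Lam -mulr_sumr /k1 mulrAC mulrC ler_wpM2l ?powR_ge0// ler_pdivrMl//.
  apply: (@le_trans _ _ (C * S x + C1 * \sum_(j < N.+1) flr j x)).
    rewrite !mulr_sumr -big_split/=; apply: ler_sum => j _.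
    by rewrite /C1 mulrDl mul1r addrA lerD2r -mulrDr; exact: HC.
  rewrite mulrDr lerD ?ler_wpM2r ?lerDl// ler_wpM2l ?(ltW C10)//; exact: flr_sum_le.
have Tr x : T x `^ (p x / q x) <= 2 `^ rM * (1 + 1 * `|x - 0|) ^- (2 * n).
  have /andP[r1 r2] := r_bound x; have c0 := scl_gt0 0 (corner 0 x).
  rewrite /T powRM ?invr_ge0 ?exprn_ge0 ?(ltW c0)//; apply: ler_pM; rewrite ?powR_ge0//.
    by rewrite ler_powR// ler1n.
  have y1 : 1 <= 1 + 1 * `|x - 0| by rewrite lerDl mulr_ge0.
  have y0 : 0 < 1 + 1 * `|x - 0| by apply: lt_le_trans y1.
  have cy : 1 + 1 * `|x - 0| <= scl 0 (corner 0 x).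
    have d1 : `|x - corner 0 x| <= 1 by apply: le_trans (corner_dist 0 x) _; rewrite expr0 invr1.
    have := scl_near 0 d1; rewrite {1}/scl expr1 mul1r subr0 ler_pM2l//.
  apply: (@le_trans _ _ (((1 + 1 * `|x - 0|) ^- a0) `^ (p x / q x))).
    rewrite ge0_ler_powR ?nnegrE ?(ltW (r0 x)) ?invr_ge0 ?exprn_ge0 ?(ltW c0) ?(ltW y0)//.
    by rewrite lef_pV2 ?posrE ?exprn_gt0// lerXn2r ?nnegrE ?(ltW c0) ?(ltW y0).
  rewrite -!powR_invn ?(ltW y0)// -powRrM ler_powR// mulNr lerN2.
  apply: (@le_trans _ _ (a0%:R * rm)); last by rewrite ler_wpM2l.
  by rewrite -ler_pdivrMr// ltW// truncnS_gt.
have mk : meas (fun x => (1 + 1 * `|x - 0|) ^- (2 * n)) by exact: meas_kernel.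
have kk0 x : 0 <= (1 + 1 * `|x - 0|) ^- (2 * n) :> R.
  by nneg.
apply: (@le_trans _ _ (\int[mu]_x ((C3^-1 * 2 `^ rM)%:E *
    ((S x `^ (p x / q x))%:E + (2 `^ rM)%:E * ((1 + 1 * `|x - 0|) ^- (2 * n))%:E)))%E).
  apply: ge0_le_integral => //.
  - by nneg.
  - apply/measurable_EFinP; apply: meas_fun_powR => //.
    apply: measurable_sum => j; apply: (@meas_cubewise _ _ j).
    move=> x y e; rewrite /Lam /wtc e (corner_cidx e); congr (_ * (_ + _)); exact: flr_cubewise.
  - apply: emeasurable_funM; first exact: measurable_cst.
    apply: emeasurable_funD; first by apply/measurable_EFinP; exact: meas_fun_powR.
    by apply: emeasurable_funM; [exact: measurable_cst|exact/measurable_EFinP].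
  move=> x _; have /andP[r1 r2] := r_bound x.
  apply: (@le_trans _ _ (C3^-1 * 2 `^ rM * (S x `^ (p x / q x) + 2 `^ rM * (1 + 1 * `|x - 0|) ^- (2 * n)))%:E);
    last by rewrite EFinM EFinD (EFinM (2 `^ rM)).
  rewrite lee_fin.
  have F0 : 0 <= Fsum Lam N x by apply: sumr_ge0 => j _; exact: ltW.
  apply: (@le_trans _ _ ((C3 `^ (- rm^-1) * (S x + T x)) `^ (p x / q x))).
    by rewrite ge0_ler_powR ?nnegrE ?(ltW (r0 x))// mulr_ge0 ?powR_ge0// addr_ge0.
  rewrite powRM ?powR_ge0 ?addr_ge0// -mulrA; apply: ler_pM; rewrite ?powR_ge0//.
    rewrite -powRrM -[leRHS](powR_inv1 (ltW C30)) ler_powR// mulNr lerN2.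
    by rewrite mulrC -ler_pdivrMr ?invr_gt0// invrK mul1r.
  apply: le_trans (powR_sum2 (S0 x) (T0 x) (ltW (r0 x)) r2) _.
  by rewrite ler_wpM2l ?powR_ge0// lerD2l.
rewrite ge0_integralZl_EFin ?mulr_ge0 ?invr_ge0 ?powR_ge0 ?(ltW C30)//; last 2 first.
- by nneg.
- apply: emeasurable_funD; first by apply/measurable_EFinP; exact: meas_fun_powR.
  by apply: emeasurable_funM; [exact: measurable_cst|exact/measurable_EFinP].
rewrite ge0_integralD//; last 3 first.
- by nneg.
- by apply/measurable_EFinP; exact: meas_fun_powR.
- by apply: emeasurable_funM; [exact: measurable_cst|exact/measurable_EFinP].
rewrite ge0_integralZl_EFin ?powR_ge0//; last exact/measurable_EFinP.
apply: (@le_trans _ _ ((C3^-1 * 2 `^ rM)%:E * (1%:E + (2 `^ rM)%:E * (2 ^+ n)%:E))%E).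
  rewrite lee_wpmul2l ?lee_fin ?mulr_ge0 ?invr_ge0 ?powR_ge0 ?(ltW C30)//; apply: leeD.
    exact: (proj2 mu_).
  rewrite lee_wpmul2l ?lee_fin ?powR_ge0//.
  by have := @integral_kernel_le R n 1 0 ltr01; rewrite divr1.
rewrite (_ : (_ * _)%E = (C3^-1 * 2 `^ rM * (1 + 2 `^ rM * 2 ^+ n))%:E)// lee_fin.
by rewrite -mulrA mulVf ?gt_eqF.
Qed.

Variables (tau : 'rV[R]_n -> R) (T : nat).
Hypotheses (sp : slow p) (tau1 : forall x, 1 <= tau x <= T%:R)
  (taup : forall x, (p x)^-1 <= tau x) (tauq : forall x, (q x)^-1 <= tau x).

Definition hw M (u : nat -> 'rV[int]_n -> R) d j x :=
  fine (hh tau j d M (wtc (j + d) (u (j + d)%N)) x).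

Lemma meas_wtc nu c : meas (wtc nu c).
Proof.
apply: (@meas_cubewise _ _ nu) => x y e; by rewrite /wtc e (corner_cidx e).
Qed.

Lemma hw_core : exists M, [/\
  forall u, modular_le u -> forall d j x, (hw M u d j x)%:E = hh tau j d M (wtc (j + d) (u (j + d)%N)) x,
  forall j, exists2 C, 0 < C & forall u, modular_le u -> forall d x, hw M u d j x <= C &
  forall rho, 0 < rho < 1 -> exists2 C, 0 < C & forall u, modular_le u -> forall N,
    (\int[mu]_x ((\sum_(j < N.+1) twosum rho N (fun d j => hw M u d j x) j `^ q x)
       `^ (p x / q x))%:E <= C%:E)%E].
Proof.
have [A0 [C0 [k [A00 C00 k0 HN]]]] := normalise.
pose M := M1 T pm0 qm0 A00 hp hq sp sq; exists M.
have HE := @hrealE R n p q tau pm qm P A0 C0 T pm0 qm0 A00 C00 hp hq sp sq mp mq tau1 taup.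
have Hsup := @hreal_sup R n p q tau pm qm P A0 C0 T pm0 qm0 A00 C00 hp hq sp sq mp mq tau1 taup.
have [C1 C10 Hcore] := @core_bound R n p q tau pm qm P A0 C0 T pm0 qm0 A00 C00 hp hq sp sq mp mq tau1 taup tauq.
have Hm := @meas_hreal R n p q tau pm qm P A0 C0 T pm0 qm0 A00 hp hq sp sq.
have H0 := @hreal_ge0 R n p q tau pm qm P A0 T pm0 qm0 A00 hp hq sp sq.
rewrite -/M in HE Hsup Hcore Hm H0; clearbody M.
have wt0 u nu y : modular_le u -> 0 <= wtc nu (u nu) y.
  by move=> [u0 _]; rewrite mulr_ge0 ?powR_ge0.
have le_k u (Lam : nat -> 'rV[R]_n -> R) : modular_le u -> good_data (fun x => p x / q x) A0 C0 Lam ->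
    (forall nu w, wtc nu (u nu) w <= k * Lam nu w `^ (q (corner nu w))^-1) ->
    forall d j x, (hh tau j d M (wtc (j + d) (u (j + d)%N)) x <= (k * hreal q tau M Lam d j x)%:E)%E.
  move=> mu_ gL hL d j x; rewrite EFinM HE//.
  pose fL y := Lam (j + d)%N y `^ (q (corner (j + d) y))^-1; rewrite -/fL.
  have mL : meas fL.
    apply: (@meas_cubewise _ _ (j + d)) => y y' e.
    by rewrite /fL (good_cube gL e) (corner_cidx e).
  rewrite /hh -ge0_integralZl_EFin ?(ltW k0)//; last 2 first.
  - by move=> y _; rewrite lee_fin; apply: (@hh_integrand_ge0 _ _ tau j d M fL) => z; exact: powR_ge0.
  - exact: (@meas_hh_integrand _ _ tau).
  apply: ge0_le_integral => //.
  - move=> y _; rewrite lee_fin.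
    by apply: (@hh_integrand_ge0 _ _ tau j d M (wtc (j + d) (u (j + d)%N))) => z; exact: wt0.
  - by apply: (@meas_hh_integrand _ _ tau); exact: meas_wtc.
  - apply: emeasurable_funM; first exact: measurable_cst.
    exact: (@meas_hh_integrand _ _ tau).
  move=> y _; set W := 2 ^+ _ * _ * _.
  have W0 : 0 <= W by rewrite !mulr_ge0 ?exprn_ge0 ?invr_ge0 ?exprn_ge0 ?om_ge0 ?powR_ge0.
  apply: (@le_trans _ _ (W * (k * fL y))%:E); last by rewrite mulrCA EFinM.
  by rewrite lee_fin; apply: (ler_wpM2l W0); exact: hL.
have hE u : modular_le u -> forall d j x, (hw M u d j x)%:E = hh tau j d M (wtc (j + d) (u (j + d)%N)) x.
  move=> mu_ d j x; have [Lam gL hL] := HN _ mu_.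
  rewrite fineK// ge0_fin_numE; first by apply: le_lt_trans (le_k _ _ mu_ gL hL d j x) (ltry _).
  by apply: hh_ge0 => y; exact: wt0.
have hwk u (Lam : nat -> 'rV[R]_n -> R) : modular_le u -> good_data (fun x => p x / q x) A0 C0 Lam ->
    (forall nu w, wtc nu (u nu) w <= k * Lam nu w `^ (q (corner nu w))^-1) ->
    forall d j x, hw M u d j x <= k * hreal q tau M Lam d j x.
  by move=> mu_ gL hL d j x; rewrite -lee_fin hE//; exact: le_k.
have hw0 u d j x : modular_le u -> 0 <= hw M u d j x.
  by move=> mu_; apply: fine_ge0; apply: hh_ge0 => y; exact: wt0.
split=> //.
  move=> j; have [C Cp HC] := Hsup j; exists (k * C) => [|u mu_ d x]; first exact: mulr_gt0.
  have [Lam gL hL] := HN _ mu_; apply: le_trans (hwk _ _ mu_ gL hL d j x) _.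
  by rewrite ler_pM2l//; exact: HC.
move=> rho r01; pose kk := Num.max 1 k; have kk1 : 1 <= kk by rewrite le_max lexx.
have kk0 : 0 < kk by apply: lt_le_trans kk1.
pose Ck := (kk `^ P) `^ (P / qm) * C1; have Ck0 : 0 < Ck by nneg.
have [C Cp HC] := @modular_sum R n rho qm P rm (P / qm) Ck r01 qm0 rm0 Ck0.
exists C => // u mu_ N; have [Lam gL hL] := HN _ mu_.
have mr : meas (fun x => p x / q x) by apply: measurable_funM => //; exact: meas_funV.
have mhw d j : meas (hw M u d j).
  apply: (measurableT_comp (f := @fine R)) => //.
  by apply: meas_hh; [exact: meas_wtc|move=> y; exact: wt0].
apply: (HC q (fun x => p x / q x) (hw M u)) => // [d j x|d N']; first exact: hw0.
have mS (f : nat -> 'rV[R]_n -> R) : (forall j, meas (f j)) ->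
    meas (fun x => (\sum_(j < N'.+1) f j x `^ q x) `^ (p x / q x)).
  move=> mf; apply: meas_fun_powR => //; apply: measurable_sum => j.
  exact: meas_fun_powR.
have mh d' j : meas (hreal q tau M Lam d' j) by exact: Hm gL.
apply: (@le_trans _ _ (\int[mu]_x (((kk `^ P) `^ (P / qm))%:E *
    ((\sum_(j < N'.+1) hreal q tau M Lam d j x `^ q x) `^ (p x / q x))%:E))%E).
  apply: ge0_le_integral => //.
  - by nneg.
  - by apply/measurable_EFinP; exact: mS.
  - by apply: emeasurable_funM; [exact: measurable_cst|apply/measurable_EFinP; exact: mS].
  move=> x _; rewrite -EFinM lee_fin; have /andP[r1 r2] := r_bound x; have /andP[q1 q2] := hq x.
  have s0 : 0 <= \sum_(j < N'.+1) hreal q tau M Lam d j x `^ q x by apply: sumr_ge0 => j _; exact: powR_ge0.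
  apply: (@le_trans _ _ ((kk `^ P * \sum_(j < N'.+1) hreal q tau M Lam d j x `^ q x) `^ (p x / q x))).
    apply: powR_mono; [exact: ltW (r0 x)|by apply: sumr_ge0 => j _; exact: powR_ge0|].
    rewrite mulr_sumr; apply: ler_sum => j _.
    apply: (@le_trans _ _ ((kk * hreal q tau M Lam d j x) `^ q x)).
      apply: powR_mono; [exact: ltW (q0 x)|exact: hw0|].
      apply: le_trans (hwk _ _ mu_ gL hL d j x) _; rewrite ler_wpM2r ?H0//.
      by rewrite le_max lexx orbT.
    by rewrite powRM ?(ltW kk0) ?H0// ler_wpM2r ?powR_ge0// ler_powR.
  rewrite powRM ?powR_ge0// ler_wpM2r ?powR_ge0// ler_powR//.
  by rewrite powR_ge1// ltW.
rewrite ge0_integralZl_EFin ?powR_ge0//; last 2 first.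
- by nneg.
- by apply/measurable_EFinP; exact: mS.
rewrite /Ck -mulrA EFinM lee_wpmul2l ?lee_fin ?powR_ge0//; exact: Hcore.
Qed.

End normalisation.

(** * Bounds of the exponents and the number of moments *)

Section exponents.
Context {R : realType} {n : nat}.
Implicit Types (x y z w : 'rV[R]_n) (e : 'rV[R]_n -> R).

Lemma slow_min e e' : slow e -> slow e' -> slow (fun x => Num.min (e x) (e' x)).
Proof.
move=> [[b hb] [c c0 hc]] [[b' hb'] [c' c'0 hc']]; split.
  exists (b + b') => x; have b0 : 0 <= b by apply: le_trans (hb x).
  have b'0 : 0 <= b' by apply: le_trans (hb' x).
  have := hb x; have := hb' x; case: (leP (e x) (e' x)) => _ h1 h2.
    by apply: le_trans h2 _; rewrite lerDl.
  by apply: le_trans h1 _; rewrite lerDr.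
exists (c + c') => [|j x y]; first exact: addr_ge0.
apply: (@le_trans _ _ ((`|e x - e y| + `|e' x - e' y|) * ln (scl j x))); last first.
  by rewrite !mulrDl lerD.
rewrite ler_wpM2r ?ln_scl_ge0//.
have h1 := ler_norm (e x - e y); have h2 := ler_norm (e' x - e' y).
have h3 := ler_norm (e y - e x); have h4 := ler_norm (e' y - e' x).
have p1 := normr_ge0 (e x - e y); have p2 := normr_ge0 (e' x - e' y).
rewrite (distrC (e y)) in h3; rewrite (distrC (e' y)) in h4.
by rewrite ler_norml; case: (leP (e x) (e' x)) => a1; case: (leP (e y) (e' y)) => a2; apply/andP; split; lra.
Qed.

Lemma ae_cube (P : 'rV[R]_n -> Prop) : (\forall y \ae mu, P y) ->
  forall nu x, exists2 y, cidx nu y = cidx nu x & P y.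
Proof.
move=> [N [mN N0 PN]] nu x; apply: contrapT => H.
have QN : cubeQ nu (cidx nu x) `<=` N.
  by move=> y /cubeQP e; apply: PN => Py; apply: H; exists y.
have : (mu (cubeQ nu (cidx nu x)) <= mu N)%E.
  by apply: le_measure => //; rewrite inE//; exact: meas_cubeQ.
by rewrite (measure_cubeQ nu (cidx nu x)) [X in (_ <= X)%E]N0 leNgt lte_fin !exprn_gt0 ?invr_gt0 ?exprn_gt0.
Qed.

Lemma slow_cube e : slow e -> exists2 c, 0 <= c &
  forall nu x y, cidx nu x = cidx nu y -> `|e x - e y| <= c / nu.+1%:R.
Proof.
have l2 : 0 < ln 2 :> R by rewrite ln_gt0// ltr1n.
move=> [_ [c c0 hc]]; exists (c * (1 + ln 2) / ln 2).
  by nneg.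
move=> nu x y e_; rewrite mulrAC ler_pdivlMr// ler_pdivlMr ?ltr0n// -mulrA.
apply: (@le_trans _ _ (`|e x - e y| * ln (scl nu x))).
  by rewrite ler_wpM2l// ln_scl mulrC lerDl ln_ge0// lerDl.
apply: le_trans (hc nu x y) _; rewrite ler_wpM2l// lerD2l ler_ln ?posrE ?om_gt0//.
by apply: om_near; exact: cidx_dist.
Qed.

(** The oscillation of [e] on the cubes of level [nu] tends to 0, and every cube contains a point at
    which the almost everywhere bound holds. *)
Lemma slow_ae_ge e (lo : R) : slow e -> (\forall y \ae mu, lo <= e y) -> forall x, lo <= e x.
Proof.
move=> /slow_cube[c c0 hc] H x; rewrite leNgt; apply/negP; rewrite -subr_gt0 => h.
pose nu := Num.trunc (c / (lo - e x)).
have [y yx ly] := ae_cube H nu x.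
have := hc nu x y (esym yx); rewrite leNgt => /negP; apply.
rewrite distrC; apply: (@lt_le_trans _ _ (lo - e x)); last first.
  by apply: le_trans (ler_norm _); rewrite lerD2r.
by rewrite ltr_pdivrMr ?ltr0n// mulrC -ltr_pdivrMr// truncnS_gt.
Qed.

Lemma ess_inf_on_bounds nu m e (lo hi : R) : (exists y, cidx nu y = m) ->
  (forall y, cidx nu y = m -> lo <= e y <= hi) ->
  lo <= fine (ess_inf_on (cubeQ nu m) e) <= hi.
Proof.
move=> [x xm] H.
have h1 : (lo%:E <= ess_inf_on (cubeQ nu m) e)%E.
  apply: ereal_sup_ubound => /=; apply: aeW => y /cubeQP ym.
  by rewrite lee_fin; case/andP: (H y ym).
have h2 : (ess_inf_on (cubeQ nu m) e <= hi%:E)%E.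
  apply: ge_ereal_sup => y /= /ae_cube/(_ nu x)[z zx hz]; rewrite xm in zx.
  apply: (le_trans (hz _)); first exact/cubeQP.
  by rewrite lee_fin; case/andP: (H z zx).
by rewrite -!lee_fin fineK ?h1// fin_real// (lt_le_trans (ltNyr _) h1) (le_lt_trans h2 (ltry _)).
Qed.

Lemma P0_bounds e : P0 e -> slow e -> exists em eM : R, 0 < em /\ forall x, em <= e x <= eM.
Proof.
move=> [_ _ i0 _] se; have [[b hb] _] := se.
have [em em0 hem] : exists2 em : R, 0 < em & \forall x \ae mu, em <= e x.
  have [v vae v0] := ereal_sup_gt i0.
  have [em em0 hv] : exists2 em : R, 0 < em & (em%:E <= v)%E.
    by case: v v0 {vae} => [r r0| _|//]; [exists r|exists 1 => //; rewrite leey].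
  by exists em => //; apply: filterS vae => x; rewrite -lee_fin; exact: le_trans.
exists em, b; split=> // x; rewrite (le_trans (ler_norm _) (hb x)) andbT.
by move: x; exact: slow_ae_ge.
Qed.

Lemma ess_sup_lt e (K : R) : slow e -> (ess_sup mu (fun x => (e x)%:E) < K%:E)%E ->
  exists2 del, 0 < del & forall x, e x <= K - del.
Proof.
move=> se h; have [v vK hv] : exists2 v : R, v < K & (ess_sup mu (fun x => (e x)%:E) <= v%:E)%E.
  move: h; case: (ess_sup _ _) => [r rK|//|_]; first by exists r.
  by exists (K - 1); rewrite ?ltrBlDr ?ltrDl// leNye.
exists (K - v) => [|x]; first by rewrite subr_gt0.
rewrite subKr -lerN2; apply: (slow_ae_ge (slowN se)).
have := ess_supP hv; apply: filterS => y; by rewrite lee_fin lerN2.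
Qed.

Variables (tau s : 'rV[R]_n -> R) (eps : R).
Hypotheses (stau : slow tau) (ss : slow s).

Let L x := n%:R * (tau x - 1) - s x + eps.

(** Counts the orders [0, ..., floor l] of the vanishing moments; there are none if
    [floor l <= -1]. *)
Definition nmom (l : R) : nat := absz (Num.max 0 (Num.floor l + 1)).

Lemma nmom_ge l : l <= (nmom l)%:R.
Proof.
apply: ltW; apply: lt_le_trans (floorD1_gt l) _.
by rewrite -[X in _ <= X]pmulrn natr_absz ger0_norm ?le_max ?lexx// ler_int le_max lexx orbT.
Qed.

Lemma nmom_lt l k : (k < nmom l)%N -> k%:Z <= Num.floor l.
Proof. by rewrite /nmom; move: (Num.floor l) => f; case: leP => h; lia. Qed.

Lemma nmom_le l (b : R) : l <= b -> (nmom l <= nmom b)%N.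
Proof.
move=> /le_floor; rewrite /nmom; move: (Num.floor l) (Num.floor b) => f g fg.
by case: leP => h; case: leP => h'; lia.
Qed.

Definition cube_nmom nu m : nat :=
  if nu is 0%N then 0%N else nmom (fine (ess_inf_on (cubeQ nu m) L)).

(** Passing from the infimum over the cube to the value at the corner costs [c / (nu + 1)], and
    [d <= nu] such losses stay bounded; what remains is [2 ^ (- d (L + n))], factored. At level 0,
    where no moments are asked, [d] is 0. The bound [Nmax] is there for constants uniform in the
    number of moments. *)
Lemma cube_nmom_spec : exists2 Nmax, forall nu w, (cube_nmom nu (cidx nu w) <= Nmax)%N &
  exists2 C, 0 < C & forall nu d w, (d <= nu)%N ->
    2 ^- (d * cube_nmom nu (cidx nu w)) * 2 ^- (d * n) <=
    C * 2 `^ (- d%:R * eps) * 2 `^ (- (d * n)%:R * tau (corner nu w)) * 2 `^ (d%:R * s (corner nu w)).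
Proof.
have sL : slow L.
  rewrite /L; apply: slowD (slow_cst eps); apply: slowD (slowN ss).
  by apply: slowM (slow_cst _) _; apply: slowD stau (slow_cst _).
have [[b hb] _] := sL; have [c c0 hc] := slow_cube sL.
have H nu w : L (corner nu w) - c / nu.+1%:R <= fine (ess_inf_on (cubeQ nu (cidx nu w)) L) <= b.
  apply: ess_inf_on_bounds; first by exists w.
  move=> y yw; rewrite (le_trans (ler_norm _) (hb y)) andbT.
  have := hc nu (corner nu w) y; rewrite cidx_corner yw => /(_ erefl).
  by rewrite ler_norml => /andP[_ h]; rewrite lerBlDr addrC -lerBlDr.
exists (nmom b).
  by case=> // nu w /=; apply: nmom_le; case/andP: (H nu.+1 w).
exists (2 `^ c) => [|nu d w dn]; first exact: powR_gt0.
have -> : 2 ^- (d * cube_nmom nu (cidx nu w)) * 2 ^- (d * n) =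
    2 `^ (- (d%:R * ((cube_nmom nu (cidx nu w))%:R + n%:R))) :> R.
  by rewrite -invfM -exprD -mulnDr -powR_invn// natrM natrD.
rewrite -!powRD; try by rewrite pnatr_eq0 implybT.
rewrite ler_powR ?ler1n//.
case: nu d dn w => [|nu] d dn w.
  by move: dn; rewrite leqn0 => /eqP ->; rewrite mul0n !(mul0r, mulr0, oppr0, addr0).
have /andP[h _] := H nu.+1 w; have := le_trans h (nmom_ge _).
rewrite -/(cube_nmom nu.+1 (cidx nu.+1 w)) /L; set N := (cube_nmom _ _)%:R; set z := corner _ _ => h1.
have d0 : 0 <= d%:R :> R by [].
have dn' : d%:R * (c / nu.+2%:R) <= c.
  by rewrite mulrA ler_pdivrMr ?ltr0n// mulrC ler_wpM2l// ler_nat leqW.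
have := ler_wpM2l d0 h1; rewrite natrM; set t := d%:R in d0 dn' *.
set k := c / _ in dn' h1 *; move=> h2; clear -h2 dn'; nra.
Qed.

End exponents.

(** * Bounds for atoms *)

Section atom_bounds.
Context {R : realType} {n : nat}.
Implicit Types (x y z w c : 'rV[R]_n) (f th phi : 'rV[R]_n -> R[i]) (b : bool).

(** The product of the normalising factors of [ifourier] and [fourier]. *)
Definition c2pi : R := Num.sqrt (2 * pi) ^- n * Num.sqrt (2 * pi) ^- n.

Lemma c2pi_ge0 : 0 <= c2pi.
Proof. by rewrite mulr_ge0// invr_ge0 exprn_ge0// sqrtr_ge0. Qed.
Hint Extern 0 (is_true (@Order.le _ _ _ c2pi)) => by apply: c2pi_ge0 : nneg.

(** The convolution kernel of [theta(D)]. *)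
Definition cK th z : R[i] := c2pi%:C * cintegral (fun xi => expi (dotv z xi) * th xi).

Definition ph b : R := if b then 0 else pi / 2.

Lemma cK_part th z : (forall b, bdsupp (pt b th)) ->
  complex.Re (cK th z) = c2pi * (KK 0 (pt true th) z + KK (pi / 2) (pt false th) z) /\
  complex.Im (cK th z) = c2pi * (KK 0 (pt false th) z + KK (- (pi / 2)) (pt true th) z).
Proof.
move=> bd; have I t b : intg (fun xi => cos (dotv z xi + t) * pt b th xi).
  by have [B [r [mg r0 B0 gB g0]]] := bd b; case: (KK_bound mg r0 B0 gB g0 t z).
have [_ E1] := Rint_lin 1 1 (I 0 true) (I (pi / 2) false).
have [_ E2] := Rint_lin 1 1 (I 0 false) (I (- (pi / 2)) true).
rewrite /cK ReM ImM /= !(mul0r, subr0, addr0); split; congr (_ * _).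
  rewrite !mul1r in E1; rewrite -E1; apply: eq_Rintegral => xi _.
  by rewrite ReM /= !mul1r addr0 cosDpihalf mulNr.
rewrite !mul1r in E2; rewrite -E2; apply: eq_Rintegral => xi _.
by rewrite ImM /= !mul1r addr0 cosBpihalf.
Qed.

Lemma lin4 (u1 u2 u3 u4 : 'rV[R]_n -> R) (e1 e2 e3 e4 k E : R) : intg u1 -> intg u2 -> intg u3 -> intg u4 ->
  `|e1| <= k -> `|e2| <= k -> `|e3| <= k -> `|e4| <= k ->
  `|\int[mu]_x u1 x| <= E -> `|\int[mu]_x u2 x| <= E -> `|\int[mu]_x u3 x| <= E -> `|\int[mu]_x u4 x| <= E ->
  intg (fun x => 1 * (e1 * u1 x + e2 * u2 x) + 1 * (e3 * u3 x + e4 * u4 x)) /\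
  `|\int[mu]_x (1 * (e1 * u1 x + e2 * u2 x) + 1 * (e3 * u3 x + e4 * u4 x))| <= 4 * k * E.
Proof.
move=> I1 I2 I3 I4 k1 k2 k3 k4 h1 h2 h3 h4.
have [J1 F1] := Rint_lin e1 e2 I1 I2; have [J2 F2] := Rint_lin e3 e4 I3 I4.
have [J F] := Rint_lin 1 1 J1 J2; split=> //; rewrite F F1 F2 !mul1r.
have H (e v : R) : `|e| <= k -> `|v| <= E -> `|e * v| <= k * E.
  by move=> ek vE; rewrite normrM ler_pM.
have := H _ _ k1 h1; have := H _ _ k2 h2; have := H _ _ k3 h3; have := H _ _ k4 h4.
set v1 := e1 * _; set v2 := e2 * _; set v3 := e3 * _; set v4 := e4 * _.
rewrite (_ : 4 * k * E = (k * E + k * E) + (k * E + k * E)); last by ring.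
move=> a4 a3 a2 a1; apply: le_trans (ler_normD _ _) (lerD _ _);
  by apply: le_trans (ler_normD _ _) (lerD _ _).
Qed.

Lemma cK_atom th f x c (r E : R) : (forall b, bdsupp (pt b th)) -> 0 < r ->
  (forall b, meas (pt b f)) -> (forall y, cmod (f y) <= 1) ->
  (forall b y, r < `|y - c| -> pt b f y = 0) ->
  (forall b b' t, `|\int[mu]_y (KK t (pt b th) (y - x) * pt b' f y)| <= E) ->
  cintegrable (fun y => f y * cK th (x - y)) /\
  cmod (cintegral (fun y => f y * cK th (x - y))) <= 8 * c2pi * E.
Proof.
move=> bd r0 mf f1 f0 hE; have k0 := c2pi_ge0.
pose I t b b' y := KK t (pt b th) (y - x) * pt b' f y.
have II t b b' : intg (I t b b').
  by apply: (intg_KKshift x (bd b) t (mf b') r0 ler01 _ (f0 b')) => y; apply: le_trans (part_le _ _) (f1 y).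
have e1 : `|c2pi| <= c2pi by rewrite ger0_norm.
have e2 : `|- c2pi| <= c2pi by rewrite normrN ger0_norm.
have [I1 E1] := lin4 (II 0 true true) (II (- (pi / 2)) false true) (II 0 false false) (II (pi / 2) true false)
  e1 e1 e2 e2 (hE _ _ _) (hE _ _ _) (hE _ _ _) (hE _ _ _).
have [I2 E2] := lin4 (II 0 false true) (II (pi / 2) true true) (II 0 true false) (II (- (pi / 2)) false false)
  e1 e1 e1 e1 (hE _ _ _) (hE _ _ _) (hE _ _ _) (hE _ _ _).
have R1 : (fun y => complex.Re (f y * cK th (x - y))) = (fun y =>
    1 * (c2pi * I 0 true true y + c2pi * I (- (pi / 2)) false true y) +
    1 * (- c2pi * I 0 false false y + - c2pi * I (pi / 2) true false y)).
  apply/funext => y; rewrite ReM; have [-> ->] := cK_part (x - y) bd.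
  by rewrite !(KK_refl _ _ x) oppr0 opprK /I /pt /=; ring.
have R2 : (fun y => complex.Im (f y * cK th (x - y))) = (fun y =>
    1 * (c2pi * I 0 false true y + c2pi * I (pi / 2) true true y) +
    1 * (c2pi * I 0 true false y + c2pi * I (- (pi / 2)) false false y)).
  apply/funext => y; rewrite ImM; have [-> ->] := cK_part (x - y) bd.
  by rewrite !(KK_refl _ _ x) oppr0 opprK /I /pt /=; ring.
rewrite -R1 in I1 E1; rewrite -R2 in I2 E2; split; first by split.
apply: le_trans (cmod_le _) _; apply: (@le_trans _ _ (4 * c2pi * E + 4 * c2pi * E)); last by lra.
exact: lerD.
Qed.

Hypothesis n0 : (0 < n)%N.
Variables (theta : nat -> 'rV[R]_n -> R[i]) (ga eps : R) (K : nat) (s tau : 'rV[R]_n -> R)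
  (a : nat -> 'rV[int]_n -> 'rV[R]_n -> R[i]).
Hypotheses (htheta : in_Phi theta) (ga1 : 1 < ga) (ss : slow s) (stau : slow tau)
  (ha : smooth_atoms ga K (fun x => n%:R * (tau x - 1) - s x + eps) a).

Local Notation N_ := (cube_nmom tau s eps).

Lemma bdsupp_theta b j : bdsupp (pt b (theta j)).
Proof.
have [cc cc0 hb] := theta_bump n0 htheta.
exact: (@bdsupp_th R n n0 (fun j => pt b (theta j)) _ _ cc0 (hb b) j).
Qed.

Definition Bk nu m j x : R[i] := cintegral (fun y => a nu m y * cK (theta j) (x - y)).

Lemma a_mom b nu m (l : seq 'I_n) : (size l < N_ nu m)%N ->
  \int[mu]_x (mon l x * pt b (a nu m) x) = 0.
Proof. by case: nu => // nu /= h; apply: (atom_mom (ha _ _)) => //; exact: nmom_lt. Qed.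

Let ga0 : 0 < ga. Proof. exact: lt_trans ga1. Qed.

Lemma a_supp b nu m y : ga * 2 ^- nu < `|y - cube_center nu m| -> pt b (a nu m) y = 0.
Proof. exact: (ra_supp (atom_ratom ga1 (ha nu m) b) (Ordinal n0) (leq0n K)). Qed.

Lemma a_meas b nu m : meas (pt b (a nu m)).
Proof. exact: (atom_meas (ha nu m)). Qed.

Lemma a_le1 b nu m y : `|pt b (a nu m) y| <= 1.
Proof. exact: le_trans (part_le _ _) (atom_le (ha nu m) y). Qed.

Lemma om_center M j nu x w : (j <= nu)%N ->
  om j x (cube_center nu (cidx nu w)) ^- M <= 2 ^+ M * om j x w ^- M.
Proof.
move=> jn; rewrite -[leLHS]mul1r ler_pdivrMr ?exprn_gt0 ?om_gt0// mulrAC ler_pdivlMr ?exprn_gt0 ?om_gt0//.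
rewrite mul1r -exprMn lerXn2r ?nnegrE ?om_ge0 ?mulr_ge0 ?om_ge0// mulrC.
apply: le_trans (om_tri j x (cube_center nu (cidx nu w)) w) _.
rewrite ler_wpM2l ?om_ge0//; apply: om_near; rewrite distrC.
apply: le_trans (cube_center_dist (erefl _)) _.
by rewrite lef_pV2 ?posrE ?exprn_gt0// ler_weXn2l// ler1n.
Qed.

Lemma uniform_nat (P : nat -> R -> Prop) N : (forall k C C', C <= C' -> P k C -> P k C') ->
  (forall k, exists2 C, 0 <= C & P k C) -> exists2 C, 0 <= C & forall k, (k <= N)%N -> P k C.
Proof.
move=> mP H; have [C C0 hC] := @fin_bound R N.+1 (fun i => P i) (fun i => mP i) (fun i => H i).
by exists C => // k kN; exact: (hC (Ordinal (kN : (k < N.+1)%N))).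
Qed.

Lemma pow_s : exists Bs, exists2 D, 0 < D & forall j nu x w, (j <= nu)%N ->
  2 `^ (j%:R * s x) <= D * om j x w ^+ Bs * 2 `^ (j%:R * s (corner nu w)).
Proof.
have [B H] := slow_exp_change ss ler01; have [D D0 {}H] := H 0 (lexx 0); exists B, D => // j nu x w jn.
have tt : tame (1 : R) 0 j x (2 ^+ j) by have := tame_pow2 1 j x; rewrite muln1.
by have [h _] := H j x w (corner nu w) (2 ^+ j) (corner_near w jn) tt; rewrite !pow2_powR.
Qed.

(** Integrated in [w] against [2 ^ ((j + d) n)] times the moduli of the coefficients, this yields
    [hh] of [wtc]. The case [d = 0] serves the levels coarser than the kernel, and [j = 0], [x = 0]
    the test functions. *)
Definition wk M j d x w : R := om j x w ^- M * 2 `^ (- (d * n)%:R * tau (corner (j + d) w)) *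
  2 `^ ((j + d)%:R * s (corner (j + d) w)).

Lemma wk_ge0 M j d x w : 0 <= wk M j d x w.
Proof. by rewrite /wk !mulr_ge0 ?powR_ge0// invr_ge0 exprn_ge0// om_ge0. Qed.
Hint Extern 0 (is_true (@Order.le _ _ _ (wk _ _ _ _ _ _ _))) => by apply: wk_ge0 : nneg.

Let om_split j x w M Bs : om j x w ^+ Bs * om j x w ^- (M + Bs) = om j x w ^- M.
Proof.
have o0 : om j x w ^+ Bs != 0 by rewrite expf_neq0// gt_eqF// om_gt0.
by rewrite exprD invfM mulrCA mulfV ?mulr1.
Qed.

(** [atom_coarse] and [cube_nmom_spec] combined. Moving the exponent [s] from [x] to the corner
    costs [om ^ Bs], which is why the kernel is asked for the decay [M + Bs]. *)
Lemma coarse_bound M : exists2 C, 0 <= C & forall j d x w,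
  cintegrable (fun y => a (j + d)%N (cidx (j + d) w) y * cK (theta j) (x - y)) /\
  2 `^ (j%:R * s x) * cmod (Bk (j + d) (cidx (j + d) w) j x) <=
    C * 2 `^ (- d%:R * eps) * wk M j d x w.
Proof.
have [cc cc0 hb] := theta_bump n0 htheta.
have al0 : 0 < (2 * n%:R)^-1 :> R by nneg.
have [Bs [D D0 HD]] := pow_s; have [Nm HN [E E0 HE]] := cube_nmom_spec eps stau ss.
pose P (N : nat) (C : R) := forall b (j d : nat) c (u : 'rV[R]_n -> R) x (t : R), meas u -> (forall y, `|u y| <= 1) ->
  (forall y, ga * 2 ^- (j + d) < `|y - c| -> u y = 0) ->
  (forall be, (size be < N)%N -> \int[mu]_x (mon be x * u x) = 0) ->
  `|\int[mu]_y (KK t (pt b (theta j)) (y - x) * u y)| <= C * 2 ^- (d * N) * 2 ^- (d * n) * om j x c ^- (M + Bs).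
(* The number of moments varies with the cube but takes finitely many values, so one constant serves
   for all of them. *)
have [C C0 HC] : exists2 C, 0 <= C & forall N, (N <= Nm)%N -> P N C.
  apply: uniform_nat => [N C C' CC h b j d c u x t mu_ u1 u0 mom|N].
    apply: le_trans (h b j d c u x t mu_ u1 u0 mom) _.
    by rewrite !ler_wpM2r ?invr_ge0 ?exprn_ge0 ?om_ge0.
  have [C1 C10 H1] := @atom_coarse R n n0 _ _ _ al0 cc0 (fun j i => hb true j i) (M + Bs) N ga ga0.
  have [C2 C20 H2] := @atom_coarse R n n0 _ _ _ al0 cc0 (fun j i => hb false j i) (M + Bs) N ga ga0.
  exists (C1 + C2) => [|b j d c u x t mu_ u1 u0 mom]; first exact: addr_ge0.
  pose p := 2 ^- (d * N) * 2 ^- (d * n) * om j x c ^- (M + Bs) : R.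
  have p0 : 0 <= p by nneg.
  have pE (k : R) : k * 2 ^- (d * N) * 2 ^- (d * n) * om j x c ^- (M + Bs) = k * p by rewrite /p !mulrA.
  have := H1 j d c u x t mu_ u1 u0 mom; have := H2 j d c u x t mu_ u1 u0 mom; rewrite !pE => h2 h1.
  by case: b; [apply: le_trans h1 _|apply: le_trans h2 _]; rewrite ler_wpM2r// ?lerDl ?lerDr.
exists (8 * c2pi * C * 2 ^+ (M + Bs) * E * D) => [|j d x w].
  by nneg.
set nu := (j + d)%N; set m := cidx nu w; set z := corner nu w.
have mom b be : (size be < N_ nu m)%N -> \int[mu]_x (mon be x * pt b (a nu m) x) = 0 by exact: a_mom.
have r0 : 0 < ga * 2 ^- nu by rewrite mulr_gt0 ?invr_gt0 ?exprn_gt0.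
have [I h] := @cK_atom (theta j) (a nu m) x (cube_center nu m) _ _ (fun b => bdsupp_theta b j) r0
  (fun b => a_meas b nu m) (atom_le (ha nu m)) (fun b y => @a_supp b nu m y)
  (fun b b' t => HC _ (HN nu w) b j d (cube_center nu m) _ x t (a_meas b' nu m) (a_le1 b' nu m)
    (fun y => @a_supp b' nu m y) (mom b')).
split=> //.
have k8 : 0 <= 8 * c2pi * C by nneg.
apply: (@le_trans _ _ (D * om j x w ^+ Bs * 2 `^ (j%:R * s z) * (8 * c2pi * C *
    (E * 2 `^ (- d%:R * eps) * 2 `^ (- (d * n)%:R * tau z) * 2 `^ (d%:R * s z)) *
    (2 ^+ (M + Bs) * om j x w ^- (M + Bs))))).
  apply: ler_pM; rewrite ?powR_ge0 ?cmod_ge0//; first exact: HD (leq_addr _ _).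
  apply: le_trans h _; set X := _ * (2 `^ (_ * s z)).
  have X0 : 0 <= X by nneg.
  have := ler_pM _ _ (HE nu d w (leq_addl _ _)) (om_center (M + Bs) x w (leq_addr d j)).
  rewrite -/nu -/m -/z -/X !mulr_ge0 ?invr_ge0 ?exprn_ge0 ?om_ge0// => /(_ isT isT).
  move/(ler_wpM2l k8); rewrite (mulrA _ X) => /(le_trans _); apply.
  by rewrite le_eqVlt; apply/orP; left; apply/eqP; ring.
rewrite le_eqVlt; apply/orP; left; apply/eqP.
have e : 2 `^ (nu%:R * s z) = 2 `^ (j%:R * s z) * 2 `^ (d%:R * s z).
  by rewrite -powRD ?pnatr_eq0 ?implybT// -mulrDl -natrD.
by rewrite /wk -/nu -/z e -(om_split j x w M Bs); ring.
Qed.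

(** The weight [2 ^ (j s)] exceeds [2 ^ (nu s)] by [2 ^ ((j - nu) s)], and the smoothness of the
    atom gains [2 ^- ((j - nu) K)]; the difference between [K] and [s] leaves the decay. *)
Lemma fine_bound del M : (forall x, s x <= K%:R - del) -> exists2 C, 0 <= C & forall nu j x w,
  (nu < j)%N ->
  cintegrable (fun y => a nu (cidx nu w) y * cK (theta j) (x - y)) /\
  2 `^ (j%:R * s x) * cmod (Bk nu (cidx nu w) j x) <=
    C * 2 `^ (- (j - nu)%:R * del) * wk M nu 0 x w.
Proof.
move=> sK; have [cc cc0 hb] := theta_bump n0 htheta.
have al0 : 0 < (2 * n%:R)^-1 :> R by nneg.
have [Bs [D D0 HD]] := pow_s.
have [C1 C10 H1] := @atom_fine R n n0 _ _ _ al0 cc0 (hb true) (M + Bs) K ga ga0.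
have [C2 C20 H2] := @atom_fine R n n0 _ _ _ al0 cc0 (hb false) (M + Bs) K ga ga0.
pose C := C1 + C2; have C0 : 0 <= C by nneg.
exists (8 * c2pi * C * 2 ^+ (M + Bs) * D) => [|nu j x w nuj].
  by nneg.
set m := cidx nu w; set z := corner nu w.
have r0 : 0 < ga * 2 ^- nu by nneg.
pose c := cube_center nu m : 'rV[R]_n.
pose p := 2 ^- ((j - nu) * K) * om nu x c ^- (M + Bs) : R.
have p0 : 0 <= p by nneg.
have HC b b' t : `|\int[mu]_y (KK t (pt b (theta j)) (y - x) * pt b' (a nu m) y)| <= C * p.
  have h1 := H1 nu j c _ x t nuj (atom_ratom ga1 (ha nu m) b').
  have h2 := H2 nu j c _ x t nuj (atom_ratom ga1 (ha nu m) b').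
  by case: b; [apply: le_trans h1 _|apply: le_trans h2 _]; rewrite -mulrA ler_wpM2r// ?lerDl ?lerDr.
have [I h] := @cK_atom (theta j) (a nu m) x c _ _ (fun b => bdsupp_theta b j) r0
  (fun b => a_meas b nu m) (atom_le (ha nu m)) (fun b y => @a_supp b nu m y) HC.
split=> //; have k8 : 0 <= 8 * c2pi * C by nneg.
have dK : 2 `^ ((j - nu)%:R * s x) * 2 ^- ((j - nu) * K) <= 2 `^ (- (j - nu)%:R * del).
  rewrite -powR_invn// natrM -powRD ?pnatr_eq0 ?implybT// ler_powR ?ler1n//.
  rewrite -mulrN -mulrDr mulNr -mulrN ler_wpM2l// lerBlDr addrC; exact: sK.
apply: (@le_trans _ _ (D * om nu x w ^+ Bs * 2 `^ (nu%:R * s z) * 2 `^ ((j - nu)%:R * s x) *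
    (8 * c2pi * C * (2 ^- ((j - nu) * K) * (2 ^+ (M + Bs) * om nu x w ^- (M + Bs)))))).
  apply: ler_pM; rewrite ?powR_ge0 ?cmod_ge0//.
    have -> : 2 `^ (j%:R * s x) = 2 `^ (nu%:R * s x) * 2 `^ ((j - nu)%:R * s x).
      by rewrite -powRD ?pnatr_eq0 ?implybT// -mulrDl -natrD subnKC// ltnW.
    by rewrite ler_wpM2r ?powR_ge0//; exact: HD (leqnn _).
  apply: le_trans h _; rewrite (mulrA _ C p); apply: (ler_wpM2l k8); apply: ler_wpM2l.
    by nneg.
  exact: om_center (leqnn _).
apply: (@le_trans _ _ (8 * c2pi * C * 2 ^+ (M + Bs) * D * (2 `^ ((j - nu)%:R * s x) * 2 ^- ((j - nu) * K)) *
    wk M nu 0 x w)); last by rewrite ler_wpM2r ?wk_ge0// ler_wpM2l// !mulr_ge0 ?c2pi_ge0 ?exprn_ge0// ltW.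
rewrite le_eqVlt; apply/orP; left; apply/eqP.
by rewrite /wk mul0n oppr0 mul0r powRr0 mulr1 addn0 -/z -(om_split nu x w M Bs); ring.
Qed.

(** The counterpart of [coarse_bound] at [j = 0], [x = 0], [d = nu] with a test function in place of
    the kernel. The seminorm bound enters linearly, which gives continuity in the space of tempered
    distributions. *)
Lemma test_bound M : exists Nm C, 0 <= C /\ forall nu w phi (dd : R), schwartz phi ->
  (forall al be : {ffun 'I_n -> nat}, (mdeg al <= Nm)%N -> (mdeg be <= Nm)%N ->
     forall x, cmod ((mpow x be)%:C * mderive al phi x) <= dd) ->
  cintegrable (fun y => a nu (cidx nu w) y * phi y) /\
  cmod (pairing (a nu (cidx nu w)) phi) <= C * dd * 2 `^ (- nu%:R * eps) * wk M 0 nu 0 w.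
Proof.
have [Nm HN [E E0 HE]] := cube_nmom_spec eps stau ss.
pose P (N : nat) (C : R) := forall (phi : 'rV[R]_n -> R[i]) (dd : R) b (nu : nat) c (u : 'rV[R]_n -> R), 0 <= dd -> schwartz phi ->
  (forall al be : {ffun 'I_n -> nat}, (mdeg al <= maxn N M)%N -> (mdeg be <= maxn N M)%N ->
     forall x, cmod ((mpow x be)%:C * mderive al phi x) <= dd) ->
  meas u -> (forall y, `|u y| <= 1) -> (forall y, ga * 2 ^- nu < `|y - c| -> u y = 0) ->
  (forall l, (size l < N)%N -> \int[mu]_x (mon l x * u x) = 0) ->
  `|\int[mu]_y (pt b phi y * u y)| <= C * dd * 2 ^- (nu * N) * 2 ^- (nu * n) * om 0 0 c ^- M.
have [C C0 HC] : exists2 C, 0 <= C & forall N, (N <= Nm)%N -> P N C.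
  apply: uniform_nat => [N C C' CC h phi dd b nu c u dd0 sphi sem mu_ u1 u0 mom|N].
    apply: le_trans (h phi dd b nu c u dd0 sphi sem mu_ u1 u0 mom) _.
    by do 3! rewrite ler_wpM2r ?invr_ge0 ?exprn_ge0 ?om_ge0//; rewrite ler_wpM2r.
  have [C C0 H] := @schwartz_atom R n ga N M n0 ga0; exists C => // phi dd b nu c u _.
  exact: H.
exists (maxn Nm M), (8 * C * E * 2 ^+ M); split; first by nneg.
move=> nu w phi dd sphi sem; set m := cidx nu w; set z := corner nu w.
pose c := cube_center nu m : 'rV[R]_n.
have dd0 : 0 <= dd.
  have m0 : mdeg (single (Ordinal n0) 0) = 0%N by exact: mdeg_single.
  by apply: le_trans (sem (single (Ordinal n0) 0) (single (Ordinal n0) 0) _ _ 0); rewrite ?m0 ?cmod_ge0.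
have r0 : 0 < ga * 2 ^- nu by nneg.
have mph b : meas (pt b phi).
  by apply: meas_cont; apply: pt_continuous; case: sphi => /(_ 0%N)/classC_cont.
have phb y : cmod (phi y) <= dd.
  have := sem (single (Ordinal n0) 0) (single (Ordinal n0) 0).
  by rewrite mdeg_single mderive_single => /(_ isT isT y); rewrite mpow_single expr0 mul1r.
have II b b' : intg (fun y => pt b phi y * pt b' (a nu m) y).
  apply: (proj1 (@Rint_ball _ _ _ c dd _ _ r0 dd0 _ _)).
  - by apply: measurable_funM => //; exact: a_meas.
  - move=> y; rewrite normrM -[leRHS]mulr1; apply: ler_pM; [by []|by []| |exact: a_le1].
    exact: le_trans (part_le _ _) (phb y).
  - by move=> y yr; rewrite (a_supp b' yr) mulr0.
pose p := dd * 2 ^- (nu * N_ nu m) * 2 ^- (nu * n) * om 0 0 c ^- M.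
have hE b b' : `|\int[mu]_y (pt b phi y * pt b' (a nu m) y)| <= C * p.
  rewrite /p !mulrA; apply: (HC _ (HN nu w)) => //.
  - move=> al be h1 h2; apply: sem.
      by apply: leq_trans h1 _; rewrite geq_max leq_maxr leq_max HN.
    by apply: leq_trans h2 _; rewrite geq_max leq_maxr leq_max HN.
  - exact: a_meas.
  - exact: a_le1.
  - by move=> y; exact: a_supp.
  - by move=> l; exact: a_mom.
have n1 : `|1| <= 1 :> R by rewrite normr1.
have n2 : `|-1| <= 1 :> R by rewrite normrN normr1.
have nz : `|(0 : R)| <= 1 by rewrite normr0 ler01.
have [I1 E1] := lin4 (II true true) (II false false) (II true true) (II true true)
  n1 n2 nz nz (hE _ _) (hE _ _) (hE _ _) (hE _ _).
have [I2 E2] := lin4 (II false true) (II true false) (II true true) (II true true)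
  n1 n1 nz nz (hE _ _) (hE _ _) (hE _ _) (hE _ _).
have R1 : (fun y => complex.Re (a nu m y * phi y)) = (fun y =>
    1 * (1 * (pt true phi y * pt true (a nu m) y) + -1 * (pt false phi y * pt false (a nu m) y)) +
    1 * (0 * (pt true phi y * pt true (a nu m) y) + 0 * (pt true phi y * pt true (a nu m) y))).
  by apply/funext => y; rewrite ReM /pt /=; ring.
have R2 : (fun y => complex.Im (a nu m y * phi y)) = (fun y =>
    1 * (1 * (pt false phi y * pt true (a nu m) y) + 1 * (pt true phi y * pt false (a nu m) y)) +
    1 * (0 * (pt true phi y * pt true (a nu m) y) + 0 * (pt true phi y * pt true (a nu m) y))).
  by apply/funext => y; rewrite ImM /pt /=; ring.
rewrite -R1 in I1 E1; rewrite -R2 in I2 E2; split; first by split.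
apply: le_trans (cmod_le _) _; apply: (@le_trans _ _ (4 * 1 * (C * p) + 4 * 1 * (C * p))).
  exact: lerD.
have c80 : 0 <= 8 * C * dd by nneg.
have X0 : 0 <= E * 2 `^ (- nu%:R * eps) * 2 `^ (- (nu * n)%:R * tau z) * 2 `^ (nu%:R * s z).
  by nneg.
have q0 : 0 <= 2 ^- (nu * N_ nu m) * 2 ^- (nu * n) :> R by nneg.
have q1 : 0 <= om 0 0 c ^- M :> R by nneg.
have := ler_wpM2l c80 (ler_pM q0 q1 (HE nu nu w (leqnn nu)) (om_center M 0 w (leq0n nu))).
rewrite -/m -/z -/c => h; rewrite (_ : _ + _ = 8 * C * dd * (2 ^- (nu * N_ nu m) * 2 ^- (nu * n) * om 0 0 c ^- M)).
  apply: le_trans h _; rewrite le_eqVlt; apply/orP; left; apply/eqP.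
  by rewrite /wk !add0n -/z; ring.
by rewrite /p; ring.
Qed.

End atom_bounds.

Hint Extern 0 (is_true (@Order.le _ _ _ c2pi)) => by apply: c2pi_ge0 : nneg.
Hint Extern 0 (is_true (@Order.le _ _ _ (wk _ _ _ _ _ _ _))) => by apply: wk_ge0 : nneg.

(** * Complex series with geometric bounds *)

Section series.
Context {R : realType}.
Local Notation Re := complex.Re.
Local Notation Im := complex.Im.
Implicit Types (a : nat -> R[i]).

Lemma real_geo (a : nat -> R) (D rho : R) : 0 <= rho -> rho < 1 -> (forall k, `|a k| <= D * rho ^+ k) ->
  exists2 l, (fun N => \sum_(k < N) a k) @ \oo --> l &
    forall N, `|l - \sum_(k < N) a k| <= D * rho ^+ N / (1 - rho).
Proof.
move=> r0 r1 ha; have D0 : 0 <= D by have := ha 0%N; rewrite expr0 mulr1; exact: le_trans.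
have d0 : 0 < 1 - rho by rewrite subr_gt0.
have cv : cvgn (series a).
  apply: normed_cvg; apply: (@series_le_cvg _ _ (geometric D rho)).
  - by move=> k /=.
  - by move=> k; rewrite /geometric /= mulr_ge0 ?exprn_ge0.
  - by move=> k /=; exact: ha.
  - by apply: is_cvg_geometric_series; rewrite ger0_norm.
have E : series a = (fun N => \sum_(k < N) a k) by apply/funext => N; rewrite /series /= big_mkord.
rewrite E in cv; exists (lim ((fun N => \sum_(k < N) a k) @ \oo)) => // N.
apply/ler_addgt0Pr => e e0; have /cvgrPdist_lt/(_ _ e0)[M _ hM] := cv.
have := hM (N + M)%N (leq_addl _ _); rewrite /= big_split_ord/= => h.
have tail : `|\sum_(i < M) a (N + i)%N| <= D * rho ^+ N / (1 - rho).
  apply: le_trans (ler_norm_sum _ _ _) _.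
  apply: (@le_trans _ _ (\sum_(i < M) D * rho ^+ N * rho ^+ i)).
    by apply: ler_sum => i _; rewrite -mulrA -exprD; exact: ha.
  by rewrite -mulr_sumr ler_wpM2l ?geo_sum_le// mulr_ge0// exprn_ge0.
rewrite (_ : _ - _ = (lim ((fun N => \sum_(k < N) a k) @ \oo) -
  (\sum_(i < N) a i + \sum_(i < M) a (N + i)%N)) + \sum_(i < M) a (N + i)%N); last by ring.
by apply: le_trans (ler_normD _ _) _; rewrite addrC lerD// ltW.
Qed.

Definition csum a : R[i] := lim ((fun N => \sum_(k < N) Re (a k)) @ \oo) +i*
  lim ((fun N => \sum_(k < N) Im (a k)) @ \oo).

Lemma cmodC (z z' : R[i]) : cmod (z - z') = cmod (z' - z).
Proof. by rewrite !cmodE !ReD !ImD !ReN !ImN -sqrrN opprB -[X in _ + X]sqrrN opprB. Qed.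

Lemma ccvg_near (u : nat -> R[i]) l (v : nat -> R) : (forall k, cmod (u k - l) <= v k) ->
  v @ \oo --> (0 : R) -> ccvg u l.
Proof.
move=> uv v0; apply: (@squeeze_cvgr _ _ _ _ (cst 0) v) => //; last exact: cvg_cst.
by apply: nearW => k; rewrite uv cmod_ge0.
Qed.

Lemma csum_geo a (D rho : R) : 0 <= rho -> rho < 1 -> (forall k, cmod (a k) <= D * rho ^+ k) ->
  ccvg (fun N => \sum_(k < N) a k) (csum a) /\
  forall N, cmod (csum a - \sum_(k < N) a k) <= 2 * (D * rho ^+ N / (1 - rho)).
Proof.
move=> r0 r1 ha.
have [l1 c1 h1] := real_geo r0 r1 (fun k => le_trans (Re_le (a k)) (ha k)).
have [l2 c2 h2] := real_geo r0 r1 (fun k => le_trans (Im_le (a k)) (ha k)).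
have E1 := cvg_lim (@Rhausdorff R) c1; have E2 := cvg_lim (@Rhausdorff R) c2.
have H N : cmod (csum a - \sum_(k < N) a k) <= 2 * (D * rho ^+ N / (1 - rho)).
  apply: le_trans (cmod_le _) _; rewrite mulr_natl mulr2n ReD ImD ReN ImN Re_sum Im_sum.
  by move: (h1 N) (h2 N); rewrite -(E1 _) -(E2 _); apply: lerD.
split=> //; apply: (ccvg_near (v := fun N => 2 * (D * rho ^+ N / (1 - rho)))).
  by move=> k; rewrite cmodC.
have -> : (fun N => 2 * (D * rho ^+ N / (1 - rho))) = (fun N => 2 * D / (1 - rho) * rho ^+ N).
  by apply/funext => N; rewrite -!mulrA [rho ^+ N * _]mulrC.
rewrite -[X in _ --> X](mulr0 (2 * D / (1 - rho))); apply: cvgMr.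
by apply: cvg_expr; rewrite ger0_norm.
Qed.

Lemma ccvg_unique (u : nat -> R[i]) l l' : ccvg u l -> ccvg u l' -> l = l'.
Proof.
move=> c c'; have H : (fun k => cmod (u k - l) + cmod (u k - l')) @ \oo --> (0 : R).
  by rewrite -[X in _ --> X](addr0 0); exact: cvgD.
have h : cmod (l - l') <= 0.
  apply/ler_addgt0Pr => e e0; have /cvgrPdist_lt/(_ _ e0)[M _ /(_ M (leqnn M))] := H.
  rewrite sub0r normrN ger0_norm ?addr_ge0 ?cmod_ge0// add0r => /ltW; apply: le_trans.
  rewrite (_ : l - l' = (l - u M) + (u M - l')); last by rewrite addrA subrK.
  by rewrite (cmodC (u M) l); exact: cmodD.
apply: eq_ReIm; apply/eqP; rewrite -subr_eq0 -normr_le0.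
  by rewrite -ReN -ReD; apply: le_trans (Re_le _) h.
by rewrite -ImN -ImD; apply: le_trans (Im_le _) h.
Qed.

End series.

(** * Modulars of the mixed norm *)

Section modulars.
Context {R : realType} {n : nat}.

(** The integral of a nonnegative function is the supremum over the simple functions below it, hence
    monotone for arbitrary functions; the integrands in [Lplq] are compared in this way. *)
Lemma le_integral_nonmeas (f g : 'rV[R]_n -> \bar R) : (forall x, (0 <= f x)%E) ->
  (forall x, (f x <= g x)%E) -> (\int[mu]_x f x <= \int[mu]_x g x)%E.
Proof.
move=> f0 fg; rewrite !ge0_integralTE//; last by move=> x; exact: le_trans (fg x).
apply: le_ereal_sup => _ [h hf <-]; exists h => // x; exact: le_trans (fg x).
Qed.

Variables (c : nat -> R) (p q l : R).
Hypotheses (c0 : forall j, 0 <= c j) (p0 : 0 < p) (q0 : 0 < q) (l0 : 0 < l).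

Local Notation nrm := (poweR (`|poweR (\sum_(0 <= j <oo) poweR (c j)%:E q)%E q^-1| * (l^-1)%:E) p)%E.

Let q00 : 0 <= q := ltW q0.

Let nrm_fin (S : R) : (poweR (`|poweR S%:E q^-1| * (l^-1)%:E) p)%E = ((S `^ q^-1 / l) `^ p)%:E.
Proof. by rewrite poweR_EFin/= ger0_norm ?powR_ge0// -EFinM poweR_EFin. Qed.

Lemma lq_term_le N : (((\sum_(j < N.+1) (c j / l) `^ q) `^ (p / q))%:E <= nrm)%E.
Proof.
have t0 k : (0 <= poweR (c k)%:E q)%E by exact: poweR_ge0.
have := @nneseries_lim_ge R (fun j => poweR (c j)%:E q) predT 0 N.+1 (fun k _ _ => t0 k).
set S := (\sum_(0 <= j <oo) _)%E; rewrite big_mkord.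
under eq_bigr do rewrite poweR_EFin.
rewrite sumEFin; have S0 : (0 <= S)%E by exact: nneseries_ge0.
(* If the inner sum is infinite, so is the right-hand side. *)
case: S S0 => [S S0 h| _ _|//]; last first.
  rewrite poweRyr ?invr_eq0 ?gt_eqF// gt0_mulye ?lte_fin ?invr_gt0//.
  by rewrite poweRyr ?gt_eqF// leey.
rewrite (nrm_fin S) lee_fin.
have li0 : 0 <= l^-1 by rewrite invr_ge0 ltW.
have -> : (S `^ q^-1 / l) `^ p = (l^-1 `^ q * S) `^ (p / q).
  rewrite (_ : S `^ q^-1 / l = (l^-1 `^ q * S) `^ q^-1); last first.
    by rewrite powRM ?powR_ge0// -powRrM mulfV ?gt_eqF// powRr1// mulrC.
  by rewrite -powRrM [q^-1 * p]mulrC.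
apply: powR_mono; [by nneg|by apply: sumr_ge0 => j _; exact: powR_ge0|].
under eq_bigr do rewrite mulrC powRM//.
by rewrite -mulr_sumr ler_wpM2l ?powR_ge0// -lee_fin.
Qed.

Lemma lq_term_ge m : 0 <= m -> (forall J, \sum_(j < J.+1) c j `^ q <= m) ->
  (nrm <= ((m `^ q^-1 / l) `^ p)%:E)%E.
Proof.
move=> m0 H; have t0 k : (0 <= poweR (c k)%:E q)%E by exact: poweR_ge0.
have : (\sum_(0 <= j <oo) poweR (c j)%:E q <= m%:E)%E.
  apply: lime_le; first exact: is_cvg_nneseries.
  apply: nearW => N; rewrite big_mkord; under eq_bigr do rewrite poweR_EFin.
  rewrite sumEFin lee_fin; case: N => [|N]; first by rewrite big_ord0.
  exact: H.
set S := (\sum_(0 <= j <oo) _)%E; have S0 : (0 <= S)%E by exact: nneseries_ge0.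
case: S S0 => [S S0 h|//|//].
rewrite lee_fin in S0 h.
rewrite (nrm_fin S) lee_fin.
apply: powR_mono; first exact: ltW.
  by nneg.
by rewrite ler_wpM2r ?invr_ge0 ?(ltW l0)//; apply: powR_mono => //; rewrite invr_ge0.
Qed.

End modulars.

(** * Joint measurability and integrability *)

Section joint.
Context {R : realType} {n : nat}.
Implicit Types (x y z w : 'rV[R]_n) (f th phi : 'rV[R]_n -> R[i]) (F : 'rV[R]_n -> 'rV[R]_n -> R[i]).

Definition jcm F := jmeas (fun x y => complex.Re (F x y)) /\ jmeas (fun x y => complex.Im (F x y)).

Lemma jcmM F F' : jcm F -> jcm F' -> jcm (fun x y => F x y * F' x y).
Proof.
move=> [m1 m2] [m3 m4]; split.
  under eq_fun do rewrite ReM.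
  by apply: measurable_funB; apply: measurable_funM.
under eq_fun do rewrite ImM.
by apply: measurable_funD; apply: measurable_funM.
Qed.

Lemma jcm_fst f : cmeasurable f -> jcm (fun x _ => f x).
Proof. by move=> [m1 m2]; split; [exact: (measurableT_comp m1 measurable_fst)|exact: (measurableT_comp m2 measurable_fst)]. Qed.

Lemma jcm_snd f : cmeasurable f -> jcm (fun _ y => f y).
Proof. by move=> [m1 m2]; split; [exact: (measurableT_comp m1 measurable_snd)|exact: (measurableT_comp m2 measurable_snd)]. Qed.

Lemma jcm_cst (z : R[i]) : jcm (fun _ _ => z).
Proof. by split; exact: measurable_cst. Qed.

Lemma jcm_expi (r : R) : jcm (fun x y => expi (r * dotv x y)).
Proof.
have m : measurable_fun [set: 'rV[R]_n * 'rV[R]_n] (fun t => r * dotv t.1 t.2).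
  apply: measurable_funM; first exact: measurable_cst.
  apply: measurable_sum => i; apply: measurable_funM.
    by apply: (measurableT_comp (measurable_rV_coord _)); exact: measurable_fst.
  by apply: (measurableT_comp (measurable_rV_coord _)); exact: measurable_snd.
split; apply: measurableT_comp m.
  exact: (continuous_measurable_fun (@continuous_cos R)).
exact: (continuous_measurable_fun (@continuous_sin R)).
Qed.

Lemma jcm_cK th : (forall b, bdsupp (pt b th)) -> jcm (fun y x => cK th (x - y)).
Proof.
move=> bd; have ms : measurable_fun [set: 'rV[R]_n * 'rV[R]_n] (fun t : 'rV[R]_n * 'rV[R]_n => t.2 - t.1).
  apply: measurable_fun_rVP => i; under eq_fun do rewrite !mxE.
  apply: measurable_funB.
    by apply: (measurableT_comp (measurable_rV_coord _)); exact: measurable_snd.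
  by apply: (measurableT_comp (measurable_rV_coord _)); exact: measurable_fst.
have mK t b : measurable_fun [set: 'rV[R]_n * 'rV[R]_n] (fun w : 'rV[R]_n * 'rV[R]_n => KK t (pt b th) (w.2 - w.1)).
  have [B [r [mg r0 B0 gB g0]]] := bd b; apply: measurableT_comp ms.
  by apply: meas_cont; exact: (continuous_KK mg r0 B0 gB g0).
split.
  under eq_fun => w do rewrite (proj1 (cK_part (w.2 - w.1) bd)).
  by apply: measurable_funM; [exact: measurable_cst|exact: measurable_funD].
under eq_fun => w do rewrite (proj2 (cK_part (w.2 - w.1) bd)).
by apply: measurable_funM; [exact: measurable_cst|exact: measurable_funD].
Qed.

Lemma jcm_cube nu (f : 'rV[int]_n -> 'rV[R]_n -> R[i]) : (forall m, cmeasurable (f m)) ->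
  jcm (fun w x => f (cidx nu w) x).
Proof.
move=> mf; suff H : forall (u : 'rV[int]_n -> 'rV[R]_n -> R), (forall m, meas (u m)) ->
    jmeas (fun w x => u (cidx nu w) x).
  split; [apply: (H (fun m x => complex.Re (f m x)))|apply: (H (fun m x => complex.Im (f m x)))].
    by move=> k; case: (mf k).
  by move=> k; case: (mf k).
move=> u mu_ _ Y mY; rewrite setTI.
rewrite (_ : _ @^-1` Y = \bigcup_(m in [set: 'rV[int]_n]) (cubeQ nu m `*` (u m @^-1` Y))).
  apply: countable_bigcupT_measurable; first exact: countableP.
  move=> m; apply: measurableX; first exact: meas_cubeQ.
  by rewrite -[X in measurable X]setTI; exact: mu_.
apply/seteqP; split=> [[w x] /= Yx|[w x] [m _] [/= /cubeQP <-]]//.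
by exists (cidx nu w) => //; split=> //=; apply/cubeQP.
Qed.

Lemma jcm_cint F : jcm F -> cmeasurable (fun x => cintegral (fun y => F y x)).
Proof. by move=> [m1 m2]; split=> /=; [exact: (proj1 (meas_Rint m1))|exact: (proj1 (meas_Rint m2))]. Qed.

Lemma cmod_expi (r : R) : cmod (expi r) = 1.
Proof. by rewrite cmodE /= cos2Dsin2 sqrtr1. Qed.

Lemma cmeas_bdsupp th : (forall b, bdsupp (pt b th)) -> cmeasurable th.
Proof. by move=> bd; have [? [? []]] := bd true; have [? [? []]] := bd false; split. Qed.

Lemma bdsupp_int th : (forall b, bdsupp (pt b th)) -> exists2 C, 0 <= C &
  (\int[mu]_x (cmod (th x))%:E <= C%:E)%E.
Proof.
move=> bd; have H b : exists2 C, 0 <= C & (\int[mu]_x `|(pt b th x)%:E| <= C%:E)%E.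
  have [B [r [mg r0 B0 gB g0]]] := bd b; exists (B * (8 * r) ^+ n).
    by nneg.
  by apply: (int_ball (c := 0)) => // x; rewrite subr0; exact: g0.
have [C1 C10 h1] := H true; have [C2 C20 h2] := H false; exists (C1 + C2); first exact: addr_ge0.
have [m1 m2] := cmeas_bdsupp bd.
have mm (u : 'rV[R]_n -> R) : meas u -> meas (fun x => `|(u x)%:E|)%E.
  by move=> m; apply/measurable_EFinP; exact: measurableT_comp.
apply: (@le_trans _ _ (\int[mu]_x (`|(pt true th x)%:E| + `|(pt false th x)%:E|))%E).
  by apply: le_integral_nonmeas => x; rewrite ?lee_fin ?cmod_ge0//; exact: cmod_le.
rewrite ge0_integralD//; [by rewrite EFinD; exact: leeD|exact: mm|exact: mm].
Qed.

Lemma schwartz_int phi : (0 < n)%N -> schwartz phi -> cmeasurable phi /\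
  exists2 v : 'rV[R]_n -> R, intg v & forall x, cmod (phi x) <= v x.
Proof.
move=> n0 [cl sem]; have m0 : cmeasurable phi.
  have /classC_cont[c1 c2] := cl 0%N; split; exact: meas_cont.
split=> //; pose i0 := Ordinal n0.
have /choice[c hc] : forall ik : 'I_n * nat, exists c, forall x, `|x ord0 ik.1| ^+ ik.2 * cmod (phi x) <= c.
  move=> [i k]; have [c hc] := sem (single i0 0) (single i k); exists c => x /=.
  by have := hc x; rewrite cmodM cmod_real mpow_single mderive_single normrX.
pose D := \sum_i `|c (i, (2 * n)%N)| + `|c (i0, 0%N)|.
exists (fun x => 2 ^+ (2 * n) * D * (1 + 1 * `|x - 0|) ^- (2 * n)); last first.
  move=> x; rewrite subr0; apply: om_decay => //; first exact: cmod_ge0.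
    have := hc (i0, 0%N) x; rewrite /= expr0 mul1r => /le_trans; apply.
    by apply: le_trans (ler_norm _) _; rewrite lerDr sumr_ge0.
  move=> i; rewrite mul1r; apply: le_trans (hc (i, (2 * n)%N) x) _.
  apply: le_trans (ler_norm _) _; rewrite /D (bigD1 i)//= -addrA lerDl addr_ge0// sumr_ge0//.
have mk : meas (fun x => (1 + 1 * `|x - 0|) ^- (2 * n)) by exact: meas_kernel.
have Ik : intg (fun x => (1 + 1 * `|x - 0|) ^- (2 * n)).
  apply/integrableP; split; first exact/measurable_EFinP.
  apply: le_lt_trans (ltry ((2 / 1) ^+ n)); apply: le_trans (integral_kernel_le 0 ltr01).
  have k0 (x : 'rV[R]_n) : 0 <= (1 + 1 * `|x - 0|) ^- (2 * n).
    by nneg.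
  by apply: le_integral_nonmeas => x; rewrite /= ?lee_fin ger0_norm.
have [I _] := Rint_lin (2 ^+ (2 * n) * D) 0 Ik Ik.
by move: I; rewrite (_ : (fun x => _) = (fun x => 2 ^+ (2 * n) * D * (1 + 1 * `|x - 0|) ^- (2 * n)))//;
  apply/funext => x; rewrite mul0r addr0.
Qed.

End joint.

(** * The atomic sum *)

Lemma cintegral_sum {R : realType} {n : nat} N (h : nat -> 'rV[R]_n -> R[i]) : (forall k, cintegrable (h k)) ->
  cintegrable (fun x => \sum_(k < N) h k x) /\
  cintegral (fun x => \sum_(k < N) h k x) = \sum_(k < N) cintegral (h k).
Proof.
move=> ih; elim: N => [|N [I E]].
  have [I0 E0] := cintegralZ 0 (ih 0%N).
  rewrite (_ : (fun x => \sum_(k < 0) h k x) = fun x => 0 * h 0%N x).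
    by rewrite E0 mul0r big_ord0.
  by apply/funext => x; rewrite big_ord0 mul0r.
have [I1 E1] := cintegralD I (ih N); rewrite big_ord_recr /= -E -E1.
rewrite (_ : (fun x => \sum_(k < N.+1) h k x) = fun x => \sum_(k < N) h k x + h N x)//.
by apply/funext => x; rewrite big_ord_recr.
Qed.

Lemma cmeasurableB {R : realType} {n : nat} (f g : 'rV[R]_n -> R[i]) : cmeasurable f -> cmeasurable g ->
  cmeasurable (fun x => f x - g x).
Proof.
move=> [m1 m2] [m3 m4]; split; first by under eq_fun do rewrite ReD ReN; apply: measurable_funB.
by under eq_fun do rewrite ImD ImN; apply: measurable_funB.
Qed.

Lemma cmeas_sum {R : realType} {n : nat} N (h : nat -> 'rV[R]_n -> R[i]) : (forall k, cmeasurable (h k)) ->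
  cmeasurable (fun x => \sum_(k < N) h k x).
Proof.
move=> mh; split; [under eq_fun do rewrite Re_sum|under eq_fun do rewrite Im_sum];
  by apply: measurable_sum => k; case: (mh k).
Qed.

Section fubini.
Context {R : realType} {n : nat}.
Implicit Types (x y z w : 'rV[R]_n).
Variables (th phi : 'rV[R]_n -> R[i]) (v : 'rV[R]_n -> R).
Hypotheses (bth : forall b, bdsupp (pt b th)) (mphi : cmeasurable phi) (iv : intg v)
  (phiv : forall x, cmod (phi x) <= v x).

Lemma jcm_sec (F : 'rV[R]_n -> 'rV[R]_n -> R[i]) y : jcm F -> cmeasurable (F y).
Proof.
have m : meas (fun x => (y, x)) by exact: pair1_measurable.
by move=> [m1 m2]; split; [exact: (measurableT_comp m1 m)|exact: (measurableT_comp m2 m)].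
Qed.

Lemma expi_add (r t : R) : expi (r + t) = expi r * expi t.
Proof. by apply: eq_ReIm; rewrite ?ReM ?ImM /= ?cosD ?sinD// addrC. Qed.

Let mexpi (r : R) z : cmeasurable (fun xi => expi (r * dotv z xi)).
Proof. exact: (jcm_sec z (jcm_expi r)). Qed.

Lemma intg_scale k : intg (fun x => k * v x).
Proof.
have [I _] := Rint_lin k 0 iv iv; move: I.
by rewrite (_ : (fun x => _) = (fun x => k * v x))//; apply/funext => x; rewrite mul0r addr0.
Qed.

Lemma phi_bounded f C : cmeasurable f -> (forall x, cmod (f x) <= C) -> cintegrable (fun x => phi x * f x).
Proof.
move=> mf fC; apply: (cintegrable_le (v := fun x => C * v x)); first exact: cmeasurableM.
  exact: intg_scale.
by move=> x; rewrite cmodM mulrC; apply: ler_pM => //; exact: cmod_ge0.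
Qed.

Lemma cK_int z : cintegrable (fun xi => expi (dotv z xi) * th xi).
Proof.
have [C C0 hC] := bdsupp_int bth.
apply: (proj1 (cintegral_le (B := C) _ _)).
  apply: cmeasurableM; last exact: cmeas_bdsupp.
  by have := mexpi 1 z; under eq_fun do rewrite mul1r.
by under eq_integral => xi _ do rewrite cmodM cmod_expi mul1r.
Qed.

Lemma cK_le : exists2 C, 0 <= C & forall z, cmod (cK th z) <= C.
Proof.
have [C C0 hC] := bdsupp_int bth; exists (@c2pi R n * (2 * C)).
  by nneg.
move=> z; rewrite /cK cmodM cmod_real ger0_norm ?c2pi_ge0// ler_wpM2l ?c2pi_ge0//.
apply: (proj2 (cintegral_le (B := C) _ _)).
  apply: cmeasurableM; last exact: cmeas_bdsupp.
  by have := mexpi 1 z; under eq_fun do rewrite mul1r.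
by under eq_integral => xi _ do rewrite cmodM cmod_expi mul1r.
Qed.

(** Convolution of [phi] with the reflected kernel; by [fourier_tw], [theta(D) T] evaluated at [phi]
    is [T] evaluated at this function. *)
Definition tw y := cintegral (fun x => phi x * cK th (x - y)).

(* Both sides are the double integral of expi ((x - y).xi) th(xi) phi(x). *)
Lemma fourier_tw y : fourier (fun xi => th xi * ifourier phi xi) y = tw y.
Proof.
have [C C0 hC] := bdsupp_int bth.
pose F xi x := (expi (- dotv xi y) * th xi) * (expi (dotv xi x) * phi x).
have mth := cmeas_bdsupp bth.
have dC z z' : dotv z z' = dotv z' z :> R by apply: eq_bigr => i _; rewrite mulrC.
have m1 : cmeasurable (fun xi => expi (- dotv xi y) * th xi).
  apply: cmeasurableM => //; have := mexpi (-1) y.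
  by under eq_fun do rewrite mulN1r dC.
have m2 xi : cmeasurable (fun x => expi (dotv xi x) * phi x).
  by apply: cmeasurableM => //; have := mexpi 1 xi; under eq_fun do rewrite mul1r.
have cF xi x : cmod (F xi x) = cmod (th xi) * cmod (phi x) by rewrite !cmodM !cmod_expi !mul1r.
have i2 xi : cintegrable (fun x => expi (dotv xi x) * phi x).
  by apply: cintegrable_le (m2 xi) iv _ => x; rewrite cmodM cmod_expi mul1r.
have [jR jI] : jcm F.
  apply: jcmM; first exact: (jcm_fst m1).
  apply: jcmM; last exact: jcm_snd.
  by have := @jcm_expi R n 1; rewrite /jcm; under eq_fun do rewrite mul1r; under [X in _ /\ measurable_fun _ X]eq_fun do rewrite mul1r.
case: (cfub (F := F) (v := fun x => C * v x) jR jI _ (intg_scale C) _) => [x|xi|E I1 I2 _].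
- apply: (@le_trans _ _ (\int[mu]_w ((v x)%:E * (cmod (th w))%:E))%E).
    apply: le_integral_nonmeas => w; first by nneg.
    by rewrite -EFinM lee_fin cF mulrC ler_wpM2r ?cmod_ge0.
  have vx0 : 0 <= v x by apply: le_trans (phiv x); exact: cmod_ge0.
  rewrite ge0_integralZl_EFin//; last 2 first.
  + by move=> w _; rewrite lee_fin cmod_ge0.
  + by apply/measurable_EFinP; exact: cmeas_mod.
  by rewrite mulrC EFinM lee_wpmul2l// lee_fin.
- exact: (proj1 (cintegralZ _ (i2 xi))).
rewrite /fourier /ifourier /tw.
set c := (Num.sqrt (2 * pi) ^- n)%:C.
transitivity (c * (c * cintegral (fun w => cintegral (F w)))).
  have [_ <-] := cintegralZ c I1; congr (_ * _); apply: eq_cintegral => xi.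
  by have [_ ->] := cintegralZ (expi (- dotv xi y) * th xi) (i2 xi); ring.
rewrite E mulrA (_ : c * c = (@c2pi R n)%:C); last by rewrite /c -rmorphM.
have [_ <-] := cintegralZ (@c2pi R n)%:C I2; apply: eq_cintegral => x.
rewrite /cK mulrCA; congr (_ * _); have [_ <-] := cintegralZ (phi x) (cK_int (x - y)).
apply: eq_cintegral => xi; rewrite /F (_ : dotv (x - y) xi = - dotv xi y + dotv xi x); last first.
  by rewrite /dotv -sumrN -big_split /=; apply: eq_bigr => i _; rewrite !mxE; ring.
by rewrite expi_add; ring.
Qed.

Variable f : 'rV[R]_n -> R[i].
Hypothesis bf : forall b, bdsupp (pt b f).

Local Notation B x := (cintegral (fun y => f y * cK th (x - y))).

Lemma jcm_conv : jcm (fun y x => f y * cK th (x - y)).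
Proof. by apply: jcmM; [apply: jcm_fst; exact: cmeas_bdsupp|exact: jcm_cK]. Qed.

Let conv_int : exists2 C, 0 <= C & forall x, (\int[mu]_y (cmod (f y * cK th (x - y)))%:E <= C%:E)%E.
Proof.
have [C C0 hC] := cK_le; have [C' C'0 hC'] := bdsupp_int bf; exists (C * C'); first exact: mulr_ge0.
move=> x; apply: (@le_trans _ _ (\int[mu]_y (C%:E * (cmod (f y))%:E))%E).
  apply: le_integral_nonmeas => y; first by nneg.
  by rewrite -EFinM lee_fin cmodM mulrC ler_wpM2r ?cmod_ge0.
rewrite ge0_integralZl_EFin//; last 2 first.
- by nneg.
- by apply/measurable_EFinP; exact: (cmeas_mod (cmeas_bdsupp bf)).
by rewrite EFinM lee_wpmul2l// lee_fin.
Qed.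

Let mconv x : cmeasurable (fun y => f y * cK th (x - y)).
Proof.
have [m1 m2] := jcm_conv.
have m : meas (fun y => (y, x)) by exact: pair2_measurable.
by split; [exact: (measurableT_comp m1 m)|exact: (measurableT_comp m2 m)].
Qed.

Lemma conv_meas : cmeasurable (fun x => B x). Proof. exact: jcm_cint jcm_conv. Qed.

Lemma conv_bound : exists2 C, 0 <= C & forall x, cmod (B x) <= C.
Proof.
have [C C0 hC] := conv_int; exists (2 * C) => [|x]; first exact: mulr_ge0.
by have [] := cintegral_le (mconv x) (hC x).
Qed.

Lemma pair_tw : cintegral (fun y => f y * tw y) = cintegral (fun x => phi x * B x).
Proof.
have [C C0 hC] := conv_int; have [CK CK0 hK] := cK_le.
have [jR jI] : jcm (fun y x => phi x * (f y * cK th (x - y))).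
  by apply: jcmM; [exact: jcm_snd|exact: jcm_conv].
have mK y : cmeasurable (fun x => cK th (x - y)) by exact: (jcm_sec y (jcm_cK bth)).
have iK y : cintegrable (fun x => phi x * cK th (x - y)) by apply: (phi_bounded (C := CK)).
case: (cfub (F := fun y x => phi x * (f y * cK th (x - y))) (v := fun x => C * v x) jR jI _ (intg_scale C) _)
  => [x|y|E _ _ _].
- under eq_integral => y _ do rewrite cmodM EFinM.
  rewrite ge0_integralZl_EFin ?cmod_ge0//; last 2 first.
  + by nneg.
  + by apply/measurable_EFinP; exact: (cmeas_mod (mconv x)).
  by rewrite mulrC EFinM; apply: lee_pmul => //; nneg.
- have [I _] := cintegralZ (f y) (iK y).
  by move: I; congr cintegrable; apply/funext => x; rewrite mulrCA.
transitivity (cintegral (fun y => cintegral (fun x => phi x * (f y * cK th (x - y))))).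
  apply: eq_cintegral => y; have [_ <-] := cintegralZ (f y) (iK y).
  by apply: eq_cintegral => x; rewrite mulrCA.
rewrite E; apply: eq_cintegral => x.
by have [I _] := cintegral_le (mconv x) (hC x); have [_ ->] := cintegralZ (phi x) I.
Qed.

End fubini.

(** * Convergence of the sum and the functions representing its pieces *)

Section synthesis.
Context {R : realType} {n : nat}.
Local Notation seminorms N dd phi := (forall al be : {ffun 'I_n -> nat}, (mdeg al <= N)%N -> (mdeg be <= N)%N ->
  forall x, cmod ((mpow x be)%:C * mderive al phi x) <= dd).
Implicit Types (x y z w : 'rV[R]_n) (f th phi : 'rV[R]_n -> R[i]).

Lemma schwartz_seminorms N phi : schwartz phi -> exists2 dd, 0 <= dd & seminorms N dd phi.
Proof.
move=> [_ sem]; have /choice[c hc] : forall ab : mindex * mindex, exists c, forall x,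
  cmod ((mpow x ab.2)%:C * mderive ab.1 phi x) <= c by move=> [al be]; exact: sem.
(* Multi-indices of degree at most [N] are coded by a finite type, over which the constants can be
   summed. *)
pose v (k : {ffun 'I_n -> 'I_N.+1}) : mindex := [ffun i => nat_of_ord (k i)].
have vE al : (mdeg al <= N)%N -> v [ffun i => inord (al i)] = al.
  move=> h; apply/ffunP => i; rewrite !ffunE inordK// ltnS; apply: leq_trans h.
  by rewrite /mdeg (bigD1 i)//= leq_addr.
exists (\sum_(k : {ffun 'I_n -> 'I_N.+1} * {ffun 'I_n -> 'I_N.+1}) `|c (v k.1, v k.2)|).
  exact: sumr_ge0.
move=> al be /vE <- /vE <- x; apply: le_trans (hc (v _, v _) x) _; apply: le_trans (ler_norm _) _.
rewrite (bigD1 ([ffun i => inord (al i)], [ffun i => inord (be i)]))//= lerDl.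
exact: sumr_ge0.
Qed.

Lemma tempered_bound (T : @tdist R n) N C : (forall (c : R[i]) f g, schwartz f -> schwartz g ->
     T (fun x => c * f x + g x) = c * T f + T g) ->
  (forall phi dd, schwartz phi -> 0 <= dd -> seminorms N dd phi -> cmod (T phi) <= C * dd) -> tempered T.
Proof.
move=> lin H; split=> // e e0; exists N, (e / (`|C| + 1)); first by nneg.
move=> f sf hf; apply: le_trans (H _ _ sf _ hf) _; first by nneg.
rewrite mulrCA -[leRHS]mulr1 ler_wpM2l ?(ltW e0)// ler_pdivrMr ?ltr_wpDl// mul1r.
by rewrite (le_trans (ler_norm C))// lerDl.
Qed.

Lemma ccvgP (u : nat -> R[i]) l : ccvg u l -> (fun k => complex.Re (u k)) @ \oo --> complex.Re l /\
  (fun k => complex.Im (u k)) @ \oo --> complex.Im l.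
Proof.
move=> c; have cl (e : R) : 0 < e -> \forall k \near \oo, cmod (u k - l) < e.
  move=> e0; have /cvgrPdist_lt/(_ _ e0) := c; apply: filterS => k.
  by rewrite sub0r normrN ger0_norm ?cmod_ge0.
split; apply/cvgrPdist_lt => e /cl; apply: filterS => k; apply: le_lt_trans; rewrite cmodC.
  by rewrite -ReN -ReD; exact: Re_le.
by rewrite -ImN -ImD; exact: Im_le.
Qed.

Lemma ccvg_lin (c : R[i]) (u v : nat -> R[i]) l l' : ccvg u l -> ccvg v l' ->
  ccvg (fun k => c * u k + v k) (c * l + l').
Proof.
move=> cu cv; apply: (ccvg_near (v := fun k => cmod c * cmod (u k - l) + cmod (v k - l'))).
  move=> k; rewrite (_ : _ - _ = c * (u k - l) + (v k - l')); last by ring.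
  by rewrite -cmodM; exact: cmodD.
rewrite -[X in _ --> X](addr0 0) -[X in X + _](mulr0 (cmod c)).
by apply: cvgD => //; exact: cvgMr.
Qed.

Lemma cmeas_cidx nu (f : 'rV[int]_n -> R[i]) : cmeasurable (fun w => f (cidx nu w)).
Proof.
split; first exact: (meas_cidx nu (fun m => complex.Re (f m))).
exact: (meas_cidx nu (fun m => complex.Im (f m))).
Qed.

Lemma cmod_sum N (u : nat -> R[i]) : cmod (\sum_(k < N) u k) <= \sum_(k < N) cmod (u k).
Proof.
elim: N => [|N IH]; first by rewrite !big_ord0 cmod0.
by rewrite !big_ord_recr/=; apply: le_trans (cmodD _ _) _; rewrite lerD2r.
Qed.

Lemma pow2_expr (e : R) k : 2 `^ (- k%:R * e) = (2 `^ (- e)) ^+ k.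
Proof. by rewrite -powR_mulrn ?powR_ge0// -powRrM mulNr -mulrN mulrC. Qed.

Hypothesis n0 : (0 < n)%N.
Variables (theta : nat -> 'rV[R]_n -> R[i]) (a : nat -> 'rV[int]_n -> 'rV[R]_n -> R[i])
  (p q s tau : 'rV[R]_n -> R) (eps del ga Cc Cf Ct : R) (K M Nm : nat).
Hypotheses (htheta : in_Phi theta) (ga1 : 1 < ga) (eps0 : 0 < eps) (del0 : 0 < del) (ss : slow s)
  (ha : smooth_atoms ga K (fun x => n%:R * (tau x - 1) - s x + eps) a).

Local Notation hw := (hw s tau M).
Local Notation wk := (wk s tau M).
Local Notation Bk := (Bk theta a).
Local Notation modular_le := (modular_le p q s).
Hypotheses
  (hwE : forall u, modular_le u -> forall d j x,
     (hw u d j x)%:E = hh tau j d M (wtc s (j + d) (u (j + d)%N)) x)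
  (hwsup : forall j, exists2 C, 0 < C & forall u, modular_le u -> forall d x, hw u d j x <= C)
  (Cc0 : 0 <= Cc) (Cf0 : 0 <= Cf) (Ct0 : 0 <= Ct)
  (coarse : forall j d x w, 2 `^ (j%:R * s x) * cmod (Bk (j + d) (cidx (j + d) w) j x) <=
     Cc * 2 `^ (- d%:R * eps) * wk j d x w)
  (fine_ : forall nu j x w, (nu < j)%N -> 2 `^ (j%:R * s x) * cmod (Bk nu (cidx nu w) j x) <=
     Cf * 2 `^ (- (j - nu)%:R * del) * wk nu 0 x w)
  (test : forall nu w phi dd, schwartz phi -> seminorms Nm dd phi ->
     cintegrable (fun y => a nu (cidx nu w) y * phi y) /\
     cmod (pairing (a nu (cidx nu w)) phi) <= Ct * dd * 2 `^ (- nu%:R * eps) * wk 0 nu 0 w).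

Variables (lam : nat -> 'rV[int]_n -> R[i]).

(** The sum over the cubes of level [nu] as an integral, see [cube_csum]. It is a formula for
    arbitrary [psi], not only for Schwartz functions. *)
Definition Sd nu : @tdist R n := fun psi => cintegral (fun w => (2 ^+ (nu * n))%:C *
  (lam nu (cidx nu w) * pairing (a nu (cidx nu w)) psi)).

Definition Gd nu j x := cintegral (fun w => (2 ^+ (nu * n))%:C *
  (lam nu (cidx nu w) * Bk nu (cidx nu w) j x)).

Definition Td : @tdist R n := fun psi => csum (fun nu => Sd nu psi).

Definition gd j x := csum (fun nu => Gd nu j x).

Variable l : R.
Local Notation u := (fun nu m => cmod (lam nu m) / l).
Hypotheses (l0 : 0 < l) (hu : modular_le u).

Let rho := 2 `^ (- eps).
Let rho0 : 0 < rho. Proof. exact: powR_gt0. Qed.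
Let rho1 : rho < 1.
Proof.
rewrite /rho powRN invf_lt1 ?powR_gt0//.
have {1}<- : (1 : R) `^ eps = 1 by rewrite powR1.
by apply: gt0_ltr_powR; rewrite // ?nnegrE// ?in_itv/= ?ler0n ?ltr1n.
Qed.

Let rhoX k : 0 <= rho ^+ k. Proof. by apply: exprn_ge0; exact: ltW. Qed.

Lemma hw_ge0 d j x : 0 <= hw u d j x.
Proof.
rewrite -lee_fin (hwE hu); apply: integral_ge0 => w _; rewrite lee_fin hh_integrand_ge0// => y.
by rewrite /wtc mulr_ge0 ?powR_ge0// divr_ge0 ?cmod_ge0// ltW.
Qed.

Lemma int_bound d j x (be : 'rV[int]_n -> R[i]) k : 0 <= k ->
  (forall w, cmod (be (cidx (j + d) w)) <= k * wk j d x w) ->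
  (\int[mu]_w (cmod ((2 ^+ ((j + d) * n))%:C * (lam (j + d) (cidx (j + d) w) * be (cidx (j + d) w))))%:E
     <= (k * l * hw u d j x)%:E)%E.
Proof.
move=> k0 H; have kl0 : 0 <= k * l by nneg.
have w0 y : 0 <= wtc s (j + d) (u (j + d)%N) y.
  by rewrite /wtc mulr_ge0 ?powR_ge0// divr_ge0 ?cmod_ge0// ltW.
rewrite EFinM (hwE hu) /hh -ge0_integralZl_EFin//; last 2 first.
- by nneg.
- by apply: meas_hh_integrand; exact: meas_wtc.
apply: le_integral_nonmeas => w; first by nneg.
rewrite -EFinM lee_fin !cmodM cmod_real ger0_norm ?exprn_ge0//.
have := H w; set A := cmod (lam _ _) => /(ler_wpM2l (cmod_ge0 (lam (j + d)%N (cidx (j + d) w)))).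
rewrite -/A => /(ler_wpM2l (exprn_ge0 ((j + d) * n) (ler0n R 2))) /le_trans; apply.
rewrite /wk /wtc -/A; move: (om j x w ^- M) => O; rewrite le_eqVlt; apply/orP; left; apply/eqP.
by field; rewrite gt_eqF.
Qed.

Lemma cint_bound nu (be : 'rV[int]_n -> R[i]) k :
  (\int[mu]_w (cmod ((2 ^+ (nu * n))%:C * (lam nu (cidx nu w) * be (cidx nu w))))%:E <= k%:E)%E ->
  cintegrable (fun w => (2 ^+ (nu * n))%:C * (lam nu (cidx nu w) * be (cidx nu w))) /\
  cmod (cintegral (fun w => (2 ^+ (nu * n))%:C * (lam nu (cidx nu w) * be (cidx nu w)))) <= 2 * k.
Proof. by apply: cintegral_le; exact: (cmeas_cidx nu (fun m => (2 ^+ (nu * n))%:C * (lam nu m * be m))). Qed.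

Lemma Sd_bound : exists2 D, 0 <= D & forall nu phi dd, schwartz phi -> 0 <= dd -> seminorms Nm dd phi ->
  cintegrable (fun w => (2 ^+ (nu * n))%:C * (lam nu (cidx nu w) * pairing (a nu (cidx nu w)) phi)) /\
  cmod (Sd nu phi) <= D * dd * rho ^+ nu.
Proof.
have [C C0 hC] := hwsup 0; exists (2 * (Ct * l * C)).
  by apply: mulr_ge0 => //; apply: mulr_ge0; [apply: mulr_ge0 => //|]; exact: ltW.
move=> nu phi dd sp d0 sem; have Cd0 : 0 <= Ct * dd * 2 `^ (- nu%:R * eps).
  by apply: mulr_ge0; [exact: mulr_ge0|exact: powR_ge0].
have I := int_bound (d := nu) (j := 0) (be := fun m => pairing (a nu m) phi) Cd0
  (fun w => proj2 (test nu w sp sem)).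
have [h1 h2] := cint_bound (nu := nu) (be := fun m => pairing (a nu m) phi) I; split=> //; apply: le_trans h2 _.
rewrite -[rho ^+ nu]pow2_expr -!mulrA ler_wpM2l// ler_wpM2l//.
rewrite (_ : l * (C * (dd * _)) = dd * (2 `^ (- nu%:R * eps) * (l * C))); last by ring.
by rewrite ler_wpM2l// ler_wpM2l ?powR_ge0// ler_wpM2l ?(ltW l0)//; exact: hC.
Qed.

Lemma atomic : atomic_sum lam a Td.
Proof.
have [D D0 hD] := Sd_bound.
have linS nu (c : R[i]) f g : schwartz f -> schwartz g ->
    Sd nu (fun x => c * f x + g x) = c * Sd nu f + Sd nu g.
  move=> sf sg; have [d1 d10 h1] := schwartz_seminorms Nm sf; have [d2 d20 h2] := schwartz_seminorms Nm sg.
  have [If _] := hD nu _ _ sf d10 h1; have [Ig _] := hD nu _ _ sg d20 h2.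
  have [Icf <-] := cintegralZ c If; have [_ <-] := cintegralD Icf Ig.
  apply: eq_cintegral => w; have [jf _] := test nu w sf h1; have [jg _] := test nu w sg h2.
  have [jcf E1] := cintegralZ c jf; have [_ E2] := cintegralD jcf jg.
  rewrite (_ : pairing _ (fun x => c * f x + g x) = c * pairing (a nu (cidx nu w)) f + pairing (a nu (cidx nu w)) g).
    by ring.
  by rewrite -E1 -E2; apply: eq_cintegral => x; ring.
have bT f : schwartz f -> exists E, forall nu, cmod (Sd nu f) <= E * rho ^+ nu.
  move=> sf; have [d1 d10 h1] := schwartz_seminorms Nm sf; exists (D * d1) => nu.
  exact: (proj2 (hD nu _ _ sf d10 h1)).
have cT f : schwartz f -> ccvg (fun N => \sum_(nu < N) Sd nu f) (Td f).
  by move=> /bT[E hE]; exact: (proj1 (csum_geo (ltW rho0) rho1 hE)).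
exists Sd; split=> [nu|]; split=> //.
- apply: (@tempered_bound _ Nm (D * rho ^+ nu)); first exact: linS.
  by move=> phi dd sp d0 h; rewrite mulrAC; exact: (proj2 (hD nu _ _ sp d0 h)).
- move=> phi sp; have [d1 d10 h1] := schwartz_seminorms Nm sp.
  by apply: cube_csum; exact: (proj1 (hD nu _ _ sp d10 h1)).
apply: (@tempered_bound _ Nm (2 * D / (1 - rho))) => [c f g sf sg|phi dd sp d0 h].
  have [E1 hE1] := bT _ sf; have [E2 hE2] := bT _ sg.
  have [c1 _] : ccvg (fun N => \sum_(nu < N) Sd nu (fun x => c * f x + g x)) (Td (fun x => c * f x + g x)) /\ True.
    split=> //; apply: (proj1 (csum_geo (D := cmod c * E1 + E2) (ltW rho0) rho1 _)) => nu.
    rewrite linS// mulrDl; apply: le_trans (cmodD _ _) _; rewrite lerD// cmodM -mulrA.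
    by rewrite ler_wpM2l ?cmod_ge0.
  apply: (ccvg_unique c1); rewrite (_ : (fun N => _) = fun N => c * \sum_(nu < N) Sd nu f + \sum_(nu < N) Sd nu g).
    by apply: ccvg_lin; exact: cT.
  by apply/funext => N; rewrite mulr_sumr -big_split; apply: eq_bigr => nu _; exact: linS.
have [_ /(_ 0%N)] := csum_geo (ltW rho0) rho1 (fun nu => proj2 (hD nu _ _ sp d0 h)).
by rewrite big_ord0 subr0 expr0 mulr1 (_ : 2 * D / (1 - rho) * dd = 2 * (D * dd / (1 - rho)))//; ring.
Qed.

Lemma Gd_coarse j d x :
  (\int[mu]_w (cmod ((2 ^+ ((j + d) * n))%:C * (lam (j + d)%N (cidx (j + d) w) *
     Bk (j + d) (cidx (j + d) w) j x)))%:E <=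
   ((2 `^ (j%:R * s x))^-1 * (Cc * 2 `^ (- d%:R * eps)) * l * hw u d j x)%:E)%E.
Proof.
have P0 : 0 < 2 `^ (j%:R * s x) by nneg.
apply: (int_bound (be := fun m => Bk (j + d) m j x)) => [|w].
  by nneg.
by rewrite -mulrA ler_pdivlMl//; exact: coarse.
Qed.

Lemma Gd_fine nu j x : (nu < j)%N ->
  (\int[mu]_w (cmod ((2 ^+ (nu * n))%:C * (lam nu (cidx nu w) * Bk nu (cidx nu w) j x)))%:E <=
   ((2 `^ (j%:R * s x))^-1 * (Cf * 2 `^ (- (j - nu)%:R * del)) * l * hw u 0 nu x)%:E)%E.
Proof.
move=> nj; have P0 : 0 < 2 `^ (j%:R * s x) by nneg.
have := int_bound (d := 0) (j := nu) (x := x) (be := fun m => Bk nu m j x)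
  (k := (2 `^ (j%:R * s x))^-1 * (Cf * 2 `^ (- (j - nu)%:R * del))).
rewrite addn0; apply=> [|w].
  by nneg.
by rewrite -mulrA ler_pdivlMl//; exact: fine_.
Qed.

(** Geometric in [nu] for fixed [j]: the levels below [j] are finitely many and are covered by the
    factor [1 / rho ^ j] in the constant. *)
Lemma Gd_bound j : exists2 D, 0 <= D & forall nu x,
  (\int[mu]_w (cmod ((2 ^+ (nu * n))%:C * (lam nu (cidx nu w) * Bk nu (cidx nu w) j x)))%:E <=
    (D * rho ^+ nu)%:E)%E.
Proof.
have [[b hb] _] := ss; have /choice[C hC] : forall i, exists C, 0 < C /\ forall d x, hw u d i x <= C.
  by move=> i; have [C C0 h] := hwsup i; exists C; split=> // d x; exact: h.
have C0 i : 0 <= C i by apply: ltW; case: (hC i).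
pose H := \sum_(i < j.+1) C i; have H0 : 0 <= H by apply: sumr_ge0 => i _; exact: C0.
have leH i d x : (i <= j)%N -> hw u d i x <= H.
  move=> ij; apply: le_trans (proj2 (hC i) d x) _.
  rewrite /H (bigD1 (inord i))//= inordK ?ltnS// lerDl; apply: sumr_ge0 => k _; exact: C0.
have rj : 0 < rho ^+ j by nneg.
pose A := 2 `^ (j%:R * b); have A0 : 0 <= A by nneg.
have Pinv x : (2 `^ (j%:R * s x))^-1 <= A.
  rewrite -powRN ler_powR ?ler1n// -mulrN ler_wpM2l//.
  by apply: le_trans (hb x); rewrite -normrN ler_norm.
have main x c t h e : 0 <= c -> c <= Cc + Cf -> 0 <= t -> t * rho ^+ j <= e -> 0 <= h -> h <= H ->
    (2 `^ (j%:R * s x))^-1 * (c * t) * l * h <= A * (Cc + Cf) * l * H / rho ^+ j * e.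
  move=> c0 c1 t0 te h0 h1; rewrite (_ : A * _ * l * H / _ * e = A * ((Cc + Cf) * (e / rho ^+ j)) * l * H); last by ring.
  have tq : t <= e / rho ^+ j by rewrite ler_pdivlMr.
  apply: ler_pM; [|by []| |by []].
    by nneg.
  rewrite ler_wpM2r ?(ltW l0)//; apply: ler_pM; [by nneg|exact: mulr_ge0|exact: Pinv|].
  by apply: ler_pM.
exists (A * (Cc + Cf) * l * H / rho ^+ j).
  by rewrite mulr_ge0 ?invr_ge0 ?(ltW rj)// mulr_ge0// mulr_ge0 ?(ltW l0)// mulr_ge0// addr_ge0.
move=> nu x; case: (ltnP nu j) => nj.
  apply: le_trans (Gd_fine x nj) _; rewrite lee_fin; apply: main => //; rewrite ?powR_ge0 ?lerDr ?hw_ge0 ?leH//; last exact: ltnW.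
  rewrite pow2_expr; apply: (@le_trans _ _ (1 * rho ^+ j)).
    rewrite ler_wpM2r ?(ltW rj)// exprn_ile1// ?powR_ge0//.
    by rewrite powRN invf_le1 ?powR_gt0// -[leLHS](powRr0 2) ler_powR ?ler1n// ltW.
  by rewrite mul1r ler_wiXn2l ?(ltW rho0) ?(ltW rho1)// ltnW.
rewrite -(subnKC nj); apply: le_trans (Gd_coarse _ _ _) _; rewrite lee_fin.
apply: main => //; rewrite ?powR_ge0 ?lerDl ?hw_ge0 ?leH//.
by rewrite pow2_expr -exprD addnC.
Qed.


Lemma bdsupp_a nu m b : bdsupp (pt b (a nu m)).
Proof.
exists 1, (`|cube_center nu m : 'rV[R]_n| + ga * 2 ^- nu + 1).
have g0 : 0 <= ga * 2 ^- nu by rewrite mulr_ge0 ?invr_ge0 ?exprn_ge0// (le_trans _ (ltW ga1)).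
split=> //; [exact: (a_meas ha)|by nneg|exact: (a_le1 ha)|].
move=> x hx; apply: (a_supp n0 ga1 ha).
have := ler_normD (x - cube_center nu m) (cube_center nu m); rewrite subrK.
by move: (`|x|) (`|x - _|) (`|_|) (ga * 2 ^- nu) hx => A B C' D; lra.
Qed.

Let bth j b : bdsupp (pt b (theta j)). Proof. exact: bdsupp_theta. Qed.

Let Gint nu j x : cintegrable (fun w => (2 ^+ (nu * n))%:C * (lam nu (cidx nu w) * Bk nu (cidx nu w) j x)).
Proof.
have [D D0 hD] := Gd_bound j.
by have [] := cint_bound (be := fun m => Bk nu m j x) (hD nu x).
Qed.

Lemma Gd_le j : exists2 D, 0 <= D & forall nu x, cmod (Gd nu j x) <= D * rho ^+ nu.
Proof.
have [D D0 hD] := Gd_bound j; exists (2 * D) => [|nu x]; first exact: mulr_ge0.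
by rewrite -mulrA; have [] := cint_bound (be := fun m => Bk nu m j x) (hD nu x).
Qed.

Let jcmG nu j : jcm (fun w x => (2 ^+ (nu * n))%:C * (lam nu (cidx nu w) * Bk nu (cidx nu w) j x)).
Proof.
apply: jcmM; first exact: jcm_cst.
apply: jcmM; first exact: (jcm_fst (cmeas_cidx nu (lam nu))).
by apply: (@jcm_cube R n nu (fun m => Bk nu m j)) => m; exact: (conv_meas (@bth j) (@bdsupp_a nu m)).
Qed.

Lemma meas_Gd nu j : cmeasurable (Gd nu j). Proof. exact: (jcm_cint (jcmG nu j)). Qed.

Lemma gd_cvg j x : ccvg (fun N => \sum_(nu < N) Gd nu j x) (gd j x).
Proof. by have [D D0 hD] := Gd_le j; exact: (proj1 (csum_geo (ltW rho0) rho1 (hD^~ x))). Qed.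

Lemma meas_gd j : cmeasurable (gd j).
Proof.
split; [apply: (measurable_fun_cvg (h := fun N x => complex.Re (\sum_(nu < N) Gd nu j x)))|
        apply: (measurable_fun_cvg (h := fun N x => complex.Im (\sum_(nu < N) Gd nu j x)))] => //.
- by move=> N; case: (cmeas_sum N (meas_Gd^~ j)).
- by move=> x _; exact: (proj1 (ccvgP (gd_cvg j x))).
- by move=> N; case: (cmeas_sum N (meas_Gd^~ j)).
- by move=> x _; exact: (proj2 (ccvgP (gd_cvg j x))).
Qed.

(** [Sd] is evaluated at [tw] by Fubini's theorem alone, without passing through Schwartz seminorms
    of [tw]. *)
Lemma Sd_tw nu j phi v : cmeasurable phi -> intg v -> (forall x, cmod (phi x) <= v x) ->
  Sd nu (tw (theta j) phi) = cintegral (fun x => phi x * Gd nu j x).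
Proof.
move=> mphi iv phiv; have [D D0 hD] := Gd_bound j.
pose F w x := phi x * ((2 ^+ (nu * n))%:C * (lam nu (cidx nu w) * Bk nu (cidx nu w) j x)).
have [jR jI] : jcm F by apply: jcmM; [exact: jcm_snd|exact: jcmG].
have iF m : cintegrable (fun x => phi x * Bk nu m j x).
  have [C C0 hC] := conv_bound (@bth j) (@bdsupp_a nu m).
  by apply: (phi_bounded mphi iv phiv (C := C)) => //; exact: (conv_meas (@bth j) (@bdsupp_a nu m)).
have EF w : F w = fun x => ((2 ^+ (nu * n))%:C * lam nu (cidx nu w)) * (phi x * Bk nu (cidx nu w) j x).
  by apply/funext => x; rewrite /F; ring.
case: (cfub (F := F) (v := fun x => D * rho ^+ nu * v x) jR jI _ (intg_scale iv _) _) => [x|w|E _ _ _].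
- under eq_integral => w _ do rewrite cmodM EFinM.
  rewrite ge0_integralZl_EFin ?cmod_ge0//; last 2 first.
  + by nneg.
  + by apply/measurable_EFinP; exact: (cmeas_mod (cmeas_cidx nu (fun m => (2 ^+ (nu * n))%:C * (lam nu m * Bk nu m j x)))).
  by rewrite mulrC EFinM; apply: lee_pmul => //; nneg.
- by rewrite EF; exact: (proj1 (cintegralZ _ (iF _))).
transitivity (cintegral (fun w => cintegral (F w))).
  apply: eq_cintegral => w; rewrite EF; have [_ ->] := cintegralZ ((2 ^+ (nu * n))%:C * lam nu (cidx nu w)) (iF (cidx nu w)).
  have P : pairing (a nu (cidx nu w)) (tw (theta j) phi) = cintegral (fun x => phi x * Bk nu (cidx nu w) j x).
    exact: (pair_tw (@bth j) mphi iv phiv (@bdsupp_a nu (cidx nu w))).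
  by rewrite P mulrA.
by rewrite E; apply: eq_cintegral => x; have [_ ->] := cintegralZ (phi x) (Gint nu j x).
Qed.

(** For finite partial sums this is [Sd_tw]. The tails are geometric uniformly in [x], and [phi] is
    integrable, so the limit passes under the integral. *)
Lemma represents_gd j : represents (gd j) (fmult (theta j) Td).
Proof.
split=> [|phi sphi]; first exact: meas_gd.
have [mphi [v iv phiv]] := schwartz_int n0 sphi; have [D D0 hD] := Gd_le j.
have v0 x : 0 <= v x by apply: le_trans (phiv x); exact: cmod_ge0.
have mG nu := meas_Gd nu j.
have iG nu : cintegrable (fun x => phi x * Gd nu j x).
  by apply: (phi_bounded mphi iv phiv (C := D * rho ^+ nu)).
have tail N x : cmod (gd j x - \sum_(nu < N) Gd nu j x) <= 2 * (D * rho ^+ N / (1 - rho)).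
  exact: (proj2 (csum_geo (ltW rho0) rho1 (hD^~ x))).
have ig : cintegrable (fun x => phi x * gd j x).
  apply: (phi_bounded mphi iv phiv (C := 2 * (D * rho ^+ 0 / (1 - rho)))); first exact: meas_gd.
  by move=> x; have := tail 0%N x; rewrite big_ord0 subr0.
have [V V0 hV] : exists2 V, 0 <= V & (\int[mu]_x (v x)%:E <= V%:E)%E.
  exists (\int[mu]_x v x); first by apply: Rintegral_ge0.
  by rewrite /Rintegral fineK//; exact: integrable_fin_num iv.
have bnd f C : 0 <= C -> cmeasurable f -> (forall x, cmod (f x) <= C) -> cmod (cintegral (fun x => phi x * f x)) <= 2 * (C * V).
  move=> C0 mf fC; apply: (proj2 (cintegral_le _ _)); first exact: cmeasurableM.
  apply: (@le_trans _ _ (\int[mu]_x (C%:E * (v x)%:E))%E).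
    apply: le_integral_nonmeas => x; first by nneg.
    by rewrite -EFinM lee_fin cmodM mulrC; apply: ler_pM => //; exact: cmod_ge0.
  rewrite ge0_integralZl_EFin//; last 2 first.
  - by move=> x _; rewrite lee_fin.
  - by apply/measurable_EFinP; exact: (meas_intg iv).
  by rewrite EFinM lee_wpmul2l// lee_fin.
have E0 : fmult (theta j) Td phi = Td (tw (theta j) phi).
  rewrite /fmult /dist_ifourier /dist_mul /dist_fourier; congr Td; apply/funext => y.
  exact: (fourier_tw (@bth j) mphi iv phiv).
split; first by move: ig; congr cintegrable; apply/funext => x; rewrite mulrC.
have Sb nu : cmod (Sd nu (tw (theta j) phi)) <= 2 * D * V * rho ^+ nu.
  rewrite (Sd_tw nu j mphi iv phiv) (_ : 2 * D * V * _ = 2 * ((D * rho ^+ nu) * V)); last by ring.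
  apply: bnd; [|exact: mG|exact: hD].
  exact: (mulr_ge0 D0 (rhoX _)).
have c1 := proj1 (csum_geo (ltW rho0) rho1 Sb).
rewrite E0 /pairing (eq_cintegral (g := fun x => phi x * gd j x)); last by move=> x; rewrite mulrC.
apply: (ccvg_unique c1); apply: (ccvg_near (v := fun N => (4 * D * V / (1 - rho)) * rho ^+ N)); last first.
  rewrite -[X in _ --> X](mulr0 (4 * D * V / (1 - rho))); apply: cvgMr.
  by apply: cvg_expr; rewrite ger0_norm ?(ltW rho0) ?rho1.
move=> N; rewrite (_ : _ * _ = 2 * (2 * (D * rho ^+ N / (1 - rho)) * V)); last by ring.
have [IS1 ES] := cintegral_sum N iG.
have -> : \sum_(k < N) Sd k (tw (theta j) phi) = cintegral (fun x => \sum_(nu < N) phi x * Gd nu j x).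
  by rewrite ES; apply: eq_bigr => nu _; exact: (Sd_tw nu j mphi iv phiv).
have [I2 E2] := cintegralZ (-1) ig; have [_ E3] := cintegralD IS1 I2.
rewrite (_ : cintegral _ - cintegral _ = cintegral (fun x => phi x * (\sum_(nu < N) Gd nu j x - gd j x))); last first.
  by rewrite -mulN1r -E2 -E3; apply: eq_cintegral => x; rewrite mulrBr mulr_sumr mulN1r.
apply: bnd => [||x]; last by rewrite cmodC; exact: tail.
  by apply: le_trans (tail N 0); exact: cmod_ge0.
exact: (cmeasurableB (cmeas_sum N mG) (meas_gd j)).
Qed.

End synthesis.

(** * From the bounds on each level to the modular of the sum *)

Section modular_estimate.
Context {R : realType} {n : nat}.
Variables (p q s : 'rV[R]_n -> R) (pm qm P : R) (G : nat -> nat -> 'rV[R]_n -> R[i])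
  (g : nat -> 'rV[R]_n -> R[i]) (h : nat -> nat -> 'rV[R]_n -> R) (rho A C1 : R).
Hypotheses (pm0 : 0 < pm) (qm0 : 0 < qm) (hp : forall x, pm <= p x <= P) (hq : forall x, qm <= q x <= P)
  (mp : meas p) (mq : meas q) (mh : forall d j, meas (h d j)) (h0 : forall d j x, 0 <= h d j x)
  (rho0 : 0 < rho) (A0 : 0 < A) (C10 : 0 < C1)
  (gG : forall j x, ccvg (fun N => \sum_(nu < N) G nu j x) (g j x))
  (coarse : forall j d x, 2 `^ (j%:R * s x) * cmod (G (j + d) j x) <= A * (rho ^+ d * h d j x))
  (fine_ : forall nu j x, (nu < j)%N ->
     2 `^ (j%:R * s x) * cmod (G nu j x) <= A * (rho ^+ (j - nu) * h 0 nu x))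
  (hmod : forall N, (\int[mu]_x ((\sum_(j < N.+1) twosum rho N (fun d j => h d j x) j `^ q x)
       `^ (p x / q x))%:E <= C1%:E)%E).

Let q0 x : 0 < q x. Proof. by have /andP[e _] := hq x; apply: lt_le_trans e. Qed.
Let p0 x : 0 < p x. Proof. by have /andP[e _] := hp x; apply: lt_le_trans e. Qed.

Let tw0 x N j : 0 <= twosum rho N (fun d j => h d j x) j.
Proof. by apply: twosum_ge0 => //; exact: ltW. Qed.

Let term0 d j x : 0 <= rho ^+ d * h d j x.
Proof. by nneg. Qed.

Lemma partial_le N j x : (j <= N)%N ->
  2 `^ (j%:R * s x) * cmod (\sum_(nu < N.+1) G nu j x) <= A * twosum rho N (fun d j => h d j x) j.
Proof.
move=> jN; apply: le_trans (ler_wpM2l (powR_ge0 _ _) (cmod_sum N.+1 (fun nu => G nu j x))) _; rewrite mulr_sumr.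
rewrite -(subnKC jN) -addnS big_split_ord /twosum/= mulrDr addrC lerD//.
  rewrite -[(j + (N - j)).+1]addnS [(j + (N - j).+1)%N]addnC big_split_ord/= mulrDr ler_wpDr//.
    by rewrite mulr_ge0 ?(ltW A0)// sumr_ge0// => i _; rewrite mulr_ge0// exprn_ge0// ltW.
  by rewrite mulr_sumr; apply: ler_sum => i _; exact: coarse.
(* The term [i = 0] of the second sum is dropped, as level [j] was counted in the first. *)
rewrite big_ord_recl mulrDr ler_wpDl//.
  by nneg.
rewrite (reindex_inj rev_ord_inj)/= mulr_sumr; apply: ler_sum => i _.
have ij : (j - i.+1 < j)%N by rewrite ltn_subrL (leq_ltn_trans _ (ltn_ord i)).
by apply: le_trans (fine_ x ij) _; rewrite subKn ?ltn_ord.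
Qed.

Let S N x := \sum_(j < N.+1) twosum rho N (fun d j => h d j x) j `^ q x.

Let S0 N x : 0 <= S N x. Proof. by apply: sumr_ge0 => j _; exact: powR_ge0. Qed.

Let S_mono N N' x : (N <= N')%N -> S N x <= S N' x.
Proof.
move=> NN; rewrite /S -(subnKC NN) -addSn big_split_ord/= ler_wpDr//.
  by apply: sumr_ge0 => j _; exact: powR_ge0.
apply: ler_sum => j _; apply: powR_mono; [exact: ltW|exact: tw0|].
rewrite /twosum lerD2r -addSn big_split_ord/= ler_wpDr// sumr_ge0// => i _.
Qed.

(** Where [g j x] is not 0, its modulus is at most twice that of all late partial sums; a common [N]
    then serves the finitely many [j], and the bound is obtained without taking a limit in
    [twosum]. *)
Let limit_le x J : exists N, \sum_(j < J.+1) cmod ((2 `^ (j%:R * s x))%:C * g j x) `^ q x <= (2 * A) `^ q x * S N x.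
Proof.
have /choice[k hk] : forall j, exists k, forall N, (k <= N)%N -> cmod (g j x) <= 2 * cmod (\sum_(nu < N) G nu j x).
  move=> j; have [g0|gp] := leP (cmod (g j x)) 0.
    by exists 0%N => N _; apply: le_trans g0 _; rewrite mulr_ge0 ?cmod_ge0.
  have /cvgrPdist_lt/(_ _ (divr_gt0 gp (ltr0n R 2)))[k _ hk] := @gG j x; exists k => N /hk.
  rewrite sub0r normrN ger0_norm ?cmod_ge0// => /ltW hN.
  have := cmodD (g j x - \sum_(nu < N) G nu j x) (\sum_(nu < N) G nu j x); rewrite subrK cmodC.
  by move: (cmod _) (cmod _) (cmod _) hN => a b c; lra.
pose N := (J + \sum_(j < J.+1) k j)%N; exists N.
apply: (@le_trans _ _ (\sum_(j < J.+1) (2 * A) `^ q x * twosum rho N (fun d j => h d j x) j `^ q x)).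
  apply: ler_sum => j _; have jJ : (j <= N)%N by apply: leq_trans (leq_addr _ _); rewrite -ltnS.
  rewrite -powRM//; last by nneg.
  apply: powR_mono; [exact: ltW|exact: cmod_ge0|].
  rewrite cmodM cmod_real ger0_norm ?powR_ge0// -mulrA.
  apply: (@le_trans _ _ (2 `^ (j%:R * s x) * (2 * cmod (\sum_(nu < N.+1) G nu j x)))).
    rewrite ler_wpM2l ?powR_ge0//; apply: hk; apply: leqW; apply: leq_trans (leq_addl _ _).
    by rewrite (bigD1 j)//= leq_addr.
  by rewrite mulrCA ler_wpM2l//; exact: partial_le.
rewrite -mulr_sumr ler_wpM2l ?powR_ge0// /S (_ : N.+1 = J.+1 + \sum_(j < J.+1) k j)%N//.
rewrite big_split_ord/= ler_wpDr//.
by apply: sumr_ge0 => j _; exact: powR_ge0.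
Qed.

Let Sp N x := (S N x `^ (p x / q x))%:E.

Let pq0 x : 0 < p x / q x. Proof. by nneg. Qed.

Let mS N : meas (Sp N).
Proof.
apply/measurable_EFinP; apply: meas_fun_powR.
  by apply: measurable_sum => j; apply: meas_fun_powR => //; apply: measurable_funD;
    apply: measurable_sum => i; apply: measurable_funM => //; exact: measurable_cst.
by apply: measurable_funM => //; exact: meas_funV.
Qed.

Let Sp_mono x : {homo Sp^~ x : N N' / (N <= N')%N >-> (N <= N')%E}.
Proof. by move=> N N' NN; rewrite lee_fin; apply: powR_mono; [exact: ltW|exact: S0|exact: S_mono]. Qed.

(** [S N] increases with [N], so by monotone convergence the limit of its powers has integral at
    most [C1]. The factor [Num.max 1 C1 ^ (1 / pm)] in the norm, raised to the power [p >= pm],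
    brings the modular down to 1. *)
Lemma modular_gd : (\int[mu]_x poweR (`|poweR (\sum_(0 <= j <oo)
   poweR (cmod ((2 `^ (j%:R * s x))%:C * g j x))%:E (q x))%E (q x)^-1|
     * ((2 * A * (Num.max 1 C1) `^ pm^-1)^-1)%:E) (p x) <= 1)%E.
Proof.
set k := Num.max 1 C1; have k1 : 1 <= k by rewrite le_max lexx.
have k0 : 0 < k by apply: lt_le_trans k1.
have kp0 : 0 < k `^ pm^-1 by exact: powR_gt0.
have A20 : 0 < 2 * A by nneg.
pose I x := limn (Sp^~ x); have SI N x : (Sp N x <= I x)%E.
  rewrite /I (cvg_lim _ (ereal_nondecreasing_cvgn (@Sp_mono x)))//.
  by apply: ereal_sup_ubound; exists N.
have I0 x : (0 <= I x)%E by apply: le_trans (SI 0%N x); rewrite lee_fin powR_ge0.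
have intI : (\int[mu]_x I x <= C1%:E)%E.
  rewrite (@monotone_convergence _ _ _ mu _ measurableT Sp)//; last by move=> N x _; rewrite lee_fin powR_ge0.
  apply: lime_le; last by apply: nearW => N; exact: hmod.
  apply: ereal_nondecreasing_is_cvgn => N N' NN; apply: le_integral_nonmeas => x.
    by rewrite lee_fin powR_ge0.
  exact: Sp_mono.
have mI : measurable_fun [set: 'rV[R]_n] I.
  apply: (emeasurable_fun_cvg (fun N => Sp N)) => // x _.
  exact: ereal_nondecreasing_is_cvgn (@Sp_mono x).
apply: (@le_trans _ _ (\int[mu]_x ((k^-1)%:E * I x))%E); last first.
  rewrite ge0_integralZl_EFin ?invr_ge0 ?(ltW k0)//.
  apply: (@le_trans _ _ (k^-1 * C1)%:E); first by rewrite EFinM lee_wpmul2l// lee_fin invr_ge0 ltW.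
  by rewrite lee_fin ler_pdivrMl// mulr1 le_max lexx orbT.
apply: le_integral_nonmeas => x; first exact: poweR_ge0.
case: (I x) (SI^~ x) (I0 x) => [y Sy y0|_ _|//]; last first.
  by rewrite mulry gtr0_sg ?invr_gt0// mul1e leey.
rewrite lee_fin in y0; pose m := (2 * A) `^ q x * y `^ (q x / p x).
have Sm N : S N x <= y `^ (q x / p x).
  have := Sy N; rewrite lee_fin => Sy'; rewrite -[leLHS]powRr1// (_ : 1 = p x / q x * (q x / p x)); last first.
    by rewrite mulrA divfK ?gt_eqF// mulfV ?gt_eqF.
  by rewrite powRrM; apply: powR_mono; [rewrite divr_ge0// ltW|exact: powR_ge0|].
have L0 : 0 < 2 * A * k `^ pm^-1 by nneg.
have m0 : 0 <= m by rewrite mulr_ge0 ?powR_ge0.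
have := lq_term_ge (c := fun j => cmod ((2 `^ (j%:R * s x))%:C * g j x)) (p0 x) (q0 x) L0 m0.
move=> /(_ _)/le_trans; apply.
  by move=> J; have [N /le_trans] := limit_le x J; apply; rewrite ler_wpM2l ?powR_ge0.
have -> : m `^ (q x)^-1 = 2 * A * y `^ (p x)^-1.
  rewrite powRM ?powR_ge0// -!powRrM mulfV ?gt_eqF// powRr1 ?(ltW A20)//.
  by rewrite [q x / p x / q x]mulrAC mulfV ?gt_eqF// mul1r.
rewrite -mulf_div mulfV ?gt_eqF// mul1r powRM ?powR_ge0 ?invr_ge0 ?powR_ge0//.
rewrite -powRrM mulVf ?gt_eqF// powRr1// -EFinM lee_fin mulrC ler_wpM2r//.
rewrite -powRN -powRrM -[leRHS](powRr1 (a := k^-1)) ?invr_ge0 ?(ltW k0)//.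
rewrite (_ : k^-1 `^ 1 = k `^ (- 1)); last by rewrite powRr1 ?invr_ge0 ?(ltW k0)// powR_inv1// ltW.
rewrite ler_powR// mulNr lerN2 mulrC ler_pdivlMr// mul1r.
by have /andP[] := hp x.
Qed.

End modular_estimate.

(** The limit of the values at the corners, because the oscillation on cubes tends to 0. *)
Lemma meas_slow {R : realType} {n : nat} (e : 'rV[R]_n -> R) : slow e ->
  measurable_fun [set: 'rV[R]_n] e.
Proof.
move=> /slow_cube[c c0 hc]; apply: (@measurable_fun_cvg _ _ _ _ (fun j x => e (corner j x))).
  by move=> j; apply: (@meas_cubewise _ _ j) => x y /corner_cidx ->.
move=> x _; apply: (@squeeze_cvgr _ _ _ _ (fun j => e x - c * harmonic j) (fun j => e x + c * harmonic j)).
- apply: nearW => j; have := hc j (corner j x) x (cidx_corner j x).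
  by rewrite ler_distl.
- rewrite -[X in _ --> X](subr0 (e x)) -(mulr0 c).
  by apply: cvgB; [exact: cvg_cst|apply: cvgMr; exact: cvg_harmonic].
- rewrite -[X in _ --> X](addr0 (e x)) -(mulr0 c).
  by apply: cvgD; [exact: cvg_cst|apply: cvgMr; exact: cvg_harmonic].
Qed.

Lemma fseqnorm_modular {R : realType} {n : nat} (s p q : 'rV[R]_n -> R) (lam : nat -> 'rV[int]_n -> R[i]) l :
  (forall x, 0 < p x) -> (forall x, 0 < q x) -> 0 < l ->
  (\int[lebesgue_rV R n]_x poweR (`|poweR (\sum_(0 <= j <oo) poweR (cmod ((2 `^ (j%:R * s x))%:C *
    \sum_(m \in [set: 'rV[int]_n]) lam j m * (\1_(cubeQ j m) x)%:C))%:E (q x))%E (q x)^-1| *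
      (l^-1)%:E) (p x) <= 1)%E ->
  modular_le p q s (fun nu m => cmod (lam nu m) / l).
Proof.
move=> p0 q0 l0 H; split=> [nu m|N]; first by nneg.
have E j x : \sum_(m \in [set: 'rV[int]_n]) lam j m * (\1_(cubeQ j m) x)%:C = lam j (cidx j x).
  rewrite -(@fsbig_widen _ _ _ _ [set cidx j x])//.
    by rewrite fsbig_set1 indicE mem_set ?mulr1//; exact/cubeQP.
  move=> m [_ /= hm]; rewrite indicE memNset ?mulr0//.
  by move=> /cubeQP h; exact: hm.
apply: le_trans H; apply: le_integral_nonmeas => x; first by nneg.
apply: (le_trans _ (lq_term_le _ (p0 x) (q0 x) l0 N)) => [|j]; last exact: cmod_ge0.
rewrite lee_fin le_eqVlt; apply/orP; left; apply/eqP; congr (_ `^ _); apply: eq_bigr => j _.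
by rewrite E cmodM cmod_real ger0_norm ?powR_ge0// /wt mulrA.
Qed.

Lemma tau_bounds {R : realType} {n : nat} (p q : 'rV[R]_n -> R) (m P : R) : 0 < m ->
  (forall x, m <= p x <= P) -> (forall x, m <= q x <= P) -> slow p -> slow q ->
  let tau x := (Num.min 1 (Num.min (p x) (q x)))^-1 in
  [/\ slow tau, exists T : nat, forall x, 1 <= tau x <= T%:R, forall x, (p x)^-1 <= tau x &
      forall x, (q x)^-1 <= tau x].
Proof.
move=> m0 hp hq sp sq tau; pose k := Num.min 1 m.
have k0 : 0 < k by rewrite lt_min ltr01.
have km x : k <= Num.min 1 (Num.min (p x) (q x)).
  have /andP[h1 _] := hp x; have /andP[h2 _] := hq x.
  by rewrite !le_min !ge_min lexx h1 h2 !orbT.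
have t0 x := lt_le_trans k0 (km x).
have lem x a : Num.min 1 (Num.min (p x) (q x)) <= a -> a^-1 <= tau x.
  by move=> h; rewrite lef_pV2 ?posrE//; exact: lt_le_trans (t0 x) h.
split=> [||x|x].
- apply: (slowV k0 km); apply: slow_min; last exact: slow_min.
  split; first by exists 1 => x; rewrite normr1.
  by exists 0 => // j x y; rewrite subrr normr0 !mul0r.
- have [N hN] : exists N : nat, k^-1 <= N%:R by exists (Num.trunc k^-1).+1; rewrite ltW// truncnS_gt.
  exists N => x; apply/andP; split; first by rewrite -[leLHS]invr1 lem// ge_min lexx.
  by apply: le_trans hN; rewrite lef_pV2 ?posrE.
- by apply: lem; rewrite !ge_min lexx orbT.
- by apply: lem; rewrite !ge_min lexx !orbT.
Qed.

Theorem theorem4p11 (R : realType) (n : nat) (hn : (0 < n)%N)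
    (theta : nat -> 'rV[R]_n -> R[i]) (htheta : in_Phi theta)
    (gamma : R) (hgamma : 1 < gamma)
    (s p q : 'rV[R]_n -> R)
    (hp : P0 p) (hplog : Clog p) (hq : P0 q) (hqlog : Clog q) (hs : Clog s)
    (a : nat -> 'rV[int]_n -> 'rV[R]_n -> R[i])
    (ha : F_atoms gamma s p q a) :
  exists2 C : R, 0 < C &
    forall lambda : nat -> 'rV[int]_n -> R[i],
      (fseqnorm s p q lambda < +oo)%E ->
      exists2 f : @tdist R n, atomic_sum lambda a f &
        (Fnorm theta s p q f <= C%:E * fseqnorm s p q lambda)%E.
Proof.
have sp := Clog_slow hn hplog; have sq := Clog_slow hn hqlog; have ss := Clog_slow hn hs.
have [pm [pM [pm0 pb]]] := P0_bounds hp sp; have [qm [qM [qm0 qb]]] := P0_bounds hq sq.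
pose m := Num.min pm qm; pose P := Num.max pM qM; have m0 : 0 < m by rewrite lt_min pm0.
have hpb x : m <= p x <= P.
  by have /andP[h1 h2] := pb x; rewrite ge_min h1 le_max h2.
have hqb x : m <= q x <= P.
  by have /andP[h1 h2] := qb x; rewrite ge_min h1 le_max h2 !orbT.
have p0 x : 0 < p x by have /andP[h _] := hpb x; exact: lt_le_trans h.
have q0 x : 0 < q x by have /andP[h _] := hqb x; exact: lt_le_trans h.
have mp := meas_slow sp; have mq := meas_slow sq; have ms := meas_slow ss.
have [stau [T tau1] taup tauq] := tau_bounds m0 hpb hqb sp sq.
have [eps [K [eps0 sK {}ha]]] := ha; have [del del0 {}sK] := ess_sup_lt ss sK.
pose tau x := (Num.min 1 (Num.min (p x) (q x)))^-1.
have {}ha : smooth_atoms gamma K (fun x => n%:R * (tau x - 1) - s x + eps) a by [].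
have [M [hwE hwsup hwmod]] := hw_core m0 m0 hpb hqb sq ss mp mq ms sp tau1 taup tauq.
rewrite -/tau in stau tau1 taup tauq hwE hwsup hwmod; clearbody tau.
have [Cc Cc0 HC] := coarse_bound hn htheta hgamma ss stau ha M.
have [Cf Cf0 HF] := fine_bound hn htheta hgamma ss ha M sK.
have [Nm [Ct [Ct0 HT]]] := test_bound hn hgamma ss stau ha M.
have {}HC j d x w := proj2 (HC j d x w); have {}HF nu j x w nj := proj2 (HF nu j x w nj).
pose me := Num.min eps del; have me0 : 0 < me by rewrite lt_min eps0.
(* A common ratio for the decay from the moments and that from the smoothness. *)
pose rho := 2 `^ (- me); have rho01 : 0 < rho < 1.
  rewrite powR_gt0//= /rho powRN invf_lt1 ?powR_gt0//.
  have {1}<- : (1 : R) `^ me = 1 by rewrite powR1.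
  by apply: gt0_ltr_powR; rewrite // ?nnegrE// ?in_itv/= ?ler0n ?ltr1n.
have rhoX e d : me <= e -> 2 `^ (- d%:R * e) <= rho ^+ d.
  by move=> h; rewrite -pow2_expr ler_powR ?ler1n// !mulNr lerN2 ler_wpM2l.
have [C1 C10 {}hwmod] := hwmod rho rho01.
have rho0 : 0 < rho by case/andP: rho01.
clearbody rho; pose Cm := Cc + Cf + 1; have Cm0 : 0 < Cm by nneg.
pose kap := Num.max 1 C1 `^ m^-1; have kap0 : 0 < kap by nneg.
(* [C * l] is the norm reached in [modular_gd] for [A = 2 * Cm * l]; this factor 2 in [A] is the one
   lost in [cintegral_le]. *)
pose C := 2 * (2 * Cm) * kap; have C0 : 0 < C by nneg.
exists C => // lam fin; pose L := [set l : R | 0 < l /\ modular_le p q s (fun nu k => cmod (lam nu k) / l)].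
(* The norm of the coefficients is the infimum of the admissible [l], so it is enough to prove the
   bound for each of these. *)
have LE (t : \bar R) : (forall l, L l -> (t <= (C * l)%:E)%E) -> (t <= C%:E * fseqnorm s p q lam)%E.
  move=> H; rewrite -lee_pdivrMl//; apply: le_ereal_inf_tmp => _ [l [l0 hl] <-].
  by rewrite lee_pdivrMl//; apply: H; split=> //; exact: (fseqnorm_modular p0 q0 l0 hl).
(* Finiteness of the norm provides one admissible [l], from which the convergence of the sum
   follows; [Td] itself does not depend on [l]. *)
have [_ [l [l0 hl] _] _] := ereal_inf_lt fin.
have {hl} hu : modular_le p q s (fun nu k => cmod (lam nu k) / l) by exact: (fseqnorm_modular p0 q0 l0 hl).
exists (Td a lam); first exact: (atomic eps0 hwE hwsup Ct0 HT l0 hu).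
apply: LE => {l0 hu}l [l0 hu].
have rep := represents_gd hn htheta hgamma eps0 del0 ss ha hwE hwsup Cc0 Cf0 HC HF l0 hu.
apply: (@le_trans _ _ (Lplq p q (fun j x => (2 `^ (j%:R * s x))%:C * gd theta a lam j x))).
  by apply: ereal_inf_lbound; exists (gd theta a lam).
apply: ereal_inf_lbound; exists (C * l) => //; split; first exact: mulr_gt0.
rewrite (_ : C * l = 2 * (2 * Cm * l) * kap); last by rewrite /C; ring.
pose h d j x := hw s tau M (fun nu k => cmod (lam nu k) / l) d j x.
have hw0 d j x : 0 <= h d j x by exact: (hw_ge0 hwE l0 hu).
have bnd nu j x k Ck (d : nat) H : 0 <= Ck -> Ck <= Cm -> 0 <= k -> k <= rho ^+ d -> 0 <= H ->
    (\int[lebesgue_rV R n]_w (cmod ((2 ^+ (nu * n))%:C * (lam nu (cidx nu w) *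
       Bk theta a nu (cidx nu w) j x)))%:E <= ((2 `^ (j%:R * s x))^-1 * (Ck * k) * l * H)%:E)%E ->
    2 `^ (j%:R * s x) * cmod (Gd theta a lam nu j x) <= 2 * Cm * l * (rho ^+ d * H).
  move=> Ck0 CkC k0 kr H0 hI; have [_ le] := cint_bound (be := fun m => Bk theta a nu m j x) hI.
  have W0 : 0 < 2 `^ (j%:R * s x) by nneg.
  apply: le_trans (ler_wpM2l (ltW W0) le) _.
  rewrite (_ : _ * (2 * _) = 2 * (Ck * k * (l * H))); last by field; rewrite gt_eqF.
  rewrite (_ : 2 * Cm * l * _ = 2 * (Cm * rho ^+ d * (l * H))); last by ring.
  rewrite ler_wpM2l// ler_wpM2r ?mulr_ge0 ?(ltW l0)//.
  by apply: ler_pM.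
have cm1 : Cc <= Cm by rewrite /Cm -addrA lerDl addr_ge0.
have cm2 : Cf <= Cm by rewrite /Cm addrAC lerDr addr_ge0.
apply: (modular_gd (G := Gd theta a lam) (h := h) (rho := rho) m0 m0 hpb hqb mp mq) => //.
- move=> d j; apply: (measurableT_comp (f := @fine R)) => //.
  apply: meas_hh; first exact: meas_wtc.
  by move=> y; rewrite /wtc mulr_ge0 ?powR_ge0// divr_ge0 ?cmod_ge0// ltW.
- by nneg.
- exact: (gd_cvg eps0 del0 ss hwE hwsup Cc0 Cf0 HC HF l0 hu).
- move=> j d x; apply: (bnd _ _ _ (2 `^ (- d%:R * eps)) Cc d _ Cc0 cm1 (powR_ge0 _ _) _ (hw0 _ _ _)).
    by apply: rhoX; rewrite ge_min lexx.
  exact: (Gd_coarse hwE Cc0 HC l0 hu).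
- move=> nu j x nj; apply: (bnd _ _ _ (2 `^ (- (j - nu)%:R * del)) Cf _ _ Cf0 cm2 (powR_ge0 _ _) _ (hw0 _ _ _)).
    by apply: rhoX; rewrite ge_min lexx orbT.
  exact: (Gd_fine hwE Cf0 HF l0 hu).
- by move=> N; exact: hwmod.
Qed.
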